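(* Let $d\ge2$, $T>0$, $\gamma>1$ and $\alpha:=\frac{2}{3\min\{\gamma,2\}}$. Let $(\varrho,\mathbf u)$ be a weak solution of the compressible isentropic Euler system with pressure $\varrho^\gamma$ on $\mathbb T^d\times(0,T)$ with initial data $(\varrho_0,\varrho_0\mathbf u_0)$. Assume $$\varrho>0,\quad\varrho,\varrho^{-1}\in L^\infty(\mathbb T^d\times(0,T)),\qquad\mathbf u\in L^3(\mathbb T^d\times(0,T)),$$ that for some $\delta_0>0$ $$\|\varrho\|_{L^\infty(0,T;\mathcal V^{\alpha,\infty}_{\delta_0}(\mathbb T^d))}+\|\mathbf u\|_{L^3(0,T;\mathcal V^{1/3,3}_{\delta_0}(\mathbb T^d))}<\infty,\qquad\limsup_{\delta\to0}\|\mathbf u\|_{L^3(0,T;\mathcal V^{1/3,3}_\delta(\mathbb T^d))}=0,$$ and, in case $\gamma\ge2$, additionally $\limsup_{\delta\to0}\|\varrho\|_{L^\infty(0,T;\mathcal V^{\alpha,\infty}_\delta(\mathbb T^d))}=0$. Then $$\int_{\mathbb T^d}\Big(\tfrac12(\varrho|\mathbf u|^2)(x,t)+\frac{\varrho(x,t)^\gamma}{\gamma-1}\Big)dx=\int_{\mathbb T^d}\Big(\tfrac12(\varrho_0|\mathbf u_0|^2)(x)+\frac{\varrho_0(x)^\gamma}{\gamma-1}\Big)dx$$ for (almost) every $t\in(0,T)$.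
   Context: Weak solution of the compressible isentropic Euler system on a domain $\Omega$ ($\Omega=\mathbb T^d$ here): measurable $\varrho:\Omega\times(0,T)\to\mathbb R_+$, $\mathbf u:\Omega\times(0,T)\to\mathbb R^d$ (with enough integrability for the integrals below to make sense) such that (i) $\int_0^T\int_\Omega(\varrho\,\partial_t\varphi+\varrho\mathbf u\cdot\nabla\varphi)\,dxdt=0$ for all $\varphi\in C_0^\infty(\Omega\times(0,T))$; (ii) $\int_0^T\int_\Omega(\varrho\mathbf u\cdot\partial_t\psi+\varrho\mathbf u\otimes\mathbf u:\nabla\psi+\varrho^\gamma\,\nabla\cdot\psi)\,dxdt=0$ for all $\psi\in C_0^\infty(\Omega\times(0,T))^d$; (iii) $\lim_{t\to0}\int_\Omega\varrho(x,t)\varphi(x)dx=\int_\Omega\varrho_0\varphi\,dx$ for all $\varphi\in C_0^\infty(\Omega)$; (iv) $\lim_{t\to0}\int_\Omega(\varrho\mathbf u)(x,t)\cdot\psi(x)dx=\int_\Omega\varrho_0\mathbf u_0\cdot\psi\,dx$ for all $\psi\in C_0^\infty(\Omega)^d$. This is the weak form of $\partial_t\varrho+\operatorname{div}(\varrho\mathbf u)=0$, $\partial_t(\varrho\mathbf u)+\operatorname{div}(\varrho\mathbf u\otimes\mathbf u)+\nabla\varrho^\gamma=0$. For $\beta>0$, $\delta>0$, $p\in[1,\infty]$ and $f$ on $\mathbb T^d$: $\|f\|_{\mathcal V^{\beta,p}_\delta(\mathbb T^d)}:=\sup_{|h|<\delta}|h|^{-\beta}\|f(\cdot+h)-f(\cdot)\|_{L^p(\mathbb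 T^d)}$. For time-dependent $f$, $\|f\|_{L^q(0,T;\mathcal V^{\beta,p}_\delta)}:=\big(\int_0^T\|f(t)\|_{\mathcal V^{\beta,p}_\delta}^qdt\big)^{1/q}$ for $q<\infty$ and the essential supremum in $t$ for $q=\infty$. *)

(* Defs.v *)
From HB Require Import structures.
From mathcomp Require Import all_boot all_order all_algebra.
From mathcomp Require Import all_classical all_reals all_analysis.
Set Implicit Arguments. Unset Strict Implicit. Unset Printing Implicit Defensive.
Import Order.TTheory GRing.Theory Num.Theory.
Import numFieldNormedType.Exports.
Local Open Scope classical_set_scope.
Local Open Scope ring_scope.

Section EulerDefs.
Variable R : realType.

Definition tadd d (x h : d.-tuple R) : d.-tuple R :=
  [tuple tnth x i + tnth h i | i < d].
Definition tunit d (j : 'I_d) : d.-tuple R := [tuple (i == j)%:R | i < d].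
Definition tnorm d (h : d.-tuple R) : R := Num.sqrt (\sum_(i < d) tnth h i ^+ 2).
Definition trow d (x : d.-tuple R) : 'rV[R]_d := \row_i tnth x i.

(* Lebesgue measure on R^d, built by iterated integration (Tonelli):
   leb^{n+1}(A) = \int_R leb^n({t | (x::t) \in A}) dx. *)
Fixpoint lebT (n : nat) : set (n.-tuple R) -> \bar R :=
  match n with
  | 0 => fun A => ((\1_A : _ -> R) [tuple])%:E
  | n.+1 => fun A =>
      (\int[@lebesgue_measure R]_x @lebT n [set t | A (cons_tuple x t)])%E
  end.
Arguments lebT : clear implicits.

(* Fundamental cell [0,1)^d of the torus T^d = R^d / Z^d; functions on T^d
   are represented by 1-periodic functions on R^d. *)
Definition cell d : set (d.-tuple R) := [set x | forall i, 0 <= tnth x i < 1].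
Arguments cell : clear implicits.
Definition periodic d (f : d.-tuple R -> R) :=
  forall x (j : 'I_d), f (tadd x (tunit j)) = f x.

Definition intT d (f : d.-tuple R -> R) : \bar R :=
  (\int[lebT d]_(x in cell d) (f x)%:E)%E.

Definition LpT d (p : R) (f : d.-tuple R -> R) : \bar R :=
  poweR (\int[lebT d]_(x in cell d) ((`|f x| `^ p)%:E))%E p^-1.
Definition LinfT d (f : d.-tuple R -> R) : \bar R :=
  ereal_inf [set M : \bar R |
     lebT d [set x | cell d x /\ (M < (`|f x|)%:E)%E] = 0%E].
Definition LpinfT d (p : \bar R) (f : d.-tuple R -> R) : \bar R :=
  match p with p%:E => LpT p f | _ => LinfT f end.

(* The V^{beta,p}_delta(T^d) norm of a function, given the pointwise size of
   its increments: incr h x = |f(x+h) - f(x)|. *)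
Definition Vnorm d (beta : R) (p : \bar R) (delta : R)
    (incr : d.-tuple R -> d.-tuple R -> R) : \bar R :=
  ereal_sup [set (powR (tnorm h) (- beta))%:E * LpinfT p (incr h)
             | h in [set h : d.-tuple R | (0 < tnorm h < delta)%R]]%E.

Definition incrS d (f : d.-tuple R -> R) h x := `|f (tadd x h) - f x|.
Definition incrV d k (u : 'I_k -> d.-tuple R -> R) h x :=
  Num.sqrt (\sum_(i < k) (u i (tadd x h) - u i x) ^+ 2).

(* L^q(0,T; X) norm of t |-> N t, N t = ||f(t)||_X in [0,+oo]. *)
Definition LqTime (T : R) (q : \bar R) (N : R -> \bar R) : \bar R :=
  match q with
  | q%:E => poweR (\int[@lebesgue_measure R]_(t in `]0%R, T[) poweR (N t) q)%E q^-1
  | _ => ereal_inf [set M : \bar R |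
           @lebesgue_measure R [set t | 0 < t < T /\ (M < N t)%E] = 0%E]
  end.

Fixpoint Ck (n k : nat) (f : 'rV[R]_n -> R) : Prop :=
  match k with
  | 0 => continuous f
  | k.+1 => (forall v, differentiable f v) /\
            forall i : 'I_n, Ck k (fun v => 'D_(delta_mx 0 i) f v)
  end.
Definition smooth n (f : 'rV[R]_n -> R) := forall k, Ck k f.

(* Space-time points (x,t) as rows of length d+1, coordinate 0 = time,
   coordinate (lift ord0 j) = x_j. *)
Definition stpt d (x : d.-tuple R) (t : R) : 'rV[R]_d.+1 :=
  \row_i (match unlift ord0 i with Some j => tnth x j | None => t end).
Definition dt d (phi : 'rV[R]_d.+1 -> R) x t : R :=
  'D_(delta_mx 0 ord0) phi (stpt x t).
Definition dx d (j : 'I_d) (phi : 'rV[R]_d.+1 -> R) x t : R :=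
  'D_(delta_mx 0 (lift ord0 j)) phi (stpt x t).

Definition testST d (T : R) (phi : 'rV[R]_d.+1 -> R) :=
  smooth phi /\
  (forall v (j : 'I_d), phi (v + delta_mx 0 (lift ord0 j)) = phi v) /\
  exists a b, 0 < a /\ a <= b /\ b < T /\
    forall v : 'rV[R]_d.+1, v 0 ord0 < a \/ b < v 0 ord0 -> phi v = 0.
Definition testS d (phi : 'rV[R]_d -> R) :=
  smooth phi /\ forall v (j : 'I_d), phi (v + delta_mx 0 j) = phi v.

Definition intST d (T : R) (F : d.-tuple R -> R -> R) : \bar R :=
  (\int[@lebesgue_measure R]_(t in `]0%R, T[) intT (fun x => F x t))%E.

Definition sqnorm d (u : 'I_d -> d.-tuple R -> R -> R) x t : R :=
  \sum_(i < d) u i x t ^+ 2.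

Definition weak_solution d (T gamma : R) (rho : d.-tuple R -> R -> R)
    (u : 'I_d -> d.-tuple R -> R -> R) (rho0 : d.-tuple R -> R)
    (u0 : 'I_d -> d.-tuple R -> R) : Prop :=
  measurable_fun [set: d.-tuple R * R] (fun p => rho p.1 p.2) /\
  (forall i, measurable_fun [set: d.-tuple R * R] (fun p => u i p.1 p.2)) /\
  (forall t, periodic (rho ^~ t)) /\ (forall i t, periodic (u i ^~ t)) /\
  (forall x t, 0 <= rho x t) /\
  measurable_fun [set: d.-tuple R] rho0 /\
  (forall i, measurable_fun [set: d.-tuple R] (u0 i)) /\
  periodic rho0 /\ (forall i, periodic (u0 i)) /\ (forall x, 0 <= rho0 x) /\
  (lebT d).-integrable (cell d) (fun x => (rho0 x)%:E) /\
  (forall i, (lebT d).-integrable (cell d) (fun x => (rho0 x * u0 i x)%:E)) /\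
  (forall phi, testST T phi ->
     intST T (fun x t => rho x t * dt phi x t +
                         \sum_(j < d) rho x t * u j x t * dx j phi x t) = 0%E) /\
  (forall psi : 'I_d -> 'rV[R]_d.+1 -> R, (forall i, testST T (psi i)) ->
     intST T (fun x t =>
        \sum_(i < d) rho x t * u i x t * dt (psi i) x t
      + \sum_(i < d) \sum_(j < d) rho x t * u i x t * u j x t * dx j (psi i) x t
      + rho x t `^ gamma * \sum_(i < d) dx i (psi i) x t) = 0%E) /\
  (forall phi, testS phi ->
     (fun t => intT (fun x => rho x t * phi (trow x))) @ 0^'+
       --> intT (fun x => rho0 x * phi (trow x))) /\
  (forall psi : 'I_d -> 'rV[R]_d -> R, (forall i, testS (psi i)) ->
     (fun t => intT (fun x => \sum_(i < d) rho x t * u i x t * psi i (trow x)))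
       @ 0^'+
       --> intT (fun x => \sum_(i < d) rho0 x * u0 i x * psi i (trow x))).

End EulerDefs.

(* Main.v *)
(* Fix a non-negative smooth periodic kernel E^eps and put r = E^eps rho and
   m = E^eps (rho u), so that w = m / r is the density-weighted average of u.
   The mollified equations hold at each x as ordinary differential equations
   in t, and the integral over the torus of the energy |m|^2 / (2 r) +
   r^gamma / (gamma - 1) changes at the rate of a sum of Constantin--E--Titi
   commutators.  These are cubic in the increments of u, up to the bounds on
   rho, divided by eps, and the hypothesis on u makes the space-time integral
   of |u(x + h) - u(x)|^3 of order o(|h|).  Since rho stays in a compact subset
   of (0, oo), where the pressure is smooth, the pressure commutator is of order
   |delta rho|^2 |delta u|; Young's inequality splits it with a small weight on
   |delta rho|^3, which is O(|h|) because 3 alpha >= 1.  As eps tends to 0 the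
   mollified energies converge by Jensen's inequality from above and Fatou's
   lemma from below. *)
Require Import Defs.
From HB Require Import structures.
From mathcomp Require Import all_boot all_order all_algebra.
From mathcomp Require Import all_classical all_reals all_analysis.
From mathcomp Require Import measurable_realfun ring lra.
Set Implicit Arguments.
Unset Strict Implicit.
Unset Printing Implicit Defensive.
Import Order.TTheory GRing.Theory Num.Theory.
Import numFieldNormedType.Exports.
Local Open Scope classical_set_scope.
Local Open Scope ring_scope.

(** * Lebesgue measure on the unit cell and its translation invariance *)

(** Three obstacles shape the development. [lebT] is a bare set function, so integrals against it
    are transferred to the probability [muT], concentrated on the cell, where Tonelli and
    translation invariance are available. The bounds on the density and the finiteness of the L^3
    norm hold almost everywhere only, whereas the mollified identities are used at every x; the
    density is therefore clipped to [c, C] and the velocity set to 0 at exceptional times. The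
    mollified equations hold in time as distributions, so mollified quantities are primitives of
    merely integrable functions; the chain rule for the energy rests on a quadratic bound on
    increments and not on pointwise derivatives. The average m / r is chosen because the mollified
    mass equation then has no commutator: after integration by parts only centred third moments and
    the Jensen defect of the pressure remain. The kernel is one-sided, supported in (0, eps)^d
    modulo 1, so that its support meets the cell in a single box. Energies are compared in the
    extended reals, since the initial energy is not assumed finite. *)

Section Restriction.
Context d (T : measurableType d) (R : realType) (m : {measure set T -> \bar R})
  (D : set T) (mD : measurable D).
Local Open Scope ereal_scope.

Lemma ge0_integral_mrestr (f : T -> \bar R) : measurable_fun setT f ->
  (forall x, 0 <= f x) -> \int[mrestr m mD]_x f x = \int[m]_(x in D) f x.
Proof.
move=> mf f0.
have z : mrestr m mD (~` D) = 0 by rewrite /mrestr/= setICl measure0.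
rewrite (@ge0_negligible_integral _ _ _ _ setT (~` D))//=; last exact: measurableC.
rewrite setDE setCK setTI; apply: eq_measure_integral => A mA AD.
by rewrite /mrestr/=; congr (m _); apply/setIidPl.
Qed.

Lemma integral_mrestr (f : T -> \bar R) : measurable_fun setT f ->
  \int[mrestr m mD]_x f x = \int[m]_(x in D) f x.
Proof.
move=> mf; rewrite [LHS]integralE [RHS]integralE; congr (_ - _);
  apply: ge0_integral_mrestr => //.
exact: measurable_funepos. exact: measurable_funeneg.
Qed.

End Restriction.

Section Unit.
Variable R : realType.
Let I01 : set R := `[0%R, 1%R[%classic.
Lemma mI01 : measurable (I01 : set (measurableTypeR R)).
Proof. exact: measurable_itv. Qed.

(** The mass sits on [0, 1) while the carrier stays all of R, so translates of a periodic function
    need no change of domain. *)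
Definition lam1 : set (measurableTypeR R) -> \bar R :=
  mrestr (@lebesgue_measure R) mI01.
HB.instance Definition _ := Measure.on lam1.
Lemma lam1T : lam1 setT = 1%E.
Proof.
rewrite /lam1 /mrestr setTI lebesgue_measure_itv/= lte_fin ltr01.
by rewrite sube0.
Qed.
HB.instance Definition _ := Measure_isProbability.Build _ _ _ lam1 lam1T.

Definition tcons n (p : measurableTypeR R * n.-tuple R) :
  n.+1.-tuple R := cons_tuple p.1 p.2.
Lemma measurable_tcons n : measurable_fun setT (@tcons n).
Proof. exact: (measurable_cons measurable_fst measurable_snd). Qed.
HB.instance Definition _ n :=
  isMeasurableFun.Build _ _ _ _ (@tcons n) (@measurable_tcons n).
(** The recursion mirrors that of [lebT], but each stage is a genuine probability measure (the image
    of a product under consing), concentrated on the cell. *)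
Fixpoint muT n : probability (n.-tuple R) R :=
  match n with
  | 0 => \d_([tuple] : 0.-tuple R)
  | n.+1 => distribution (lam1 \x muT n)%E (@tcons n)
  end.

Lemma ge0_integral_muTS n (f : n.+1.-tuple R -> \bar R) :
  measurable_fun setT f -> (forall x, (0 <= f x)%E) ->
  (\int[muT n.+1]_x f x = \int[lam1]_s \int[muT n]_t f (cons_tuple s t))%E.
Proof.
move=> mf f0 /=; rewrite ge0_integral_distribution// .
rewrite (fubini_tonelli1 (f \o @tcons n))//=.
by apply: measurableT_comp => //; exact: measurable_tcons.
Qed.


Lemma cell_cons n s (t : n.-tuple R) :
  @cell R n.+1 (cons_tuple s t) <-> (0 <= s < 1) /\ @cell R n t.
Proof.
split=> [H|[hs ht] i].
  by split=> [|i]; [exact: (H ord0)|have := H (lift ord0 i); rewrite tnthS].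
by case: (unliftP ord0 i) => [j ->|->]; [rewrite tnthS; exact: ht|].
Qed.

(** Induction on the dimension: for a first coordinate in [0, 1) the section of the cell is the
    smaller cell, and for any other coordinate it is empty. *)
Lemma lebT_cell n (A : set (n.-tuple R)) : measurable A ->
  @lebT R n (A `&` @cell R n) = muT n A.
Proof.
elim: n A => [|n IH] A mA /=.
  rewrite /dirac; congr (_%:E); rewrite !indicE; congr (_%:R).
  congr (nat_of_bool _); apply/idP/idP; rewrite !inE; first by case.
  by move=> A0; split=> // -[].
have m1 : measurable (@tcons n @^-1` A).
  rewrite -[X in measurable X]setTI; exact: measurable_tcons.
rewrite /distribution /pushforward /= /product_measure1.
rewrite [RHS]integral_mrestr; last exact: measurable_fun_xsection.
rewrite [RHS]integral_mkcond; apply: eq_integral => x _.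
rewrite /patch; case: ifPn => [|].
  rewrite inE /I01/= in_itv/= => hx; rewrite -IH; last exact: measurable_xsection.
  congr (@lebT R n _); apply/seteqP; split => t /=.
    by move=> [At /cell_cons[_ ct]]; split=> //; rewrite /xsection/= inE.
  by rewrite /xsection/= inE => -[At ct]; split=> //; apply/cell_cons.
rewrite notin_setE /I01/= in_itv/= => hx.
rewrite [X in @lebT R n X](_ : _ = set0 `&` @cell R n).
  by rewrite IH// measure0.
rewrite set0I; apply/seteqP; split => t //= [_ /cell_cons[]].
by move=> h; rewrite h in hx.
Qed.

Lemma measurable_cell n : measurable (@cell R n : set (n.-tuple R)).
Proof.
rewrite (_ : @cell R n = \bigcap_(i in [set: 'I_n])
   ((@tnth n R)^~ i @^-1` `[0%R, 1%R[%classic)).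
  apply: fin_bigcap_measurable => // i _.
  rewrite -[X in measurable X]setTI; apply: measurable_tnth => //.
by apply/seteqP; split=> x /= H i; have := H i; rewrite /= in_itv/= => //; apply.
Qed.

Lemma muT_cell n : muT n (@cell R n) = 1%E.
Proof.
rewrite -lebT_cell; last exact: measurable_cell.
rewrite setIid -[@cell R n in LHS]setTI lebT_cell//; exact: probability_setT.
Qed.

Import HBNNSimple.

(** The left integral is unfolded to suprema of [sintegral] over simple functions. A nonnegative
    simple function below a function restricted to the cell vanishes outside the cell, so its level
    sets at nonzero values lie in the cell, where [lebT] and [muT] agree. *)
Lemma integral_cell n (f : n.-tuple R -> \bar R) :
  measurable_fun setT f ->
  (\int[@lebT R n]_(x in @cell R n) f x = \int[muT n]_x f x)%E.
Proof.
move=> mf.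
have muC : muT n (~` @cell R n) = 0%E.
  rewrite probability_setC; last exact: measurable_cell.
  by rewrite muT_cell subee.
have key : forall g : n.-tuple R -> \bar R, measurable_fun setT g -> (forall x, 0 <= g x)%E ->
   (\int[muT n]_x g x = \int[muT n]_(x in @cell R n) g x)%E.
  move=> g mg g0.
  rewrite (@ge0_negligible_integral _ _ _ (muT n) setT (~` @cell R n))//=; last first.
    by apply: measurableC; exact: measurable_cell.
  by rewrite setDE setCK setTI.
transitivity (\int[muT n]_(x in @cell R n) f x)%E; last first.
  rewrite [LHS]integralE [RHS]integralE; congr (_ - _)%E; apply/esym/key => //.
  exact: measurable_funepos. exact: measurable_funeneg.
rewrite /integral funepos_restrict funeneg_restrict.
have aux : forall g : n.-tuple R -> \bar R,
  [set sintegral (@lebT R n) h | h in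
    [set h : {nnsfun (n.-tuple R) >-> R} |
       (forall x, (h x)%:E <= (g \_ (@cell R n)) x)%E]] =
  [set sintegral (muT n) h | h in
    [set h : {nnsfun (n.-tuple R) >-> R} |
       (forall x, (h x)%:E <= (g \_ (@cell R n)) x)%E]].
  move=> g.
  have E : forall h : {nnsfun (n.-tuple R) >-> R},
     (forall x, (h x)%:E <= (g \_ (@cell R n)) x)%E ->
     sintegral (@lebT R n) h = sintegral (muT n) h.
    move=> h hg; apply: eq_fsbigr => r _.
    have [->|r0] := eqVneq r 0; first by rewrite !mul0e.
    congr (_ * _)%E; rewrite -lebT_cell//; congr (@lebT R n _).
    apply/esym/setIidPl => t/= htr.
    have := hg t; rewrite /patch; case: ifPn; first by rewrite inE.
    move=> tD; move: r0; rewrite -htr => ht0.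
    by rewrite le_eqVlt eqe (negbTE ht0)/= lte_fin// ltNge// fun_ge0.
  by apply/seteqP; split=> _ [h hg <-]; exists h => //; rewrite E.
by congr (ereal_sup _ - ereal_sup _)%E; exact: aux.
Qed.

Lemma intT_muT n (f : n.-tuple R -> R) : measurable_fun setT f ->
  intT f = (\int[muT n]_x (f x)%:E)%E.
Proof. by move=> mf; apply: integral_cell; exact/measurable_EFinP. Qed.

End Unit.

Section Shift1.
Variable R : realType.
Notation RM := (measurableTypeR R).
Notation leb := (@lebesgue_measure R).

Lemma lebesgue_measure_shift (h : R) (A : set RM) : measurable A ->
  pushforward leb (fun x : RM => x + h : RM) A = leb A.
Proof.
have mh : measurable_fun setT (fun x : RM => x + h : RM).
  by apply: measurable_funD => //; exact: measurable_cst.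
pose f : {mfun RM >-> RM} := HB.pack (fun x : RM => x + h : RM)
  (isMeasurableFun.Build _ _ _ _ _ mh).
move=> mA; apply/esym; apply: (@lebesgue_measure_unique _ (pushforward leb f)) => //.
move=> _ [[a b]] _ <-.
transitivity (leb (`]a - h, b - h] : set RM)); last first.
  by congr (leb _); apply/seteqP; split => x /=; rewrite !in_itv/=; lra.
rewrite !lebesgue_measure_itv/= !lte_fin ltrD2r.
by case: ifPn => // _; rewrite -!EFinB; congr (_%:E); ring.
Qed.

Lemma ge0_integral_shift (F : RM -> \bar R) (a b h : R) : measurable_fun setT F ->
  (forall x, 0 <= F x)%E ->
  (\int[leb]_(s in `[a, b[) F (s + h)%R = \int[leb]_(s in `[(a + h)%R, (b + h)%R[) F s)%E.
Proof.
move=> mF F0.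
have mh : measurable_fun setT (fun x : RM => x + h : RM).
  by apply: measurable_funD => //; exact: measurable_cst.
pose f : {mfun RM >-> RM} := HB.pack (fun x : RM => x + h : RM)
  (isMeasurableFun.Build _ _ _ _ _ mh).
transitivity (\int[pushforward leb f]_(s in `[(a + h)%R, (b + h)%R[) F s)%E; last first.
  by apply: eq_measure_integral => A mA _; exact: lebesgue_measure_shift.
rewrite ge0_integral_pushforward//=; last exact: measurable_funTS.
rewrite (_ : _ @^-1` _ = `[a, b[%classic)//.
by apply/seteqP; split => x /=; rewrite !in_itv/= lerD2r ltrD2r.
Qed.

(** Periodicity reduces h to its fractional part. The shifted interval [h, 1 + h) is then cut at 1
    and the piece beyond 1 is moved back by one period onto [0, h). *)
Lemma lam1_shift (F : RM -> \bar R) (h : R) : measurable_fun setT F ->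
  (forall x, 0 <= F x)%E -> (forall x, F (x + 1)%R = F x) ->
  (\int[@lam1 R]_s F (s + h)%R = \int[@lam1 R]_s F s)%E.
Proof.
move=> mF F0 F1.
have Fn : forall (k : nat) x, F (x + k%:R) = F x.
  elim=> [|k IH] x; first by rewrite addr0.
  by rewrite -natr1 addrA F1.
have Fz : forall (z : int) x, F (x + z%:~R) = F x.
  move=> [k|k] x; first exact: Fn.
  by rewrite NegzE mulrNz -[LHS](Fn k.+1) addrNK.
wlog hh : h / 0 <= h < 1.
  move=> W; rewrite -(W (h - (Num.floor h)%:~R)).
    by apply: eq_integral => s _; rewrite addrA -[in RHS](Fz (Num.floor h)) addrNK.
  have := Num.Theory.floor_le h; have := Num.Theory.floorD1_gt h.
  rewrite intrD; lra.
have mFh : measurable_fun setT (fun s : RM => F (s + h : RM)).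
  by apply: measurableT_comp => //; apply: measurable_funD => //; exact: measurable_cst.
rewrite !ge0_integral_mrestr// ge0_integral_shift// add0r.
have mT : forall (A : set RM), measurable_fun A F by move=> A; exact: measurable_funTS.
have -> : (`[h, 1 + h[%classic : set R) = `[h, 1[ `|` `[1, 1 + h[.
  by apply/seteqP; split => x /=; rewrite !in_itv/=; lra.
have -> : (`[0, 1[%classic : set R) = `[0, h[ `|` `[h, 1[.
  by apply/seteqP; split => x /=; rewrite !in_itv/=; lra.
rewrite !ge0_integral_setU//; last 2 first.
- apply/disj_setPS => x [] /=; rewrite !in_itv/=; lra.
- apply/disj_setPS => x [] /=; rewrite !in_itv/=; lra.
rewrite addeC; congr (_ + _)%E.
transitivity (\int[leb]_(s in `[0%R, h[) F (s + 1)%R)%E; last by apply: eq_integral => s _; exact: F1.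
by rewrite ge0_integral_shift// add0r addrC.
Qed.
End Shift1.

Section Torus.
Variable R : realType.
Notation RM := (measurableTypeR R).
Notation leb := (@lebesgue_measure R).

Definition perT n (A : Type) (f : n.-tuple R -> A) :=
  forall x (j : 'I_n), f (tadd x (tunit R j)) = f x.

Lemma tadd_cons n s (t : n.-tuple R) h :
  tadd (cons_tuple s t) h = cons_tuple (s + tnth h ord0) (tadd t (behead_tuple h)).
Proof.
apply: eq_from_tnth => i; rewrite tnth_mktuple.
by case: (unliftP ord0 i) => [j ->|-> //]; rewrite !tnthS tnth_mktuple [h in LHS]tuple_eta tnthS.
Qed.

Lemma taddA n (x y z : n.-tuple R) : tadd x (tadd y z) = tadd (tadd x y) z.
Proof. by apply: eq_from_tnth => i; rewrite !tnth_mktuple addrA. Qed.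
Lemma taddC n (x y : n.-tuple R) : tadd x y = tadd y x.
Proof. by apply: eq_from_tnth => i; rewrite !tnth_mktuple addrC. Qed.
Lemma taddAC n (x y z : n.-tuple R) : tadd (tadd x y) z = tadd (tadd x z) y.
Proof. by rewrite -!taddA (taddC y). Qed.


Lemma measurable_tadd n d (T : measurableType d) (f g : T -> n.-tuple R) :
  measurable_fun setT f -> measurable_fun setT g ->
  measurable_fun setT (fun x => tadd (f x) (g x)).
Proof.
move=> /measurable_fun_tnthP mf /measurable_fun_tnthP mg.
apply/measurable_fun_tnthP => i.
rewrite (_ : _ \o _ = (fun x => tnth (f x) i + tnth (g x) i)).
  by apply: measurable_funD; [exact: mf|exact: mg].
by apply/funext => x /=; rewrite tnth_mktuple.
Qed.

Lemma measurable_taddl n (h : n.-tuple R) :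
  measurable_fun setT (fun x : n.-tuple R => tadd x h).
Proof. by apply: measurable_tadd => //; exact: measurable_cst. Qed.

Lemma perT_cons n A (f : n.+1.-tuple R -> A) : perT f ->
  (forall s t, f (cons_tuple (s + 1) t) = f (cons_tuple s t)) /\
  (forall s, perT (fun t => f (cons_tuple s t))).
Proof.
move=> pf; split=> [s t|s t j].
  rewrite -[RHS](pf _ ord0); congr (f _); apply: eq_from_tnth => i.
  rewrite tnth_mktuple; case: (unliftP ord0 i) => [k ->|->].
    by rewrite !tnthS tnth_mktuple /= addr0.
  by rewrite tnth_mktuple eqxx.
rewrite -[RHS](pf _ (lift ord0 j)); congr (f _); apply: eq_from_tnth => i.
rewrite tnth_mktuple; case: (unliftP ord0 i) => [k ->|->].
  by rewrite !tnthS !tnth_mktuple (inj_eq lift_inj).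
by rewrite tnth_mktuple /= addr0.
Qed.

Lemma measurable_cons1 n (s : RM) :
  measurable_fun setT (fun t : n.-tuple R => (cons_tuple s t : n.+1.-tuple R)).
Proof. exact: (@measurable_cons _ _ _ _ (fun=> s) n id (measurable_cst _) (@measurable_id _ _ _)). Qed.

(** Induction on the dimension: the induction hypothesis absorbs the shift of the tail at a fixed
    first coordinate, and [lam1_shift] that of the first coordinate. *)
Lemma ge0_muT_shift n (f : n.-tuple R -> \bar R) h : measurable_fun setT f ->
  (forall x, 0 <= f x)%E -> perT f ->
  (\int[muT R n]_x f (tadd x h) = \int[muT R n]_x f x)%E.
Proof.
elim: n f h => [|n IH] f h mf f0 pf.
  by apply: eq_integral => x _; congr f; apply: eq_from_tnth => -[].
have mfh : measurable_fun setT (fun x => f (tadd x h)).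
  by apply: measurableT_comp => //; exact: measurable_taddl.
have E2 := ge0_integral_muTS mfh (fun x => f0 (tadd x h)).
rewrite [RHS](ge0_integral_muTS mf f0) [LHS]E2.
pose F (s : RM) := (\int[muT R n]_t f (cons_tuple s t))%E.
have mF : measurable_fun setT F.
  apply: (@measurable_fun_fubini_tonelli_F _ _ _ _ _ (muT R n) (f \o @tcons R n)).
    by apply: measurableT_comp => //; exact: measurable_tcons.
  by move=> x; exact: f0.
have [p1 p2] := perT_cons pf.
transitivity (\int[@lam1 R]_s F (s + tnth h ord0)%R)%E.
  apply: eq_integral => s _.
  under eq_integral do rewrite tadd_cons.
  apply: (IH (fun t => f (cons_tuple (s + tnth h ord0) t))) => //.
  by apply: measurableT_comp => //; exact: measurable_cons1.
apply: lam1_shift => //.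
  by move=> s; apply: integral_ge0.
by move=> s; apply: eq_integral => t _; exact: p1.
Qed.

Lemma muT_prod n (h : 'I_n -> RM -> \bar R) :
  (forall i, measurable_fun setT (h i)) -> (forall i x, 0 <= h i x)%E ->
  (\int[muT R n]_x \prod_(i < n) h i (tnth x i) = \prod_(i < n) \int[@lam1 R]_s h i s)%E.
Proof.
elim: n h => [|n IH] h mh h0.
  rewrite big_ord0; under eq_integral do rewrite big_ord0.
  by rewrite integral_cst//= probability_setT mule1.
have mp : forall n (k : 'I_n -> RM -> \bar R), (forall i, measurable_fun setT (k i)) ->
    measurable_fun setT (fun x : n.-tuple R => \prod_(i < n) k i (tnth x i))%E.
  move=> m k mk.
  have : forall s : seq 'I_m, measurable_fun setT
       (fun x : m.-tuple R => \prod_(i <- s) k i (tnth x i))%E.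
    elim=> [|i s IHs]; first by under eq_fun do rewrite big_nil; exact: measurable_cst.
    under eq_fun do rewrite big_cons; apply: emeasurable_funM => //.
    by apply: (measurableT_comp (mk i)); exact: measurable_tnth.
  exact.
rewrite ge0_integral_muTS//; last 2 first.
- exact: mp.
- by move=> x; apply: prode_ge0 => i _.
rewrite big_ord_recl -(IH (fun i => h (lift ord0 i)))//.
rewrite -ge0_integralZr//; last by apply: integral_ge0 => x _; apply: prode_ge0 => i _.
apply: eq_integral => s _; rewrite -ge0_integralZl//; last 2 first.
- exact: (mp _ (fun i => h (lift ord0 i))).
- by move=> x _; apply: prode_ge0 => i _.
apply: eq_integral => t _; rewrite big_ord_recl; congr (_ * _)%E.
by apply: eq_bigr => i _; rewrite tnthS.
Qed.

End Torus.

(** * Continuity of translations in L^1 of the torus *)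

Section L1.
Variable R : realType.
Notation RM := (measurableTypeR R).

Definition fracpart (x : R) : R := x - (Num.floor x)%:~R.
Lemma fracpart_itv x : 0 <= fracpart x < 1.
Proof.
rewrite /fracpart; have := floor_le x; have := floorD1_gt x.
by rewrite intrD; lra.
Qed.
Lemma fracpart_id x : 0 <= x < 1 -> fracpart x = x.
Proof.
move=> h; rewrite /fracpart (_ : Num.floor x = 0) ?subr0//.
by apply: floor_def; rewrite add0r.
Qed.
Lemma measurable_frac : measurable_fun setT fracpart.
Proof.
apply: measurable_funB => //.
by apply: nondecreasing_measurable => // x y xy; rewrite ler_int le_floor.
Qed.
Lemma fracpartD1 x : fracpart (x + 1) = fracpart x.
Proof.
rewrite /fracpart floorDrz ?floor1; last by rewrite rpred1.
by rewrite intrD; ring.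
Qed.

Definition fr n (x : n.-tuple R) : n.-tuple R := [tuple fracpart (tnth x i) | i < n].

Lemma measurable_fr n : measurable_fun setT (@fr n).
Proof.
apply/measurable_fun_tnthP => i.
rewrite (_ : _ \o _ = (fun x => fracpart (tnth x i))).
  by apply: (measurableT_comp measurable_frac); exact: measurable_tnth.
by apply/funext => x /=; rewrite tnth_mktuple.
Qed.

Lemma fr_cell n x : @cell R n (fr x).
Proof. by move=> i; rewrite tnth_mktuple fracpart_itv. Qed.

Lemma fr_id n (x : n.-tuple R) : cell x -> fr x = x.
Proof. by move=> cx; apply: eq_from_tnth => i; rewrite tnth_mktuple fracpart_id. Qed.

Lemma fr_per n : perT (@fr n).
Proof.
move=> x j; apply: eq_from_tnth => i; rewrite !tnth_mktuple.
by case: eqP => _; [rewrite fracpartD1|rewrite addr0].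
Qed.

Lemma per_fr n A (f : n.-tuple R -> A) : perT f -> forall x, f (fr x) = f x.
Proof.
elim: n f => [|n IH] f pf x; first by congr f; apply: eq_from_tnth => -[].
have [p1 p2] := perT_cons pf.
have pn : forall (k : nat) s t, f (cons_tuple (s + k%:R) t) = f (cons_tuple s t).
  elim=> [|k IHk] s t; first by rewrite addr0.
  by rewrite -natr1 addrA p1.
have pz : forall (z : int) s t, f (cons_tuple (s + z%:~R) t) = f (cons_tuple s t).
  move=> [k|k] s t; first exact: pn.
  by rewrite NegzE mulrNz -[LHS](pn k.+1) addrNK.
have xE : x = cons_tuple (thead x) (behead_tuple x).
  by rewrite {1}(tuple_eta x); exact/val_inj.
have fE : fr x = cons_tuple (fracpart (thead x)) (fr (behead_tuple x)).
  apply: eq_from_tnth => i; rewrite tnth_mktuple.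
  case: (unliftP ord0 i) => [k ->|-> //].
  by rewrite {1}xE !tnthS tnth_mktuple.
rewrite [in RHS]xE fE -[RHS](IH (fun t => f (cons_tuple (thead x) t)))//.
by rewrite /fracpart -mulrNz pz.
Qed.

Lemma measure_indic d (T : measurableType d) (m : {measure set T -> \bar R}) A :
  measurable A -> m A = (\int[m]_x (\1_A x)%:E)%E.
Proof. by move=> mA; rewrite integral_indic// setIT. Qed.

Variable n : nat.
Notation X := (n.-tuple R).
Notation mu := (muT R n).

Lemma le_mu (A B : set X) : measurable A -> measurable B -> A `<=` B -> (mu A <= mu B)%E.
Proof. by move=> mA mB; apply: le_measure; rewrite inE. Qed.

Let P (A : set X) h := [set x | A (fr (tadd x h))].
(** The points at which the indicator of A, made periodic through [fr], changes under the shift by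
    h; its measure is the L^1 modulus of continuity of that indicator. *)
Let D (A : set X) h := [set x | ~ (A (fr (tadd x h)) <-> A (fr x))].

Let mP A h : measurable A -> measurable (P A h).
Proof.
move=> mA; rewrite -[X in measurable X]setTI.
have : measurable_fun setT (fun x : X => fr (tadd x h)).
  by apply: (measurableT_comp (@measurable_fr n)); exact: measurable_taddl.
exact.
Qed.
Let mfr A : measurable A -> measurable [set x : X | A (fr x)].
Proof.
by move=> mA; rewrite -[X in measurable X]setTI; exact: measurable_fr.
Qed.

Let DE A h : D A h = (P A h `\` [set x | A (fr x)]) `|` ([set x | A (fr x)] `\` P A h).
Proof.
apply/seteqP; split=> x /=; rewrite /D/P/=.
  by case: (pselect (A (fr (tadd x h)))); case: (pselect (A (fr x))) => /=; tauto.
by move=> [[a b] [c _]|[a b] [_ c]]; [exact/b/c|exact/b/c].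
Qed.
Let mD A h : measurable A -> measurable (D A h).
Proof.
by move=> mA; rewrite DE; apply: measurableU; apply: measurableD;
  try exact: mP; exact: mfr.
Qed.

Let muP A h : measurable A -> mu (P A h) = mu [set x : X | A (fr x)].
Proof.
move=> mA.
have m1 := mfr mA. have m2 := mP h mA.
rewrite !measure_indic//.
pose F (y : X) : \bar R := (\1_A (fr y))%:E.
transitivity (\int[mu]_x F (tadd x h))%E.
  by apply: eq_integral => x _; congr (_%:E); rewrite !indicE.
rewrite (@ge0_muT_shift R n F)//.
- by apply/measurable_EFinP; apply: (measurableT_comp (measurable_indic mA)); exact: measurable_fr.
- by move=> x; rewrite lee_fin.
- by move=> x j; rewrite /F fr_per.
Qed.

Let small (h : X) (dl : R) := forall i, `|tnth h i| < dl.

(** The sets whose periodized indicator is continuous under translation in L^1. They form a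
    sigma-algebra containing the half-spaces, hence contain every measurable set. *)
Let C : set (set X) := [set A | measurable A /\ forall e, 0 < e ->
  exists2 dl, 0 < dl & forall h, small h dl -> (mu (D A h) <= e%:E)%E].

Let C0 : C set0.
Proof.
split=> // e e0; exists 1 => // h _.
rewrite (_ : D set0 h = set0) ?measure0 ?lee_fin ?ltW//.
by apply/seteqP; split => // x []; split.
Qed.

Let CC A : C A -> C (setT `\` A).
Proof.
move=> [mA H]; split; first exact: measurableD.
move=> e /H[dl dl0 Hd]; exists dl => // h /Hd.
rewrite (_ : D (setT `\` A) h = D A h)//.
by apply/seteqP; split=> x; rewrite /D/=;
  case: (pselect (A (fr x))); case: (pselect (A (fr (tadd x h)))); tauto.
Qed.

Let CU A B : C A -> C B -> C (A `|` B).
Proof.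
move=> [mA HA] [mB HB]; split; first exact: measurableU.
move=> e e0.
have e2 : 0 < e / 2 by rewrite divr_gt0.
have [d1 d10 H1] := HA _ e2; have [d2 d20 H2] := HB _ e2.
exists (Num.min d1 d2); first by rewrite lt_min d10.
move=> h sh.
apply: (@le_trans _ _ (mu (D A h `|` D B h))).
  apply: le_mu; [apply: mD; exact: measurableU|by apply: measurableU; apply: mD|].
  move=> x; rewrite /D/=.
  case: (pselect (A (fr x))); case: (pselect (A (fr (tadd x h))));
  case: (pselect (B (fr x))); case: (pselect (B (fr (tadd x h)))); tauto.
apply: (le_trans (measureU2 _ _ _)); [exact: mD|exact: mD|].
rewrite [e]splitr EFinD; apply: leeD.
  by apply: H1 => i; apply: (lt_le_trans (sh i)); rewrite ge_min lexx.
by apply: H2 => i; apply: (lt_le_trans (sh i)); rewrite ge_min lexx orbT.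
Qed.

(** A finite union approximates the countable one up to measure e / 3. One third is spent on the
    finite union, one on the remainder at x, and one on the remainder at x + h, whose measure is the
    same by shift invariance. *)
Let CbU (F : (set X)^nat) : (forall k, C (F k)) -> C (\bigcup_k F k).
Proof.
move=> CF.
pose G N := \big[setU/set0]_(k < N) F k.
have CG N : C (G N) by rewrite /G; elim/big_ind: _ => // k _; exact: CF.
have mF k := (CF k).1. have mG N := (CG N).1.
have mU : measurable (\bigcup_k F k) by exact: bigcupT_measurable.
split=> // e e0.
have e3 : 0 < e / 3 by rewrite divr_gt0.
pose B N := [set x : X | ((\bigcup_k F k) `\` G N) (fr x)].
have mB N : measurable (B N) by apply: mfr; exact: measurableD.
have : (mu \o B) N @[N --> \oo] --> mu (\bigcap_N B N).
  apply: nonincreasing_cvg_mu => //.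
  - exact: (le_lt_trans (probability_le1 _ _) (ltry _)).
  - exact: bigcapT_measurable.
  - move=> N M NM; apply/subsetPset => x [/= xF nx]; split=> //.
    by move=> GN; apply: nx; move: GN; apply: subset_bigsetU.
rewrite (_ : \bigcap_N B N = set0); last first.
  apply/seteqP; split=> // x /= H.
  have [[k _ Fk] _] := H 0%N I.
  have [_] := H k.+1 I; apply.
  by rewrite /G -bigcup_mkord; exists k => /=.
rewrite measure0 => /fine_cvgP[_ /cvgrPdist_le /(_ _ e3)[N _ HN]].
have BN : (mu (B N) <= (e / 3)%:E)%E.
  have := HN N (leqnn N); rewrite sub0r normrN ger0_norm ?fine_ge0//=.
  by rewrite -lee_fin fineK// fin_num_measure.
have [dl dl0 Hd] := (CG N).2 _ e3.
exists dl => // h /Hd DG.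
have mDG : measurable (D (G N) h) by exact: mD.
have mPB : measurable (P ((\bigcup_k F k) `\` G N) h) by apply: mP; exact: measurableD.
have PB : (mu (P ((\bigcup_k F k) `\` G N) h) <= (e / 3)%:E)%E.
  by rewrite muP//; exact: measurableD.
apply: (@le_trans _ _ (mu (D (G N) h `|` (B N `|` P ((\bigcup_k F k) `\` G N) h)))).
  apply: le_mu => //; [exact: mD|by apply: measurableU => //; exact: measurableU|].
  have GU x : G N x -> (\bigcup_k F k) x.
    by rewrite /G -bigcup_mkord => -[k _ Fk]; exists k.
  move=> x; rewrite /D/B/P /mkset /setD /setU /mkset; have := @GU (fr x); have := @GU (fr (tadd x h)).
  set U := \bigcup_k F k.
  case: (pselect (U (fr x))); case: (pselect (U (fr (tadd x h))));
  case: (pselect (G N (fr x))); case: (pselect (G N (fr (tadd x h)))); tauto.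
apply: (le_trans (measureU2 _ _ _)) => //; first exact: measurableU.
rewrite (_ : e = e / 3 + (e / 3 + e / 3)); last by lra.
rewrite EFinD; apply: leeD => //.
apply: (le_trans (measureU2 _ _ _)) => //.
by rewrite EFinD; apply: leeD.
Qed.

Let mu_coord i (B : set RM) : measurable B ->
  mu [set x : X | B (tnth x i)] = lam1 B.
Proof.
move=> mB.
have mS : measurable [set x : X | B (tnth x i)].
  rewrite -[X in measurable X]setTI.
  exact: (@measurable_tnth _ R n i measurableT B mB).
rewrite !measure_indic//.
pose k (j : 'I_n) (s : RM) : \bar R := if j == i then (\1_B s)%:E else 1%E.
transitivity (\int[mu]_x \prod_(j < n) k j (tnth x j))%E.
  apply: eq_integral => x _; rewrite (bigD1 i)//= /k eqxx big1 ?mule1//.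
  by move=> j /negPf ->.
rewrite muT_prod.
- rewrite (bigD1 i)//= [X in (_ * X)%E]big1 ?mule1.
    by apply: eq_integral => s _; rewrite /k eqxx.
  move=> j /negPf ji; rewrite /k ji integral_cst//= mul1e.
  exact: probability_setT.
- move=> j; rewrite /k; case: eqP => _; last exact: measurable_cst.
  by apply/measurable_EFinP; exact: measurable_indic.
- by move=> j s; rewrite /k; case: eqP.
Qed.

(** Membership can change only if the i-th coordinate is within dl of the threshold a or of a face 0
    or 1 of the cell, where [fr] jumps. These are three slabs of width 2 dl, each of measure at most
    e / 6. *)
Let Cray i (a : R) : C [set x : X | tnth x i < a].
Proof.
have mA : measurable [set x : X | tnth x i < a].
  rewrite -[X in measurable X]setTI.
  apply: (@measurable_tnth _ R n i measurableT `]-oo, a[%classic).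
  exact: measurable_itv.
split=> // e e0.
pose dl := Num.min (1/2) (e / 12).
have dl0 : 0 < dl by rewrite lt_min divr_gt0//= divr_gt0.
have dle : dl <= e / 12 by rewrite ge_min lexx orbT.
have dl2 : dl <= 1/2 by rewrite ge_min lexx.
exists dl => // h sh.
pose J (c : R) : set RM := `[c - dl, c + dl]%classic.
have mJ c : measurable (J c) by exact: measurable_itv.
pose S c := [set x : X | J c (tnth x i)].
have mS c : measurable (S c).
  rewrite -[X in measurable X]setTI.
  exact: (@measurable_tnth _ R n i measurableT (J c) (mJ c)).
have SJ c : (mu (S c) <= (e / 3)%:E)%E.
  rewrite mu_coord// /lam1 /mrestr.
  apply: (@le_trans _ _ (lebesgue_measure (J c))).
    by apply: measureIl; [exact: mJ|exact: mI01].
  rewrite lebesgue_measure_itv/=; case: ifPn => _; last by rewrite lee_fin; lra.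
  by rewrite -EFinB lee_fin; lra.
have mDA := mD h mA.
have mDc : measurable (D [set x : X | tnth x i < a] h `&` @cell R n).
  by apply: measurableI => //; exact: measurable_cell.
have -> : mu (D [set x : X | tnth x i < a] h) = mu (D [set x : X | tnth x i < a] h `&` @cell R n).
  apply/eqP; rewrite eq_le; apply/andP; split; last first.
    by apply: le_mu => //; exact: subIsetl.
  have mC := @measurable_cell R n.
  have muC : mu (~` @cell R n) = 0%E.
    by rewrite probability_setC// muT_cell subee.
  apply: (@le_trans _ _ (mu ((D [set x : X | tnth x i < a] h `&` @cell R n) `|` ~` @cell R n))).
    apply: le_mu => //; first by apply: measurableU => //; exact: measurableC.
    by move=> x Dx; case: (pselect (cell x)) => cx; [left|right].
  apply: (le_trans (measureU2 _ _ _)) => //; first exact: measurableC.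
  by rewrite [X in (_ + X)%E]muC adde0.
apply: (@le_trans _ _ (mu (S a `|` (S 0 `|` S 1)))).
  apply: le_mu => //; first by apply: measurableU => //; exact: measurableU.
  move=> x []; rewrite /D /S/J/= => Dx /(_ i) cx.
  rewrite !in_itv/=.
  have := sh i; rewrite ltr_norml => hi.
  move: Dx; rewrite !tnth_mktuple (fracpart_id cx) => Dx.
  have [xh|xh] := boolP (0 <= tnth x i + tnth h i < 1).
    left; rewrite (fracpart_id xh) in Dx.
    have [xa|xa] := ltP (tnth x i) a; have [xa'|xa'] := ltP (tnth x i + tnth h i) a.
    - by exfalso; apply: Dx; split.
    - lra.
    - lra.
    - by exfalso; apply: Dx; split=> H; exfalso; lra.
  right; have [xd|xd] := leP (tnth x i) dl; first by left; lra.
  right.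
  have [x1|x1] := ltP (tnth x i + tnth h i) 1; last by lra.
  by move: xh; rewrite x1 andbT -ltNge; lra.
apply: (le_trans (measureU2 _ _ _)) => //; first exact: measurableU.
rewrite (_ : e = e / 3 + (e / 3 + e / 3)); last by lra.
rewrite EFinD; apply: leeD; first exact: SJ.
apply: (le_trans (measureU2 _ (mS 0) (mS 1))).
by rewrite EFinD; apply: leeD; exact: SJ.
Qed.

Let CT A : measurable A -> C A.
Proof.
have SC : sigma_algebra setT C by split; [exact: C0|exact: CC|exact: CbU].
move=> mA; move: A mA; apply: smallest_sub => // A.
move=> HA.
have [i [B mB <-]] : exists i : 'I_n, exists2 B, measurable B &
    setT `&` (@tnth n R)^~ i @^-1` B = A.
  by move: HA; elim/big_ind : _ => //[S1 S2 I1 I2 [/I1|/I2]//|i _ [B mB <-]]; exists i, B.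
(* For a fixed coordinate, the sets of reals whose cylinder lies in [C] form a sigma-algebra, so it
   suffices to treat rays. *)
have SB : sigma_algebra setT [set B | C ((@tnth n R)^~ i @^-1` B)].
  split => /=; first by rewrite preimage_set0.
    by move=> E CE; have := CC CE; rewrite !setTD.
  by move=> F CF; rewrite preimage_bigcup; exact: CbU.
rewrite setTI.
have : (@ocitv R).-sigma.-measurable B by [].
rewrite RGenInftyO.measurableE; move: B {mB}; apply: smallest_sub => //.
move=> _ [a ->] /=.
rewrite (_ : _ @^-1` _ = [set x : X | tnth x i < a]); first exact: Cray.
by apply/seteqP; split=> x /=; rewrite in_itv.
Qed.

Lemma ge0_integral_muT_cell (g : X -> \bar R) :
  measurable_fun setT g -> (forall x, 0 <= g x)%E ->
  (\int[mu]_x g x = \int[mu]_(x in @cell R n) g x)%E.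
Proof.
move=> mg g0.
have mC := @measurable_cell R n.
have muC : mu (~` @cell R n) = 0%E by rewrite probability_setC// muT_cell subee.
rewrite (@ge0_negligible_integral _ _ _ mu setT (~` @cell R n))//; last exact: measurableC.
by rewrite setDE setCK setTI.
Qed.

Let Good (g : X -> R) := measurable_fun setT g /\ forall e, 0 < e ->
  exists2 dl, 0 < dl & forall h, small h dl ->
    (\int[mu]_x `|g (fr (tadd x h)) - g (fr x)|%:E <= e%:E)%E.

Let mfrh h : measurable_fun setT (fun x : X => fr (tadd x h)).
Proof. by apply: (measurableT_comp (@measurable_fr n)); exact: measurable_taddl. Qed.

Let mdiff (g : X -> R) h : measurable_fun setT g ->
  measurable_fun setT (fun x => `|g (fr (tadd x h)) - g (fr x)|%:E).
Proof.
move=> mg; apply/measurable_EFinP; apply: measurableT_comp => //.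
apply: measurable_funB.
  exact: (measurableT_comp mg (mfrh h)).
exact: (measurableT_comp mg (@measurable_fr n)).
Qed.

Let Good_indic r A : measurable A -> Good (fun x => r * \1_A x).
Proof.
move=> mA; split.
  by apply: measurable_funM; [exact: measurable_cst|exact: measurable_indic].
move=> e e0.
have e1 : 0 < e / (`|r| + 1) by rewrite divr_gt0// ltr_pwDr.
have [dl dl0 H] := (CT mA).2 _ e1.
exists dl => // h /H Dh.
have mDA := mD h mA.
apply: (@le_trans _ _ (\int[mu]_x (`|r|%:E * (\1_(D A h) x)%:E))%E).
  apply: ge0_le_integral => //.
  - apply: (@mdiff (fun x => r * \1_A x)).
    by apply: measurable_funM => //; exact: measurable_indic.
  - by apply: measurable_funeM; apply/measurable_EFinP; exact: measurable_indic.
  - move=> x _; rewrite -EFinM lee_fin -mulrBr normrM ler_wpM2l//.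
    have [Dx|nDx] := pselect (D A h x).
      rewrite [\1_(D A h) x]indicE mem_set// !indicE.
      by case: (_ \in A); case: (_ \in A); rewrite ?subrr ?subr0 ?sub0r ?normrN ?normr1 ?normr0.
    rewrite (_ : \1_A (fr (tadd x h)) = \1_A (fr x)) ?subrr ?normr0//.
    rewrite !indicE; congr (_%:R); congr nat_of_bool.
    move/contrapT : nDx => nDx.
    by apply/idP/idP; rewrite !inE; apply nDx.
rewrite ge0_integralZl//; last by apply/measurable_EFinP; exact: measurable_indic.
rewrite -measure_indic//.
apply: (@le_trans _ _ (`|r|%:E * (e / (`|r| + 1))%:E)%E).
  exact: lee_wpmul2l.
rewrite -EFinM lee_fin mulrCA ler_piMr ?(ltW e0)// ler_pdivrMr ?ltr_pwDr//.
by rewrite mul1r lerDl.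
Qed.

Let Good_add f g : Good f -> Good g -> Good (fun x => f x + g x).
Proof.
move=> [mf Hf] [mg Hg]; split; first exact: measurable_funD.
move=> e e0; have e2 : 0 < e / 2 by rewrite divr_gt0.
have [d1 d10 H1] := Hf _ e2; have [d2 d20 H2] := Hg _ e2.
exists (Num.min d1 d2); first by rewrite lt_min d10.
move=> h sh.
have s1 : small h d1 by move=> i; apply: (lt_le_trans (sh i)); rewrite ge_min lexx.
have s2 : small h d2 by move=> i; apply: (lt_le_trans (sh i)); rewrite ge_min lexx orbT.
rewrite [e]splitr EFinD; apply: le_trans (leeD (H1 _ s1) (H2 _ s2)).
rewrite -ge0_integralD//; last 2 first.
- exact: mdiff.
- exact: mdiff.
apply: ge0_le_integral => //.
- by apply: (@mdiff (fun x => f x + g x)); exact: measurable_funD.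
- by apply: emeasurable_funD; exact: mdiff.
- move=> x _; rewrite -EFinD lee_fin opprD addrACA; exact: ler_normD.
Qed.

Let Good_sum (s : seq R) (A : R -> set X) : (forall r, measurable (A r)) ->
  Good (fun x => \sum_(r <- s) r * \1_(A r) x).
Proof.
move=> mA; elim: s => [|r s IH].
  rewrite (_ : (fun x => _) = (fun x => 0 * \1_set0 x)); first exact: Good_indic.
  by apply/funext => x; rewrite big_nil mul0r.
rewrite (_ : (fun x => _) = (fun x => r * \1_(A r) x + \sum_(r <- s) r * \1_(A r) x)).
  by apply: Good_add => //; exact: Good_indic.
by apply/funext => x; rewrite big_cons.
Qed.

Import HBSimple.

Lemma L1_translate (f : X -> R) : perT f -> mu.-integrable setT (EFin \o f) ->
  forall e, 0 < e -> exists2 dl, 0 < dl & forall h, (forall i, `|tnth h i| < dl) ->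
   (\int[mu]_x `|f (tadd x h) - f x|%:E <= e%:E)%E.
Proof.
move=> pf intf e e0.
have e3 : 0 < e / 3 by rewrite divr_gt0.
have mf : measurable_fun setT f by apply/measurable_EFinP; exact: (measurable_int mu).
have [g_ [gi _ /fine_cvgP[_ /cvgrPdist_le/(_ _ e3)[N _ HN]]]] :=
  approximation_sfun_integrable (@measurableT _ X) intf.
have {HN} := HN N (leqnn N); set g := g_ N => HN.
have mg : measurable_fun setT g by [].
have Gg : Good g.
  rewrite (_ : (g : X -> R) = (fun x => \sum_(r <- finmap.enum_fset (fset_set (range g))) r * \1_(g @^-1` [set r]) x)).
    by apply: Good_sum => r; exact: measurable_sfunP.
  by apply/funext => x; rewrite fimfunE fsbig_finite.
have [dl dl0 H] := Gg.2 _ e3.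
exists dl => // h sh.
(* The approximating simple function is not periodic. Reading it through [fr] makes the error [w]
   periodic, so that its translate has the same integral. *)
pose w x := `|f x - g (fr x)|%:E.
have mw : measurable_fun setT w.
  apply/measurable_EFinP; apply: measurableT_comp => //; apply: measurable_funB => //.
  exact: (measurableT_comp mg (@measurable_fr n)).
have pw : perT w by move=> x j; rewrite /w pf fr_per.
have w0 : forall x, (0 <= w x)%E by move=> x; rewrite lee_fin.
have wle : (\int[mu]_x w x <= (e / 3)%:E)%E.
  have -> : (\int[mu]_x w x = \int[mu]_x `|f x - g x|%:E)%E.
    rewrite !ge0_integral_muT_cell//.
      by apply: eq_integral => x /set_mem cx; rewrite /w fr_id.
      by apply/measurable_EFinP; apply: measurableT_comp => //; exact: measurable_funB.
  pose I0 := (\int[mu]_x `|f x - g x|%:E)%E; rewrite -/I0.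
  have I00 : (0 <= I0)%E by exact: integral_ge0.
  have If : I0 \is a fin_num.
    have : mu.-integrable setT (fun z => (EFin \o f) z - (EFin \o g) z)%E.
      by apply: integrableB => //; exact: gi.
    by move=> /integrableP[_ Hfin]; rewrite ge0_fin_numE.
  have : `|0 - fine I0| <= e / 3 by exact: HN.
  rewrite sub0r normrN ger0_norm ?fine_ge0// => H1.
  have H2 : (I0 <= (e / 3)%:E)%E by rewrite -(fineK If) lee_fin.
  exact: H2.
rewrite (_ : e = e / 3 + (e / 3 + e / 3)); last by lra.
rewrite !EFinD.
have mwh : measurable_fun setT (fun x => w (tadd x h)).
  by apply: (measurableT_comp mw); exact: measurable_taddl.
have whle : (\int[mu]_x w (tadd x h) <= (e / 3)%:E)%E by rewrite ge0_muT_shift.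
apply: le_trans (leeD whle (leeD (H h sh) wle)).
have md := mdiff h mg.
rewrite -ge0_integralD//.
rewrite -ge0_integralD//; [|by move=> x _; rewrite adde_ge0|exact: emeasurable_funD].
apply: ge0_le_integral => //.
- apply/measurable_EFinP; apply: measurableT_comp => //; apply: measurable_funB => //.
  by apply: (measurableT_comp mf); exact: measurable_taddl.
- by apply: emeasurable_funD => //; exact: emeasurable_funD.
move=> x _; rewrite /w -!EFinD lee_fin.
set a := f (tadd x h); set b := f x; set c := g _; set d0 := g (fr x).
rewrite (_ : a - b = (a - c) + ((c - d0) - (b - d0))); last by ring.
apply: le_trans (ler_normD _ _) _; rewrite lerD2l.
exact: ler_normB.
Qed.

End L1.

(** * Smooth functions of one variable and tensor-product test functions *)

Section Smooth1.
Variable R : realType.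
Implicit Types (f g : R -> R) (k n : nat).

(** The derivative is carried as a witness, so closure under sums, products and inverses follows by
    induction on k from the differentiation rules. *)
Fixpoint C1k k f : Prop :=
  match k with
  | 0 => continuous f
  | k.+1 => exists2 g, (forall x : R, is_derive x 1 f (g x)) & C1k k g
  end.
Definition smooth1 f := forall k, C1k k f.

Lemma is_derive_continuous f g : (forall x : R, is_derive x 1 f (g x)) -> continuous f.
Proof.
move=> H x; apply/differentiable_continuous/derivable1_diffP.
exact: ex_derive.
Qed.

Lemma C1kW k f : C1k k.+1 f -> C1k k f.
Proof.
elim: k f => [|k IH] f; first by move=> [g /is_derive_continuous].
by move=> [g H Cg]; exists g => //; exact: IH.
Qed.

Lemma C1k_cst k c : C1k k (fun=> c).
Proof.
elim: k c => [|k IH] c; first by move=> x; exact: cvg_cst.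
by exists (fun=> 0) => // x; exact: is_derive_cst.
Qed.

Lemma C1k_add k f g : C1k k f -> C1k k g -> C1k k (fun x => f x + g x).
Proof.
elim: k f g => [|k IH] f g.
  by move=> cf cg x; apply: cvgD; [exact: cf|exact: cg].
move=> [f' Hf Cf] [g' Hg Cg]; exists (fun x => f' x + g' x); last exact: IH.
by move=> x; apply: is_deriveD.
Qed.

Lemma C1k_mul k f g : C1k k f -> C1k k g -> C1k k (fun x => f x * g x).
Proof.
elim: k f g => [|k IH] f g.
  by move=> cf cg x; apply: cvgM; [exact: cf|exact: cg].
move=> Cf Cg; have := C1kW Cf; have := C1kW Cg => Cg' Cf'.
case: Cf Cg => [f' Hf Cf] [g' Hg Cg]; exists (fun x => f x * g' x + g x * f' x).
  by move=> x; exact: is_deriveM.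
by apply: C1k_add; exact: IH.
Qed.

Lemma C1k_aff k f a b : C1k k f -> C1k k (fun x => f (a * x + b)).
Proof.
elim: k f => [|k IH] f.
  move=> cf x; apply: (@continuous_comp _ _ _ (fun x => a * x + b) f); last exact: cf.
  by apply: cvgD; [apply: cvgM; [exact: cvg_cst|exact: cvg_id]|exact: cvg_cst].
move=> [f' Hf Cf]; exists (fun x => f' (a * x + b) * a); last first.
  by apply: C1k_mul; [exact: IH|exact: C1k_cst].
move=> x; apply: (@is_derive1_comp _ f (fun x => a * x + b)) => //.
have E : is_derive x (1:R) (fun x : R => a * x + b) (a * 1 + 0).
  by apply: is_deriveD.
by rewrite addr0 mulr1 in E.
Qed.

Lemma C1k_inv k f : (forall x, f x != 0) -> C1k k f -> C1k k (fun x => (f x)^-1).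
Proof.
move=> f0; elim: k => [|k IH]; first by move=> cf x; apply: cvgV; [exact: f0|exact: cf].
move=> Cf; have Cf' := C1kW Cf; case: Cf => f' Hf Cf.
exists (fun x => - (f x)^-1 * ((f x)^-1 * f' x)).
  move=> x; have := is_deriveV (f0 x) (Hf x).
  by rewrite /GRing.scale/= expr2 invfM mulNr -mulrA mulNr.
apply: C1k_mul; last by apply: C1k_mul => //; exact: IH.
rewrite (_ : (fun x => - (f x)^-1) = (fun x => (-1) * (f x)^-1)).
  by apply: C1k_mul; [exact: C1k_cst|exact: IH].
by apply/funext => x; rewrite mulN1r.
Qed.

Lemma smooth1_derive f : smooth1 f ->
  smooth1 (derive1 f) /\ forall x : R, is_derive x 1 f (derive1 f x).
Proof.
move=> sf; have D (x : R) : is_derive x 1 f (derive1 f x).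
  have [g Hg _] := sf 1%N; have := Hg x => h.
  by rewrite derive1E derive_val.
split=> // k; have [g Hg Cg] := sf k.+1.
suff -> : derive1 f = g by [].
by apply/funext => x; rewrite derive1E; have := Hg x => h; rewrite derive_val.
Qed.

Lemma is_derive_sq f (x K : R) : (forall y, `|f y - f x| <= K * (y - x) ^+ 2) ->
  is_derive x 1 f 0.
Proof.
move=> H.
have C : h^-1 *: (f (h *: 1 + x) - f x) @[h --> 0^'] --> (0 : R).
  have K0 : 0 <= K.
    by have := H (x + 1); rewrite (_ : x + 1 - x = 1) ?expr1n ?mulr1; [apply: le_trans|ring].
  apply/cvgrPdist_le => e e0; near=> h.
  have h0 : h != 0 by near: h; exact: nbhs_dnbhs_neq.
  rewrite sub0r normrN normrZ [h *: 1]mulr1.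
  apply: (@le_trans _ _ (`|h^-1| * (K * h ^+ 2))).
    by apply: ler_wpM2l => //; have := H (h + x); rewrite addrK.
  rewrite -[h ^+ 2]real_normK ?num_real// expr2 normfV.
  rewrite (_ : `|h|^-1 * (K * (`|h| * `|h|)) = K * `|h|); last by field; rewrite normr_eq0.
  apply: (@le_trans _ _ ((K + 1) * `|h|)); first by rewrite ler_wpM2r// lerDl.
  have K1 : 0 < K + 1 by rewrite ltr_wpDl.
  rewrite mulrC -ler_pdivlMr//; apply: ltW.
  near: h; apply: dnbhs0_lt; by rewrite divr_gt0// ltr_wpDl.
by apply: DeriveDef; [apply/cvg_ex; exists 0|apply/cvg_lim].
Unshelve. all: by end_near. Qed.

(** The n-th derivative of exp(-1/x) on x > 0 is p(1/x) exp(-1/x) with p = [pfl n]; the chain rule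
    turns p into X^2 (p - p'). *)
Definition pfl n : {poly R} := iter n (fun p => 'X^2 * (p - p^`())) 1.
Definition fl n (x : R) : R := if 0 < x then (pfl n).[x^-1] * expR (- x^-1) else 0.

Lemma expR_ge_pow (y : R) n : 0 <= y -> y ^+ n / n`!%:R <= expR y.
Proof.
move=> y0; case: n => [|n]; first by rewrite expr0 fact0 divr1 -expR0 ler_expR.
by apply: le_trans (expR_ge1Dxn n y0); rewrite lerDr.
Qed.

(** Coefficient by coefficient, y^(i+2) is at most (i+2)! exp(y), one term of the exponential
    series. *)
Lemma pfl_bound (p : {poly R}) : exists2 K, 0 <= K &
  forall y, 0 < y -> `|p.[y]| * y ^+ 2 <= K * expR y.
Proof.
exists (\sum_(i < size p) `|p`_i| * (i.+2)`!%:R); first by apply: sumr_ge0 => i _; rewrite mulr_ge0.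
move=> y y0; rewrite horner_coef.
apply: (@le_trans _ _ ((\sum_(i < size p) `|p`_i| * y ^+ i) * y ^+ 2)).
  apply: ler_wpM2r; first by rewrite exprn_ge0// ltW.
  apply: le_trans (ler_norm_sum _ _ _) _; apply: ler_sum => i _.
  by rewrite normrM normrX (gtr0_norm y0).
rewrite !mulr_suml; apply: ler_sum => i _.
rewrite -!mulrA; apply: ler_wpM2l => //.
rewrite -exprD addn2.
have := expR_ge_pow i.+2 (ltW y0).
by rewrite ler_pdivrMr ?ltr0n ?fact_gt0// mulrC.
Qed.

Lemma fl_le0 n x : x <= 0 -> fl n x = 0.
Proof. by move=> x0; rewrite /fl ltNge x0. Qed.

Lemma is_derive_fl n (x : R) : is_derive x 1 (fl n) (fl n.+1 x).
Proof.
have [x0|x0|->] := ltgtP x 0.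
- rewrite [X in is_derive _ _ _ X]fl_le0 ?ltW//.
  apply: (near_eq_is_derive _ (is_derive_cst (0 : R) x 1)).
  near=> y; rewrite /= fl_le0//; apply/ltW; near: y; exact: lt_nbhsl.
- have E : is_derive x 1 (fun y => (pfl n).[y^-1] * expR (- y^-1))
     ((pfl n).[x^-1] *: (expR (- x^-1) * (x^-2)) +
      expR (- x^-1) *: ((pfl n)^`().[x^-1] * (- x^-2))).
    have x00 : x != 0 by rewrite gt_eqF.
    have DV : is_derive x 1 (fun y : R => y^-1) (- x^-2).
      have := @is_deriveV R id x 1 1 x00 (is_derive_id (x : R^o) 1).
      by rewrite /GRing.scale/= mulr1.
    have DN : is_derive x 1 (fun y : R => - y^-1) (x^-2).
      by have := is_deriveN DV; rewrite opprK.
    have DH : is_derive x^-1 1 (horner (pfl n)) ((pfl n)^`().[x^-1]).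
      by apply: DeriveDef; [exact: derivable_horner|rewrite derivE derive1E].
    have D1 : is_derive x 1 (fun y : R => (pfl n).[y^-1]) ((pfl n)^`().[x^-1] * (- x^-2)).
      exact: (is_derive1_comp DH DV).
    have D2 : is_derive x 1 (fun y : R => expR (- y^-1)) (expR (- x^-1) * x^-2).
      exact: (@is_derive1_comp _ (@expR R) (fun y : R => - y^-1) x (expR (- x^-1)) (x^-2) _ DN).
    exact: (is_deriveM D1 D2).
  rewrite [X in is_derive _ _ _ X](_ : _ = ((pfl n).[x^-1] *: (expR (- x^-1) * (x^-2)) +
      expR (- x^-1) *: ((pfl n)^`().[x^-1] * (- x^-2)))).
    apply: (near_eq_is_derive _ E); near=> y; rewrite /fl ifT//.
    near: y; exact: lt_nbhsr.
  rewrite /fl x0 /= /GRing.scale/= !hornerE/=; rewrite /pfl exprVn; ring.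
(* At the origin, [pfl_bound] taken at 1/y says that the function is bounded by K y^2, which forces
   the derivative to be 0. *)
- rewrite [X in is_derive _ _ _ X]fl_le0//.
  have [K K0 HK] := pfl_bound (pfl n).
  apply: (@is_derive_sq _ _ K) => y; rewrite [fl n 0]fl_le0// !subr0.
  have [y0|y0] := leP y 0; first by rewrite fl_le0// normr0 mulr_ge0// sqr_ge0.
  rewrite /fl y0 normrM (ger0_norm (expR_ge0 _)).
  have yV : 0 < y^-1 by rewrite invr_gt0.
  have := HK _ yV; rewrite expRN -ler_pdivlMr ?exprn_gt0// => H.
  rewrite ler_pdivrMr ?expR_gt0//; apply: le_trans H _.
  by rewrite exprVn invrK mulrAC.
Unshelve. all: by end_near. Qed.

Lemma fl_smooth n : smooth1 (fl n).
Proof.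
move=> k; elim: k n => [|k IH] n.
  by apply: (@is_derive_continuous _ (fl n.+1)) => x; exact: is_derive_fl.
by exists (fl n.+1) => // x; exact: is_derive_fl.
Qed.

Lemma fl0E x : 0 < x -> fl 0 x = expR (- x^-1).
Proof. by move=> x0; rewrite /fl x0 /pfl/= hornerC mul1r. Qed.
Lemma fl0_ge0 x : 0 <= fl 0 x.
Proof. by have [x0|x0] := leP x 0; [rewrite fl_le0|rewrite fl0E// expR_ge0]. Qed.
Lemma fl0_gt0 x : 0 < x -> 0 < fl 0 x.
Proof. by move=> x0; rewrite fl0E// expR_gt0. Qed.
Lemma fl0_nd x y : x <= y -> fl 0 x <= fl 0 y.
Proof.
move=> xy; have [x0|x0] := leP x 0; first by rewrite fl_le0// fl0_ge0.
have y0 := lt_le_trans x0 xy.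
by rewrite !fl0E// ler_expR lerN2 lef_pV2.
Qed.

(** The classical smooth transition from 0 to 1 across [0, 1]. Its derivative is the profile of the
    spatial kernel; the function itself supplies the cut-offs in time. *)
Definition stp (x : R) : R := fl 0 x * (fl 0 x + fl 0 (1 - x))^-1.

Lemma stp_den x : 0 < fl 0 x + fl 0 (1 - x).
Proof.
have [x0|x0] := leP x 0; last by rewrite ltr_pwDl ?fl0_gt0 ?fl0_ge0.
by rewrite ltr_wpDl ?fl0_ge0// fl0_gt0// ; lra.
Qed.

Lemma stp_smooth : smooth1 stp.
Proof.
move=> k; apply: C1k_mul; first exact: fl_smooth.
apply: C1k_inv; first by move=> x; rewrite gt_eqF// stp_den.
apply: C1k_add; first exact: fl_smooth.
rewrite (_ : (fun x => fl 0 (1 - x)) = (fun x => fl 0 ((-1) * x + 1))).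
  by apply: C1k_aff; exact: fl_smooth.
by apply/funext => x; congr (fl 0 _); ring.
Qed.

Lemma stp_le0 x : x <= 0 -> stp x = 0.
Proof. by move=> x0; rewrite /stp fl_le0// mul0r. Qed.
Lemma stp_ge1 x : 1 <= x -> stp x = 1.
Proof.
move=> x1; rewrite /stp [fl 0 (1 - x)]fl_le0; last by lra.
by rewrite addr0 mulfV// gt_eqF// fl0_gt0; lra.
Qed.
Lemma stp_nd x y : x <= y -> stp x <= stp y.
Proof.
move=> xy; rewrite /stp ler_pdivrMr ?stp_den// mulrAC ler_pdivlMr ?stp_den//.
rewrite !mulrDr [X in _ <= X + _]mulrC lerD2l.
by rewrite ler_pM ?fl0_ge0 ?fl0_nd//; lra.
Qed.
Lemma stp_itv x : 0 <= stp x <= 1.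
Proof.
rewrite /stp divr_ge0 ?fl0_ge0 ?(ltW (stp_den _))//=.
by rewrite ler_pdivrMr ?stp_den// mul1r lerDl fl0_ge0.
Qed.

Definition dstp : R -> R := derive1 stp.
Definition ddstp : R -> R := derive1 dstp.
Lemma dstp_smooth : smooth1 dstp. Proof. exact: (smooth1_derive stp_smooth).1. Qed.
Lemma ddstp_smooth : smooth1 ddstp. Proof. exact: (smooth1_derive dstp_smooth).1. Qed.
Lemma is_derive_stp (x : R) : is_derive x 1 stp (dstp x).
Proof. exact: (smooth1_derive stp_smooth).2. Qed.
Lemma is_derive_dstp (x : R) : is_derive x 1 dstp (ddstp x).
Proof. exact: (smooth1_derive dstp_smooth).2. Qed.

Lemma dstp_ge0 x : 0 <= dstp x.
Proof.
have := is_derive_stp x => D.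
rewrite -[dstp x](@derive_val _ _ _ _ _ _ _ D).
apply: limr_ge; first exact: ex_derive.
near=> h.
have h0 : h != 0 by near: h; exact: nbhs_dnbhs_neq.
rewrite /= /GRing.scale/= mulr1.
have [hp|hn|hz] := ltgtP h 0.
- apply: mulr_le0; first by rewrite invr_le0 ltW.
  by rewrite subr_le0; apply: stp_nd; rewrite gerDr ltW.
- apply: mulr_ge0; first by rewrite invr_ge0 ltW.
  by rewrite subr_ge0; apply: stp_nd; rewrite lerDr ltW.
- by rewrite hz eqxx in h0.
Unshelve. all: by end_near. Qed.

(* derivative vanishes where the function is locally constant; by continuity up to the boundary *)
Lemma deriv_out f f' (c : R) : continuous f' -> (forall x : R, is_derive x 1 f (f' x)) ->
  (forall x, ~ (0 < x < 1) -> f x = (if x <= 0 then 0 else c)) ->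
  forall x, ~ (0 < x < 1) -> f' x = 0.
Proof.
move=> cf' Hf Hc x hx.
have near0 (y : R) : y < 0 \/ 1 < y -> f' y = 0.
  move=> hy.
  have : is_derive y 1 f 0.
    apply: (near_eq_is_derive _ (is_derive_cst (f y) y 1)).
    case: hy => hy; near=> z.
      have z0 : z < 0 by near: z; exact: lt_nbhsl.
      by rewrite /= !Hc ?(ltW z0) ?(ltW hy)//; lra.
    have z0 : 1 < z by near: z; exact: lt_nbhsr.
    by rewrite /= !Hc ?ifF//; try lra; apply/negbTE; rewrite -ltNge; lra.
  by move=> h; rewrite -(@derive_val _ _ _ _ _ _ _ (Hf y)); exact: (@derive_val _ _ _ _ _ _ _ h).
have [x0|x0|->] := ltgtP x 0; first by apply: near0; left.
  have [x1|x1|->] := ltgtP x 1; first by exfalso; apply: hx; rewrite x0.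
    by apply: near0; right.
  have C : f' z @[z --> 1^'+] --> f' 1 by apply: cvg_at_right_filter; exact: cf'.
  rewrite -(cvg_lim _ C)//; apply/cvg_lim => //.
  apply: (@cvg_trans _ (cst 0 z @[z --> (1:R)^'+])); last exact: cvg_cst.
  apply: near_eq_cvg; near=> z; rewrite near0//; right; near: z; exact: nbhs_right_gt.
have C : f' z @[z --> 0^'-] --> f' 0 by apply: cvg_at_left_filter; exact: cf'.
rewrite -(cvg_lim _ C)//; apply/cvg_lim => //.
apply: (@cvg_trans _ (cst 0 z @[z --> (0:R)^'-])); last exact: cvg_cst.
apply: near_eq_cvg; near=> z; rewrite near0//; left; near: z; exact: nbhs_left_lt.
Unshelve. all: by end_near. Qed.

Lemma dstp_out x : ~ (0 < x < 1) -> dstp x = 0.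
Proof.
apply: (@deriv_out stp dstp 1); [exact: (dstp_smooth 0)|exact: is_derive_stp|].
move=> y hy; case: ifPn => [y0|]; first exact: stp_le0.
by rewrite -ltNge => y0; apply: stp_ge1; rewrite leNgt; apply/negP => y1; apply: hy; rewrite y0.
Qed.
Lemma ddstp_out x : ~ (0 < x < 1) -> ddstp x = 0.
Proof.
apply: (@deriv_out dstp ddstp 0); [exact: (ddstp_smooth 0)|exact: is_derive_dstp|].
by move=> y hy; rewrite dstp_out//; case: ifP.
Qed.

Lemma cpt_bounded f : continuous f -> (forall x, ~ (0 < x < 1) -> f x = 0) ->
  exists2 M, 0 <= M & forall x, `|f x| <= M.
Proof.
move=> cf f0.
have cn : {within `[0, 1], continuous (fun x => `|f x|)}.
  by apply: continuous_subspaceT => x; apply: cvg_norm; exact: cf.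
have [c _ Hc] := EVT_max ler01 cn.
exists `|f c| => // x; have [h|/negP h] := boolP (0 < x < 1).
  by apply: Hc; rewrite in_itv/=; lra.
by rewrite f0// normr0.
Qed.

End Smooth1.

(** * The periodic mollifying kernel in one variable *)

Section Kernel1.
Variable R : realType.
Notation RM := (measurableTypeR R).
Notation leb := (@lebesgue_measure R).
Variable eps : R.
Hypothesis eps01 : 0 < eps < 1.

Definition out01 (f : R -> R) := forall x, ~ (0 < x < 1) -> f x = 0.
Definition gper (f : R -> R) (s : R) : R := f (fracpart s / eps).

Let e0 : 0 < eps. Proof. by case/andP: eps01. Qed.

(* Across an integer the periodization agrees with one translate, since [f] vanishes to the left of 0. *)
Lemma gper_loc f (s : R) : out01 f ->
  \forall y \near s, f (eps^-1 * y + (- (Num.floor s)%:~R / eps)) = gper f y.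
Proof.
move=> of_.
have h1 := floor_le s; have h2 := floorD1_gt s; rewrite intrD in h2.
have [e1 e2] := andP eps01.
near=> y.
have y1 : (Num.floor s)%:~R - (1 - eps) < y.
  by near: y; apply: lt_nbhsr; lra.
have y2 : y < (Num.floor s)%:~R + 1 by near: y; apply: lt_nbhsl.
rewrite /gper /fracpart; set z := (Num.floor s)%:~R in y1 y2 *.
have [yz|yz] := leP z y.
  rewrite (_ : Num.floor y = Num.floor s).
    by congr f; rewrite -/z; ring.
  by apply: floor_def; rewrite intrD -/z yz.
rewrite (_ : Num.floor y = Num.floor s - 1); last first.
  by apply: floor_def; rewrite subrK intrD -/z yz andbT /=; lra.
rewrite intrD -/z !of_//.
  by move=> /andP[_]; rewrite ltr_pdivrMr// mul1r; lra.
rewrite (_ : _ + _ = (y - z) / eps); last by ring.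
by move=> /andP[]; rewrite ltr_pdivlMr// mul0r; lra.
Unshelve. all: by end_near. Qed.

Lemma is_derive_gper f f' (s : R) : out01 f ->
  (forall x : R, is_derive x 1 f (f' x)) ->
  is_derive s 1 (gper f) (eps^-1 * gper f' s).
Proof.
move=> of_ Hf.
apply: (near_eq_is_derive (gper_loc s of_)).
rewrite [eps^-1 * gper f' s]mulrC.
have -> : gper f' s = f' (eps^-1 * s + - (Num.floor s)%:~R / eps).
  by rewrite /gper /fracpart; congr f'; ring.
have E : is_derive s 1 (fun x : R => eps^-1 * x + - (Num.floor s)%:~R / eps) (eps^-1 * 1 + 0).
  exact: is_deriveD.
rewrite addr0 mulr1 in E.
exact: (@is_derive1_comp _ f (fun x : R => eps^-1 * x + - (Num.floor s)%:~R / eps) s _ _ (Hf _) E).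
Qed.

Lemma gper_smooth f : smooth1 f -> out01 f -> smooth1 (gper f).
Proof.
move=> + + k; elim: k f => [|k IH] f sf of_; have [sf' Hf] := smooth1_derive sf.
  apply: (@is_derive_continuous _ _ (fun s => eps^-1 * gper (derive1 f) s)) => s.
  exact: is_derive_gper.
exists (fun s => eps^-1 * gper (derive1 f) s); first by move=> s; exact: is_derive_gper.
apply: C1k_mul; first exact: C1k_cst.
apply: IH => //; apply: (@deriv_out _ f _ 0) => //; first exact: (sf' 0%N).
by move=> x hx; rewrite of_//; case: ifP.
Qed.

(** A probability density on the circle. Its support (0, eps) inside [0, 1) does not wrap around, so
    points of the support are close to 0 within the cell itself. *)
Definition gk (s : R) : R := eps^-1 * gper (@dstp R) s.
Definition gk' (s : R) : R := eps^-1 * (eps^-1 * gper (@ddstp R) s).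

Lemma gk_smooth : smooth1 gk.
Proof.
by move=> k; apply: C1k_mul; [exact: C1k_cst|
  apply: gper_smooth; [exact: dstp_smooth|exact: dstp_out]].
Qed.
Lemma gk'_smooth : smooth1 gk'.
Proof.
move=> k; apply: C1k_mul; first exact: C1k_cst.
apply: C1k_mul; first exact: C1k_cst.
by apply: gper_smooth; [exact: ddstp_smooth|exact: ddstp_out].
Qed.

Lemma is_derive_gk (s : R) : is_derive s 1 gk (gk' s).
Proof.
have H := is_derive_gper s (@dstp_out R) (@is_derive_dstp R).
exact: (@is_deriveZ _ _ _ (gper (@dstp R)) eps^-1 s 1 _ H).
Qed.

Lemma gper1 f s : gper f (s + 1) = gper f s.
Proof. by rewrite /gper fracpartD1. Qed.
Lemma gk1 s : gk (s + 1) = gk s. Proof. by rewrite /gk gper1. Qed.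
Lemma gk'1 s : gk' (s + 1) = gk' s. Proof. by rewrite /gk' gper1. Qed.
Lemma gk_ge0 s : 0 <= gk s.
Proof. by rewrite /gk mulr_ge0 ?invr_ge0 ?(ltW e0)//; exact: dstp_ge0. Qed.
Lemma gper_supp f s : out01 f -> 0 <= s < 1 -> ~ (0 < s < eps) -> gper f s = 0.
Proof.
move=> of_ s01 sn; rewrite /gper fracpart_id//; apply: of_ => /andP[h1 h2]; apply: sn.
by move: h1 h2; rewrite ltr_pdivlMr// mul0r => ->; rewrite ltr_pdivrMr// mul1r.
Qed.
Lemma gk_supp s : 0 <= s < 1 -> ~ (0 < s < eps) -> gk s = 0.
Proof. by move=> h1 h2; rewrite /gk gper_supp ?mulr0//; exact: dstp_out. Qed.
Lemma gk'_supp s : 0 <= s < 1 -> ~ (0 < s < eps) -> gk' s = 0.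
Proof. by move=> h1 h2; rewrite /gk' gper_supp ?mulr0//; exact: ddstp_out. Qed.

Lemma gk_cellE s : 0 <= s < 1 -> gk s = eps^-1 * dstp (eps^-1 * s).
Proof. by move=> hs; rewrite /gk /gper (fracpart_id hs) [s / eps]mulrC. Qed.

Lemma gk_measurable : measurable_fun setT gk.
Proof. exact: (continuous_measurable_fun (gk_smooth 0)). Qed.
Lemma gk'_measurable : measurable_fun setT gk'.
Proof. exact: (continuous_measurable_fun (gk'_smooth 0)). Qed.

(** On [0, 1) the kernel is the derivative of [stp] at s / eps, which rises from 0 to 1 there
    because eps is below 1. *)
Lemma int_gk : (\int[@lam1 R]_s (gk s)%:E = 1)%E.
Proof.
have [e1 e2] := andP eps01.
rewrite ge0_integral_mrestr; last 2 first.
- by apply/measurable_EFinP; exact: gk_measurable.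
- by move=> s; rewrite lee_fin gk_ge0.
pose F (s : R) : R := stp (eps^-1 * s).
pose f (s : R) : R := eps^-1 * dstp (eps^-1 * s).
have DF (s : R) : is_derive s 1 F (f s).
  have E : is_derive s 1 (fun x : R => eps^-1 * x) (eps^-1 * 1) by exact: is_deriveZ.
  rewrite mulr1 in E; rewrite /f mulrC.
  exact: (@is_derive1_comp _ (@stp R) (fun x : R => eps^-1 * x) s _ _ (is_derive_stp _) E).
have cf : continuous f.
  have := C1k_aff eps^-1 0 (dstp_smooth R 0).
  rewrite (_ : (fun x => _) = (fun x => dstp (eps^-1 * x))) => [c x|].
    by apply: cvgM; [exact: cvg_cst|exact: c].
  by apply/funext => x; rewrite addr0.
transitivity (\int[leb]_(s in `[0%R, 1%R[) (f s)%:E)%E.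
  apply: eq_integral => s /set_mem; rewrite /= in_itv/= => hs.
  by rewrite (gk_cellE hs).
rewrite integral_itv_bndo_bndc; last first.
  by apply/measurable_EFinP; exact: (measurable_funTS (continuous_measurable_fun cf)).
rewrite (@continuous_FTC2 _ f F 0 1)//.
- rewrite /F mulr0 [X in (_ - X%:E)%E]stp_le0// stp_ge1 ?sube0//.
  by rewrite mulr1 invf_ge1// ltW.
- exact: continuous_subspaceT.
- split.
  + by move=> x _; have := DF x => h; exact: ex_derive.
  + by apply: cvg_at_right_filter; exact: (is_derive_continuous DF).
  + by apply: cvg_at_left_filter; exact: (is_derive_continuous DF).
- by move=> x _; have := DF x => h; rewrite derive1E derive_val.
Qed.

(** Height M / eps^2 times length eps of the support. The remaining 1 / eps is the loss that
    increments of order |h| have to compensate. *)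
Lemma int_gk' M : 0 <= M -> (forall x, `|ddstp (x : R)| <= M) ->
  (\int[@lam1 R]_s `|gk' s|%:E <= (M / eps)%:E)%E.
Proof.
move=> M0 HM; have [e1 e2] := andP eps01.
pose J : set RM := `]0, eps[%classic.
have mI : measurable J by exact: measurable_itv.
apply: (@le_trans _ _ (\int[@lam1 R]_s ((eps^-1 * (eps^-1 * M))%:E * (\1_J s)%:E))%E).
  have mg : measurable_fun setT (fun s => `|gk' s|%:E).
    by apply/measurable_EFinP; apply: measurableT_comp => //; exact: gk'_measurable.
  have m1 : measurable_fun setT (fun s : RM => (\1_J s : R)%:E).
    by apply/measurable_EFinP; exact: measurable_indic.
  rewrite !ge0_integral_mrestr//; last 2 first.
  - by apply: measurable_funeM.
  - by move=> s; rewrite -EFinM lee_fin !mulr_ge0// invr_ge0 ltW.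
  apply: ge0_le_integral => //.
  - exact: measurable_funTS.
  - by apply: measurable_funeM; exact: measurable_funTS.
  move=> s /=; rewrite in_itv/= => hs.
  have [sn|sn] := boolP (0 < s < eps).
    rewrite indicE mem_set /J/= ?in_itv// mule1 lee_fin /gk' !normrM (ger0_norm (_ : 0 <= eps^-1)) ?invr_ge0 ?(ltW e0)//.
    by do 2!(apply: ler_wpM2l; first by rewrite invr_ge0 ltW); exact: HM.
  rewrite gk'_supp//; last exact/negP.
  by rewrite normr0 -EFinM lee_fin !mulr_ge0// invr_ge0 ltW.
rewrite ge0_integralZl_EFin//; last 2 first.
- by apply/measurable_EFinP; exact: measurable_indic.
- by rewrite !mulr_ge0// invr_ge0 ltW.
rewrite -measure_indic//.
apply: (@le_trans _ _ ((eps^-1 * (eps^-1 * M))%:E * eps%:E)%E).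
  apply: lee_wpmul2l; first by rewrite lee_fin !mulr_ge0// invr_ge0 ltW.
  apply: (@le_trans _ _ (leb J)).
    by apply: measureIl; [exact: mI|exact: mI01].
  by rewrite lebesgue_measure_itv/= lte_fin e0 sube0.
rewrite -EFinM lee_fin (_ : _ * _ * _ = M / eps)//.
by field; rewrite gt_eqF.
Qed.

End Kernel1.

(** * Smooth functions of several variables; translated kernels as test functions *)

Section Rows.
Variable R : realType.

Lemma is_derive_line n (F : 'rV[R]_n -> R) (v w : 'rV[R]_n) df :
  is_derive (0 : R) 1 (fun s : R => F (s *: w + v)) df -> is_derive v w F df.
Proof.
move=> [D1 D2].
have E : (fun h : R => h^-1 *: ((F \o shift v) (h *: w) - F v)) =
  (fun h : R => h^-1 *: (((fun s : R => F (s *: w + v)) \o shift (0 : R)) (h *: (1 : R))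
     - (fun s : R => F (s *: w + v)) 0)).
  by apply/funext => h /=; rewrite addr0 [h *: 1]mulr1 scale0r add0r.
by split; [rewrite /derivable E|rewrite /derive E].
Qed.

Lemma CkW n k (f : 'rV[R]_n -> R) : Ck k.+1 f -> Ck k f.
Proof.
elim: k f => [|k IH] f; first by move=> [H _] v; exact: differentiable_continuous.
by move=> [H H']; split=> // i; apply: IH; exact: H'.
Qed.

Lemma Ck_ext n k (f g : 'rV[R]_n -> R) : f =1 g -> Ck k g -> Ck k f.
Proof. by move=> /funext ->. Qed.

Lemma Ck_cst n k c : @Ck R n k (fun=> c).
Proof.
elim: k c => [|k IH] c; first exact: cst_continuous.
split=> [v|i]; first exact: differentiable_cst.
by apply: (Ck_ext (g := fun=> 0)) => // v; exact: derive_cst.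
Qed.

Lemma Ck_add n k (f g : 'rV[R]_n -> R) : Ck k f -> Ck k g -> Ck k (fun v => f v + g v).
Proof.
elim: k f g => [|k IH] f g.
  by move=> cf cg x; apply: continuousD; [exact: (cf x)|exact: (cg x)].
move=> [Df Cf] [Dg Cg]; split=> [v|i]; first exact: differentiableD.
apply: (Ck_ext (g := fun v => 'D_(delta_mx 0 i) f v + 'D_(delta_mx 0 i) g v)).
  by move=> v; apply: deriveD; exact: diff_derivable.
by apply: IH; [exact: Cf|exact: Cg].
Qed.

Lemma Ck_mul n k (f g : 'rV[R]_n -> R) : Ck k f -> Ck k g -> Ck k (fun v => f v * g v).
Proof.
elim: k f g => [|k IH] f g.
  by move=> cf cg x; apply: continuousM; [exact: (cf x)|exact: (cg x)].
move=> Hf Hg; have Hf' := CkW Hf; have Hg' := CkW Hg.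
case: Hf Hg => [Df Cf] [Dg Cg]; split=> [v|i]; first exact: differentiableM.
apply: (Ck_ext (g := fun v => f v * 'D_(delta_mx 0 i) g v + g v * 'D_(delta_mx 0 i) f v)).
  by move=> v; apply: deriveM; exact: diff_derivable.
by apply: Ck_add; apply: IH => //; [exact: Cg|exact: Cf].
Qed.

Lemma Ck_prod n k (I : Type) (s : seq I) (f : I -> 'rV[R]_n -> R) :
  (forall i, Ck k (f i)) -> Ck k (fun v => \prod_(i <- s) f i v).
Proof.
move=> Cf; elim: s => [|i s IH].
  by apply: (Ck_ext (g := fun=> 1)); [move=> v; rewrite big_nil|exact: Ck_cst].
apply: (Ck_ext (g := fun v => f i v * \prod_(i <- s) f i v)); last exact: Ck_mul.
by move=> v; rewrite big_cons.
Qed.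

Lemma Ck_coord n k (i : 'I_n) (f : R -> R) : C1k k f -> Ck k (fun v : 'rV[R]_n => f (v 0 i)).
Proof.
elim: k f => [|k IH] f.
  move=> cf v; apply: (@continuous_comp _ _ _ (fun v : 'rV[R]_n => v 0 i) f).
    exact: coord_continuous.
  exact: cf.
move=> [f' Hf Cf]; split=> [v|j].
  apply: (@differentiable_comp _ _ _ _ (fun v : 'rV[R]_n => v 0 i) f).
    exact: differentiable_coord.
  by apply/derivable1_diffP; have := Hf (v 0 i) => h; exact: ex_derive.
apply: (Ck_ext (g := fun v : 'rV[R]_n => (i == j)%:R * f' (v 0 i))); last first.
  by apply: Ck_mul; [exact: Ck_cst|exact: IH].
move=> v.
have D : is_derive v (delta_mx 0 j) (fun v : 'rV[R]_n => f (v 0 i)) ((i == j)%:R * f' (v 0 i)).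
  apply: is_derive_line.
  rewrite (_ : (fun s : R => _) = (fun s : R => f ((i == j)%:R * s + v 0 i))); last first.
    by apply/funext => s; rewrite !mxE mulrC eqxx.
  have E : is_derive (0 : R) 1 (fun x : R => (i == j)%:R * x + v 0 i) ((i == j)%:R * 1 + 0).
    exact: is_deriveD.
  rewrite addr0 mulr1 in E; rewrite mulrC.
  apply: (@is_derive1_comp _ f (fun x : R => (i == j)%:R * x + v 0 i) 0) => //.
  by rewrite mulr0 add0r.
exact: derive_val.
Qed.

End Rows.

Section TestFun.
Variables (R : realType) (d : nat).
Implicit Type h : 'I_d -> R -> R.

Definition prodk h (y : d.-tuple R) : R := \prod_(i < d) h i (tnth y i).
(** Differentiating a tensor product in direction j replaces only its j-th factor by the
    derivative. *)
Definition hpick j (h h' : 'I_d -> R -> R) : 'I_d -> R -> R := fun i => if i == j then h' i else h i.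
Definition topp (x : d.-tuple R) : d.-tuple R := [tuple - tnth x i | i < d].

Definition rowker h (x : d.-tuple R) (v : 'rV[R]_d) : R :=
  \prod_(i < d) h i (v 0 i - tnth x i).
(** Tested against this function, the weak form becomes the mollified equation at the single point
    x, in which chi remains as a test function of time. *)
Definition stker (chi : R -> R) h (x : d.-tuple R) (v : 'rV[R]_d.+1) : R :=
  chi (v 0 ord0) * \prod_(i < d) h i (v 0 (lift ord0 i) - tnth x i).

Lemma smooth1_shift (f : R -> R) a : smooth1 f -> smooth1 (fun s => f (s - a)).
Proof.
move=> sf k; rewrite (_ : (fun s => _) = (fun s => f (1 * s + (- a)))).
  exact: C1k_aff.
by apply/funext => s; rewrite mul1r.
Qed.

Lemma prod_shift1 (I : finType) (f g : I -> R) : (forall i, f i = g i) ->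
  \prod_i f i = \prod_i g i.
Proof. by move=> H; apply: eq_bigr => i _. Qed.

Lemma rowker_test h x : (forall i, smooth1 (h i)) -> (forall i s, h i (s + 1) = h i s) ->
  testS (rowker h x).
Proof.
move=> sh ph; split=> [k|v j].
  apply: Ck_prod => i.
  by apply: (Ck_coord i (f := fun s => h i (s - tnth x i))); exact: smooth1_shift.
apply: prod_shift1 => i; rewrite !mxE eqxx /=.
by case: eqP => _; rewrite ?addr0// addrAC ph.
Qed.

Lemma rowker_trow h x y : rowker h x (trow y) = prodk h (tadd y (topp x)).
Proof. by apply: prod_shift1 => i; rewrite !mxE !tnth_mktuple. Qed.

Lemma stker_test T chi h x a b : 0 < a -> a <= b -> b < T ->
  (forall t, t < a \/ b < t -> chi t = 0) -> smooth1 chi ->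
  (forall i, smooth1 (h i)) -> (forall i s, h i (s + 1) = h i s) ->
  testST T (stker chi h x).
Proof.
move=> a0 ab bT chi0 sc sh ph; split=> [k|].
  apply: Ck_mul; first exact: Ck_coord.
  apply: Ck_prod => i.
  by apply: (Ck_coord (lift ord0 i) (f := fun s => h i (s - tnth x i))); exact: smooth1_shift.
split=> [v j|].
  rewrite /stker !mxE /= addr0; congr (_ * _).
  apply: prod_shift1 => i; rewrite !mxE eqxx /= (inj_eq lift_inj).
  by case: eqP => _; rewrite ?addr0// addrAC ph.
by exists a, b; do 3!split=> //; move=> v hv; rewrite /stker chi0// mul0r.
Qed.

Lemma stpt0 (x : d.-tuple R) t : stpt x t 0 ord0 = t.
Proof. by rewrite mxE unlift_none. Qed.
Lemma stptS (x : d.-tuple R) t j : stpt x t 0 (lift ord0 j) = tnth x j.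
Proof. by rewrite mxE liftK. Qed.


Lemma dt_stker chi chi' h x y t : (forall s : R, is_derive s 1 chi (chi' s)) ->
  dt (stker chi h x) y t = chi' t * prodk h (tadd y (topp x)).
Proof.
move=> Hc; rewrite /dt.
set P := prodk _ _.
have D : is_derive (stpt y t) (delta_mx 0 ord0) (stker chi h x) (chi' t * P).
  apply: is_derive_line.
  rewrite (_ : (fun s : R => _) = (fun s : R => chi (s + t) * P)); last first.
    apply/funext => s; rewrite /stker !mxE unlift_none eqxx mulr1; congr (_ * _).
    by apply: prod_shift1 => i; rewrite !mxE liftK !tnth_mktuple /= mulr0 add0r.
  have E : is_derive (0 : R) 1 (fun s : R => s + t) (1 + 0) by exact: is_deriveD.
  rewrite addr0 in E.
  have H0 : is_derive (0 + t : R) 1 chi (chi' t) by rewrite add0r.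
  have E1 := @is_derive1_comp _ chi (fun s : R => s + t) 0 _ _ H0 E.
  have := is_deriveM E1 (is_derive_cst P (0 : R) 1).
  by rewrite /GRing.scale/= mulr0 add0r mulr1 => H; rewrite [chi' t * P]mulrC; exact: H.
exact: derive_val.
Qed.

Lemma is_derive_Ml (c : R) (f : R -> R) (x df : R) :
  is_derive x 1 f df -> is_derive x 1 (fun s => c * f s) (c * df).
Proof. by move=> D; exact: (@is_deriveZ _ _ _ f c x 1 df D). Qed.

Lemma prodk_line h (h' : 'I_d -> R -> R) (y : d.-tuple R) j :
  (forall i s, is_derive (s : R) 1 (h i) (h' i s)) ->
  forall s : R, is_derive s 1 (fun s : R => \prod_(i < d) h i (tnth y i + (i == j)%:R * s))
     (prodk (hpick j h h') [tuple tnth y i + (i == j)%:R * s | i < d]).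
Proof.
move=> Hh s.
pose P : R := \prod_(i < d | i != j) h i (tnth y i).
rewrite (_ : (fun s : R => _) = (fun s : R => h j (tnth y j + s) * P)); last first.
  apply/funext => r; rewrite (bigD1 j)//= eqxx mul1r; congr (_ * _).
  by apply: eq_bigr => i /negPf ->; rewrite mul0r addr0.
rewrite /prodk (bigD1 j)//= /hpick eqxx tnth_mktuple eqxx mul1r.
rewrite (eq_bigr (fun i => h i (tnth y i))); last first.
  by move=> i /negPf ij; rewrite ij tnth_mktuple ij mul0r addr0.
rewrite -/P.
have E : is_derive s 1 (fun s : R => tnth y j + s) (0 + 1) by exact: is_deriveD.
rewrite add0r in E.
have E1 := @is_derive1_comp _ (h j) (fun s : R => tnth y j + s) s _ _ (Hh j _) E.
have := is_deriveM E1 (is_derive_cst P s 1).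
by rewrite /GRing.scale/= mulr0 add0r mulr1 => H; rewrite [_ * P in X in is_derive _ _ _ X]mulrC; exact: H.
Qed.

Lemma dx_stker chi h (h' : 'I_d -> R -> R) x y t j : (forall i s, is_derive (s : R) 1 (h i) (h' i s)) ->
  dx j (stker chi h x) y t = chi t * prodk (hpick j h h') (tadd y (topp x)).
Proof.
move=> Hh; rewrite /dx.
have D : is_derive (stpt y t) (delta_mx 0 (lift ord0 j)) (stker chi h x)
    (chi t * prodk (hpick j h h') (tadd y (topp x))).
  apply: is_derive_line.
  have L := prodk_line (tadd y (topp x)) j Hh 0.
  rewrite (_ : (fun s : R => _) = (fun s : R => chi t *
     \prod_(i < d) h i (tnth (tadd y (topp x)) i + (i == j)%:R * s))); last first.
    apply/funext => s; rewrite /stker !mxE unlift_none /= mulr0 add0r; congr (_ * _).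
    apply: prod_shift1 => i; rewrite !mxE liftK !tnth_mktuple eqxx /= (inj_eq lift_inj).
    by congr (h i _); ring.
  rewrite (_ : prodk _ (tadd y _) = prodk (hpick j h h')
     [tuple tnth (tadd y (topp x)) i + (i == j)%:R * 0 | i < d]).
    exact: (is_derive_Ml (chi t) L).
  by congr prodk; apply: eq_from_tnth => i; rewrite [RHS]tnth_mktuple mulr0 addr0.
exact: derive_val.
Qed.

End TestFun.

(** * Real-valued integrals and mollification on the torus *)

Section RintTools.
Context d (T : measurableType d) (R : realType) (m : {finite_measure set T -> \bar R}).
Implicit Types f g : T -> R.

Definition intg f := m.-integrable setT (EFin \o f).

Lemma intg_meas f : intg f -> measurable_fun setT f.
Proof. by move=> /integrableP[/measurable_EFinP]. Qed.

Lemma intg_le f g : measurable_fun setT f -> intg g -> (forall x, `|f x| <= g x) -> intg f.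
Proof.
move=> mf ig fg; apply: le_integrable ig => //; first exact/measurable_EFinP.
by move=> x _ /=; rewrite lee_fin (le_trans (fg x))// ler_norm.
Qed.

Lemma intg_cst (c : R) : intg (fun=> c).
Proof. exact: finite_measure_integrable_cst. Qed.

Lemma intg_bounded f M : measurable_fun setT f -> (forall x, `|f x| <= M) -> intg f.
Proof. by move=> mf fM; apply: (@intg_le _ (fun=> M)) => //; exact: intg_cst. Qed.

Lemma intgD f g : intg f -> intg g -> intg (fun x => f x + g x).
Proof. by move=> iF ig; apply: (integrableD measurableT iF ig). Qed.
Lemma intgB f g : intg f -> intg g -> intg (fun x => f x - g x).
Proof. by move=> iF ig; apply: (integrableB measurableT iF ig). Qed.
Lemma intgZ (c : R) f : intg f -> intg (fun x => c * f x).
Proof. by move=> iF; apply: (integrableZl measurableT c iF). Qed.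
Lemma intgZr (c : R) f : intg f -> intg (fun x => f x * c).
Proof.
by move=> /(intgZ c); congr intg; apply/funext => x; rewrite mulrC.
Qed.
Lemma intg_abs f : intg f -> intg (fun x => `|f x|).
Proof. exact: integrable_norm. Qed.
Lemma intg_sum (I : Type) (s : seq I) (f : I -> T -> R) : (forall i, intg (f i)) ->
  intg (fun x => \sum_(i <- s) f i x).
Proof.
move=> H; elim: s => [|i s IH].
  rewrite (_ : (fun x => _) = (fun=> 0)); first exact: intg_cst.
  by apply/funext => x; rewrite big_nil.
rewrite (_ : (fun x => _) = (fun x => f i x + \sum_(i <- s) f i x)); first exact: intgD.
by apply/funext => x; rewrite big_cons.
Qed.
Lemma intgMb f g M : intg f -> measurable_fun setT g -> (forall x, `|g x| <= M) ->
  intg (fun x => g x * f x).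
Proof.
move=> iF mg gM; apply: (@intg_le _ (fun x => M * `|f x|)).
- by apply: measurable_funM => //; exact: intg_meas.
- exact: intgZ (intg_abs iF).
- by move=> x; rewrite normrM ler_wpM2r.
Qed.

Local Notation I f := (\int[m]_x f x).

Lemma RintD f g : intg f -> intg g -> \int[m]_x (f x + g x) = I f + I g.
Proof. exact: RintegralD. Qed.
Lemma RintB f g : intg f -> intg g -> \int[m]_x (f x - g x) = I f - I g.
Proof. exact: RintegralB. Qed.
Lemma RintZ c f : intg f -> \int[m]_x (c * f x) = c * I f.
Proof. by move=> iF; rewrite RintegralZl. Qed.
Lemma RintZr c f : intg f -> \int[m]_x (f x * c) = I f * c.
Proof. by move=> iF; rewrite RintegralZr. Qed.
Lemma RintN f : intg f -> \int[m]_x (- f x) = - I f.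
Proof.
move=> iF; rewrite -mulN1r -RintZ//; apply: eq_Rintegral => x _.
by rewrite mulN1r.
Qed.
Lemma Rint_sum (J : Type) (s : seq J) (f : J -> T -> R) : (forall i, intg (f i)) ->
  \int[m]_x (\sum_(i <- s) f i x) = \sum_(i <- s) \int[m]_x f i x.
Proof.
move=> H; elim: s => [|i s IH].
  rewrite big_nil (eq_Rintegral _ (g := fun=> 0)); first by rewrite Rintegral_cst// mul0r.
  by move=> x _; rewrite big_nil.
rewrite big_cons -IH -RintD//; last exact: intg_sum.
by apply: eq_Rintegral => x _; rewrite big_cons.
Qed.
Lemma Rint_le f g : intg f -> intg g -> (forall x, f x <= g x) -> I f <= I g.
Proof. by move=> iF ig fg; apply: le_Rintegral. Qed.
Lemma Rint_abs f : intg f -> `|I f| <= \int[m]_x `|f x|.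
Proof. by move=> iF; apply: le_normr_Rintegral. Qed.
Lemma Rint_ge0 f : (forall x, 0 <= f x) -> 0 <= I f.
Proof. by move=> f0; apply: Rintegral_ge0. Qed.
Lemma EFin_Rint f : intg f -> (I f)%:E = (\int[m]_x (f x)%:E)%E.
Proof. by move=> iF; rewrite /Rintegral fineK//; exact: integrable_fin_num iF. Qed.
Lemma intgP f : measurable_fun setT f -> (\int[m]_x `|f x|%:E < +oo)%E -> intg f.
Proof. by move=> mf H; apply/integrableP; split => //; exact/measurable_EFinP. Qed.
Lemma intg_lt f : intg f -> (\int[m]_x `|f x|%:E < +oo)%E.
Proof. by move=> /integrableP[]. Qed.
End RintTools.

Section Param.
Context d1 d2 (T1 : measurableType d1) (T2 : measurableType d2) (R : realType)
  (m1 : {finite_measure set T1 -> \bar R}) (m2 : {finite_measure set T2 -> \bar R}).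

Lemma measurable_param (f : T1 * T2 -> \bar R) : measurable_fun setT f ->
  measurable_fun setT (fun x => \int[m2]_y f (x, y))%E.
Proof.
move=> mf.
have E : (fun x => \int[m2]_y f (x, y))%E =
  (fun x => (fubini_F m2 f^\+%E x - fubini_F m2 f^\-%E x)%E).
  apply/funext => x; rewrite integralE /fubini_F.
  under eq_integral do rewrite funepos_comp/=.
  by under [X in (_ - X = _)%E]eq_integral do rewrite funeneg_comp/=.
rewrite E; apply: emeasurable_funB; apply: measurable_fun_fubini_tonelli_F.
- exact: measurable_funepos.
- by [].
- exact: measurable_funeneg.
- by [].
Qed.

Lemma measurable_Rparam (f : T1 * T2 -> R) : measurable_fun setT f ->
  measurable_fun setT (fun x => \int[m2]_y f (x, y)).
Proof.
move=> mf; have H0 := @measurable_param (EFin \o f) ((measurable_EFinP _ _).2 mf).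
exact: (measurableT_comp (@fine_measurable R setT measurableT) H0).
Qed.

Lemma Rint_fubini (f : T1 * T2 -> R) : (m1 \x m2)%E.-integrable setT (EFin \o f) ->
  (forall x, intg m2 (fun y => f (x, y))) -> (forall y, intg m1 (fun x => f (x, y))) ->
  \int[m1]_x \int[m2]_y f (x, y) = \int[m2]_y \int[m1]_x f (x, y).
Proof.
move=> iF i2 i1; rewrite /Rintegral; congr fine.
have := Fubini iF => /= E.
transitivity (\int[m1]_x \int[m2]_y (f (x, y))%:E)%E.
  by apply: eq_integral => x _; rewrite -EFin_Rint.
by rewrite E; apply: eq_integral => y _; rewrite -EFin_Rint.
Qed.
End Param.

Section TorusReal.
Variables (R : realType) (n : nat).
Notation X := (n.-tuple R).
Notation mu := (muT R n).

Lemma muT_shift (f : X -> R) h : perT f -> measurable_fun setT f ->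
  (\int[mu]_x (f (tadd x h))%:E = \int[mu]_x (f x)%:E)%E.
Proof.
move=> pf mf.
have mfE : measurable_fun setT (EFin \o f) by exact/measurable_EFinP.
pose g1 : X -> \bar R := (EFin \o f)^\+%E.
pose g2 : X -> \bar R := (EFin \o f)^\-%E.
have m1 : measurable_fun setT g1 by exact: measurable_funepos.
have m2 : measurable_fun setT g2 by exact: measurable_funeneg.
have p1 : perT g1 by move=> x j; rewrite /g1 !funeposE /= pf.
have p2 : perT g2 by move=> x j; rewrite /g2 !funenegE /= pf.
have n1 x : (0 <= g1 x)%E by rewrite /g1 funepos_ge0.
have n2 x : (0 <= g2 x)%E by rewrite /g2 funeneg_ge0.
rewrite [LHS]integralE [RHS]integralE.
have -> : (\int[mu]_x (fun x => (f x)%:E)^\+%E x = \int[mu]_x g1 (tadd x h))%E.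
  by rewrite ge0_muT_shift.
have -> : (\int[mu]_x (fun x => (f x)%:E)^\-%E x = \int[mu]_x g2 (tadd x h))%E.
  by rewrite ge0_muT_shift.
by congr (_ - _)%E; apply: eq_integral => x _; rewrite /g1 /g2 ?funeposE ?funenegE.
Qed.

Lemma Rmu_shift (f : X -> R) h : perT f -> measurable_fun setT f ->
  \int[mu]_x f (tadd x h) = \int[mu]_x f x.
Proof. by move=> pf mf; rewrite /Rintegral muT_shift. Qed.

Lemma measurable_shift (f : X -> R) h : measurable_fun setT f ->
  measurable_fun setT (fun x => f (tadd x h)).
Proof. by move=> mf; apply: (measurableT_comp mf); exact: measurable_taddl. Qed.
Lemma measurable_shiftl (f : X -> R) x : measurable_fun setT f ->
  measurable_fun setT (fun a => f (tadd x a)).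
Proof.
by move=> mf; apply: (measurableT_comp mf); apply: measurable_tadd => //; exact: measurable_cst.
Qed.

Lemma intg_shift (f : X -> R) h : perT f -> intg mu f -> intg mu (fun x => f (tadd x h)).
Proof.
move=> pf iF; have mf := intg_meas iF.
apply: intgP; first exact: measurable_shift.
rewrite (@muT_shift (fun x => `|f x|)).
- exact: intg_lt iF.
- by move=> x j; rewrite pf.
- exact: measurableT_comp.
Qed.

Lemma intg_shiftl (f : X -> R) x : perT f -> intg mu f -> intg mu (fun a => f (tadd x a)).
Proof.
move=> pf iF; have := intg_shift x pf iF.
by congr intg; apply/funext => a; rewrite taddC.
Qed.

Lemma Rmu_shiftl (f : X -> R) x : perT f -> measurable_fun setT f ->
  \int[mu]_a f (tadd x a) = \int[mu]_a f a.
Proof.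
move=> pf mf; rewrite -(Rmu_shift x pf mf); apply: eq_Rintegral => a _.
by rewrite taddC.
Qed.

Lemma Rmu_cst (c : R) : \int[mu]_x (fun=> c) x = c.
Proof. by rewrite /Rintegral integral_cst//= probability_setT mule1. Qed.

Definition sline (j : 'I_n) (s : R) : X := [tuple (i == j)%:R * s | i < n].
Lemma sline0 j (x : X) : tadd x (sline j 0) = x.
Proof. by apply: eq_from_tnth => i; rewrite !tnth_mktuple mulr0 addr0. Qed.
Lemma slineD j (x : X) s t : tadd (tadd x (sline j s)) (sline j t) = tadd x (sline j (s + t)).
Proof. by apply: eq_from_tnth => i; rewrite !tnth_mktuple mulrDr addrA. Qed.

(** Only restrictions to lines parallel to the j-th axis are differentiated; this is the form in
    which integration by parts on the torus ([int_pd0]) consumes derivatives. *)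
Definition pd j (G G' : X -> R) := forall x,
  is_derive (0 : R) 1 (fun s => G (tadd x (sline j s))) (G' x).

Lemma pd_at j G G' x s0 : pd j G G' ->
  is_derive (s0 : R) 1 (fun s => G (tadd x (sline j s))) (G' (tadd x (sline j s0))).
Proof.
move=> H; have := H (tadd x (sline j s0)) => D.
rewrite (_ : (fun s => _) = (fun s => G (tadd (tadd x (sline j s0)) (sline j (s - s0))))); last first.
  by apply/funext => s; rewrite slineD addrC subrK.
have E : is_derive (s0 : R) 1 (fun s : R => s - s0) (1 + 0).
  by apply: is_deriveD.
rewrite addr0 in E.
have D' : is_derive (s0 - s0 : R) 1 (fun s => G (tadd (tadd x (sline j s0)) (sline j s))) (G' (tadd x (sline j s0))).
  by rewrite subrr.
have := @is_derive1_comp _ (fun s => G (tadd (tadd x (sline j s0)) (sline j s))) (fun s : R => s - s0) s0 _ _ D' E.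
by rewrite mulr1.
Qed.

Lemma pd_ext j G G' F' : pd j G G' -> (forall x, G' x = F' x) -> pd j G F'.
Proof. by move=> H E x; rewrite -E. Qed.

Lemma pd_add j G G' F F' : pd j G G' -> pd j F F' ->
  pd j (fun x => G x + F x) (fun x => G' x + F' x).
Proof. by move=> H1 H2 x; exact: (is_deriveD (H1 x) (H2 x)). Qed.

Lemma pd_opp j G G' : pd j G G' -> pd j (fun x => - G x) (fun x => - G' x).
Proof. by move=> H1 x; exact: (is_deriveN (H1 x)). Qed.

Lemma pd_mul j G G' F F' : pd j G G' -> pd j F F' ->
  pd j (fun x => G x * F x) (fun x => G x * F' x + F x * G' x).
Proof.
by move=> H1 H2 x; have := is_deriveM (H1 x) (H2 x); rewrite sline0.
Qed.

Lemma pd_comp j G G' (f : R -> R) (f' : X -> R) : pd j G G' ->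
  (forall x, is_derive (G x) 1 f (f' x)) ->
  pd j (fun x => f (G x)) (fun x => f' x * G' x).
Proof.
move=> H1 H2 x.
have D : is_derive (G (tadd x (sline j 0))) 1 f (f' x) by rewrite sline0.
exact: (@is_derive1_comp _ f (fun s => G (tadd x (sline j s))) 0 _ _ D (H1 x)).
Qed.

Lemma pd_inv j G G' : pd j G G' -> (forall x, G x != 0) ->
  pd j (fun x => (G x)^-1) (fun x => - (G x)^-2 * G' x).
Proof.
move=> H1 H2; apply: pd_comp H1 _ => x.
have := @is_deriveV R id (G x) 1 1 (H2 x) (is_derive_id (G x : R^o) 1).
by rewrite /GRing.scale/= mulr1.
Qed.

(* The torus integral of [G] along a line is constant, so its derivative at 0 vanishes. *)
Lemma int_pd0 j G G' B : perT G -> measurable_fun setT G -> pd j G G' ->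
  (forall x, `|G' x| <= B) -> intg mu G -> \int[mu]_x G' x = 0.
Proof.
move=> pG mG HG HB iG.
pose f (s : R) (x : X) : R := G (tadd x (sline j s)).
have dE s x : (f ^~ x)^`()%classic s = G' (tadd x (sline j s)).
  by rewrite derive1E; have := pd_at x s HG => h; rewrite derive_val.
have B0 : 0 <= B by apply: le_trans (HB [tuple 0 | i < n]).
have I0 : (`]-1, 1[%classic : set R) 0 by rewrite /= in_itv/=; lra.
have := @differentiation_under_integral R _ X mu f setT measurableT 0 (-1) 1 I0.
rewrite (_ : (fun x' => _) = (fun=> \int[mu]_x G x)); last first.
  by apply/funext => s; exact: Rmu_shift.
rewrite derive1_cst => H.
transitivity (\int[mu]_y (partial1of2 f ^~ y) 0).
  by apply: eq_Rintegral => x _; rewrite /partial1of2 dE sline0.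
apply/esym/(H _ _ (fun=> B)) => //.
- by move=> s _; exact: intg_shift.
- by move=> s x _ _; have := pd_at x s HG => h; exact: ex_derive.
- exact: intg_cst.
- by move=> s x _ _; rewrite /partial1of2 dE.
Qed.

Section Mollify.
Variables (k : X -> R) (N : R).
Hypotheses (mk : measurable_fun setT k) (pk : perT k) (kN : forall x, `|k x| <= N).

(** A forward average, the convolution with the reflected kernel; hence the minus sign in
    [EE_pd]. *)
Definition EE (f : X -> R) (x : X) : R := \int[mu]_a (k a * f (tadd x a)).

Lemma intg_E f x : perT f -> intg mu f -> intg mu (fun a => k a * f (tadd x a)).
Proof. by move=> pf iF; apply: (@intgMb _ _ _ mu _ k N) => //; exact: intg_shiftl. Qed.

Lemma EE_per f : perT f -> perT (EE f).
Proof.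
by move=> pf x j; apply: eq_Rintegral => a _; rewrite taddAC pf.
Qed.

Lemma EE_bound f x : perT f -> intg mu f -> `|EE f x| <= N * \int[mu]_a `|f a|.
Proof.
move=> pf iF; apply: (le_trans (Rint_abs (intg_E x pf iF))).
rewrite -(@Rmu_shiftl (fun a => `|f a|) x); last 2 first.
- by move=> y j; rewrite pf.
- by apply: measurableT_comp => //; exact: intg_meas iF.
rewrite -RintZ; last exact: intg_abs (intg_shiftl x pf iF).
apply: Rint_le; first exact: intg_abs (intg_E x pf iF).
  by apply: intgZ; exact: intg_abs (intg_shiftl x pf iF).
by move=> a; rewrite normrM ler_wpM2r.
Qed.

Lemma EE_meas f : measurable_fun setT f -> measurable_fun setT (EE f).
Proof.
move=> mf; apply: (@measurable_Rparam _ _ X X R mu (fun p => k p.2 * f (tadd p.1 p.2))).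
apply: measurable_funM; first exact: (measurableT_comp mk).
by apply: (measurableT_comp mf); exact: measurable_tadd.
Qed.

Lemma EED f g x : perT f -> perT g -> intg mu f -> intg mu g ->
  EE (fun y => f y + g y) x = EE f x + EE g x.
Proof.
move=> pf pg iF ig; rewrite /EE -RintD; [|exact: intg_E..].
by apply: eq_Rintegral => a _; rewrite mulrDr.
Qed.
Lemma EEZ c f x : perT f -> intg mu f -> EE (fun y => c * f y) x = c * EE f x.
Proof.
move=> pf iF; rewrite /EE -RintZ; last exact: intg_E.
by apply: eq_Rintegral => a _; rewrite mulrCA.
Qed.
End Mollify.

(** Translation invariance moves the parameter s from f, which is only integrable, onto the smooth
    kernel; one then differentiates under the integral sign. *)
Lemma EE_pd (eta etaj : X -> R) j N N' f :
  measurable_fun setT eta -> measurable_fun setT etaj -> perT eta ->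
  (forall x, `|eta x| <= N) -> (forall x, `|etaj x| <= N') -> pd j eta etaj ->
  perT f -> intg mu f -> pd j (EE eta f) (fun x => - EE etaj f x).
Proof.
move=> meta metaj peta HN HN' HD pf iF x.
have mf := intg_meas iF.
pose F (s : R) (b : X) : R := eta (tadd b (sline j (- s))) * f (tadd x b).
have EF s : EE eta f (tadd x (sline j s)) = \int[mu]_b F s b.
  rewrite -(@Rmu_shift (F s) (sline j s)).
  - apply: eq_Rintegral => a _; rewrite /F slineD subrr sline0.
    by rewrite -taddA (taddC (sline _ _)).
  - by move=> y i; rewrite /F taddAC peta taddA pf.
  - by apply: measurable_funM; [exact: measurable_shift|exact: measurable_shiftl].
have DF s b : is_derive (s : R) 1 (F ^~ b) (- etaj (tadd b (sline j (- s))) * f (tadd x b)).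
  have E : is_derive (s : R) 1 (fun s : R => - s) (- 1) by exact: is_deriveNid.
  have := @is_derive1_comp _ (fun s => eta (tadd b (sline j s))) (fun s : R => - s) s _ _ (pd_at b (- s) HD) E.
  rewrite mulrN1 => D.
  by have := is_deriveM D (is_derive_cst (f (tadd x b)) s 1);
    rewrite /GRing.scale/= mulr0 add0r => D2; rewrite mulrC.
have dE s b : (F ^~ b)^`()%classic s = - etaj (tadd b (sline j (- s))) * f (tadd x b).
  by rewrite derive1E; have := DF s b => h; rewrite derive_val.
have I0 : (`]-1, 1[%classic : set R) 0 by rewrite /= in_itv/=; lra.
have iF1 s : intg mu (F s).
  apply: (@intgMb _ _ _ mu _ _ N); first exact: intg_shiftl.
    exact: measurable_shift.
  by move=> b; exact: HN.
have iG : intg mu (fun b => N' * `|f (tadd x b)|).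
  by apply: intgZ; exact: intg_abs (intg_shiftl x pf iF).
have N0 : 0 <= N' by apply: le_trans (HN' x).
have D1 : forall x0 y, (`]-1, 1[%classic : set R) x0 -> [set: X] y -> derivable (F^~ y) x0 1.
  by move=> s b _ _; have := DF s b => h; exact: ex_derive.
have G0 : forall y, 0 <= N' * `|f (tadd x y)| by move=> y; rewrite mulr_ge0.
have Gb : forall x0 y, (`]-1, 1[%classic : set R) x0 -> [set: X] y -> `|partial1of2 F x0 y| <= N' * `|f (tadd x y)|.
  by move=> s b _ _; rewrite /partial1of2 dE normrM normrN ler_wpM2r.
have H1 := @derivable_under_integral R _ X mu F setT measurableT 0 (-1) 1 I0
  (fun s _ => iF1 s) D1 _ G0 iG Gb.
have H2 := @differentiation_under_integral R _ X mu F setT measurableT 0 (-1) 1 I0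
  (fun s _ => iF1 s) D1 _ G0 iG Gb.
rewrite (_ : (fun s => _) = (fun s => \int[mu]_b F s b)); last by apply/funext.
apply: DeriveDef => //; rewrite -derive1E H2 /EE -RintN; last exact: (@intg_E etaj N').
apply: eq_Rintegral => b _; rewrite /partial1of2 dE oppr0 sline0.
by rewrite mulNr.
Qed.

End TorusReal.

(** * Commutator estimates at a fixed time *)

Section Ineq.
Variable R : realType.
Implicit Types s t p : R.
Lemma le1cube s : 0 <= s -> s <= 1 + s ^+ 3.
Proof. by move=> s0; have := sqr_ge0 (s - 1); have := mulr_ge0 s0 (sqr_ge0 (s - 1)); nra. Qed.
Lemma sq_le1cube s : 0 <= s -> s ^+ 2 <= 1 + s ^+ 3.
Proof. by move=> s0; have := mulr_ge0 s0 (sqr_ge0 (s - 1)); have := sqr_ge0 (s-1); nra. Qed.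
Lemma mulsq_le s t : 0 <= s -> 0 <= t -> s * t ^+ 2 <= s ^+ 3 + t ^+ 3.
Proof.
move=> s0 t0; have [st|/ltW ts] := leP s t.
  have : s * t ^+ 2 <= t ^+ 3 by rewrite [t ^+ 3]exprS ler_wpM2r// sqr_ge0.
  by have := exprn_ge0 3 s0; lra.
have : s * t ^+ 2 <= s ^+ 3 by rewrite [s ^+ 3]exprS ler_wpM2l// lerXn2r.
by have := exprn_ge0 3 t0; lra.
Qed.
Lemma mul_le1cube s t : 0 <= s -> 0 <= t -> s * t <= 1 + s ^+ 3 + t ^+ 3.
Proof.
move=> s0 t0; have := mulsq_le s0 t0; have := mulr_ge0 s0 (sqr_ge0 (t - 1)).
have := le1cube s0.
have := exprn_ge0 3 s0; have := exprn_ge0 3 t0; have := sq_le1cube t0; have := sq_le1cube s0.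
have := sqr_ge0 (s - t); nra.
Qed.
(** This is [mulsq_le] for p^2 s and t / p. For large p the cube of t receives the small weight
    p^-3: with t a density increment and s a velocity increment, the pressure term becomes small
    although density increments are only O(|h|) in the cubic sense. *)
Lemma young_p s t p : 0 <= s -> 0 <= t -> 0 < p ->
  s * t ^+ 2 <= p ^+ 6 * s ^+ 3 + (p ^+ 3)^-1 * t ^+ 3.
Proof.
move=> s0 t0 p0.
have := @mulsq_le (p ^+ 2 * s) (t / p) (mulr_ge0 (exprn_ge0 _ (ltW p0)) s0) (divr_ge0 t0 (ltW p0)).
have pn : p != 0 by rewrite gt_eqF.
rewrite (_ : p ^+ 2 * s * (t / p) ^+ 2 = s * t ^+ 2); last by field.
rewrite (_ : (p ^+ 2 * s) ^+ 3 = p ^+ 6 * s ^+ 3); last by ring.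
by rewrite (_ : (t / p) ^+ 3 = (p ^+ 3)^-1 * t ^+ 3) //; field.
Qed.
Lemma cubeD_le s t : 0 <= s -> 0 <= t -> (s + t) ^+ 3 <= 4 * (s ^+ 3 + t ^+ 3).
Proof.
move=> s0 t0; rewrite -subr_ge0.
rewrite (_ : _ - _ = 3 * ((s + t) * (s - t) ^+ 2)); last by ring.
by apply: mulr_ge0 => //; apply: mulr_ge0; [exact: addr_ge0|exact: sqr_ge0].
Qed.
Lemma cubeB_le s t : `|s - t| ^+ 3 <= 4 * (`|s| ^+ 3 + `|t| ^+ 3).
Proof.
apply: le_trans (cubeD_le (normr_ge0 s) (normr_ge0 t)).
by apply: lerXn2r; rewrite ?nnegrE ?addr_ge0// ler_normB.
Qed.
(** The tangent inequality for the cube on the half-line; averaged in t, with s the mean, it is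
    Jensen's inequality [E_cube]. *)
Lemma cube_tangent s t : 0 <= s -> 0 <= t -> s ^+ 3 + 3 * s ^+ 2 * (t - s) <= t ^+ 3.
Proof.
move=> s0 t0; rewrite -subr_ge0.
rewrite (_ : _ - _ = (t + 2 * s) * (t - s) ^+ 2); last by ring.
by apply: mulr_ge0; [apply: addr_ge0 => //; exact: mulr_ge0|exact: sqr_ge0].
Qed.
End Ineq.

Section BM.
Context d (T : measurableType d) (R : realType).
(** At a fixed time all mollified quantities are bounded and measurable; closure of this class under
    the algebraic operations settles their integrability. *)
Definition bm (f : T -> R) := measurable_fun setT f /\ exists B, forall x, `|f x| <= B.
Lemma bmD f g : bm f -> bm g -> bm (fun x => f x + g x).
Proof.
move=> [mf [B HB]] [mg [B' HB']]; split; first exact: measurable_funD.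
by exists (B + B') => x; apply: (le_trans (ler_normD _ _)); apply: lerD.
Qed.
Lemma bmM f g : bm f -> bm g -> bm (fun x => f x * g x).
Proof.
move=> [mf [B HB]] [mg [B' HB']]; split; first exact: measurable_funM.
by exists (B * B') => x; rewrite normrM; apply: ler_pM.
Qed.
Lemma bm_cst c : bm (fun=> c).
Proof. by split; [exact: measurable_cst|exists `|c|]. Qed.
Lemma bmN f : bm f -> bm (fun x => - f x).
Proof.
move=> H; have := bmM (bm_cst (-1)) H; congr bm.
by apply/funext => x; rewrite mulN1r.
Qed.
Lemma bmX f k : bm f -> bm (fun x => f x ^+ k).
Proof.
move=> H; elim: k => [|k IH]; first exact: bm_cst.
have := bmM H IH; congr bm.
by apply/funext => x; rewrite exprS.
Qed.
Lemma bmV f c : bm f -> 0 < c -> (forall x, c <= f x) -> bm (fun x => (f x)^-1).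
Proof.
move=> [mf _] c0 H; split.
  rewrite (_ : (fun x => _) = (fun x => f x `^ (-1))).
    exact: (measurableT_comp (measurable_powR (-1)) mf).
  by apply/funext => x; rewrite powR_inv1// ltW// (lt_le_trans c0).
exists c^-1 => x; have h := lt_le_trans c0 (H x).
by rewrite normfV (gtr0_norm h) lef_pV2 ?posrE.
Qed.
Lemma bm_intg (m : {finite_measure set T -> \bar R}) f : bm f -> intg m f.
Proof. by move=> [mf [B HB]]; exact: intg_bounded HB. Qed.
End BM.

Section Static.
Variables (R : realType) (d : nat).
Notation X := (d.-tuple R).
Notation mu := (muT R d).
(** The two constants have different roles: the sup bound [N] degenerates with the kernel and
    ensures integrability, while the L^1 bound [L] on the derivative kernels is the one that enters
    the commutator estimates. *)
Variables (eta : X -> R) (etaj : 'I_d -> X -> R) (N L : R).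
Hypotheses (meta : measurable_fun setT eta) (metaj : forall j, measurable_fun setT (etaj j)).
Hypotheses (peta : perT eta) (HN : forall x, `|eta x| <= N) (HNj : forall j x, `|etaj j x| <= N).
Hypotheses (HD : forall j, pd j eta (etaj j)) (eta0 : forall x, 0 <= eta x)
  (eta1 : \int[mu]_x eta x = 1) (etaL : forall j, \int[mu]_x `|etaj j x| <= L).

Notation E := (EE eta).
Notation D j := (EE (etaj j)).

Lemma intg_eta : intg mu eta. Proof. exact: intg_bounded HN. Qed.
Lemma intg_etaj j : intg mu (etaj j). Proof. exact: intg_bounded (HNj j). Qed.

Definition pint (f : X -> R) := perT f /\ intg mu f.

Lemma bmE f : pint f -> bm (E f).
Proof.
move=> [pf iF]; split; first by apply: EE_meas => //; exact: intg_meas iF.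
by exists (N * \int[mu]_a `|f a|) => x; apply: EE_bound.
Qed.
Lemma bmDj j f : pint f -> bm (D j f).
Proof.
move=> [pf iF]; split; first by apply: EE_meas => //; exact: intg_meas iF.
by exists (N * \int[mu]_a `|f a|) => x; apply: EE_bound.
Qed.
Lemma pdE j f : pint f -> pd j (E f) (fun x => - D j f x).
Proof. by move=> [pf iF]; apply: (@EE_pd R d _ _ j N N) => //. Qed.
Lemma perE f : pint f -> perT (E f).
Proof. by move=> [pf _]; exact: EE_per. Qed.

Lemma int_pd_bm j G G' : perT G -> bm G -> pd j G G' -> bm G' -> \int[mu]_x G' x = 0.
Proof.
move=> pG bG HG [_ [B HB]]; apply: (int_pd0 pG _ HG HB); first exact: bG.1.
exact: bm_intg.
Qed.

Lemma E_cst c x : E (fun=> c) x = c.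
Proof. by rewrite /EE RintZr ?eta1 ?mul1r//; exact: intg_eta. Qed.

Lemma E_le f g x : pint f -> pint g -> (forall x, f x <= g x) -> E f x <= E g x.
Proof.
move=> [pf iF] [pg ig] fg; apply: Rint_le; [exact: (intg_E meta HN)..|].
by move=> a; rewrite ler_wpM2l.
Qed.
Lemma pint_cst c : pint (fun=> c).
Proof. by split => //; exact: intg_cst. Qed.

Section Weight.
Variables (rho : X -> R) (c C : R).
Hypotheses (prho : perT rho) (mrho : measurable_fun setT rho) (c0 : 0 < c)
  (rhoc : forall x, c <= rho x <= C).
Let rho0 x : 0 < rho x. Proof. by have /andP[h _] := rhoc x; exact: lt_le_trans c0 h. Qed.
Let rhoC x : `|rho x| <= C.
Proof. by rewrite gtr0_norm//; have /andP[] := rhoc x. Qed.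
Lemma bm_rho : bm rho. Proof. by split => //; exists C. Qed.
Lemma pint_rho : pint rho. Proof. by split => //; exact: bm_intg bm_rho. Qed.
Let C0 : 0 <= C. Proof. exact: le_trans (rhoC [tuple 0 | i < d]). Qed.

Notation r := (E rho).
Lemma r_itv x : c <= r x <= C.
Proof.
rewrite -{1}(E_cst c x) -(E_cst C x).
by rewrite !E_le//; try exact: pint_cst; try exact: pint_rho;
  move=> y; have /andP[] := rhoc y.
Qed.
Lemma r_gt0 x : 0 < r x. Proof. by have /andP[h _] := r_itv x; exact: lt_le_trans c0 h. Qed.
Let rn0 x : r x != 0. Proof. by rewrite gt_eqF// r_gt0. Qed.

(** The Favre average of a. *)
Definition wav (a : X -> R) x : R := E (fun y => rho y * a y) x / r x.

Definition p3 (a : X -> R) := [/\ perT a, measurable_fun setT a & intg mu (fun x => `|a x| ^+ 3)].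

Lemma p3_dom (a b f : X -> R) K : p3 a -> p3 b -> perT f -> measurable_fun setT f ->
  (forall x, `|f x| <= K * (1 + `|a x| ^+ 3 + `|b x| ^+ 3)) -> pint f.
Proof.
move=> [pa ma ia] [pb mb ib] pf mf H; split => //.
apply: (@intg_le _ _ _ mu _ (fun x => K * (1 + `|a x| ^+ 3 + `|b x| ^+ 3))) => //.
by apply: intgZ; apply: intgD => //; apply: intgD => //; exact: intg_cst.
Qed.

Lemma p3_rhof (a b f : X -> R) : p3 a -> p3 b -> perT f -> measurable_fun setT f ->
  (forall x, `|f x| <= 1 + `|a x| ^+ 3 + `|b x| ^+ 3) -> pint (fun y => rho y * f y).
Proof.
move=> Ha Hb pf mf H; apply: (@p3_dom a b _ C) => //.
- by move=> x j; rewrite prho pf.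
- exact: measurable_funM.
- by move=> x; rewrite normrM; apply: ler_pM.
Qed.

Variables (a b : X -> R) (j : 'I_d).
Hypotheses (Ha : p3 a) (Hb : p3 b).
Let pa : perT a. Proof. by case: Ha. Qed.
Let ma : measurable_fun setT a. Proof. by case: Ha. Qed.
Let pb : perT b. Proof. by case: Hb. Qed.
Let mb : measurable_fun setT b. Proof. by case: Hb. Qed.
Let cub (x : R) : 0 <= `|x| ^+ 3. Proof. by rewrite exprn_ge0. Qed.

Lemma pint_a : pint (fun y => rho y * a y).
Proof.
apply: (@p3_rhof a a) => // x.
by have := le1cube (normr_ge0 (a x)); have := cub (a x); lra.
Qed.
Lemma pint_ab : pint (fun y => rho y * (a y * b y)).
Proof.
apply: (@p3_rhof a b) => //.
- by move=> x i; rewrite pa pb.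
- exact: measurable_funM.
- by move=> x; rewrite normrM; exact: mul_le1cube.
Qed.
Lemma pint_aa : pint (fun y => rho y * a y ^+ 2).
Proof.
apply: (@p3_rhof a a) => //.
- by move=> x i; rewrite pa.
- exact: measurable_funX.
- by move=> x; rewrite normrX; have := sq_le1cube (normr_ge0 (a x)); have := cub (a x); lra.
Qed.
Lemma pint_baa : pint (fun y => rho y * (b y * a y ^+ 2)).
Proof.
apply: (@p3_rhof a b) => //.
- by move=> x i; rewrite pa pb.
- by apply: measurable_funM => //; exact: measurable_funX.
- by move=> x; rewrite normrM normrX; have := mulsq_le (normr_ge0 (b x)) (normr_ge0 (a x)); lra.
Qed.
End Weight.

Section Commutator.
Variables (rho : X -> R) (c C : R).
Hypotheses (prho : perT rho) (mrho : measurable_fun setT rho) (c0 : 0 < c)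
  (rhoc : forall x, c <= rho x <= C).
Variables (a b : X -> R) (j : 'I_d).
Hypotheses (Ha : p3 a) (Hb : p3 b).
Notation r := (E rho).
Notation va := (wav rho a).
Notation vb := (wav rho b).
Let rn0 x : r x != 0. Proof. by rewrite gt_eqF//; exact: (r_gt0 prho mrho c0 rhoc). Qed.
Let Pr := pint_rho prho mrho c0 rhoc.
Let Pa := pint_a prho mrho c0 rhoc Ha.
Let Pb := pint_a prho mrho c0 rhoc Hb.
Let Pab := pint_ab prho mrho c0 rhoc Ha Hb.
Let Paa := pint_aa prho mrho c0 rhoc Ha.
Let Pbaa := pint_baa prho mrho c0 rhoc Ha Hb.

Lemma bm_r : bm r. Proof. exact: bmE. Qed.
Lemma bm_rV : bm (fun x => (r x)^-1).
Proof.
apply: (bmV bm_r c0) => x.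
by have /andP[] := r_itv prho mrho c0 rhoc x.
Qed.
Lemma bm_va : bm va. Proof. exact: (bmM (bmE Pa) bm_rV). Qed.
Lemma bm_vb : bm vb. Proof. exact: (bmM (bmE Pb) bm_rV). Qed.

(** The derivative of m^2 / (2 r) is w m' - w^2 r' / 2 with w = m / r. This is the part of it coming
    from the convection of component a by component b in direction j. *)
Definition Kin x : R := va x * D j (fun y => rho y * (a y * b y)) x
  - 2^-1 * va x ^+ 2 * D j (fun y => rho y * b y) x.
(** The expansion of the derivative-kernel average of rho (b - vb) (a - va)^2 with va and vb frozen
    at x (see [Tri_E]). *)
Definition Tri x : R := D j (fun y => rho y * (b y * a y ^+ 2)) x
  - 2 * va x * D j (fun y => rho y * (a y * b y)) x + va x ^+ 2 * D j (fun y => rho y * b y) x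
  - vb x * (D j (fun y => rho y * a y ^+ 2) x - 2 * va x * D j (fun y => rho y * a y) x
            + va x ^+ 2 * D j rho x).
Definition dv (u : X -> R) x : R :=
  - (D j (fun y => rho y * u y) x - wav rho u x * D j rho x) / r x.
(** Since va r is the average of rho a, this is the average of rho (a - va)^2, a variance. *)
Definition Var x : R := E (fun y => rho y * a y ^+ 2) x - va x ^+ 2 * r x.

Lemma pd_wav (u : X -> R) : pint (fun y => rho y * u y) -> pd j (wav rho u) (dv u).
Proof.
move=> Pu; apply: pd_ext (pd_mul (pdE j Pu) (pd_inv (pdE j Pr) rn0)) _ => x.
by rewrite /dv /wav; field; exact: rn0.
Qed.

Lemma bm_dv (u : X -> R) : pint (fun y => rho y * u y) -> bm (dv u).
Proof.
move=> Pu; apply: bmM; last exact: bm_rV.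
apply: bmN; apply: bmD; first exact: bmDj.
by apply: bmN; apply: bmM; [exact: (bmM (bmE Pu) bm_rV)|exact: bmDj].
Qed.

Lemma bm_Kin : bm Kin.
Proof.
apply: bmD; first by apply: bmM; [exact: bm_va|exact: bmDj].
apply: bmN; apply: bmM; last exact: bmDj.
by apply: bmM; [exact: bm_cst|apply: bmX; exact: bm_va].
Qed.
Lemma bm_Var : bm Var.
Proof.
apply: bmD; first exact: bmE.
by apply: bmN; apply: bmM; [apply: bmX; exact: bm_va|exact: bm_r].
Qed.
Lemma bm_Tri : bm Tri.
Proof.
have b2v : bm (fun x => 2 * va x) by apply: bmM; [exact: bm_cst|exact: bm_va].
have bv2 : bm (fun x => va x ^+ 2) by apply: bmX; exact: bm_va.
apply: bmD.
  apply: bmD; last by apply: bmM => //; exact: bmDj.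
  by apply: bmD; [exact: bmDj|apply: bmN; apply: bmM => //; exact: bmDj].
apply: bmN; apply: bmM; first exact: bm_vb.
apply: bmD; last by apply: bmM => //; exact: bmDj.
by apply: bmD; [exact: bmDj|apply: bmN; apply: bmM => //; exact: bmDj].
Qed.

Lemma per_wav (u : X -> R) : pint (fun y => rho y * u y) -> perT (wav rho u).
Proof. by move=> Pu x i; rewrite /wav !perE. Qed.

(** The combination 2 [Kin] + [Tri] + [dv] [Var] is the j-th partial derivative of the flux [G], so
    it integrates to 0 over the torus. The terms left besides [Kin] are of third order in centred
    differences. The identity holds for each pair of components and each direction separately. *)
Lemma int_Kin : 2 * \int[mu]_x Kin x = - \int[mu]_x (Tri x + dv b x * Var x).
Proof.
pose G x := - E (fun y => rho y * (b y * a y ^+ 2)) x + vb x * Var x.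
pose G' x := 2 * Kin x + (Tri x + dv b x * Var x).
have iK : intg mu Kin by apply: bm_intg; exact: bm_Kin.
have bTV : bm (fun x => Tri x + dv b x * Var x).
  by apply: bmD; [exact: bm_Tri|apply: bmM; [exact: bm_dv|exact: bm_Var]].
suff H : \int[mu]_x G' x = 0.
  move: H; rewrite /G' RintD; [|exact: intgZ|exact: bm_intg].
  by rewrite RintZ// => /eqP; rewrite addr_eq0 => /eqP.
have bG' : bm G' by apply: bmD => //; apply: bmM; [exact: bm_cst|exact: bm_Kin].
apply: (@int_pd_bm j G G') => //.
- move=> x i; rewrite /G /Var.
  by rewrite !(per_wav Pb) !(per_wav Pa) !(perE Pbaa) !(perE Paa) !(perE Pr).
- apply: bmD; first by apply: bmN; exact: bmE.
  by apply: bmM; [exact: bm_vb|exact: bm_Var].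
- have PV : pd j Var (fun x => - (D j (fun y => rho y * a y ^+ 2) x
      - 2 * va x * D j (fun y => rho y * a y) x + va x ^+ 2 * D j rho x)).
    apply: pd_ext (pd_add (pdE j Paa) (pd_opp (pd_mul (pd_mul (pd_wav Pa) (pd_wav Pa)) (pdE j Pr)))) _.
    by move=> x; rewrite /dv; field; exact: rn0.
  apply: pd_ext (pd_add (pd_opp (pdE j Pbaa)) (pd_mul (pd_wav Pb) PV)) _ => x.
  by rewrite /G' /Kin /Tri; field.
Qed.

End Commutator.

Lemma pintD f g : pint f -> pint g -> pint (fun y => f y + g y).
Proof.
by move=> [pf iF] [pg ig]; split; [move=> x i; rewrite pf pg|exact: intgD].
Qed.
Lemma pintZ (v : R) f : pint f -> pint (fun y => v * f y).
Proof. by move=> [pf iF]; split; [move=> x i; rewrite pf|exact: intgZ]. Qed.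
Lemma pint_abs f : pint f -> pint (fun y => `|f y|).
Proof. by move=> [pf iF]; split; [move=> x i; rewrite pf|exact: intg_abs]. Qed.

Section KernelBounds.
Variables (k : X -> R) (M : R).
Hypotheses (mk : measurable_fun setT k) (kM : forall x, `|k x| <= M).

Lemma EE_add f g x : pint f -> pint g -> EE k (fun y => f y + g y) x = EE k f x + EE k g x.
Proof. by move=> [pf iF] [pg ig]; exact: (EED mk kM). Qed.
Lemma EE_scale (v : R) f x : pint f -> EE k (fun y => v * f y) x = v * EE k f x.
Proof. by move=> [pf iF]; exact: (EEZ mk kM). Qed.
Lemma pint_intg f x : pint f -> intg mu (fun y => k y * f (tadd x y)).
Proof. by move=> [pf iF]; exact: (intg_E mk kM). Qed.
Lemma EE_le f g x : (forall y, 0 <= k y) -> pint f -> pint g ->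
  (forall y, f y <= g y) -> EE k f x <= EE k g x.
Proof.
move=> k0 Pf Pg fg; apply: Rint_le; [exact: pint_intg..|].
by move=> y; rewrite ler_wpM2l.
Qed.
Lemma EE_norm f x : pint f -> `|EE k f x| <= EE (fun y => `|k y|) (fun y => `|f y|) x.
Proof.
move=> Pf; apply: (le_trans (Rint_abs (pint_intg x Pf))).
rewrite le_eqVlt; apply/orP; left; apply/eqP; apply: eq_Rintegral => y _.
by rewrite normrM.
Qed.
Lemma EE_ge0 f x : (forall y, 0 <= k y) -> (forall y, 0 <= f y) -> 0 <= EE k f x.
Proof. by move=> k0 f0; apply: Rint_ge0 => y; rewrite mulr_ge0. Qed.
End KernelBounds.

Lemma EE_lek (k k' : X -> R) M M' f x : measurable_fun setT k -> measurable_fun setT k' ->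
  (forall x, `|k x| <= M) -> (forall x, `|k' x| <= M') -> (forall y, k y <= k' y) ->
  pint f -> (forall y, 0 <= f y) -> EE k f x <= EE k' f x.
Proof.
move=> mk mk' kM kM' kk' Pf f0; apply: Rint_le.
- exact: (pint_intg mk kM).
- exact: (pint_intg mk' kM').
- by move=> y; rewrite ler_wpM2r.
Qed.

Section Cubes.
Variable j : 'I_d.
Hypothesis L0 : 0 <= L.
Let ae x := `|etaj j x|.
Let mae : measurable_fun setT ae. Proof. exact: measurableT_comp. Qed.
Let aeN x : `|ae x| <= N. Proof. by rewrite normr_id. Qed.
Let ae0 x : 0 <= ae x. Proof. exact: normr_ge0. Qed.

(** One weight above both |eta_j| and L eta: a product of an average against |eta_j|, whose mass is
    at most L, and an average against eta is then bounded by cubic moments against this single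
    kernel. *)
Definition kap x : R := `|etaj j x| + L * eta x.
Let mkap : measurable_fun setT kap.
Proof. by apply: measurable_funD => //; apply: measurable_funM. Qed.
Let kapN x : `|kap x| <= N + L * N.
Proof.
rewrite /kap (le_trans (ler_normD _ _))// lerD ?normr_id//.
by rewrite normrM (ger0_norm L0) ler_wpM2l.
Qed.
Let kap0 x : 0 <= kap x. Proof. by rewrite addr_ge0// mulr_ge0. Qed.
Let ae_kap x : ae x <= kap x. Proof. by rewrite lerDl mulr_ge0. Qed.
Let eta_kap x : L * eta x <= kap x. Proof. by rewrite lerDr. Qed.

Definition cubk (k u : X -> R) (v : R) x := EE k (fun y => `|u y - v| ^+ 3) x.
(** The cubic increments of u between two points near x, doubly averaged. No Favre average appears
    any more, so the space-time integral is controlled by the Besov-type norm. *)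
Definition YY (u : X -> R) x : R :=
  \int[mu]_al (kap al * \int[mu]_be (eta be * `|u (tadd x al) - u (tadd x be)| ^+ 3)).

Lemma pint_cub u v : p3 u -> pint (fun y => `|u y - v| ^+ 3).
Proof.
move=> [pu mu_ iu]; split; first by move=> x i; rewrite pu.
apply: (@intg_le _ _ _ mu _ (fun x => 4 * (`|u x| ^+ 3 + `|v| ^+ 3))).
- by apply: measurable_funX; apply: measurableT_comp => //; exact: measurable_funB.
- by apply: intgZ; apply: intgD => //; exact: intg_cst.
- by move=> x; rewrite normrX normr_id cubeB_le.
Qed.
Lemma pint_dif u v : p3 u -> pint (fun y => `|u y - v|).
Proof.
move=> Pu; have [pu mu_ iu] := Pu; split; first by move=> x i; rewrite pu.
apply: (@intg_le _ _ _ mu _ (fun x => 1 + `|u x - v| ^+ 3)).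
- by apply: measurableT_comp => //; exact: measurable_funB.
- by apply: intgD; [exact: intg_cst|exact: (pint_cub v Pu).2].
- by move=> x; rewrite normr_id le1cube.
Qed.
Lemma pint_sqr u v : p3 u -> pint (fun y => `|u y - v| ^+ 2).
Proof.
move=> Pu; have [pu mu_ iu] := Pu; split; first by move=> x i; rewrite pu.
apply: (@intg_le _ _ _ mu _ (fun x => 1 + `|u x - v| ^+ 3)).
- by apply: measurable_funX; apply: measurableT_comp => //; exact: measurable_funB.
- by apply: intgD; [exact: intg_cst|exact: (pint_cub v Pu).2].
- by move=> x; rewrite normrX normr_id sq_le1cube.
Qed.

Lemma E_cube f x : pint f -> pint (fun y => f y ^+ 3) -> (forall y, 0 <= f y) ->
  E f x ^+ 3 <= E (fun y => f y ^+ 3) x.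
Proof.
move=> Pf P3 f0; set S := E f x.
have S0 : 0 <= S by apply: EE_ge0.
have P1 : pint (fun y => 3 * S ^+ 2 * f y) by exact: pintZ.
have P2 : pint (fun=> S ^+ 3 - 3 * S ^+ 2 * S) by exact: pint_cst.
have -> : S ^+ 3 = E (fun y => (S ^+ 3 - 3 * S ^+ 2 * S) + 3 * S ^+ 2 * f y) x.
  rewrite (EE_add meta HN)// (EE_scale meta HN)// E_cst -/S; ring.
apply: (EE_le meta HN) => //; first exact: pintD.
move=> y; apply: le_trans (cube_tangent S0 (f0 y)).
by rewrite le_eqVlt; apply/orP; left; apply/eqP; ring.
Qed.

(** A - [wav] is the quotient of the averages of w (A - u) and of w, hence at most C / c times the
    average of |u - A|; Jensen's inequality for cubes finishes. *)
Lemma wav_cube (w u : X -> R) c C A x : perT w -> measurable_fun setT w -> 0 < c ->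
  (forall x, c <= w x <= C) -> p3 u ->
  `|A - wav w u x| ^+ 3 <= (C / c) ^+ 3 * E (fun y => `|u y - A| ^+ 3) x.
Proof.
move=> pw mw c0 wc Pu; have [pu mu_ iu] := Pu.
have Pr := pint_rho pw mw c0 wc.
have Pa := pint_a pw mw c0 wc Pu.
have r0 := r_gt0 pw mw c0 wc x.
have rc : c <= E w x by have /andP[] := r_itv pw mw c0 wc x.
have C0 : 0 <= C.
  by have /andP[h1 h2] := wc [tuple 0 | i < d]; apply: le_trans (le_trans h1 h2); exact: ltW.
set S := E (fun y => `|u y - A|) x.
have Pd := pint_dif A Pu.
have S0 : 0 <= S by apply: EE_ge0.
have H : `|A - wav w u x| <= C / c * S.
  have -> : A - wav w u x = E (fun y => A * w y + (-1) * (w y * u y)) x / E w x.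
    rewrite (EE_add meta HN) ?(EE_scale meta HN)//; [|exact: pintZ..].
    by rewrite /wav; field; rewrite gt_eqF.
  rewrite normrM normfV (gtr0_norm r0) ler_pdivrMr//.
  apply: (@le_trans _ _ (C * S)); last first.
    rewrite (_ : C * S = C / c * S * c); last by field; rewrite gt_eqF.
    by apply: ler_wpM2l => //; rewrite mulr_ge0// divr_ge0// ltW.
  have Pq : pint (fun y => A * w y + (-1) * (w y * u y)) by apply: pintD; exact: pintZ.
  apply: (le_trans (EE_norm meta HN x Pq)).
  rewrite -(EE_scale meta HN)//.
  have -> : (fun y => `|eta y|) = eta by apply/funext => y; rewrite ger0_norm.
  apply: (EE_le meta HN) => //; [exact: pint_abs|exact: pintZ|].
  move=> y; rewrite (_ : A * w y + _ = w y * (A - u y)); last by ring.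
  rewrite normrM distrC; apply: ler_wpM2r => //.
  have /andP[h1 h2] := wc y; rewrite ger0_norm//; exact: le_trans (ltW c0) h1.
have CS0 : 0 <= C / c * S by rewrite mulr_ge0// divr_ge0// ltW.
apply: (@le_trans _ _ ((C / c * S) ^+ 3)); first by apply: lerXn2r; rewrite ?nnegrE.
rewrite exprMn; apply: ler_wpM2l; first by rewrite exprn_ge0// divr_ge0// ltW.
by apply: E_cube => //; exact: pint_cub.
Qed.

Lemma measurable_pair1 (x : X) : measurable_fun setT (fun al : X => (x, al)).
Proof. by apply: measurable_fun_pair; [exact: measurable_cst|exact: measurable_id]. Qed.

Lemma meas_inner (u : X -> R) : measurable_fun setT u ->
  measurable_fun setT (fun p : X * X => \int[mu]_be (eta be * `|u (tadd p.1 p.2) - u (tadd p.1 be)| ^+ 3)).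
Proof.
move=> mu_.
apply: (@measurable_Rparam _ _ (X * X)%type X R mu
  (fun p => eta p.2 * `|u (tadd p.1.1 p.1.2) - u (tadd p.1.1 p.2)| ^+ 3)).
have m11 : measurable_fun setT (fun p : X * X * X => p.1.1).
  exact: (measurableT_comp measurable_fst).
have m12 : measurable_fun setT (fun p : X * X * X => p.1.2).
  exact: (measurableT_comp measurable_snd).
apply: measurable_funM; first exact: (measurableT_comp meta).
apply: measurable_funX; apply: measurableT_comp => //; apply: measurable_funB.
  by apply: (measurableT_comp mu_); exact: measurable_tadd.
by apply: (measurableT_comp mu_); exact: measurable_tadd.
Qed.

Lemma YY_meas (u : X -> R) : measurable_fun setT u -> measurable_fun setT (YY u).
Proof.
move=> mu_; apply: (@measurable_Rparam _ _ X X R mu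
  (fun p => kap p.2 * \int[mu]_be (eta be * `|u (tadd p.1 p.2) - u (tadd p.1 be)| ^+ 3))).
by apply: measurable_funM; [exact: (measurableT_comp mkap)|exact: meas_inner].
Qed.

Lemma inner_E (u : X -> R) x al :
  \int[mu]_be (eta be * `|u (tadd x al) - u (tadd x be)| ^+ 3) =
  E (fun y => `|u y - u (tadd x al)| ^+ 3) x.
Proof. by apply: eq_Rintegral => y _; rewrite distrC. Qed.

Lemma inner_intg u x : p3 u ->
  intg mu (fun al => kap al * \int[mu]_be (eta be * `|u (tadd x al) - u (tadd x be)| ^+ 3)).
Proof.
move=> Pu; have [pu mu_ iu] := Pu.
apply: (@intgMb _ _ _ mu _ kap (N + L * N)) => //.
apply: (@intg_le _ _ _ mu _ (fun al => 4 * (E (fun y => `|u y| ^+ 3) x + `|u (tadd x al)| ^+ 3))).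
- exact: (measurableT_comp (meas_inner mu_) (measurable_pair1 x)).
- apply: intgZ; apply: intgD; first exact: intg_cst.
  by apply: (@intg_shiftl _ _ (fun y => `|u y| ^+ 3)) => // y i; rewrite pu.
move=> al; rewrite inner_E ger0_norm; last by apply: EE_ge0 => // y; rewrite exprn_ge0.
have P3 : pint (fun y => `|u y| ^+ 3) by split => // y i; rewrite pu.
rewrite -[X in 4 * (_ + X)](E_cst _ x) -(EE_add meta HN)//; last exact: pint_cst.
rewrite -(EE_scale meta HN); last by apply: pintD => //; exact: pint_cst.
apply: (EE_le meta HN) => //.
- exact: pint_cub.
- by apply: pintZ; apply: pintD => //; exact: pint_cst.
- by move=> y; exact: cubeB_le.
Qed.

Lemma YY_ge0 u x : 0 <= YY u x.
Proof.
apply: Rint_ge0 => al; rewrite mulr_ge0//; apply: Rint_ge0 => be.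
by rewrite mulr_ge0// exprn_ge0.
Qed.

(** The value subtracted inside the cube is itself an average of u, so [wav_cube] with A = u(x + al)
    replaces it by a second integration variable. *)
Lemma cubk_YY (w u : X -> R) c C x : perT w -> measurable_fun setT w -> 0 < c ->
  (forall x, c <= w x <= C) -> p3 u ->
  cubk kap u (wav w u x) x <= (C / c) ^+ 3 * YY u x.
Proof.
move=> pw mw c0 wc Pu; have [pu mu_ iu] := Pu.
rewrite /cubk /EE /YY -RintZ; last exact: inner_intg.
apply: Rint_le.
- exact: (pint_intg mkap kapN x (pint_cub (wav w u x) Pu)).
- by apply: intgZ; exact: inner_intg.
move=> al; rewrite [leRHS]mulrCA; apply: ler_wpM2l => //.
by rewrite inner_E; exact: (wav_cube (u (tadd x al)) x pw mw c0 wc Pu).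
Qed.

(** Young's inequality is applied to values at two independent points, averaged first in the point
    of u1 against eta and then in the point of u2 against |eta_j|. *)
Lemma mixed_le (u1 u2 : X -> R) v1 v2 p x : p3 u1 -> p3 u2 -> 0 < p ->
  EE ae (fun y => `|u2 y - v2|) x * E (fun y => `|u1 y - v1| ^+ 2) x <=
  p ^+ 6 * cubk kap u2 v2 x + (p ^+ 3)^-1 * cubk kap u1 v1 x.
Proof.
move=> P1 P2 p0; set B := E (fun y => `|u1 y - v1| ^+ 2) x.
set w1 := E (fun y => `|u1 y - v1| ^+ 3) x.
have pV0 : 0 <= (p ^+ 3)^-1 by rewrite invr_ge0 exprn_ge0// ltW.
have p60 : 0 <= p ^+ 6 by rewrite exprn_ge0// ltW.
have w10 : 0 <= w1 by apply: EE_ge0 => // y; rewrite exprn_ge0.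
have step s : 0 <= s -> s * B <= p ^+ 6 * s ^+ 3 + (p ^+ 3)^-1 * w1.
  move=> s0; rewrite /B -(EE_scale meta HN); last exact: pint_sqr.
  have -> : p ^+ 6 * s ^+ 3 + (p ^+ 3)^-1 * w1 =
      E (fun y => p ^+ 6 * s ^+ 3 + (p ^+ 3)^-1 * `|u1 y - v1| ^+ 3) x.
    have q1 := pint_cst (p ^+ 6 * s ^+ 3).
    have q2 := pintZ (p ^+ 3)^-1 (pint_cub v1 P1).
    by rewrite (EE_add meta HN x q1 q2) (EE_scale meta HN _ x (pint_cub v1 P1)) E_cst.
  apply: (EE_le meta HN) => //.
  - by apply: pintZ; exact: pint_sqr.
  - by apply: pintD; [exact: pint_cst|apply: pintZ; exact: pint_cub].
  - by move=> y; exact: young_p.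
rewrite mulrC -(EE_scale mae aeN); last exact: pint_dif.
apply: (@le_trans _ _ (EE ae (fun y => p ^+ 6 * `|u2 y - v2| ^+ 3 + (p ^+ 3)^-1 * w1) x)).
  apply: (EE_le mae aeN) => //.
  - by apply: pintZ; exact: pint_dif.
  - by apply: pintD; [apply: pintZ; exact: pint_cub|exact: pint_cst].
  - by move=> y; rewrite mulrC; exact: step.
have q1 := pint_cst ((p ^+ 3)^-1 * w1).
have q2 := pintZ (p ^+ 6) (pint_cub v2 P2).
rewrite (EE_add mae aeN x q2 q1) (EE_scale mae aeN _ x (pint_cub v2 P2)).
apply: lerD.
  apply: ler_wpM2l => //.
  by apply: (EE_lek x mae mkap aeN kapN ae_kap (pint_cub v2 P2)) => y; rewrite exprn_ge0.
have -> : EE ae (fun=> (p ^+ 3)^-1 * w1) x = (\int[mu]_x ae x) * ((p ^+ 3)^-1 * w1).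
  by rewrite /EE RintZr//; exact: intg_abs (intg_etaj j).
rewrite mulrCA; apply: ler_wpM2l => //.
(* The second average leaves the mass of |eta_j| in front of the moment of u1; bounding it by L and
   using L eta <= [kap] brings both terms under the same kernel. *)
apply: (@le_trans _ _ (L * w1)); first by apply: ler_wpM2r => //; exact: etaL.
have -> : L * w1 = EE (fun y => L * eta y) (fun y => `|u1 y - v1| ^+ 3) x.
  rewrite /w1 /EE -RintZ; last exact: (pint_intg meta HN x (pint_cub v1 P1)).
  by apply: eq_Rintegral => y _; rewrite mulrA.
have mLe : measurable_fun setT (fun y => L * eta y) by exact: measurable_funM.
have LeN y : `|L * eta y| <= L * N by rewrite normrM (ger0_norm L0) ler_wpM2l.
by apply: (EE_lek x mLe mkap LeN kapN eta_kap (pint_cub v1 P1)) => y; rewrite exprn_ge0.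
Qed.

Section Estimates.
Variables (rho : X -> R) (c C : R).
Hypotheses (prho : perT rho) (mrho : measurable_fun setT rho) (c0 : 0 < c)
  (rhoc : forall x, c <= rho x <= C).
Variables (a b : X -> R).
Hypotheses (Ha : p3 a) (Hb : p3 b).
Notation r := (E rho).
Notation va := (wav rho a).
Notation vb := (wav rho b).
Let r0 x : 0 < r x. Proof. exact: (r_gt0 prho mrho c0 rhoc). Qed.
Let rc x : c <= r x. Proof. by have /andP[] := r_itv prho mrho c0 rhoc x. Qed.
Let Pr := pint_rho prho mrho c0 rhoc.
Let Pa := pint_a prho mrho c0 rhoc Ha.
Let Pb := pint_a prho mrho c0 rhoc Hb.
Let Pab := pint_ab prho mrho c0 rhoc Ha Hb.
Let Paa := pint_aa prho mrho c0 rhoc Ha.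
Let Pbaa := pint_baa prho mrho c0 rhoc Ha Hb.
Let rhoC x : `|rho x| <= C.
Proof.
have /andP[h1 h2] := rhoc x; rewrite ger0_norm//; exact: le_trans (ltW c0) h1.
Qed.
Let C0 : 0 <= C. Proof. exact: le_trans (rhoC [tuple 0 | i < d]). Qed.

Lemma Tri_E x : Tri rho a b j x =
  D j (fun y => rho y * ((b y - vb x) * (a y - va x) ^+ 2)) x.
Proof.
have -> : (fun y => rho y * ((b y - vb x) * (a y - va x) ^+ 2)) =
  (fun y => rho y * (b y * a y ^+ 2) + ((- (2 * va x)) * (rho y * (a y * b y)) +
    (va x ^+ 2 * (rho y * b y) + ((- vb x) * (rho y * a y ^+ 2) +
     ((2 * va x * vb x) * (rho y * a y) + (- (vb x * va x ^+ 2)) * rho y))))).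
  by apply/funext => y; ring.
have Q (v : R) f : pint f -> pint (fun y => v * f y) := @pintZ v f.
have q1 := Q (- (2 * va x)) _ Pab. have q2 := Q (va x ^+ 2) _ Pb.
have q3 := Q (- vb x) _ Paa. have q4 := Q (2 * va x * vb x) _ Pa.
have q5 := Q (- (vb x * va x ^+ 2)) _ Pr.
have s4 := pintD q4 q5. have s3 := pintD q3 s4. have s2 := pintD q2 s3. have s1 := pintD q1 s2.
have A := @EE_add (etaj j) N (metaj j) (HNj j).
have Sc := @EE_scale (etaj j) N (metaj j) (HNj j).
rewrite (A _ _ _ Pbaa s1) (A _ _ _ q1 s2) (A _ _ _ q2 s3) (A _ _ _ q3 s4) (A _ _ _ q4 q5).
rewrite (Sc _ _ _ Pab) (Sc _ _ _ Pb) (Sc _ _ _ Paa) (Sc _ _ _ Pa) (Sc _ _ _ Pr).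
by rewrite /Tri; ring.
Qed.

Lemma Tri_le x : `|Tri rho a b j x| <= C * (cubk kap a (va x) x + cubk kap b (vb x) x).
Proof.
have Pf : pint (fun y => rho y * ((b y - vb x) * (a y - va x) ^+ 2)).
  have [pa ma _] := Ha; have [pb mb _] := Hb.
  split; first by move=> y i; rewrite prho pa pb.
  apply: (@intg_le _ _ _ mu _ (fun y => C * (`|b y - vb x| ^+ 3 + `|a y - va x| ^+ 3))).
  - apply: measurable_funM => //; apply: measurable_funM; first exact: measurable_funB.
    by apply: measurable_funX; exact: measurable_funB.
  - by apply: intgZ; apply: intgD; [exact: (pint_cub _ Hb).2|exact: (pint_cub _ Ha).2].
  - by move=> y; rewrite normrM [X in _ * X]normrM normrX; apply: ler_pM => //; exact: mulsq_le.
rewrite Tri_E; apply: (le_trans (EE_norm (metaj j) (HNj j) x Pf)).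
have Ps : pint (fun y => `|a y - va x| ^+ 3 + `|b y - vb x| ^+ 3).
  by apply: pintD; exact: pint_cub.
apply: (@le_trans _ _ (EE ae (fun y => C * (`|a y - va x| ^+ 3 + `|b y - vb x| ^+ 3)) x)).
  apply: (EE_le mae aeN) => //; [exact: pint_abs|exact: pintZ|].
  move=> y; rewrite normrM [X in _ * X]normrM normrX; apply: ler_pM => //.
  by rewrite [leRHS]addrC; exact: mulsq_le.
rewrite (EE_scale mae aeN)// (EE_add mae aeN)//; [|exact: pint_cub..].
apply: ler_wpM2l => //; apply: lerD.
  by apply: (EE_lek x mae mkap aeN kapN ae_kap (pint_cub (va x) Ha)) => y; rewrite exprn_ge0.
by apply: (EE_lek x mae mkap aeN kapN ae_kap (pint_cub (vb x) Hb)) => y; rewrite exprn_ge0.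
Qed.

(** With vb frozen at x, the numerator of the derivative is the derivative-kernel average of rho (b
    - vb). *)
Lemma dv_le x : `|dv rho j b x| <= C / c * EE ae (fun y => `|b y - vb x|) x.
Proof.
have Pf : pint (fun y => rho y * b y + (- vb x) * rho y) by apply: pintD => //; exact: pintZ.
have -> : dv rho j b x = - D j (fun y => rho y * b y + (- vb x) * rho y) x / r x.
  rewrite (EE_add (metaj j) (HNj j)) ?(EE_scale (metaj j) (HNj j))//; last exact: pintZ.
  by rewrite /dv; ring.
rewrite normrM normrN normfV (gtr0_norm (r0 x)) ler_pdivrMr//.
apply: (le_trans (EE_norm (metaj j) (HNj j) x Pf)).
have Pd := pint_dif (vb x) Hb.
apply: (@le_trans _ _ (EE ae (fun y => C * `|b y - vb x|) x)).
  apply: (EE_le mae aeN) => //; [exact: pint_abs|exact: pintZ|].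
  move=> y; rewrite (_ : _ + _ = rho y * (b y - vb x)); last by ring.
  by rewrite normrM ler_wpM2r.
rewrite (EE_scale mae aeN)//.
have A0 : 0 <= EE ae (fun y => `|b y - vb x|) x by apply: EE_ge0.
rewrite [leLHS](_ : _ = (C / c * EE ae (fun y => `|b y - vb x|) x) * c); last first.
  by field; rewrite gt_eqF.
by apply: ler_wpM2l => //; rewrite mulr_ge0// divr_ge0// ltW.
Qed.

Lemma Var_le x : 0 <= Var rho a x <= C * E (fun y => `|a y - va x| ^+ 2) x.
Proof.
have q1 := pintZ (- (2 * va x)) Pa. have q2 := pintZ (va x ^+ 2) Pr.
have q3 := pintD q1 q2. have q4 := pintD Paa q3.
have VE : Var rho a x = E (fun y => rho y * a y ^+ 2 + ((- (2 * va x)) * (rho y * a y) + va x ^+ 2 * rho y)) x.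
  rewrite (EE_add meta HN x Paa q3) (EE_add meta HN x q1 q2).
  rewrite (EE_scale meta HN)// (EE_scale meta HN)// /Var.
  rewrite (_ : E (fun y => rho y * a y) x = va x * r x); first by ring.
  by rewrite /wav mulfVK// gt_eqF.
have FE y : rho y * a y ^+ 2 + ((- (2 * va x)) * (rho y * a y) + va x ^+ 2 * rho y) = rho y * `|a y - va x| ^+ 2.
  by rewrite real_normK ?num_real//; ring.
have rp y : 0 <= rho y by have /andP[h1 _] := rhoc y; exact: le_trans (ltW c0) h1.
rewrite VE; apply/andP; split.
  by apply: EE_ge0 => // y; rewrite FE mulr_ge0// exprn_ge0.
rewrite -(EE_scale meta HN); last exact: pint_sqr.
apply: (EE_le meta HN) => //; first by apply: pintZ; exact: pint_sqr.
move=> y; rewrite FE; apply: ler_wpM2r; first by rewrite exprn_ge0.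
by have /andP[] := rhoc y.
Qed.

Definition Kc : R := (C + C / c * C) * (C / c) ^+ 3.

Lemma comm_le x : `|Tri rho a b j x + dv rho j b x * Var rho a x| <= Kc * (YY a x + YY b x).
Proof.
have /andP[V0 V1] := Var_le x.
have Cc0 : 0 <= C / c by rewrite divr_ge0// ltW.
set S := cubk kap a (va x) x + cubk kap b (vb x) x.
have H1 := Tri_le x.
have A0 : 0 <= EE ae (fun y => `|b y - vb x|) x by apply: EE_ge0.
have B0 : 0 <= E (fun y => `|a y - va x| ^+ 2) x by apply: EE_ge0 => // y; rewrite exprn_ge0.
have H2 : `|dv rho j b x * Var rho a x| <= C / c * C * S.
  rewrite normrM (ger0_norm V0).
  apply: (@le_trans _ _ ((C / c * EE ae (fun y => `|b y - vb x|) x) * (C * E (fun y => `|a y - va x| ^+ 2) x))).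
    by apply: ler_pM => //; exact: dv_le.
  rewrite mulrACA; apply: ler_wpM2l; first by rewrite mulr_ge0.
  (* Both factors are velocity increments here, so no weight has to be small and p = 1 is taken. *)
  have := @mixed_le a b (va x) (vb x) 1 x Ha Hb ltr01.
  by rewrite !expr1n invr1 !mul1r /S [X in _ -> _ <= X]addrC => H; exact: H.
have SY : S <= (C / c) ^+ 3 * (YY a x + YY b x).
  by rewrite mulrDr; apply: lerD; exact: (cubk_YY x prho mrho c0 rhoc).
apply: (le_trans (ler_normD _ _)); apply: (le_trans (lerD H1 H2)).
by rewrite -mulrDl /Kc -[leRHS]mulrA; apply: ler_wpM2l => //; rewrite addr_ge0// mulr_ge0.
Qed.

(** Kept in the extended reals so that the estimates can be integrated in time before finiteness is
    known. *)
Definition YI (u : X -> R) : \bar R := (\int[mu]_x (YY u x)%:E)%E.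

Lemma YI_bound (f g h : X -> R) : bm f -> p3 g -> p3 h -> forall k1 k2, 0 <= k1 -> 0 <= k2 ->
  (forall x, `|f x| <= k1 * YY g x + k2 * YY h x) ->
  ((`|\int[mu]_x f x|)%:E <= k1%:E * YI g + k2%:E * YI h)%E.
Proof.
move=> bf [_ mg _] [_ mh _] k1 k2 k10 k20 H.
have iF := bm_intg mu bf.
have mY (u : X -> R) : measurable_fun setT u -> measurable_fun setT (fun x => (YY u x)%:E).
  by move=> mu_; apply/measurable_EFinP; exact: YY_meas.
apply: (@le_trans _ _ (\int[mu]_x `|f x|)%:E); first by rewrite lee_fin Rint_abs.
rewrite EFin_Rint; last exact: intg_abs.
rewrite /YI -!ge0_integralZl_EFin//; last 4 first.
- by move=> x _; rewrite lee_fin YY_ge0.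
- exact: mY.
- by move=> x _; rewrite lee_fin YY_ge0.
- exact: mY.
rewrite -ge0_integralD//; last 4 first.
- by move=> x _; rewrite mule_ge0// lee_fin YY_ge0.
- by apply: measurable_funeM; exact: mY.
- by move=> x _; rewrite mule_ge0// lee_fin YY_ge0.
- by apply: measurable_funeM; exact: mY.
apply: ge0_le_integral => //.
- by apply/measurable_EFinP; apply: measurableT_comp => //; exact: bf.1.
- by apply: emeasurable_funD; apply: measurable_funeM; exact: mY.
- by move=> x _; rewrite -!EFinM -EFinD lee_fin; exact: H.
Qed.

Lemma Kin_bound : ((`|\int[mu]_x Kin rho a b j x|)%:E <= Kc%:E * YI a + Kc%:E * YI b)%E.
Proof.
have Cc0 : 0 <= C / c by rewrite divr_ge0// ltW.
have K0 : 0 <= Kc.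
  by rewrite /Kc mulr_ge0 ?exprn_ge0// addr_ge0// mulr_ge0.
have bTV : bm (fun x => Tri rho a b j x + dv rho j b x * Var rho a x).
  apply: bmD; first exact: (bm_Tri prho mrho c0 rhoc).
  by apply: bmM; [exact: (bm_dv prho mrho c0 rhoc)|exact: (bm_Var prho mrho c0 rhoc)].
have H := @YI_bound _ a b bTV Ha Hb Kc Kc K0 K0 (fun x => le_trans (comm_le x) _).
apply: le_trans (H _); last by move=> x; rewrite mulrDr.
have TE : \int[mu]_x (Tri rho a b j x + dv rho j b x * Var rho a x) = - (2 * \int[mu]_x Kin rho a b j x).
  by rewrite (int_Kin prho mrho c0 rhoc j Ha Hb) opprK.
by rewrite TE normrN lee_fin normrM normr_nat ler_peMl// ler1n.
Qed.

Section Pressure.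
Variables (gamma Kg : R).
Hypotheses (gamma1 : 1 < gamma)
  (HKg : forall s t, c <= s <= C -> c <= t <= C ->
     `|s `^ gamma - t `^ gamma - gamma * t `^ (gamma - 1) * (s - t)| <= Kg * (s - t) ^+ 2).
Let p y := rho y `^ gamma.

Let powR_bm (f : X -> R) g : bm f -> (forall x, c <= f x <= C) -> 0 <= g -> bm (fun x => f x `^ g).
Proof.
move=> [mf _] fc g0; split; first exact: (measurableT_comp (measurable_powR g) mf).
exists (C `^ g) => x; rewrite ger0_norm ?powR_ge0//.
have /andP[h1 h2] := fc x.
by apply: ge0_ler_powR => //; rewrite nnegrE//; exact: le_trans (ltW c0) h1.
Qed.
Let r_in x : c <= r x <= C. Proof. exact: (r_itv prho mrho c0 rhoc). Qed.
Let g10 : 0 <= gamma - 1. Proof. by rewrite subr_ge0 ltW. Qed.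
Let gm0 : 0 <= gamma. Proof. by apply: ltW; exact: lt_trans ltr01 gamma1. Qed.

Lemma pint_p : pint p.
Proof.
split; first by move=> x i; rewrite /p prho.
by apply: bm_intg; apply: powR_bm => //; split => //; exists C.
Qed.

(** The contribution of the pressure to the rate of change of the energy: the work of the mollified
    pressure gradient, and the derivative of r^gamma / (gamma - 1) along the mass equation. *)
Definition Prs x : R := vb x * D j p x
  + gamma / (gamma - 1) * r x `^ (gamma - 1) * D j (fun y => rho y * b y) x.

Let bmr : bm r. Proof. exact: (bm_r prho mrho c0 rhoc). Qed.
Let bmvb : bm vb. Proof. exact: (bm_va prho mrho c0 rhoc). Qed.

Lemma bm_Prs : bm Prs.
Proof.
apply: bmD; first by apply: bmM => //; apply: bmDj; exact: pint_p.
apply: bmM; last exact: bmDj.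
by apply: bmM; [exact: bm_cst|exact: powR_bm].
Qed.

(** The difference of the two integrands is the derivative of the pressure flux [G]. What remains is
    the Jensen defect of s^gamma under the average, which is quadratic in density increments. *)
Lemma int_Prs : \int[mu]_x Prs x = \int[mu]_x (dv rho j b x * (E p x - r x `^ gamma)).
Proof.
have g1n : gamma - 1 != 0 by rewrite subr_eq0 gt_eqF.
pose G x := vb x * E p x + (gamma - 1)^-1 * (r x `^ gamma * vb x).
pose G' x := dv rho j b x * (E p x - r x `^ gamma) - Prs x.
have bdv : bm (dv rho j b) by exact: (bm_dv prho mrho c0 rhoc).
have brg : bm (fun x => r x `^ gamma) by exact: powR_bm.
have bEp : bm (E p) by apply: bmE; exact: pint_p.
have b1 : bm (fun x => dv rho j b x * (E p x - r x `^ gamma)).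
  by apply: bmM => //; apply: bmD => //; exact: bmN.
suff : \int[mu]_x G' x = 0.
  rewrite /G' RintB; [|exact: bm_intg|by apply: bm_intg; exact: bm_Prs].
  by move/eqP; rewrite subr_eq0 => /eqP ->.
apply: (@int_pd_bm j G G') => //.
- move=> x i; rewrite /G.
  by rewrite !(per_wav prho mrho c0 rhoc Pb) !(perE pint_p) !(perE Pr).
- apply: bmD; first exact: bmM.
  by apply: bmM; [exact: bm_cst|exact: bmM].
- have Pw : pd j (fun x => r x `^ gamma) (fun x => (gamma * r x `^ (gamma - 1)) * (- D j rho x)).
    apply: (pd_comp (f := fun s => s `^ gamma) (pdE j Pr)) => x.
    have rin : r x \in `]0, +oo[ by rewrite in_itv/= r0.
    apply: DeriveDef; first exact: derivable_powR.
    by rewrite -derive1E powR_derive1.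
  have Pwv := pd_wav prho mrho c0 rhoc j Pb.
  have Pc : pd j (fun=> (gamma - 1)^-1) (fun=> 0) by move=> x; exact: is_derive_cst.
  apply: pd_ext (pd_add (pd_mul Pwv (pdE j pint_p)) (pd_mul Pc (pd_mul Pw Pwv))) _ => x.
  rewrite /G' /Prs.
  have -> : r x `^ gamma = r x * r x `^ (gamma - 1).
    by rewrite mulr_powRB1 ?ltW//; exact: lt_trans ltr01 gamma1.
  rewrite /dv; have rn : r x != 0 by rewrite gt_eqF.
  by field; rewrite rn g1n.
- by apply: bmD => //; apply: bmN; exact: bm_Prs.
Qed.

Lemma p3_rho : p3 rho.
Proof.
split => //; apply: bm_intg; apply: bmX; split; first exact: measurableT_comp.
by exists C => x; rewrite normr_id.
Qed.

(** Subtract the tangent of s^gamma at the mean r x: its linear part averages to 0, and the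
    remainder is quadratic by [HKg]. *)
Lemma Ep_le x : 0 <= Kg -> `|E p x - r x `^ gamma| <= Kg * E (fun y => `|rho y - r x| ^+ 2) x.
Proof.
move=> Kg0.
have q1 := pintZ (- (gamma * r x `^ (gamma - 1))) Pr.
have q2 := pint_cst (gamma * r x `^ (gamma - 1) * r x - r x `^ gamma).
have q3 := pintD q1 q2. have q4 := pintD pint_p q3.
have -> : E p x - r x `^ gamma = E (fun y => p y + (- (gamma * r x `^ (gamma - 1)) * rho y
   + (gamma * r x `^ (gamma - 1) * r x - r x `^ gamma))) x.
  rewrite (EE_add meta HN x pint_p q3) (EE_add meta HN x q1 q2) (EE_scale meta HN)// E_cst.
  by ring.
apply: (le_trans (EE_norm meta HN x q4)).
have -> : (fun y => `|eta y|) = eta by apply/funext => y; rewrite ger0_norm.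
have Ps := pint_sqr (r x) p3_rho.
rewrite -(EE_scale meta HN Kg x Ps); apply: (EE_le meta HN) => //.
- exact: pint_abs.
- exact: pintZ.
move=> y; rewrite real_normK ?num_real//; apply: le_trans (HKg (rhoc y) (r_in x)).
by rewrite le_eqVlt; apply/orP; left; apply/eqP; congr `|_|; rewrite /p; ring.
Qed.

Lemma Prs_bound (q : R) : 0 <= Kg -> 0 < q ->
  ((`|\int[mu]_x Prs x|)%:E <= (C / c * Kg * q ^+ 6 * (C / c) ^+ 3)%:E * YI b
     + (C / c * Kg * (q ^+ 3)^-1)%:E * YI rho)%E.
Proof.
move=> Kg0 q0.
have Cc0 : 0 <= C / c by rewrite divr_ge0// ltW.
have q60 : 0 <= q ^+ 6 by rewrite exprn_ge0// ltW.
have q30 : 0 <= (q ^+ 3)^-1 by rewrite invr_ge0 exprn_ge0// ltW.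
have CK0 : 0 <= C / c * Kg by exact: mulr_ge0.
have CK6 : 0 <= C / c * Kg * q ^+ 6 by exact: mulr_ge0.
have CK3 : 0 <= C / c * Kg * (q ^+ 3)^-1 by exact: mulr_ge0.
rewrite int_Prs; apply: YI_bound => //.
- apply: bmM; first exact: (bm_dv prho mrho c0 rhoc).
  by apply: bmD; [apply: bmE; exact: pint_p|apply: bmN; exact: powR_bm].
- exact: p3_rho.
- by apply: mulr_ge0 => //; exact: exprn_ge0.
move=> x; rewrite normrM.
have A0 : 0 <= EE ae (fun y => `|b y - vb x|) x by apply: EE_ge0.
apply: (@le_trans _ _ ((C / c * EE ae (fun y => `|b y - vb x|) x) * (Kg * E (fun y => `|rho y - r x| ^+ 2) x))).
  by apply: ler_pM => //; [exact: dv_le|exact: Ep_le].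
have M := @mixed_le rho b (r x) (vb x) q x p3_rho Hb q0.
rewrite mulrACA; apply: (@le_trans _ _ (C / c * Kg * (q ^+ 6 * cubk kap b (vb x) x + (q ^+ 3)^-1 * cubk kap rho (r x) x))).
  exact: ler_wpM2l.
have Y1 := cubk_YY x prho mrho c0 rhoc Hb.
(* The plain average of rho is its Favre average for the constant weight 1, so [cubk_YY] applies
   with both bounds equal to 1. *)
have Y2 : cubk kap rho (r x) x <= YY rho x.
  have one (z : X) : (1 : R) <= (1 : R) <= (1 : R) by apply/andP; split; exact: lexx.
  have := @cubk_YY (fun=> 1) rho 1 1 x (fun _ _ => erefl) (measurable_cst _) ltr01 one p3_rho.
  have -> : wav (fun=> 1) rho x = r x.
    rewrite /wav E_cst divr1; congr EE.
    by apply/funext => y; rewrite mul1r.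
  by rewrite divr1 expr1n mul1r.
rewrite mulrDr; apply: lerD.
  by rewrite [leLHS]mulrA -[leRHS]mulrA; apply: (ler_wpM2l CK6); exact: Y1.
by rewrite [leLHS]mulrA; apply: (ler_wpM2l CK3); exact: Y2.
Qed.

End Pressure.
End Estimates.
End Cubes.

End Static.

(** * The one-sided periodic mollifier *)

Section Kernel.
Variables (R : realType) (d : nat).
Notation X := (d.-tuple R).
Notation RM := (measurableTypeR R).
Notation mu := (muT R d).

Lemma meas_prodk (h : 'I_d -> R -> R) : (forall i, measurable_fun setT (h i : RM -> R)) ->
  measurable_fun setT (prodk h).
Proof.
move=> mh.
have : forall s : seq 'I_d, measurable_fun setT (fun x : X => \prod_(i <- s) h i (tnth x i)).
  elim=> [|i s IHs]; first by under eq_fun do rewrite big_nil; exact: measurable_cst.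
  under eq_fun do rewrite big_cons; apply: measurable_funM => //.
  by apply: (measurableT_comp (mh i)); exact: measurable_tnth.
exact.
Qed.

Lemma per_prodk (h : 'I_d -> R -> R) : (forall i s, h i (s + 1) = h i s) -> perT (prodk h).
Proof.
move=> ph x j; apply: eq_bigr => i _; rewrite !tnth_mktuple.
by case: eqP => _; rewrite ?ph ?addr0.
Qed.

Lemma bound_prodk (h : 'I_d -> R -> R) M : (forall i s, `|h i s| <= M) ->
  forall x, `|prodk h x| <= M ^+ d.
Proof.
move=> hM x; rewrite normr_prod -[d in M ^+ d]card_ord -prodr_const.
by apply: ler_prod => i _; rewrite normr_ge0 hM.
Qed.

Lemma ge0_int_prodk (h : 'I_d -> R -> R) : (forall i, measurable_fun setT (h i : RM -> R)) ->
  (forall i s, 0 <= h i s) ->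
  (\int[mu]_x (prodk h x)%:E = \prod_(i < d) \int[@lam1 R]_s (h i s)%:E)%E.
Proof.
move=> mh h0; rewrite -(@muT_prod R d (fun i s => (h i s)%:E)).
- by apply: eq_integral => x _; rewrite /prodk prodEFin.
- by move=> i; apply/measurable_EFinP.
- by move=> i s; rewrite lee_fin.
Qed.

Lemma prodk_pd (h h' : 'I_d -> R -> R) j :
  (forall i s, is_derive (s : R) 1 (h i) (h' i s)) -> pd j (prodk h) (prodk (hpick j h h')).
Proof.
move=> Hh x; have := prodk_line x j Hh 0.
rewrite (_ : (fun s => _) = (fun s => prodk h (tadd x (sline j s)))); last first.
  by apply/funext => s; apply: eq_bigr => i _; rewrite !tnth_mktuple.
by rewrite (_ : [tuple tnth x i + (i == j)%:R * 0 | i < d] = x)//;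
  apply: eq_from_tnth => i; rewrite !tnth_mktuple mulr0 addr0.
Qed.

Variable eps : R.
Hypothesis eps01 : 0 < eps < 1.
Definition etaK : X -> R := prodk (fun=> gk eps).
Definition hj (j : 'I_d) := hpick j (fun _ : 'I_d => gk eps) (fun=> gk' eps).
Definition etajK (j : 'I_d) : X -> R := prodk (hj j).

Lemma hjP j (P : (R -> R) -> Prop) : P (gk eps) -> P (gk' eps) -> forall i, P (hj j i).
Proof. by move=> P1 P2 i; rewrite /hj /hpick; case: ifP. Qed.

Lemma etaK_meas : measurable_fun setT etaK.
Proof. by apply: meas_prodk => i; exact: gk_measurable. Qed.
Lemma hj_meas j i : measurable_fun setT (hj j i : RM -> R).
Proof.
exact: (@hjP j (fun f => measurable_fun setT (f : RM -> R)) (gk_measurable eps01) (gk'_measurable eps01)).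
Qed.
Lemma etajK_meas j : measurable_fun setT (etajK j).
Proof. by apply: meas_prodk => i; exact: hj_meas. Qed.
Lemma etaK_per : perT etaK.
Proof. by apply: per_prodk => i s; exact: gk1. Qed.
Lemma etaK_ge0 x : 0 <= etaK x.
Proof. by apply: prodr_ge0 => i _; exact: gk_ge0. Qed.
Lemma etaK_pd j : pd j etaK (etajK j).
Proof. by apply: prodk_pd => i s; exact: is_derive_gk. Qed.

Lemma gk_bound : exists2 M, 0 <= M & forall s, `|gk eps s| <= M /\ `|gk' eps s| <= M.
Proof.
have [M1 M10 H1] := cpt_bounded (dstp_smooth R 0) (@dstp_out R).
have [M2 M20 H2] := cpt_bounded (ddstp_smooth R 0) (@ddstp_out R).
have e0 : 0 <= eps^-1 by rewrite invr_ge0; have /andP[/ltW] := eps01.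
exists (eps^-1 * M1 + eps^-1 * (eps^-1 * M2)); first by rewrite addr_ge0// !mulr_ge0.
move=> s; split.
  rewrite /gk normrM (ger0_norm e0) (le_trans (ler_wpM2l e0 (H1 _)))//.
  by rewrite lerDl !mulr_ge0.
rewrite /gk' !normrM (ger0_norm e0).
rewrite (le_trans (ler_wpM2l e0 (ler_wpM2l e0 (H2 _))))//.
by rewrite lerDr !mulr_ge0.
Qed.

Lemma etaK_bound : exists N, (forall x, `|etaK x| <= N) /\ (forall j x, `|etajK j x| <= N).
Proof.
have [M M0 HM] := gk_bound; exists (M ^+ d); split=> [|j]; apply: bound_prodk => i s.
  exact: (HM s).1.
by apply: (@hjP j (fun f => `|f s| <= M)); have [] := HM s.
Qed.

Lemma etaK_int1 : \int[mu]_x etaK x = 1.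
Proof.
rewrite /Rintegral ge0_int_prodk//.
- by rewrite big1// => i _; exact: int_gk.
- by move=> i; exact: gk_measurable.
- by move=> i s; exact: gk_ge0.
Qed.

(** By Tonelli the integral is a product of one-dimensional ones, of which only the j-th differs
    from 1. *)
Lemma etajK_int j M : 0 <= M -> (forall x, `|ddstp (x : R)| <= M) ->
  \int[mu]_x `|etajK j x| <= M / eps.
Proof.
move=> M0 HM.
have e0 : 0 < eps by have /andP[] := eps01.
have -> : \int[mu]_x `|etajK j x| = \int[mu]_x prodk (fun i s => `|hj j i s|) x.
  by apply: eq_Rintegral => x _; rewrite /etajK normr_prod.
have H : (\int[mu]_x (prodk (fun i s => `|hj j i s|) x)%:E <= (M / eps)%:E)%E.
  rewrite ge0_int_prodk//; last first.
    by move=> i; apply: measurableT_comp => //; exact: hj_meas.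
  rewrite (bigD1 j)//= big1; last first.
    move=> i /negPf ij; rewrite /hj /hpick ij -(int_gk eps01).
    by apply: eq_integral => s _; rewrite ger0_norm// gk_ge0.
  by rewrite mule1 /hj /hpick eqxx; exact: int_gk'.
rewrite /Rintegral -lee_fin fineK// ge0_fin_numE.
  exact: le_lt_trans H (ltry _).
by apply: integral_ge0 => x _; rewrite lee_fin prodr_ge0.
Qed.

Lemma prodk_supp (h : 'I_d -> R -> R) x :
  (forall i s, 0 <= s < 1 -> ~ (0 < s < eps) -> h i s = 0) -> cell x ->
  prodk h x != 0 -> forall i, 0 < tnth x i < eps.
Proof.
move=> hs cx px i; apply: contrapT => ni; move: px.
by rewrite /prodk (bigD1 i)//= (hs i)// ?mul0r ?eqxx//; exact: cx.
Qed.

Lemma etaK_supp x : cell x -> etaK x != 0 -> forall i, 0 < tnth x i < eps.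
Proof. by apply: prodk_supp => i s; exact: gk_supp. Qed.
Lemma etajK_supp j x : cell x -> etajK j x != 0 -> forall i, 0 < tnth x i < eps.
Proof.
apply: prodk_supp => i; apply: (@hjP j (fun f => forall s, 0 <= s < 1 -> ~ (0 < s < eps) -> f s = 0)).
  exact: gk_supp.
exact: gk'_supp.
Qed.
End Kernel.

(** * Mean-value bounds for powers on [c, C] *)

Section PowIneq.
Variable R : realType.
Variables (c C : R).
Hypotheses (c0 : 0 < c).

Lemma powR_mvt g s t : c <= s -> s < t ->
  exists2 x, s < x < t & t `^ g - s `^ g = g * x `^ (g - 1) * (t - s).
Proof.
move=> cs st.
have pos y : c <= y -> 0 < y by exact: lt_le_trans.
have D (y : R) : c <= y -> is_derive y 1 (fun z => z `^ g) (g * y `^ (g - 1)).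
  move=> cy; have yin : y \in `]0, +oo[ by rewrite in_itv/= pos.
  by apply: DeriveDef; [exact: derivable_powR|rewrite -derive1E powR_derive1].
have [||x] := @MVT R (fun z => z `^ g) (fun z => g * z `^ (g - 1)) s t st.
- by move=> x; rewrite in_itv/= => /andP[sx _]; apply: D; exact: le_trans cs (ltW sx).
- apply: derivable_within_continuous => x; rewrite in_itv/= => /andP[sx _].
  by have h := D x (le_trans cs sx); exact: ex_derive.
- by rewrite in_itv/= => h E; exists x.
Qed.

(** The power is monotone on [c, C], in a direction given by the sign of g; the sum of the two end
    values covers both cases. *)
Lemma powR_bnd g x : c <= x <= C -> x `^ g <= c `^ g + C `^ g.
Proof.
move=> /andP[cx xC].
have x0 : 0 < x by exact: lt_le_trans cx.
have C0 : 0 < C by exact: lt_le_trans xC.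
have [g0|g0] := leP 0 g.
  by apply: ler_wpDl; [exact: powR_ge0|apply: ge0_ler_powR => //; rewrite nnegrE ltW].
apply: ler_wpDr; first exact: powR_ge0.
rewrite -(opprK g) !(powRN _ (- g)) lef_pV2 ?posrE ?powR_gt0//.
by apply: ge0_ler_powR => //; rewrite ?nnegrE ?ltW// oppr_gt0.
Qed.

(** The lower bound is convexity and serves Jensen's inequality for the internal energy; the upper
    one is a Taylor remainder and serves the pressure commutator and the chain rule. Both come from
    the mean value theorem used twice, first for s^g and then for its derivative. *)
Lemma powR_tangent g s t : 1 < g -> c <= s <= C -> c <= t <= C ->
  0 <= s `^ g - t `^ g - g * t `^ (g - 1) * (s - t) <=
    g * (g - 1) * (c `^ (g - 2) + C `^ (g - 2)) * (s - t) ^+ 2.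
Proof.
move=> g1 sI tI.
have [/andP[cs sC] /andP[ct tC]] := (sI, tI).
have g0 : 0 < g by exact: lt_trans g1.
have g10 : 0 < g - 1 by rewrite subr_gt0.
set K := c `^ (g - 2) + C `^ (g - 2).
have K0 : 0 <= K by rewrite addr_ge0// powR_ge0.
have key x y : c <= x -> x <= y -> y <= C ->
    0 <= y `^ (g - 1) - x `^ (g - 1) <= (g - 1) * K * (y - x).
  move=> cx; rewrite le_eqVlt => /predU1P[->|xy] yC; first by rewrite !subrr mulr0 lexx.
  have [z /andP[xz zy] ->] := powR_mvt (g - 1) cx xy.
  have zI : c <= z <= C by rewrite (le_trans cx (ltW xz)) (le_trans (ltW zy) yC).
  have := powR_bnd (g - 2) zI; rewrite (_ : g - 1 - 1 = g - 2); last by ring.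
  rewrite -/K => zK; rewrite !mulr_ge0 ?powR_ge0 ?subr_ge0 ?(ltW xy) ?(ltW g1)//=.
  by apply: ler_wpM2r; [rewrite subr_ge0 ltW|apply: ler_wpM2l => //; exact: ltW].
have [->|nst] := eqVneq s t; first by rewrite !subrr expr0n/= !mulr0 subrr lexx.
have [st|ts] : s < t \/ t < s by apply/orP; rewrite -neq_lt.
- have [z /andP[sz zt] E] := powR_mvt g cs st.
  have /andP[k1 k2] := key z t (le_trans cs (ltW sz)) (ltW zt) tC.
  have -> : s `^ g - t `^ g - g * t `^ (g - 1) * (s - t) = g * (t `^ (g - 1) - z `^ (g - 1)) * (t - s).
    by rewrite -[s `^ g - t `^ g]opprB E; ring.
  have ts0 : 0 <= t - s by rewrite subr_ge0 ltW.
  rewrite !mulr_ge0 ?(ltW g0)//=.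
  have -> : g * (g - 1) * K * (s - t) ^+ 2 = g * ((g - 1) * K * (t - s)) * (t - s) by ring.
  apply: ler_wpM2r => //; apply: ler_wpM2l; first exact: ltW.
  apply: (le_trans k2); apply: ler_wpM2l; first by rewrite mulr_ge0// ltW.
  by rewrite lerB// ltW.
- have [z /andP[tz zs] E] := powR_mvt g ct ts.
  have /andP[k1 k2] := key t z ct (ltW tz) (le_trans (ltW zs) sC).
  have -> : s `^ g - t `^ g - g * t `^ (g - 1) * (s - t) = g * (z `^ (g - 1) - t `^ (g - 1)) * (s - t).
    by rewrite E; ring.
  have ts0 : 0 <= s - t by rewrite subr_ge0 ltW.
  rewrite !mulr_ge0 ?(ltW g0)//=.
  have -> : g * (g - 1) * K * (s - t) ^+ 2 = g * ((g - 1) * K * (s - t)) * (s - t) by ring.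
  apply: ler_wpM2r => //; apply: ler_wpM2l; first exact: ltW.
  apply: (le_trans k2); apply: ler_wpM2l; first by rewrite mulr_ge0// ltW.
  by rewrite lerB// ltW.
Qed.
End PowIneq.

(** * From the weak form in time to pointwise identities *)

Section Time0.
Variable R : realType.
Notation RM := (measurableTypeR R).
Notation leb := (@lebesgue_measure R).

Lemma mIT (T : R) : measurable (`]0, T[%classic : set RM).
Proof. exact: measurable_itv. Qed.
Definition lamT (T : R) : set RM -> \bar R := mrestr leb (mIT T).
HB.instance Definition _ (T : R) := Measure.on (lamT T).
Lemma lamT_fin (T : R) : fin_num_fun (lamT T).
Proof.
move=> A mA; rewrite ge0_fin_numE ?measure_ge0//.
apply: (@le_lt_trans _ _ (leb `]0, T[%classic)).
  by apply: measureIr => //; exact: mIT.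
by rewrite lebesgue_measure_itv/=; case: ifPn => _; rewrite ?sube0 ltry.
Qed.
HB.instance Definition _ (T : R) := @Measure_isFinite.Build _ _ _ (lamT T) (@lamT_fin T).

Lemma lamTE (T : R) (f : RM -> R) : measurable_fun setT f ->
  \int[lamT T]_t f t = \int[leb]_(t in `]0, T[) f t.
Proof.
by move=> mf; rewrite /Rintegral integral_mrestr//; exact/measurable_EFinP.
Qed.

Lemma lamT_ae (T : R) (P : RM -> Prop) : {ae leb, forall t, 0 < t < T -> P t} ->
  {ae lamT T, forall t, P t}.
Proof.
move=> [A [mA A0 HA]]; exists (A `|` ~` `]0, T[%classic).
split.
- by apply: measurableU => //; apply: measurableC; exact: mIT.
- rewrite /lamT /mrestr setIUl setICl setU0.
  by apply/eqP; rewrite -measure_le0 -A0; apply: measureIl => //; exact: mIT.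
- move=> t nP; have [/= h|h] := pselect (0 < t < T).
    by left; apply: HA => /= H; apply: nP; exact: H.
  by right; rewrite /= in_itv.
Qed.

Lemma ae_lamT (T : R) (P : RM -> Prop) : {ae lamT T, forall t, P t} ->
  {ae leb, forall t, 0 < t < T -> P t}.
Proof.
move=> [A [mA A0 HA]]; exists (A `&` `]0, T[%classic).
split => //; first by apply: measurableI => //; exact: mIT.
move=> t /= /not_implyP[h nP]; split; last by rewrite /= in_itv.
exact: HA.
Qed.

Lemma intg_lamT (T : R) (f : RM -> R) : measurable_fun setT f ->
  leb.-integrable `]0, T[ (EFin \o f) <-> intg (lamT T) f.
Proof.
move=> mf; have ma : measurable_fun setT (fun t => `|f t|%:E).
  by apply/measurable_EFinP; exact: measurableT_comp.
split=> [/integrableP[_ H]|/intg_lt H].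
  apply: intgP => //; rewrite ge0_integral_mrestr//.
apply/integrableP; split; first by apply/measurable_EFinP; exact: measurable_funTS.
by move: H; rewrite ge0_integral_mrestr.
Qed.

(** The primitive of f vanishing at 0. Writing it with an indicator makes it a parameter integral,
    defined at every real t and jointly measurable. *)
Definition J (T : R) (f : RM -> R) (t : R) : R := \int[lamT T]_s (f s * ((s : R) < t)%R%:R).

Lemma meas_lt (t : R) : measurable_fun setT (fun s : RM => ((s : R) < t)%R%:R : R).
Proof.
rewrite (_ : (fun s => _) = \1_(`]-oo, t[%classic)); first by apply: measurable_indic; exact: measurable_itv.
by apply/funext => s; rewrite indicE; congr (_%:R); rewrite mem_setE in_itv.
Qed.

Lemma natb_le1 (b : bool) : `|b%:R : R| <= 1. Proof. by case: b; rewrite ?normr1 ?normr0. Qed.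

Lemma intg_J T (f : RM -> R) t : intg (lamT T) f -> intg (lamT T) (fun s => f s * ((s : R) < t)%R%:R).
Proof.
move=> iF; have := @intgMb _ _ _ (lamT T) f _ 1 iF (meas_lt t) (fun s => natb_le1 _).
by congr (integrable _ _ _); apply/funext => s /=; rewrite mulrC.
Qed.


Section Dct.
Context d (X : measurableType d) (m : {finite_measure set X -> \bar R}).
Lemma Rint_dct (f_ : nat -> X -> R) (f g : X -> R) :
  (forall n, measurable_fun setT (f_ n)) -> measurable_fun setT f ->
  (forall x, f_ n x @[n --> \oo] --> f x) -> intg m g ->
  (forall n x, `|f_ n x| <= g x) ->
  (\int[m]_x f_ n x) @[n --> \oo] --> \int[m]_x f x.
Proof.
move=> mf_ mf cf ig fg.
have [iF _ H] : [/\ m.-integrable setT (EFin \o f), 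
  ((\int[m]_x `|(EFin \o f_ n) x - (EFin \o f) x|)%E @[n --> \oo] --> 0%E) &
  ((\int[m]_x (EFin \o f_ n) x)%E @[n --> \oo] --> (\int[m]_x (EFin \o f) x)%E)].
  apply: (@dominated_convergence _ _ _ m setT measurableT (fun n => EFin \o f_ n) _ (EFin \o g)).
  - by move=> n; exact/measurable_EFinP.
  - exact/measurable_EFinP.
  - by apply: aeW => x _; apply: cvg_EFin; [exact: nearW|exact: cf].
  - exact: ig.
  - by apply: aeW => x n _ /=; rewrite lee_fin.
have F : (\int[m]_x (f x)%:E)%E \is a fin_num by exact: integrable_fin_num iF.
by apply: fine_cvg; rewrite fineK.
Qed.
End Dct.
End Time0.

Section Ae.
Context d (X : measurableType d) (R : realType) (m : {measure set X -> \bar R}).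
Lemma aeS (P Q : X -> Prop) : (forall x, P x -> Q x) ->
  {ae m, forall x, P x} -> {ae m, forall x, Q x}.
Proof. by move=> PQ; apply: (@filterS _ _ (ae_filter_ringOfSetsType m)). Qed.
Lemma aeI (P Q : X -> Prop) : {ae m, forall x, P x} -> {ae m, forall x, Q x} ->
  {ae m, forall x, P x /\ Q x}.
Proof. exact: (@filterI _ _ (ae_filter_ringOfSetsType m)). Qed.
End Ae.

Section DuBois.
Variables (R : realType) (T : R).
Hypothesis T0 : 0 < T.
Notation RM := (measurableTypeR R).
Notation leb := (@lebesgue_measure R).
Notation m := (lamT T).

(* sg = 1 and sg = -1 give the derivatives of the smooth cut-offs at p *)
Definition psi (sg p : R) (n : nat) (t : R) : R := n.+1%:R * dstp (n.+1%:R * (sg * (t - p))).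
Definition cut (sg p : R) (n : nat) (t : R) : R := stp (n.+1%:R * (sg * (t - p))).

Lemma C1k_ext k (f g : R -> R) : f =1 g -> C1k k f -> C1k k g.
Proof. by move=> /funext ->. Qed.

Lemma cut_smooth sg p n : smooth1 (cut sg p n).
Proof.
move=> k; have := C1k_aff (n.+1%:R * sg) (- (n.+1%:R * sg * p)) (@stp_smooth R k).
by apply: C1k_ext => t; rewrite /cut; congr stp; ring.
Qed.

Lemma is_derive_aff (a b x : R) : is_derive (x : R) 1 (fun t : R => a * t + b) a.
Proof.
have E : is_derive (x : R) 1 (fun t : R => a *: t + b) (a *: 1 + 0) by apply: is_deriveD.
by move: E; rewrite addr0 /GRing.scale /= mulr1.
Qed.

Lemma is_derive_cut sg p n (t : R) : is_derive (t : R) 1 (cut sg p n) (sg * psi sg p n t).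
Proof.
have E := is_derive_aff (n.+1%:R * sg) (- (n.+1%:R * sg * p)) t.
have := @is_derive1_comp _ (@stp R) (fun t => n.+1%:R * sg * t + - (n.+1%:R * sg * p)) t _ _ (is_derive_stp _) E.
have H s : n.+1%:R * sg * s + - (n.+1%:R * sg * p) = n.+1%:R * (sg * (s - p)) by ring.
rewrite H; congr is_derive; first by apply/funext => s /=; rewrite H.
by rewrite /psi; ring.
Qed.

Lemma smooth1_meas f : @smooth1 R f -> measurable_fun setT (f : RM -> R).
Proof. by move=> /(_ 0%N) cf; exact: continuous_measurable_fun. Qed.

Lemma psi_meas sg p n : measurable_fun setT (psi sg p n : RM -> R).
Proof.
apply: smooth1_meas => k; apply: C1k_mul; first exact: C1k_cst.
have := C1k_aff (n.+1%:R * sg) (- (n.+1%:R * sg * p)) (@dstp_smooth R k).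
by apply: C1k_ext => t; congr dstp; ring.
Qed.

Lemma psi_out sg p n t : `|sg| = 1 -> n.+1%:R^-1 <= `|t - p| -> psi sg p n t = 0.
Proof.
move=> s1 H; rewrite /psi dstp_out ?mulr0// => /andP[a1 a2].
have n0 : 0 < n.+1%:R :> R by rewrite ltr0n.
have : `|n.+1%:R * (sg * (t - p))| < 1 by rewrite gtr0_norm.
by rewrite !normrM s1 mul1r gtr0_norm// -ltr_pdivlMl// mulr1 ltNge H.
Qed.

Lemma int_psi sg p n : sg = 1 \/ sg = -1 -> n.+1%:R^-1 <= p -> n.+1%:R^-1 <= T - p ->
  \int[m]_t psi sg p n t = 1.
Proof.
move=> s1 H1 H2; rewrite lamTE; last exact: psi_meas.
have n0 : 0 < n.+1%:R :> R by rewrite ltr0n.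
have H1' : 1 <= n.+1%:R * p by rewrite -ler_pdivrMl// mulr1.
have H2' : 1 <= n.+1%:R * (T - p) by rewrite -ler_pdivrMl// mulr1.
have ss : sg * sg = 1 by case: s1 => ->; rewrite ?mulrNN mul1r.
have DF (x : R) : is_derive (x : R) 1 (fun t => sg * cut sg p n t) (psi sg p n x).
  have := is_deriveZ sg (is_derive_cut sg p n x).
  by rewrite /GRing.scale/= mulrA ss mul1r.
have cf : continuous (psi sg p n).
  have := psi_meas sg p n => _.
  have : smooth1 (psi sg p n).
    move=> k; apply: C1k_mul; first exact: C1k_cst.
    have := C1k_aff (n.+1%:R * sg) (- (n.+1%:R * sg * p)) (@dstp_smooth R k).
    by apply: C1k_ext => t; congr dstp; ring.
  by move=> /(_ 0%N).
rewrite /Rintegral integral_itv_obnd_cbnd ?integral_itv_bndo_bndc; last 2 first.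
- by apply/measurable_EFinP; exact: measurable_funTS (psi_meas _ _ _).
- by apply/measurable_EFinP; exact: measurable_funTS (psi_meas _ _ _).
rewrite (@continuous_FTC2 _ (psi sg p n) (fun t => sg * cut sg p n t) 0 T)//.
- rewrite /= /cut sub0r; case: s1 => ->.
    rewrite !mul1r stp_ge1// stp_le0 ?subr0//.
    by rewrite mulrN oppr_le0 (le_trans _ H1').
  rewrite !mulN1r !opprK [stp (_ * p)]stp_ge1// stp_le0; last first.
    by rewrite mulrN oppr_le0 (le_trans _ H2').
  by rewrite oppr0 add0r.
- exact: continuous_subspaceT.
- split.
  + by move=> x _; have := DF x => h; exact: ex_derive.
  + by apply: cvg_at_right_filter; exact: (is_derive_continuous DF).
  + by apply: cvg_at_left_filter; exact: (is_derive_continuous DF).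
- by move=> x _; have := DF x => h; rewrite derive1E derive_val.
Qed.

Lemma psi_bound : exists2 M, 0 <= M & forall sg p n t, `|psi sg p n t| <= n.+1%:R * M.
Proof.
have [M M0 H] := cpt_bounded (dstp_smooth R 0) (@dstp_out R).
by exists M => // sg p n t; rewrite /psi normrM ger0_norm// ler_wpM2l.
Qed.

Lemma near_inv_le (e : R) : 0 < e -> \forall n \near \oo, n.+1%:R^-1 <= e.
Proof.
move=> e0; near=> n; rewrite -[e]invrK lef_pV2 ?posrE ?invr_gt0 ?ltr0n//.
by rewrite (le_trans (_ : _ <= n%:R)) ?ler_nat//; near: n; exact: nbhs_infty_ger.
Unshelve. all: by end_near. Qed.

(** [psi] has mass 1, is bounded by (n+1) M and vanishes outside the ball of radius 1/(n+1) at p, so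
    the error is at most 2 M times the mean deviation of a on that ball, which tends to 0 at a
    Lebesgue point. *)
Lemma int_psi_cvg (a : RM -> R) sg p : intg m a -> sg = 1 \/ sg = -1 -> 0 < p < T ->
  lebesgue_pt (a \_ `]0, T[) p ->
  \int[m]_t (a t * psi sg p n t) @[n --> \oo] --> a p.
Proof.
pose aT : R -> R := a \_ `]0, T[.
move=> ia s1 /andP[p0 pT] lp.
have ma := intg_meas ia.
have ns1 : `|sg| = 1 by case: s1 => ->; rewrite ?normrN normr1.
have [M M0 HM] := psi_bound.
have L : davg aT p n.+1%:R^-1 @[n --> \oo] --> 0%E.
  apply: (cvg_comp (fun n => n.+1%:R^-1 : R) (davg aT p) _ lp).
  move=> A [e/= e0 HA]; near=> n; apply: HA => /=; last by rewrite invr_gt0 ltr0n.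
  rewrite sub0r normrN gtr0_norm ?invr_gt0 ?ltr0n//.
  apply: (@le_lt_trans _ _ (e / 2)); last by rewrite ltr_pdivrMr// mulr_natr mulr2n ltrDl.
  by near: n; apply: near_inv_le; rewrite divr_gt0.
have ip n : intg m (fun t => a t * psi sg p n t).
  have := intgMb ia (psi_meas sg p n) (HM sg p n).
  by congr (integrable _ _ _); apply/funext => t /=; rewrite mulrC.
have ip0 n : intg m (psi sg p n).
  by apply: intg_bounded; [exact: psi_meas|exact: HM].
have B : \forall n \near \oo,
    (`|\int[m]_t (a t * psi sg p n t) - a p|%:E <= (2 * M)%:E * davg aT p n.+1%:R^-1)%E.
  near=> n.
  have h1 : n.+1%:R^-1 <= p by near: n; exact: near_inv_le.
  have h2 : n.+1%:R^-1 <= T - p by near: n; apply: near_inv_le; rewrite subr_gt0.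
  have n0 : 0 < n.+1%:R^-1 :> R by rewrite invr_gt0 ltr0n.
  have bI : ball p n.+1%:R^-1 `<=` `]0, T[%classic.
    move=> t; rewrite ball_itv/= !in_itv/= => /andP[t1 t2].
    by rewrite (le_lt_trans _ t1) ?subr_ge0//= (lt_le_trans t2)// -lerBrDl.
  have E1 : \int[m]_t (a t * psi sg p n t) - a p = \int[m]_t ((a t - a p) * psi sg p n t).
    transitivity (\int[m]_t (a t * psi sg p n t) - \int[m]_t (a p * psi sg p n t)).
      by rewrite RintZ// int_psi// mulr1.
    rewrite -RintB//; last exact: intgZ.
    by apply: eq_Rintegral => t _; rewrite mulrBl.
  have i1 : intg m (fun t => (a t - a p) * psi sg p n t).
    have := intgB (ip n) (intgZ (a p) (ip0 n)).
    by congr (integrable _ _ _); apply/funext => t /=; rewrite mulrBl.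
  rewrite E1; apply: (@le_trans _ _ (\int[m]_t `|(a t - a p) * psi sg p n t|)%:E).
    by rewrite lee_fin; exact: Rint_abs.
  rewrite EFin_Rint; last exact: intg_abs.
  have mb : measurable (ball p n.+1%:R^-1 : set RM) by exact: measurable_ball.
  have mabs : measurable_fun setT (fun t : RM => `|a t - a p|%:E).
    by apply/measurable_EFinP; apply: measurableT_comp => //; apply: measurable_funB => //.
  rewrite ge0_integral_mrestr//; last first.
    by apply/measurable_EFinP; apply: measurableT_comp => //; exact: intg_meas i1.
  rewrite /davg /iavg lebesgue_measure_ball; last exact: ltW.
  have -> : (\int[leb]_(y in ball p n.+1%:R^-1) `|((center (aT p) \o aT) y)%:E| =
     \int[leb]_(y in ball p n.+1%:R^-1) `|a y - a p|%:E)%E.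
    apply: eq_integral => y /set_mem /bI yI.
    by rewrite /= /aT !patchE !mem_set//= in_itv/= p0.
  apply: (@le_trans _ _ (\int[leb]_(y in ball p n.+1%:R^-1) ((n.+1%:R * M)%:E * `|a y - a p|%:E))%E).
    have E2 : `]0, T[%classic = ball p n.+1%:R^-1 `|` (`]0, T[%classic `\` ball p n.+1%:R^-1) by rewrite setDUK.
    rewrite [in leLHS]E2 ge0_integral_setU//=; last 3 first.
    - by apply: measurableD => //; exact: mIT.
    - by rewrite -E2; apply/measurable_EFinP; apply: measurable_funTS; apply: measurableT_comp => //; exact: intg_meas i1.
    - by apply/disj_setPS => t [? []].
    rewrite [X in (_ + X)%E]integral0_eq ?adde0; last first.
      move=> t [_ nb]; rewrite psi_out ?mulr0 ?normr0//.
      by rewrite leNgt distrC; apply/negP.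
    apply: ge0_le_integral => //.
    - by apply/measurable_EFinP; apply: measurable_funTS; apply: measurableT_comp => //; exact: intg_meas i1.
    - by apply: measurable_funTS; exact: measurable_funeM.
    - by move=> t _; rewrite -EFinM lee_fin normrM mulrC ler_wpM2r.
  rewrite ge0_integralZl//; last 2 first.
  - by apply: measurable_funTS.
  - by rewrite lee_fin mulr_ge0.
  rewrite inver mulrn_eq0/= gt_eqF// muleA -EFinM.
  have -> : 2 * M * (n.+1%:R^-1 *+ 2)^-1 = n.+1%:R * M.
    by move: (n.+1%:R : R) => x; rewrite -(mulr_natr x^-1 2) invfM invrK; field.
  exact: lexx.
have C0 : ((2 * M)%:E * davg aT p n.+1%:R^-1)%E @[n --> \oo] --> 0%E.
  by rewrite -(mule0 (2 * M)%:E); apply: cvgeZl.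
apply/cvgrPdist_le => e e0.
have H : \forall n \near \oo, ((2 * M)%:E * davg aT p n.+1%:R^-1 < e%:E)%E.
  by apply: (C0 (fun x : \bar R => (x < e%:E)%E)); apply: open_ereal_lt'; rewrite lte_fin.
near=> n; rewrite distrC -lee_fin; apply: (@le_trans _ _ ((2 * M)%:E * davg aT p n.+1%:R^-1)%E).
  by near: n.
by apply: ltW; near: n.
Unshelve. all: by end_near. Qed.

Lemma lam_eq (f g : RM -> R) : measurable_fun setT f -> measurable_fun setT g ->
  (forall t, 0 < t < T -> f t = g t) -> \int[m]_t f t = \int[m]_t g t.
Proof.
move=> mf mg fg; rewrite !lamTE//; apply: eq_Rintegral => t /set_mem.
by rewrite /= in_itv/=; exact: fg.
Qed.

Lemma ae_pick (P : RM -> Prop) r : {ae m, forall t, P t} -> 0 < r -> r <= T ->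
  exists2 p, 0 < p < r & P p.
Proof.
move=> [A [mA A0 HA]] r0 rT; apply: contrapT => H.
have sub : `]0, r[%classic `<=` A.
  move=> p; rewrite /= in_itv/= => pr; apply: HA => Pp; apply: H.
  by exists p.
have : (m `]0%R, r[%classic <= m A)%E.
  by apply: le_measure; rewrite ?inE//; exact: (mIT r).
rewrite A0 /lamT /mrestr setIidl; last first.
  by move=> t; rewrite /= !in_itv/= => /andP[-> tr]; exact: lt_le_trans rT.
by rewrite lebesgue_measure_itv/= lte_fin r0 sube0 lee_fin leNgt r0.
Qed.

Lemma cut_itv sg p n t : 0 <= cut sg p n t <= 1. Proof. exact: stp_itv. Qed.

(** The transition zones at p and q are disjoint since q - p exceeds 2/(n+1); wherever one cut-off
    varies, the other equals 1. *)
Lemma chi_derive p q n (t : R) : 2 * n.+1%:R^-1 < q - p ->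
  is_derive (t : R) 1 (fun t => cut 1 p n t * cut (-1) q n t) (psi 1 p n t - psi (-1) q n t).
Proof.
move=> h; have := is_deriveM (is_derive_cut 1 p n t) (is_derive_cut (-1) q n t).
have n0 : 0 < n.+1%:R :> R by rewrite ltr0n.
move=> D; apply: (@is_derive_eq _ _ _ _ _ _ _ _ D); rewrite /GRing.scale/= mul1r mulN1r mulrN.
have s1 : `|1 : R| = 1 by rewrite normr1.
have sm : `|-1 : R| = 1 by rewrite normrN normr1.
have E1 : cut (-1) q n t * psi 1 p n t = psi 1 p n t.
  have [ht|ht] := leP n.+1%:R^-1 `|t - p|; first by rewrite psi_out// mulr0.
  rewrite /cut stp_ge1 ?mul1r// -ler_pdivrMl// mulr1 mulN1r opprB.
  move: ht; rewrite ltr_distl => /andP[_ ht]; rewrite lerBrDr.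
  move: h ht; move: (n.+1%:R^-1) => e; lra.
have E2 : cut 1 p n t * psi (-1) q n t = psi (-1) q n t.
  have [ht|ht] := leP n.+1%:R^-1 `|t - q|; first by rewrite psi_out// mulr0.
  rewrite /cut stp_ge1 ?mul1r// -ler_pdivrMl// mulr1.
  move: ht; rewrite ltr_distl => /andP[ht _].
  move: h ht; move: (n.+1%:R^-1) => e; lra.
by rewrite E1 E2 addrC.
Qed.

Lemma cut_lim1 p t : cut 1 p n t @[n --> \oo] --> ((p < t)%R%:R : R).
Proof.
have [pt|tp] := ltP p t; last first.
  rewrite (_ : (fun n => _) = fun=> 0); first exact: cvg_cst.
  by apply/funext => n; rewrite /cut stp_le0// mul1r pmulr_rle0 ?ltr0n// subr_le0.
apply: cvg_near_cst; near=> n.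
rewrite /cut stp_ge1// mul1r -ler_pdivrMl ?ltr0n// mulr1.
by near: n; apply: near_inv_le; rewrite subr_gt0.
Unshelve. all: by end_near. Qed.

Lemma cut_limN q t : cut (-1) q n t @[n --> \oo] --> ((t < q)%R%:R : R).
Proof.
have [pt|tp] := ltP t q; last first.
  rewrite (_ : (fun n => _) = fun=> 0); first exact: cvg_cst.
  by apply/funext => n; rewrite /cut stp_le0// mulN1r pmulr_rle0 ?ltr0n// oppr_le0 subr_ge0.
apply: cvg_near_cst; near=> n.
rewrite /cut stp_ge1// mulN1r -ler_pdivrMl ?ltr0n// mulr1 opprB.
by near: n; apply: near_inv_le; rewrite subr_gt0.
Unshelve. all: by end_near. Qed.

Lemma chi_out p q n t : t < p \/ q < t -> cut 1 p n t * cut (-1) q n t = 0.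
Proof.
case=> h; rewrite /cut.
  by rewrite [stp (_ * (1 * _))]stp_le0 ?mul0r// mul1r pmulr_rle0 ?ltr0n// subr_le0 ltW.
by rewrite [stp (_ * (-1 * _))]stp_le0 ?mulr0// mulN1r pmulr_rle0 ?ltr0n// oppr_le0 subr_ge0 ltW.
Qed.

(** The equation a' = b in the sense of distributions on (0, T). *)
Definition wtest (a b : RM -> R) := forall (chi chi' : R -> R) p q, smooth1 chi ->
  (forall t, is_derive (t : R) 1 chi (chi' t)) -> 0 < p -> p <= q -> q < T ->
  (forall t, t < p \/ q < t -> chi t = 0) ->
  intg m (fun t => a t * chi' t) -> intg m (fun t => b t * chi t) ->
  \int[m]_t (a t * chi' t) + \int[m]_t (b t * chi t) = 0.

(** Test with smooth plateaus between p and q that sharpen to the indicator of (p, q): their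
    derivatives concentrate at the two Lebesgue points. *)
Lemma wtest_itv (a b : RM -> R) p q : intg m a -> intg m b -> wtest a b ->
  lebesgue_pt (a \_ `]0, T[) p -> lebesgue_pt (a \_ `]0, T[) q -> 0 < p -> p < q -> q < T ->
  a q - a p = \int[m]_t (b t * ((p < t)%R%:R * (t < q)%R%:R)).
Proof.
move=> ia ib W lp lq p0 pq qT.
have [M M0 HM] := psi_bound.
have mcut sg r n := smooth1_meas (@cut_smooth sg r n).
have mc n : measurable_fun setT (fun t : RM => cut 1 p n t * cut (-1) q n t).
  exact: measurable_funM.
have bc n t : `|cut 1 p n t * cut (-1) q n t| <= 1.
  have /andP[a1 a2] := cut_itv 1 p n t; have /andP[b1 b2] := cut_itv (-1) q n t.
  by rewrite ger0_norm; [exact: mulr_ile1|exact: mulr_ge0].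
have ip sg r n : intg m (fun t => a t * psi sg r n t).
  have := intgMb ia (psi_meas sg r n) (HM sg r n).
  by congr (integrable _ _ _); apply/funext => t /=; rewrite mulrC.
have ic n : intg m (fun t => b t * (cut 1 p n t * cut (-1) q n t)).
  have := intgMb ib (mc n) (bc n).
  by congr (integrable _ _ _); apply/funext => t /=; rewrite mulrC.
have L1 : \int[m]_t (a t * psi 1 p n t) @[n --> \oo] --> a p.
  by apply: int_psi_cvg => //; [left|rewrite p0 (lt_trans pq)].
have L2 : \int[m]_t (a t * psi (-1) q n t) @[n --> \oo] --> a q.
  by apply: int_psi_cvg => //; [right|rewrite (lt_trans p0 pq)].
have L3 : \int[m]_t (b t * (cut 1 p n t * cut (-1) q n t)) @[n --> \oo]
    --> \int[m]_t (b t * ((p < t)%R%:R * (t < q)%R%:R)).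
  apply: (@Rint_dct _ _ _ _ _ _ (fun t => `|b t|)).
  - by move=> n; exact: (intg_meas (ic n)).
  - apply: measurable_funM; first exact: intg_meas ib.
    apply: measurable_funM; last exact: meas_lt.
    rewrite (_ : (fun s => _) = \1_(`]p, +oo[%classic)); first by apply: measurable_indic; exact: measurable_itv.
    by apply/funext => s; rewrite indicE; congr (_%:R); rewrite mem_setE in_itv/= andbT.
  - by move=> t; apply: cvgM; [exact: cvg_cst|apply: cvgM; [exact: cut_lim1|exact: cut_limN]].
  - exact: intg_abs.
  - by move=> n t; rewrite normrM -[leRHS]mulr1 ler_wpM2l.
have E : \forall n \near \oo, \int[m]_t (a t * psi (-1) q n t) - \int[m]_t (a t * psi 1 p n t)
    = \int[m]_t (b t * (cut 1 p n t * cut (-1) q n t)).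
  near=> n.
  have h : 2 * n.+1%:R^-1 < q - p.
    have : n.+1%:R^-1 <= (q - p) / 4 by near: n; apply: near_inv_le; rewrite divr_gt0// subr_gt0.
    by have := pq; move: (n.+1%:R^-1) => e; lra.
  have := W _ _ p q (fun k => C1k_mul (cut_smooth 1 p n k) (cut_smooth (-1) q n k))
     (fun t => chi_derive t h) p0 (ltW pq) qT (fun t => @chi_out p q n t) _ (ic n).
  have i2 : intg m (fun t => a t * (psi 1 p n t - psi (-1) q n t)).
    have := intgB (ip 1 p n) (ip (-1) q n).
    by congr (integrable _ _ _); apply/funext => t /=; rewrite mulrBr.
  move=> /(_ i2).
  rewrite (_ : \int[m]_t (a t * (psi 1 p n t - psi (-1) q n t)) =
     \int[m]_t (a t * psi 1 p n t) - \int[m]_t (a t * psi (-1) q n t)); last first.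
    by rewrite -RintB//; apply: eq_Rintegral => t _; rewrite mulrBr.
  by move/eqP; rewrite addr_eq0 => /eqP /(congr1 -%R); rewrite opprB opprK.
have L4 : (\int[m]_t (a t * psi (-1) q n t) - \int[m]_t (a t * psi 1 p n t)) @[n --> \oo] --> (a q - a p : R).
  exact: cvgB.
have L5 : (\int[m]_t (a t * psi (-1) q n t) - \int[m]_t (a t * psi 1 p n t)) @[n --> \oo]
   --> \int[m]_t (b t * ((p < t)%R%:R * (t < q)%R%:R)).
  apply: cvg_trans L3; apply: near_eq_cvg; near=> n.
  by apply/esym; near: n.
by rewrite -(cvg_lim (@Rhausdorff R) L4) -(cvg_lim (@Rhausdorff R) L5).
Unshelve. all: by end_near. Qed.

(** Between Lebesgue points this is [wtest_itv]. The initial value enters by letting the left point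
    approach 0 through times at which a is close to a0. *)
Lemma dubois (a b : RM -> R) a0 : intg m a -> intg m b -> wtest a b ->
  (forall e, 0 < e -> exists2 dl, 0 < dl & {ae m, forall t, t < dl -> `|a t - a0| <= e}) ->
  {ae m, forall t, a t = a0 + J T b t}.
Proof.
move=> ia ib W init.
have good : {ae m, forall t, 0 < t < T /\ lebesgue_pt (a \_ `]0, T[) t}.
  apply: lamT_ae.
  have H := lebesgue_differentiation (integrable_locally (mIT T) ((intg_lamT T (intg_meas ia)).2 ia)).
  by have [A [mA A0 HA]] := H; exists A; split => // t ht; apply: HA => /= h1; apply: ht.
apply: aeS (good) => q [/andP[q0 qT] lq].
apply/eqP; rewrite -subr_eq0 -normr_le0; apply/ler_addgt0Pr => e e0; rewrite add0r.
have e20 : 0 < e / 2 by rewrite divr_gt0.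
have [dl dl0 Hdl] := init _ e20.
have mle (p : R) : measurable_fun setT (fun s : RM => (s <= p)%R%:R : R).
  rewrite (_ : (fun s => _) = \1_(`]-oo, p]%classic)); first by apply: measurable_indic; exact: measurable_itv.
  by apply/funext => s; rewrite indicE; congr (_%:R); rewrite mem_setE in_itv.
have mabs : measurable_fun setT (fun t : RM => `|b t|).
  by apply: measurableT_comp => //; exact: intg_meas ib.
have L : \int[m]_t (`|b t| * (t <= n.+1%:R^-1)%R%:R) @[n --> \oo] --> (0 : R).
  have <- : \int[m]_t (`|b t| * (t <= 0)%R%:R) = 0.
    rewrite (@lam_eq _ (fun=> 0)) ?Rintegral_cst ?mul0r//.
      exact: measurable_funM.
    by move=> t /andP[t0 _]; rewrite leNgt t0 mulr0.
  apply: (@Rint_dct _ _ _ _ _ _ (fun t => `|b t|)).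
  - by move=> n; exact: measurable_funM.
  - exact: measurable_funM.
  - move=> t; apply: cvgM; first exact: cvg_cst.
    have [t0|t0] := leP t 0.
      by apply: cvg_near_cst; apply: nearW => n; rewrite (le_trans t0) ?invr_ge0.
    apply: cvg_near_cst; near=> n.
    rewrite leNgt (_ : _ < t)//; apply: (@le_lt_trans _ _ (t / 2)); last first.
      by rewrite ltr_pdivrMr// mulr_natr mulr2n ltrDl.
    by near: n; apply: near_inv_le; rewrite divr_gt0.
  - exact: intg_abs.
  - by move=> n t; rewrite normrM normr_id -[leRHS]mulr1 ler_wpM2l// natb_le1.
(* A left end point p below 1/(n+1) then has two defects, each at most e / 2: the distance from a p
   to a0, and the integral of |b| over (0, p]. *)
have [n [n1 n2 n3]] : exists n : nat, [/\ n.+1%:R^-1 <= q, n.+1%:R^-1 <= dl &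
    \int[m]_t (`|b t| * (t <= n.+1%:R^-1)%R%:R) <= e / 2].
  apply: (@filter_ex _ (\oo : set_system nat)); near=> n; split.
  - by near: n; exact: near_inv_le.
  - by near: n; exact: near_inv_le.
  - apply: le_trans (ler_norm _) _; rewrite -[X in `|X|]subr0 distrC.
    by near: n; move/cvgrPdist_le: L; apply.
have n0 : 0 < n.+1%:R^-1 :> R by rewrite invr_gt0 ltr0n.
have [p /andP[p0 pn] [[_ lp] pdl]] := ae_pick (aeI good Hdl) n0 (le_trans n1 (ltW qT)).
have pq : p < q by exact: lt_le_trans n1.
have E := wtest_itv ia ib W lp lq p0 pq qT.
have ibp : intg m (fun t => b t * ((p < t)%R%:R * (t < q)%R%:R)).
  have := @intgMb _ _ _ m b (fun t => ((p < t)%R%:R * (t < q)%R%:R)) 1 ib.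
  move=> /(_ _ _); rewrite (_ : (fun x => _ * b x) = (fun t => b t * ((p < t)%R%:R * (t < q)%R%:R))).
    apply.
      apply: measurable_funM; last exact: meas_lt.
      rewrite (_ : (fun s => _) = (fun s => 1 - (s <= p)%R%:R)).
        exact: measurable_funB.
      by apply/funext => s; rewrite ltNge; case: (_ <= _); rewrite ?subr0 ?subrr.
    by move=> t; rewrite normrM; apply: mulr_ile1; rewrite ?natb_le1.
  by apply/funext => t; rewrite mulrC.
have := intg_J q ib => iJ.
have -> : a q - (a0 + J T b q) = (a p - a0) - (J T b q - (a q - a p)) by ring.
rewrite E /J -RintB//.
rewrite (le_trans (ler_normB _ _))// [leRHS]splitr lerD//.
  by apply: pdl; exact: lt_le_trans n2.
apply: le_trans n3; apply: le_trans (Rint_abs (intgB iJ ibp)) _.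
apply: Rint_le; first exact: intg_abs (intgB iJ ibp).
  have := @intgMb _ _ _ m _ _ 1 (intg_abs ib) (mle n.+1%:R^-1) (fun s => natb_le1 _ _).
  by congr (integrable _ _ _); apply/funext => t /=; rewrite mulrC.
move=> t; rewrite -mulrBr normrM ler_wpM2l//.
rewrite -[X in `|X - _|]mul1r -mulrBl normrM.
have [pt|tp] := ltP p t; first by rewrite subrr normr0 mul0r.
by rewrite (le_trans tp (ltW pn)) subr0 normr1 mul1r natb_le1.
Unshelve. all: by end_near. Qed.
End DuBois.

(** * Chain rule for functions of primitives *)

Section Chain.
Variables (R : realType) (T : R).
Hypothesis T0 : 0 < T.
Notation RM := (measurableTypeR R).
Notation leb := (@lebesgue_measure R).
Notation m := (lamT T).

Lemma J_itv (f : RM -> R) x : intg m f ->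
  J T f x = \int[leb]_(t in `[0, x]) (f \_ `]0, T[) t.
Proof.
move=> iF; pose fT : RM -> R := f \_ `]0, T[.
have ifT : leb.-integrable setT (EFin \o fT).
  have := (integrable_mkcond (EFin \o f) (mIT T)).1 ((intg_lamT T (intg_meas iF)).2 iF).
  by congr (integrable _ _ _); apply/funext => s /=; rewrite /fT !patchE; case: ifP.
rewrite /J lamTE; last exact: (intg_meas (intg_J x iF)).
rewrite -[RHS]Rintegral_itv_bndo_bndc; last by apply: integrableS ifT.
rewrite Rintegral_mkcond [RHS]Rintegral_mkcond; apply: eq_Rintegral => s _.
rewrite !patchE !mem_setE !in_itv/=.
case: (ltP 0 s) => s0; last by rewrite /= if_same.
rewrite (ltW s0) /=; case: (s < T); rewrite ?if_same//.
by case: (s < x); rewrite ?mulr1 ?mulr0.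
Qed.

Lemma J_cont (f : RM -> R) t : 0 <= t -> intg m f -> {within `[0, t], continuous (J T f)}.
Proof.
move=> t0 iF.
rewrite (_ : J T f = fun x => parameterized_integral leb 0 x (f \_ `]0, T[)); last first.
  by apply/funext => x; rewrite J_itv.
apply: parameterized_integral_continuous => //.
have ifT : leb.-integrable setT (EFin \o (f \_ `]0, T[)).
  have := (integrable_mkcond (EFin \o f) (mIT T)).1 ((intg_lamT T (intg_meas iF)).2 iF).
  by congr (integrable _ _ _); apply/funext => s /=; rewrite !patchE; case: ifP.
exact: integrableS ifT.
Qed.

Lemma J_0 (f : RM -> R) : intg m f -> J T f 0 = 0.
Proof.
move=> iF; rewrite /J (lam_eq _ (g := fun=> 0)) ?Rintegral_cst ?mul0r//.
- exact: (intg_meas (intg_J 0 iF)).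
- by move=> t /andP[t0 _]; rewrite ltNge (ltW t0) mulr0.
Qed.

Lemma intg_seg (f : RM -> R) s t : intg m f ->
  intg m (fun x => f x * ((s <= x)%R%:R * (x < t)%R%:R)).
Proof.
move=> iF; have ms : measurable_fun setT (fun x : RM => (s <= x)%R%:R * (x < t)%R%:R : R).
  apply: measurable_funM; last exact: meas_lt.
  rewrite (_ : (fun s => _) = \1_(`[s, +oo[%classic)); first by apply: measurable_indic; exact: measurable_itv.
  by apply/funext => x; rewrite indicE; congr (_%:R); rewrite mem_setE in_itv/= andbT.
have := @intgMb _ _ _ m f _ 1 iF ms.
move=> H; have {H} := H (fun x => _); move=> H.
have : intg m (fun x => ((s <= x)%R%:R * (x < t)%R%:R) * f x).
  by apply: H => x; rewrite normrM; apply: mulr_ile1; rewrite ?natb_le1.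
by congr (integrable _ _ _); apply/funext => x /=; rewrite mulrC.
Qed.

Lemma J_diff (f : RM -> R) s t : s <= t -> intg m f ->
  J T f t - J T f s = \int[m]_x (f x * ((s <= x)%R%:R * (x < t)%R%:R)).
Proof.
move=> st iF; rewrite /J -RintB; [|exact: intg_J..].
apply: eq_Rintegral => x _; rewrite -mulrBr; congr (_ * _).
have [sx|xs] := leP s x; first by rewrite subr0 mul1r.
by rewrite (lt_le_trans xs st) subrr mul0r.
Qed.

Lemma J_nd (f : RM -> R) s t : (forall x, 0 <= f x) -> s <= t -> intg m f -> J T f s <= J T f t.
Proof.
move=> f0 st iF; rewrite -subr_ge0 J_diff//; apply: Rint_ge0 => x.
by rewrite !mulr_ge0.
Qed.

Lemma J_norm (f g : RM -> R) s t : s <= t -> intg m f -> intg m g -> (forall x, `|f x| <= g x) ->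
  `|J T f t - J T f s| <= J T g t - J T g s.
Proof.
move=> st iF ig fg; rewrite !J_diff//; apply: le_trans (Rint_abs (intg_seg s t iF)) _.
apply: Rint_le; [exact: intg_abs (intg_seg s t iF)|exact: intg_seg|] => x.
by rewrite normrM [X in _ * X]ger0_norm ?mulr_ge0// ler_wpM2r// mulr_ge0.
Qed.

Lemma J_D (f g : RM -> R) t : intg m f -> intg m g -> J T (fun x => f x + g x) t = J T f t + J T g t.
Proof.
move=> iF ig; rewrite /J -RintD; [|exact: intg_J..].
by apply: eq_Rintegral => x _; rewrite mulrDl.
Qed.

Lemma J_sum (I : Type) (s : seq I) (f : I -> RM -> R) t : (forall i, intg m (f i)) ->
  J T (fun x => \sum_(i <- s) f i x) t = \sum_(i <- s) J T (f i) t.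
Proof.
move=> H; rewrite /J -Rint_sum; last by move=> i; exact: intg_J.
by apply: eq_Rintegral => x _; rewrite mulr_suml.
Qed.

Lemma J_meas (f : RM -> R) : measurable_fun setT f -> measurable_fun setT (J T f : RM -> R).
Proof.
move=> mf; apply: (@measurable_Rparam _ _ _ _ _ m (fun p : RM * RM => f p.2 * (p.2 < p.1)%R%:R)).
apply: measurable_funM; first exact: measurableT_comp.
pose k : bool -> R := fun b => b%:R.
apply: (measurableT_comp (f := k)) => //.
exact: measurable_fun_ltr.
Qed.

(** Cut [0, t] by the intermediate value theorem into n pieces on which I grows equally. The
    increments of H add up to at most K (I t - I 0)^2 / n, which tends to 0. Measuring length by I
    makes the argument work for primitives of merely integrable functions. *)
Lemma quad_const (H I : R -> R) (t K : R) : 0 <= t -> {within `[0, t], continuous I} ->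
  (forall a b, 0 <= a -> a <= b -> b <= t -> I a <= I b) ->
  (forall a b, 0 <= a -> a <= b -> b <= t -> `|H b - H a| <= K * (I b - I a) ^+ 2) ->
  H t = H 0.
Proof.
move=> t0 cI nI HI.
have D0 : 0 <= I t - I 0 by rewrite subr_ge0 nI.
have step (N : nat) (k : nat) : (k <= N.+1)%N -> exists tk,
    [/\ 0 <= tk <= t, I tk = I 0 + k%:R * ((I t - I 0) / N.+1%:R) &
     `|H tk - H 0| <= k%:R * (K * ((I t - I 0) / N.+1%:R) ^+ 2)].
  elim: k => [_|k IH kN].
    by exists 0; rewrite lexx t0 !mul0r addr0 subrr normr0.
  have [tk [/andP[tk0 tkt] E1 E2]] := IH (ltnW kN).
  have S0 : 0 <= (I t - I 0) / N.+1%:R by rewrite divr_ge0.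
  have v1 : I tk <= I 0 + k.+1%:R * ((I t - I 0) / N.+1%:R).
    by rewrite E1 lerD2l ler_wpM2r// ler_nat.
  have v2 : I 0 + k.+1%:R * ((I t - I 0) / N.+1%:R) <= I t.
    rewrite -lerBrDl mulrA ler_pdivrMr ?ltr0n// mulrC ler_wpM2l// ler_nat//.
  have cI' : {within `[tk, t], continuous I}.
    apply: continuous_subspaceW cI => x /=; rewrite !in_itv/= => /andP[h ->].
    by rewrite (le_trans tk0 h).
  have [] := @IVT R I tk t (I 0 + k.+1%:R * ((I t - I 0) / N.+1%:R)) tkt cI'.
    by rewrite ge_min v1 le_max v2 orbT.
  move=> c; rewrite in_itv/= => /andP[c1 c2] Ec; exists c; split => //.
    by rewrite (le_trans tk0 c1).
  rewrite -[H c](subrK (H tk)) -addrA (le_trans (ler_normD _ _))//.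
  rewrite -natr1 mulrDl mul1r [leRHS]addrC lerD//.
  apply: le_trans (HI _ _ tk0 c1 c2) _.
  rewrite le_eqVlt (_ : I c - I tk = (I t - I 0) / N.+1%:R) ?eqxx//.
  by rewrite Ec E1 -natr1; ring.
apply/eqP; rewrite -subr_eq0 -normr_le0; apply/ler_addgt0Pr => e e0; rewrite add0r.
pose Q := `|K| * (I t - I 0) ^+ 2.
have Q0 : 0 <= Q by rewrite mulr_ge0// exprn_ge0.
(* This number of pieces brings the summed error Q / (N+1) below e. *)
pose N := Num.bound (Q / e).
have NQ : Q / e < N.+1%:R 
  by rewrite (lt_le_trans (archi_boundP (divr_ge0 Q0 (ltW e0))))// ler_nat.
have [tN [/andP[a1 a2] E1 E2]] := step N N.+1 (leqnn _).
have IE : I tN = I t by rewrite E1 mulrC divfK ?pnatr_eq0// addrC subrK.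
have : `|H t - H tN| <= 0 by rewrite (le_trans (HI _ _ a1 a2 (lexx _)))// IE subrr expr0n/= mulr0.
rewrite normr_le0 subr_eq0 => /eqP ->.
apply: (le_trans E2).
have -> : N.+1%:R * (K * ((I t - I 0) / N.+1%:R) ^+ 2) = K * (I t - I 0) ^+ 2 / N.+1%:R.
  have : N.+1%:R != 0 :> R by rewrite pnatr_eq0.
  by move: (N.+1%:R : R) (I t) (I 0) => x y z x0; field.
rewrite ler_pdivrMr ?ltr0n//; apply: (@le_trans _ _ Q).
  by rewrite ler_wpM2r ?exprn_ge0// ler_norm.
by rewrite mulrC -ler_pdivrMr// ltW.
Qed.

(** The difference of phi and the candidate primitive has increments quadratic in those of I: for
    phi this is the Taylor hypothesis, and for the primitive it holds because A and B vary by at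
    most K times the increment of I. Then [quad_const] applies. *)
Lemma J_chain (g h : RM -> R) (phi A B : R -> R) (K M : R) t : 0 <= t -> 0 <= K ->
  intg m g -> intg m h -> measurable_fun setT (A : RM -> R) -> measurable_fun setT (B : RM -> R) ->
  (forall s, `|A s| <= M /\ `|B s| <= M) ->
  let I := J T (fun s => `|g s| + `|h s|) in
  (forall a b, 0 <= a -> a <= b -> b <= t -> `|A b - A a| <= K * (I b - I a)) ->
  (forall a b, 0 <= a -> a <= b -> b <= t -> `|B b - B a| <= K * (I b - I a)) ->
  (forall a b, 0 <= a -> a <= b -> b <= t ->
     `|phi b - phi a - A a * (J T g b - J T g a) - B a * (J T h b - J T h a)| <= K * (I b - I a) ^+ 2) ->
  phi t = phi 0 + J T (fun s => A s * g s + B s * h s) t.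
Proof.
move=> t0 K0 ig ih mA mB AB I HA HB Hphi.
have iA : intg m (fun s => A s * g s) by apply: intgMb ig mA _ => s; exact: (AB s).1.
have iB : intg m (fun s => B s * h s) by apply: intgMb ih mB _ => s; exact: (AB s).2.
have iAB := intgD iA iB.
have igh := intgD (intg_abs ig) (intg_abs ih).
pose H s := phi s - J T (fun s => A s * g s + B s * h s) s.
have nI a b : a <= b -> I a <= I b by move=> ab; apply: J_nd => // x; rewrite addr_ge0.
suff : H t = H 0 by rewrite /H J_0// subr0 => <-; rewrite subrK.
apply: (@quad_const _ I t (2 * K)) => //; first exact: J_cont.
  by move=> a b _ ab _; exact: nI.
move=> a b a0 ab bt.
have DI0 : 0 <= I b - I a by rewrite subr_ge0 nI.
have -> : H b - H a = (phi b - phi a - A a * (J T g b - J T g a) - B a * (J T h b - J T h a))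
   - ((J T (fun s => A s * g s + B s * h s) b - J T (fun s => A s * g s + B s * h s) a)
      - A a * (J T g b - J T g a) - B a * (J T h b - J T h a)) by rewrite /H; ring.
rewrite (le_trans (ler_normB _ _))//.
rewrite (_ : 2 * K * (I b - I a) ^+ 2 = K * (I b - I a) ^+ 2 + K * (I b - I a) ^+ 2); last by ring.
rewrite lerD//; first exact: Hphi.
have i1 := intg_seg a b iAB; have i2 := intg_seg a b ig; have i3 := intg_seg a b ih.
have iL : intg m (fun x => (A x * g x + B x * h x) * ((a <= x)%R%:R * (x < b)%R%:R)
   - A a * (g x * ((a <= x)%R%:R * (x < b)%R%:R)) - B a * (h x * ((a <= x)%R%:R * (x < b)%R%:R))).
  exact: intgB (intgB i1 (intgZ _ i2)) (intgZ _ i3).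
rewrite (J_diff ab iAB) (J_diff ab ig) (J_diff ab ih) -(RintZ (A a) i2) -(RintZ (B a) i3).
rewrite -(RintB i1 (intgZ _ i2)) -(RintB (intgB i1 (intgZ _ i2)) (intgZ _ i3)).
apply: le_trans (Rint_abs iL) _.
have -> : K * (I b - I a) ^+ 2 = \int[m]_x ((K * (I b - I a)) * ((`|g x| + `|h x|) * ((a <= x)%R%:R * (x < b)%R%:R))).
  rewrite RintZ; last exact: intg_seg.
  by rewrite -(J_diff ab igh) -/I; ring.
apply: Rint_le; [exact: intg_abs|apply: intgZ; exact: intg_seg|] => x.
case: (leP a x) => ax; last by rewrite !mul0r !mulr0 !subr0 normr0.
case: (ltP x b) => xb; last by rewrite !mulr0 !subr0 normr0.
rewrite !mulr1.
have -> : A x * g x + B x * h x - A a * g x - B a * h x = (A x - A a) * g x + (B x - B a) * h x by ring.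
rewrite (le_trans (ler_normD _ _))// mulrDr !normrM.
have Ix : K * (I x - I a) <= K * (I b - I a) by rewrite ler_wpM2l// lerB// nI// ltW.
have xt := le_trans (ltW xb) bt.
by rewrite lerD// ler_wpM2r// (le_trans _ Ix)// ?HA ?HB.
Qed.
End Chain.

(** * Convergence of the mollified energy *)

Section Ge0.
Context d (T : measurableType d) (R : realType) (m : {finite_measure set T -> \bar R}).
Lemma Rint_le_ge0 (f g : T -> R) : intg m f -> measurable_fun setT g ->
  (forall x, 0 <= g x) -> (forall x, f x <= g x) ->
  ((\int[m]_x f x)%:E <= \int[m]_x (g x)%:E)%E.
Proof.
move=> iF mg g0 fg.
have [H|H] := ltP (\int[m]_x (g x)%:E)%E +oo%E; last by rewrite (le_trans _ H)// leey.
have ig : intg m g.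
  by apply: intgP => //; under eq_integral do rewrite ger0_norm//.
by rewrite -EFin_Rint// lee_fin; exact: Rint_le.
Qed.

Lemma fin_pos_min (n : nat) (P : 'I_n -> R -> Prop) :
  (forall i e e', P i e -> e' <= e -> P i e') ->
  (forall i, exists2 e, 0 < e & P i e) -> exists2 e, 0 < e & forall i, P i e.
Proof.
move=> mon H; have /choice[f Hf] : forall i, exists e, 0 < e /\ P i e.
  by move=> i; have [e e0 Pe] := H i; exists e.
have [e e0 He] : exists2 e, 0 < e & forall i, i \in enum 'I_n -> e <= f i.
  elim: (enum 'I_n) => [|j s [e e0 IH]]; first by exists 1.
  exists (Num.min e (f j)); first by rewrite lt_min e0 (Hf j).1.
  by move=> i; rewrite inE ge_min => /predU1P[->|/IH ->//]; rewrite lexx orbT.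
by exists e => // i; apply: mon (Hf i).2 _; apply: He; rewrite mem_enum.
Qed.
End Ge0.

Section Energy.
Variables (R : realType) (d : nat).
Notation X := (d.-tuple R).
Notation mu := (muT R d).

(** The last clause concerns coordinates in [0, 1), so it places the support near the corner 0 of
    the cell and not near the other corners. *)
Definition mollifier (eta : X -> R) (N dl : R) :=
  [/\ measurable_fun setT eta, (forall x, `|eta x| <= N), (forall x, 0 <= eta x),
    \int[mu]_x eta x = 1 & forall x, cell x -> eta x != 0 -> forall i, `|tnth x i| < dl].

Lemma mollifier_mon eta N dl dl' : dl' <= dl -> mollifier eta N dl' -> mollifier eta N dl.
Proof. by move=> dd [h1 h2 h3 h4 h5]; split => // x cx ex i; rewrite (lt_le_trans (h5 x cx ex i)). Qed.

Lemma int_eta1 eta N dl : mollifier eta N dl -> (\int[mu]_x (eta x)%:E = 1)%E.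
Proof.
move=> [h1 h2 h3 h4 _]; rewrite -EFin_Rint ?h4//.
exact: intg_bounded h2.
Qed.

(** By Tonelli the error is at most the eta-average of the L^1 norms of f(x + a) - f(x), and each
    shift a in the support is small enough for [L1_translate]. *)
Lemma E_L1 (f : X -> R) e : perT f -> intg mu f -> 0 < e ->
  exists2 dl, 0 < dl & forall eta N, mollifier eta N dl ->
    \int[mu]_x `|EE eta f x - f x| <= e.
Proof.
move=> pf iF e0; have [dl dl0 H] := L1_translate pf iF e0; exists dl => // eta N Hm.
have [meta HN eta0 eta1 supp] := Hm.
have mf := intg_meas iF.
have iE x : intg mu (fun a => eta a * f (tadd x a)) by exact: (intg_E meta HN).
have mE : measurable_fun setT (EE eta f) by exact: EE_meas.
have mta : measurable_fun setT (fun p : X * X => f (tadd p.1 p.2)).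
  by apply: (measurableT_comp mf); exact: measurable_tadd.
have mg : measurable_fun setT (fun p : X * X => (eta p.2 * `|f (tadd p.1 p.2) - f p.1|)%:E).
  apply/measurable_EFinP; apply: measurable_funM; first exact: (measurableT_comp meta).
  apply: measurableT_comp => //; apply: measurable_funB => //.
  exact: (measurableT_comp mf).
suff B : (\int[mu]_x `|EE eta f x - f x|%:E <= e%:E)%E.
  rewrite /Rintegral -lee_fin fineK// ge0_fin_numE ?integral_ge0//.
  exact: le_lt_trans B (ltry _).
apply: (@le_trans _ _ (\int[mu]_x \int[mu]_a (eta a * `|f (tadd x a) - f x|)%:E)%E).
  apply: ge0_le_integral => //.
  - by apply/measurable_EFinP; apply: measurableT_comp => //; exact: measurable_funB.
  - exact: (@measurable_param _ _ X X R mu _ mg).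
  - move=> x _.
    have -> : EE eta f x - f x = \int[mu]_a (eta a * (f (tadd x a) - f x)).
      rewrite -[f x in LHS]mul1r -eta1 -RintZr; last exact: intg_bounded HN.
      rewrite /EE -RintB//; last by apply: intgZr; exact: intg_bounded HN.
      by apply: eq_Rintegral => a _; rewrite mulrBr.
    have iL : intg mu (fun a => eta a * (f (tadd x a) - f x)).
      apply: (@intgMb _ _ _ mu _ _ N) => //; apply: intgB; first exact: intg_shiftl.
      exact: intg_cst.
    apply: le_trans (_ : (\int[mu]_a `|eta a * (f (tadd x a) - f x)|)%:E <= _)%E.
      by rewrite lee_fin; exact: Rint_abs.
    rewrite EFin_Rint; last exact: intg_abs.
    rewrite le_eqVlt (_ : integral _ _ _ = \int[mu]_a (eta a * `|f (tadd x a) - f x|)%:E)%E ?eqxx//.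
    by apply: eq_integral => a _; rewrite normrM ger0_norm.
rewrite (@fubini_tonelli _ _ X X R mu mu _ mg)/=; last by move=> p; rewrite lee_fin mulr_ge0.
have mG : measurable_fun setT (fun a => \int[mu]_x (eta a * `|f (tadd x a) - f x|)%:E)%E.
  apply: (@measurable_param _ _ X X R mu (fun p => (eta p.1 * `|f (tadd p.2 p.1) - f p.2|)%:E)).
  apply/measurable_EFinP; apply: measurable_funM; first exact: (measurableT_comp meta).
  apply: measurableT_comp => //; apply: measurable_funB; last exact: (measurableT_comp mf).
  by apply: (measurableT_comp mf); exact: measurable_tadd.
rewrite ge0_integral_muT_cell; last 2 first.
- exact: mG.
- by move=> a; apply: integral_ge0 => x _; rewrite lee_fin mulr_ge0.
have mh (a : X) : measurable_fun setT (fun x : X => `|f (tadd x a) - f x|%:E).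
  apply/measurable_EFinP; apply: measurableT_comp => //; apply: measurable_funB => //.
  by apply: (measurableT_comp mf); exact: measurable_taddl.
apply: (@le_trans _ _ (\int[mu]_(a in @cell R d) ((eta a)%:E * e%:E))%E).
  apply: ge0_le_integral => //.
  - exact: measurable_cell.
  - by move=> a _; apply: integral_ge0 => x _; rewrite lee_fin mulr_ge0.
  - apply: measurable_funTS.
    exact: mG.
  - by apply: measurable_funTS; apply: emeasurable_funM => //; exact/measurable_EFinP.
  - move=> a ca; under eq_integral do rewrite EFinM.
    rewrite ge0_integralZl//; last by rewrite lee_fin.
    have [->|ea] := eqVneq (eta a) 0; first by rewrite !mul0e.
    by apply: lee_wpmul2l; [rewrite lee_fin|apply: H; exact: supp].
rewrite -ge0_integral_muT_cell; last 2 first.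
- by apply: emeasurable_funM => //; exact/measurable_EFinP.
- by move=> a; rewrite -EFinM lee_fin mulr_ge0// ltW.
rewrite ge0_integralZr//; last 3 first.
- exact/measurable_EFinP.
- by move=> x _; rewrite lee_fin.
- by rewrite lee_fin ltW.
by rewrite (int_eta1 Hm) mul1e.
Qed.

Variables (c C gamma : R).
Hypotheses (c0 : 0 < c) (gamma1 : 1 < gamma).
Variables (rho : X -> R) (a : 'I_d -> X -> R).
Hypotheses (prho : perT rho) (mrho : measurable_fun setT rho) (rhoc : forall x, c <= rho x <= C).
Hypotheses (pa : forall i, perT (a i)) (ma : forall i, measurable_fun setT (a i))
  (ia : forall i, intg mu (fun y => rho y * a i y)).

(** Pointwise real, but possibly not integrable; its integrals are therefore taken in the extended
    reals, while those of [enE] are finite. *)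
Definition en x : R := \sum_(i < d) 2^-1 * (rho x * a i x ^+ 2) + rho x `^ gamma / (gamma - 1).
Definition enE (eta : X -> R) x : R :=
  \sum_(i < d) 2^-1 * (EE eta (fun y => rho y * a i y) x ^+ 2 / EE eta rho x)
  + EE eta rho x `^ gamma / (gamma - 1).

Let pint_m i : pint (fun y => rho y * a i y).
Proof. by split => // x j; rewrite prho pa. Qed.
Let pint_r : pint rho. Proof. exact: (pint_rho prho mrho c0 rhoc). Qed.
Let rho0 x : 0 < rho x. Proof. by have /andP[h _] := rhoc x; exact: lt_le_trans h. Qed.
Let g0 : 0 < gamma. Proof. exact: lt_trans gamma1. Qed.
Let g10 : 0 < gamma - 1. Proof. by rewrite subr_gt0. Qed.

Lemma en_ge0 x : 0 <= en x.
Proof.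
apply: addr_ge0; last by rewrite divr_ge0 ?powR_ge0 ?ltW.
by apply: sumr_ge0 => i _; rewrite mulr_ge0 ?invr_ge0// mulr_ge0 ?sqr_ge0// ltW.
Qed.
Lemma per_en : perT en.
Proof. by move=> x j; rewrite /en prho; congr (_ + _); apply: eq_bigr => i _; rewrite pa. Qed.
Lemma meas_en : measurable_fun setT en.
Proof.
apply: measurable_funD.
  apply: measurable_sum => i; apply: measurable_funM => //; apply: measurable_funM => //.
  exact: measurable_funX.
by apply: measurable_funM => //; exact: (measurableT_comp (measurable_powR gamma) mrho).
Qed.

(* tangent (lower) approximation of the energy density at velocity v and density r *)
Definition tang (v : 'I_d -> R) (r s : R) (m : 'I_d -> R) : R :=
  \sum_(i < d) (v i * m i - 2^-1 * v i ^+ 2 * s)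
  + (r `^ gamma + gamma * r `^ (gamma - 1) * (s - r)) / (gamma - 1).

Lemma kin_tang (v s m : R) : 0 < s -> v * m - 2^-1 * v ^+ 2 * s <= 2^-1 * (m ^+ 2 / s).
Proof.
move=> s0; rewrite -subr_ge0.
have -> : 2^-1 * (m ^+ 2 / s) - (v * m - 2^-1 * v ^+ 2 * s) = 2^-1 * (m - v * s) ^+ 2 / s.
  by field; rewrite gt_eqF.
apply: divr_ge0; last exact: ltW.
by rewrite mulr_ge0 ?sqr_ge0 ?invr_ge0.
Qed.

Lemma tang_le v r s m : c <= r <= C -> c <= s <= C ->
  tang v r s m <= \sum_(i < d) 2^-1 * (m i ^+ 2 / s) + s `^ gamma / (gamma - 1).
Proof.
move=> rI sI; have /andP[cs _] := sI; have s0 : 0 < s by exact: lt_le_trans cs.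
apply: lerD; first by apply: ler_sum => i _; exact: kin_tang.
rewrite ler_wpM2r ?invr_ge0 ?(ltW g10)//.
have /andP[h _] := powR_tangent c0 gamma1 sI rI.
by rewrite -subr_ge0 opprD addrA.
Qed.

Section Fixed.
Variables (eta : X -> R) (N dl : R).
Hypothesis Hm : mollifier eta N dl.
Let meta : measurable_fun setT eta. Proof. by case: Hm. Qed.
Let HN : forall x, `|eta x| <= N. Proof. by case: Hm. Qed.
Let eta0 : forall x, 0 <= eta x. Proof. by case: Hm. Qed.
Let eta1 : \int[mu]_x eta x = 1. Proof. by case: Hm. Qed.
Let rI x : c <= EE eta rho x <= C.
Proof. exact: (@r_itv R d eta N meta HN eta0 eta1 rho c C). Qed.
Let r0 x : 0 < EE eta rho x.
Proof. by have /andP[h _] := rI x; exact: lt_le_trans h. Qed.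

Lemma bm_enE : bm (enE eta).
Proof.
have br : bm (EE eta rho) by exact: (bmE meta HN).
have brV : bm (fun x => (EE eta rho x)^-1) by apply: (bmV br c0) => x; have /andP[] := rI x.
apply: bmD.
  have : forall s : seq 'I_d, bm (fun x => \sum_(i <- s) 2^-1 * (EE eta (fun y => rho y * a i y) x ^+ 2 / EE eta rho x)).
    elim=> [|i s IH]; first by under eq_fun do rewrite big_nil; exact: bm_cst.
    under eq_fun do rewrite big_cons; apply: bmD => //; apply: bmM; first exact: bm_cst.
    by apply: bmM => //; apply: bmX; exact: (bmE meta HN).
  exact.
apply: bmM; last exact: bm_cst.
split; first exact: (measurableT_comp (measurable_powR gamma) br.1).
exists (c `^ gamma + C `^ gamma) => x; rewrite ger0_norm ?powR_ge0//.
exact: powR_bnd.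
Qed.

(** Jensen's inequality by hand: the tangent [low] at the averaged state of x is affine in the
    density and the momentum, lies below [en], and averages exactly to [enE] at x. Shift invariance
    and the unit mass of eta then remove the average of [en]. *)
Lemma enE_le : ((\int[mu]_x enE eta x)%:E <= \int[mu]_x (en x)%:E)%E.
Proof.
have mta : measurable_fun setT (fun p : X * X => en (tadd p.1 p.2)).
  by apply: (measurableT_comp meas_en); exact: measurable_tadd.
have mg : measurable_fun setT (fun p : X * X => (eta p.2 * en (tadd p.1 p.2))%:E).
  by apply/measurable_EFinP; apply: measurable_funM => //; exact: (measurableT_comp meta).
have g0' (p : X * X) : (0 <= (eta p.2 * en (tadd p.1 p.2))%:E)%E by rewrite lee_fin mulr_ge0// en_ge0.
rewrite EFin_Rint; last exact: bm_intg bm_enE.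
apply: (@le_trans _ _ (\int[mu]_x \int[mu]_b (eta b * en (tadd x b))%:E)%E).
  apply: ge0_le_integral => //.
  - move=> x _; rewrite lee_fin; apply: addr_ge0.
      by apply: sumr_ge0 => i _; rewrite mulr_ge0 ?invr_ge0// divr_ge0 ?sqr_ge0// ltW.
    by rewrite divr_ge0 ?powR_ge0// ltW.
  - by apply/measurable_EFinP; exact: bm_enE.1.
  - exact: (@measurable_param _ _ X X R mu _ mg).
  move=> x _; set r := EE eta rho x; have rp : 0 < r by exact: r0.
  pose v i := EE eta (fun y => rho y * a i y) x / r.
  pose low y := tang v r (rho y) (fun i => rho y * a i y).
  have lowE : low = (fun y => \sum_(i < d) v i * (rho y * a i y) +
     ((gamma * r `^ (gamma - 1) / (gamma - 1) - \sum_(i < d) 2^-1 * v i ^+ 2) * rho y +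
     (r `^ gamma - gamma * r `^ (gamma - 1) * r) / (gamma - 1))).
    apply/funext => y; rewrite /low /tang sumrB -mulr_suml.
    set S1 := \sum_(i < d) v i * _; set S2 := \sum_(i < d) 2^-1 * _.
    move: S1 S2 (r `^ gamma) (r `^ (gamma - 1)) => S1 S2 P Q.
    by field; rewrite gt_eqF.
  have i1 : intg mu (fun y => \sum_(i < d) v i * (rho y * a i y)).
    by apply: intg_sum => i; apply: intgZ; exact: (pint_m i).2.
  have p1 : perT (fun y => \sum_(i < d) v i * (rho y * a i y)).
    by move=> y j; apply: eq_bigr => i _; rewrite (pint_m i).1.
  have plow : pint low.
    rewrite lowE; apply: pintD; first by split.
    by apply: pintD; [exact: pintZ|exact: pint_cst].
  have Elow : EE eta low x = enE eta x.
    rewrite lowE (EE_add meta HN); [|by split|by apply: pintD; [exact: pintZ|exact: pint_cst]].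
    rewrite (EE_add meta HN); [|exact: pintZ|exact: pint_cst].
    rewrite (EE_scale meta HN)// (@E_cst R d eta N meta HN eta1).
    have -> : EE eta (fun y => \sum_(i < d) v i * (rho y * a i y)) x = \sum_(i < d) v i * (v i * r).
      rewrite /EE; under eq_Rintegral do rewrite mulr_sumr.
      rewrite Rint_sum; last first.
        move=> i; have := intgZ (v i) (intg_E meta HN x (pint_m i).1 (pint_m i).2).
        by congr (integrable _ _ _); apply/funext => y /=; rewrite mulrCA.
      apply: eq_bigr => i _; rewrite /v divfK ?gt_eqF//.
      rewrite -/(v i) -RintZ; last exact: (intg_E meta HN x (pint_m i).1 (pint_m i).2).
      by apply: eq_Rintegral => y _; rewrite mulrCA.
    have -> : enE eta x = (\sum_(i < d) v i * (v i * r) - (\sum_(i < d) 2^-1 * v i ^+ 2) * r) + r `^ gamma / (gamma - 1).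
      rewrite mulr_suml -sumrB /enE -/r; congr (_ + _); apply: eq_bigr => i _.
      by rewrite /v; field; rewrite gt_eqF.
    rewrite -/r; set S1 := \sum_(i < d) v i * _; set S2 := \sum_(i < d) 2^-1 * _.
    move: S1 S2 (r `^ gamma) (r `^ (gamma - 1)) => S1 S2 P Q.
    by field; rewrite gt_eqF.
  rewrite -Elow; apply: Rint_le_ge0.
  - exact: (intg_E meta HN x plow.1 plow.2).
  - by apply: measurable_funM => //; apply: measurable_shiftl; exact: meas_en.
  - by move=> y; rewrite mulr_ge0// en_ge0.
  - move=> y; rewrite ler_wpM2l//; apply: le_trans (tang_le _ _ (rI x) (rhoc _)) _.
    rewrite /en lerD2r le_eqVlt; apply/orP; left; apply/eqP; apply: eq_bigr => i _; congr (_ * _).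
    by field; rewrite gt_eqF.
rewrite (@fubini_tonelli _ _ X X R mu mu _ mg)//=.
have me (b : X) : measurable_fun setT (fun x : X => (en (tadd x b))%:E).
  by apply/measurable_EFinP; apply: (measurableT_comp meas_en); exact: measurable_taddl.
have -> : (\int[mu]_b \int[mu]_x (eta b * en (tadd x b))%:E = \int[mu]_b ((eta b)%:E * \int[mu]_x (en x)%:E))%E.
  apply: eq_integral => b _; under eq_integral do rewrite EFinM.
  have en0 : forall x, setT x -> (0 <= (en (tadd x b))%:E)%E by move=> x _; rewrite lee_fin en_ge0.
  have eb0 : (0 <= (eta b)%:E)%E by rewrite lee_fin.
  rewrite (@ge0_integralZl _ _ _ mu setT measurableT _ (me b) (eta b)%:E en0 eb0).
  have me0 : measurable_fun setT (fun x : X => (en x)%:E) by apply/measurable_EFinP; exact: meas_en.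
  have en0' : forall x : X, (0 <= (en x)%:E)%E by move=> x; rewrite lee_fin en_ge0.
  have pen' : perT (fun x : X => (en x)%:E) by move=> x j; rewrite per_en.
  by rewrite (@ge0_muT_shift R d (fun x => (en x)%:E) b me0 en0' pen').
rewrite ge0_integralZr//; [|exact/measurable_EFinP|by move=> x _; rewrite lee_fin|].
  by rewrite (int_eta1 Hm) mul1e.
by apply: integral_ge0 => x _; rewrite lee_fin en_ge0.
Qed.
End Fixed.

(** Large values are sent to 0 and not to k. This keeps trunc(s)^2 = trunc(s) s, so the tangent at
    the truncated velocity reproduces the truncated energy exactly at the true momentum. *)
Definition trunc (k : nat) (s : R) : R := if `|s| <= k%:R then s else 0.
Lemma trunc_le k s : `|trunc k s| <= k%:R.
Proof. by rewrite /trunc; case: ifP => // _; rewrite normr0. Qed.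
Lemma trunc_meas k : measurable_fun setT (trunc k : measurableTypeR R -> R).
Proof.
apply: measurable_fun_ifT => //.
apply: measurable_fun_ler => //; exact: measurableT_comp.
Qed.

Definition enk (k : nat) x : R :=
  \sum_(i < d) 2^-1 * (rho x * trunc k (a i x) ^+ 2) + rho x `^ gamma / (gamma - 1).

Lemma enk_ge0 k x : 0 <= enk k x.
Proof.
apply: addr_ge0; last by rewrite divr_ge0 ?powR_ge0 ?ltW.
by apply: sumr_ge0 => i _; rewrite mulr_ge0 ?invr_ge0// mulr_ge0 ?sqr_ge0// ltW.
Qed.

Lemma enk_nd x k l : (k <= l)%N -> enk k x <= enk l x.
Proof.
move=> kl; rewrite lerD2r; apply: ler_sum => i _.
rewrite ler_pM2l ?invr_gt0// ler_pM2l// /trunc.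
case: ifP => h1; first by rewrite (le_trans h1) ?ler_nat.
by rewrite expr0n/= sqr_ge0.
Qed.

Lemma bm_enk k : bm (enk k).
Proof.
have br : bm rho by exact: (bm_rho mrho c0 rhoc).
apply: bmD.
  have : forall s : seq 'I_d, bm (fun x => \sum_(i <- s) 2^-1 * (rho x * trunc k (a i x) ^+ 2)).
    elim=> [|i s IH]; first by under eq_fun do rewrite big_nil; exact: bm_cst.
    under eq_fun do rewrite big_cons; apply: bmD => //; apply: bmM; first exact: bm_cst.
    apply: bmM => //; apply: bmX; split; first exact: (measurableT_comp (trunc_meas k) (ma i)).
    by exists k%:R => x; exact: trunc_le.
  exact.
apply: bmM; last exact: bm_cst.
split; first exact: (measurableT_comp (measurable_powR gamma) mrho).
exists (c `^ gamma + C `^ gamma) => x; rewrite ger0_norm ?powR_ge0//.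
exact: powR_bnd.
Qed.

Lemma enk_cvg : ((\int[mu]_x (enk k x)%:E)%E @[k --> \oo] --> (\int[mu]_x (en x)%:E)%E)%classic.
Proof.
have -> : (\int[mu]_x (en x)%:E = \int[mu]_x limn (fun k => (enk k x)%:E))%E.
  apply: eq_integral => x _; apply/esym/cvg_lim => //.
  apply: cvg_near_cst; near=> k; congr (_%:E); congr (_ + _); apply: eq_bigr => i _.
  congr (_ * (_ * _ ^+ 2)); rewrite /trunc ifT//.
  rewrite (@le_trans _ _ (\sum_(j < d) `|a j x|))//.
    by rewrite (bigD1 i)//= lerDl sumr_ge0.
  by near: k; exact: nbhs_infty_ger.
apply: cvg_monotone_convergence => //.
- by move=> k; apply/measurable_EFinP; exact: (bm_enk k).1.
- by move=> k x _; rewrite lee_fin enk_ge0.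
- by move=> x _ k l kl; rewrite lee_fin enk_nd.
Unshelve. all: by end_near. Qed.

(** A quantitative form of the lower semicontinuity. Pick a truncation whose energy already exceeds
    A; [enE] lies above the tangent at the truncated state, which differs from the truncated energy
    by terms linear in the L^1 errors of the mollified density and momenta, and [E_L1] makes these
    small. *)
Lemma enE_ge (A : R) : (A%:E < \int[mu]_x (en x)%:E)%E ->
  exists2 dl, 0 < dl & forall eta N, mollifier eta N dl -> A <= \int[mu]_x enE eta x.
Proof.
move=> HA.
have [k Hk] : exists k, A < \int[mu]_x enk k x.
  apply: contrapT => nk; move: HA; rewrite ltNge => /negP; apply.
  rewrite -(cvg_lim (@ereal_hausdorff R) enk_cvg).
  apply: lime_le; first by apply/cvg_ex; eexists; exact: enk_cvg.
  apply: nearW => k; rewrite -EFin_Rint; last exact: bm_intg (bm_enk k).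
  by rewrite lee_fin leNgt; apply/negP => h; apply: nk; exists k.
set I := \int[mu]_x enk k x in Hk.
have C0 : 0 < C.
  by have /andP[h1 h2] := rhoc [tuple 0 | i < d]; exact: lt_le_trans (lt_le_trans c0 h1) h2.
(* K - 1 is the total Lipschitz constant of that tangent in density and momenta for velocities of
   size at most k; the added 1 makes K positive. *)
pose K : R := d%:R * (k%:R + 2^-1 * k%:R ^+ 2) + gamma / (gamma - 1) * (c `^ (gamma - 1) + C `^ (gamma - 1)) + 1.
have Kp : 0 < K.
  apply: ltr_wpDl => //; apply: addr_ge0; first by rewrite mulr_ge0// addr_ge0// mulr_ge0 ?invr_ge0 ?exprn_ge0.
  by rewrite mulr_ge0 ?addr_ge0 ?powR_ge0// divr_ge0 ?ltW.
pose e := (I - A) / K.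
have e0 : 0 < e by rewrite divr_gt0// subr_gt0.
have [dl1 dl10 H1] := E_L1 prho pint_r.2 e0.
have [dl2 dl20 H2] := @fin_pos_min R d
  (fun i dl => forall eta N, mollifier eta N dl ->
    \int[mu]_x `|EE eta (fun y => rho y * a i y) x - rho x * a i x| <= e)
  (fun i dl dl' H dd eta N Hm => H eta N (mollifier_mon dd Hm))
  (fun i => E_L1 (pint_m i).1 (pint_m i).2 e0).
exists (Num.min dl1 dl2); first by rewrite lt_min dl10.
move=> eta N Hm.
have m1 : Num.min dl1 dl2 <= dl1 by rewrite ge_min lexx.
have m2 : Num.min dl1 dl2 <= dl2 by rewrite ge_min lexx orbT.
have {}H1 := H1 _ _ (mollifier_mon m1 Hm).
have {}H2 i := H2 i _ _ (mollifier_mon m2 Hm).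
have [meta HN eta0 eta1 _] := Hm.
have rI x : c <= EE eta rho x <= C by exact: (@r_itv R d eta N meta HN eta0 eta1 rho c C).
have bE f : pint f -> bm (EE eta f) by move=> pf; exact: (bmE meta HN).
have i1 : intg mu (fun x => `|EE eta rho x - rho x|).
  by apply: intg_abs; apply: intgB; [exact: bm_intg (bE _ pint_r)|exact: pint_r.2].
have i2 i : intg mu (fun x => `|EE eta (fun y => rho y * a i y) x - rho x * a i x|).
  by apply: intg_abs; apply: intgB; [exact: bm_intg (bE _ (pint_m i))|exact: (pint_m i).2].
pose K1 : R := d%:R * (2^-1 * k%:R ^+ 2) + gamma / (gamma - 1) * (c `^ (gamma - 1) + C `^ (gamma - 1)).
have pw x : enk k x - (k%:R * (\sum_(i < d) `|EE eta (fun y => rho y * a i y) x - rho x * a i x|)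
     + K1 * `|EE eta rho x - rho x|) <= enE eta x.
  have Htg := tang_le (fun i => trunc k (a i x)) (fun i => EE eta (fun y => rho y * a i y) x) (rhoc x) (rI x).
  apply: le_trans Htg.
  rewrite lerBlDr -lerBlDl.
  set r := EE eta rho x.
  have -> : enk k x - tang (fun i => trunc k (a i x)) (rho x) r (fun i => EE eta (fun y => rho y * a i y) x)
     = \sum_(i < d) (trunc k (a i x) * (rho x * a i x - EE eta (fun y => rho y * a i y) x)
          + 2^-1 * trunc k (a i x) ^+ 2 * (r - rho x))
       - gamma / (gamma - 1) * rho x `^ (gamma - 1) * (r - rho x).
    rewrite /enk /tang opprD addrACA -sumrB; congr (_ + _); last by field; rewrite gt_eqF.
    apply: eq_bigr => i _.
    have E : rho x * trunc k (a i x) ^+ 2 = trunc k (a i x) * (rho x * a i x).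
      by rewrite /trunc; case: ifP => _; rewrite ?expr0n/= ?mul0r ?mulr0// expr2; ring.
    have E' : 2^-1 * (rho x * trunc k (a i x) ^+ 2) = trunc k (a i x) * (rho x * a i x) - 2^-1 * (rho x * trunc k (a i x) ^+ 2).
      by rewrite -E; field.
    by rewrite E'; ring.
  have B1 : - (gamma / (gamma - 1) * rho x `^ (gamma - 1) * (r - rho x)) <=
      gamma / (gamma - 1) * (c `^ (gamma - 1) + C `^ (gamma - 1)) * `|r - rho x|.
    have : 0 <= gamma / (gamma - 1) by rewrite divr_ge0 ?(ltW g0) ?(ltW g10).
    move: (gamma / (gamma - 1)) => k0 k00; rewrite -mulrN -!mulrA; apply: ler_wpM2l => //.
    apply: le_trans (ler_norm _) _; rewrite normrM normrN ler_wpM2r//.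
    by rewrite ger0_norm ?powR_ge0//; exact: powR_bnd.
  have B2 : \sum_(i < d) (trunc k (a i x) * (rho x * a i x - EE eta (fun y => rho y * a i y) x)
          + 2^-1 * trunc k (a i x) ^+ 2 * (r - rho x)) <=
     k%:R * (\sum_(i < d) `|EE eta (fun y => rho y * a i y) x - rho x * a i x|)
      + d%:R * (2^-1 * k%:R ^+ 2) * `|r - rho x|.
    have -> : d%:R * (2^-1 * k%:R ^+ 2) * `|r - rho x| = \sum_(i < d) (2^-1 * k%:R ^+ 2) * `|r - rho x|.
      by rewrite sumr_const card_ord -mulrA mulr_natl.
    rewrite mulr_sumr -big_split/=; apply: ler_sum => i _; apply: lerD.
      by apply: le_trans (ler_norm _) _; rewrite normrM distrC ler_wpM2r// trunc_le.
    apply: le_trans (ler_norm _) _; rewrite normrM; apply: ler_wpM2r => //.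
    rewrite normrM ger0_norm ?invr_ge0// ler_pM2l ?invr_gt0// normrX.
    by rewrite ler_pXn2r ?nnegrE//; exact: trunc_le.
  rewrite /K1 mulrDl addrA; exact: lerD.
have iS : intg mu (fun x => \sum_(i < d) `|EE eta (fun y => rho y * a i y) x - rho x * a i x|).
  exact: intg_sum.
have ik := bm_intg mu (bm_enk k).
have iR := intgD (intgZ k%:R iS) (intgZ K1 i1).
apply: le_trans (_ : \int[mu]_x (enk k x - (k%:R * (\sum_(i < d) `|EE eta (fun y => rho y * a i y) x - rho x * a i x|)
     + K1 * `|EE eta rho x - rho x|)) <= _); last first.
  by apply: Rint_le => //; [exact: intgB|exact: bm_intg (bm_enE Hm)].
rewrite (RintB ik iR) (RintD (intgZ _ iS) (intgZ _ i1)).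
rewrite (RintZ _ iS) (RintZ _ i1) Rint_sum// -/I lerBrDr -lerBrDl.
have K10 : 0 <= K1.
  apply: addr_ge0; first by rewrite !mulr_ge0 ?invr_ge0 ?exprn_ge0.
  by rewrite mulr_ge0 ?addr_ge0 ?powR_ge0// divr_ge0 ?ltW.
apply: (@le_trans _ _ (k%:R * (d%:R * e) + K1 * e)).
  apply: lerD; apply: ler_wpM2l => //.
  by apply: le_trans (ler_sum _ (fun i _ => H2 i)) _; rewrite sumr_const card_ord mulr_natl.
rewrite (_ : k%:R * (d%:R * e) + K1 * e = (K - 1) * e); last by rewrite /K /K1; ring.
apply: (@le_trans _ _ (K * e)); first by rewrite ler_pM2r// lerBlDr lerDl.
by rewrite /e mulrC divfK// gt_eqF.
Qed.
End Energy.

(** * Cubic increments integrated in time *)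

Section Slices.
Context d1 d2 d3 (Y1 : measurableType d1) (Y2 : measurableType d2) (Y3 : measurableType d3).
Variable f : Y1 * Y2 -> Y3.
Hypothesis mf : measurable_fun setT f.
Lemma meas_sect1 (a : Y1) : measurable_fun setT (fun y => f (a, y)).
Proof.
have h : measurable_fun setT (fun y : Y2 => (a, y)).
  by apply: measurable_fun_pair; [exact: measurable_cst|exact: measurable_id].
exact: (measurableT_comp mf h).
Qed.
Lemma meas_sect2 (b : Y2) : measurable_fun setT (fun y => f (y, b)).
Proof.
have h : measurable_fun setT (fun y : Y1 => (y, b)).
  by apply: measurable_fun_pair; [exact: measurable_id|exact: measurable_cst].
exact: (measurableT_comp mf h).
Qed.
End Slices.

Section Swap3.
Context d1 d2 d3 (Y1 : measurableType d1) (Y2 : measurableType d2) (Y3 : measurableType d3) (R : realType)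
  (m1 : {finite_measure set Y1 -> \bar R}) (m2 : {finite_measure set Y2 -> \bar R})
  (m3 : {finite_measure set Y3 -> \bar R}).
Lemma tonelli3 (H : (Y1 * Y2) * Y3 -> \bar R) : measurable_fun setT H -> (forall q, 0 <= H q)%E ->
  (\int[m1]_t \int[m2]_x \int[m3]_a H ((t, x), a) = \int[m3]_a \int[m1]_t \int[m2]_x H ((t, x), a))%E.
Proof.
move=> mH H0.
have ms t : measurable_fun setT (fun q : Y2 * Y3 => H ((t, q.1), q.2)).
  apply: (measurableT_comp mH); apply: measurable_fun_pair => //.
  by apply: measurable_fun_pair => //; exact: measurable_cst.
have mt : measurable_fun setT (fun q : Y1 * Y3 => (\int[m2]_x H ((q.1, x), q.2))%E).
  apply: (@measurable_param _ _ (Y1 * Y3)%type Y2 R m2 (fun p => H ((p.1.1, p.2), p.1.2))).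
  apply: (measurableT_comp mH); apply: measurable_fun_pair; last exact: (measurableT_comp measurable_snd).
  by apply: measurable_fun_pair => //; exact: (measurableT_comp measurable_fst).
have E t : (\int[m2]_x \int[m3]_a H ((t, x), a) = \int[m3]_a \int[m2]_x H ((t, x), a))%E.
  exact: (@fubini_tonelli _ _ Y2 Y3 R m2 m3 _ (ms t) (fun q => H0 _)).
under eq_integral do rewrite E.
by apply: (@fubini_tonelli _ _ Y1 Y3 R m1 m3 _ mt) => q; apply: integral_ge0.
Qed.
End Swap3.

Section YITime.
Variables (R : realType) (d : nat) (T : R).
Notation X := (d.-tuple R).
Notation RM := (measurableTypeR R).
Notation mu := (muT R d).
Notation m := (lamT T).
Variables (eta : X -> R) (etaj : 'I_d -> X -> R) (L : R) (j : 'I_d).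
Hypotheses (meta : measurable_fun setT eta) (metaj : forall j, measurable_fun setT (etaj j)).
Hypotheses (eta0 : forall x, 0 <= eta x) (eta1 : (\int[mu]_x (eta x)%:E = 1)%E) (L0 : 0 <= L)
  (etaL : (\int[mu]_x `|etaj j x|%:E <= L%:E)%E).
Variable (w : X -> R -> R).
Hypothesis mw : measurable_fun setT (fun p : X * RM => w p.1 p.2).
Lemma mw2 d' (Y : measurableType d') (f : Y -> X) (g : Y -> RM) :
  measurable_fun setT f -> measurable_fun setT g -> measurable_fun setT (fun y => w (f y) (g y)).
Proof. by move=> mf mg; exact: (measurableT_comp mw (measurable_fun_pair mf mg)). Qed.

Notation kp := (kap eta etaj L j).

Lemma kap_ge0 x : 0 <= kp x. Proof. by rewrite addr_ge0// mulr_ge0. Qed.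
Lemma kap_meas : measurable_fun setT kp.
Proof.
by apply: measurable_funD; [exact: measurableT_comp|exact: measurable_funM].
Qed.

Let D (al be : X) (t : RM) (x : X) : \bar R := (`|w (tadd x al) t - w (tadd x be) t| ^+ 3)%:E.
Let k (P : X * X) : \bar R := (kp P.1 * eta P.2)%:E.
Let D0 al be t x : (0 <= D al be t x)%E. Proof. by rewrite lee_fin exprn_ge0. Qed.
Let k0 P : (0 <= k P)%E. Proof. by rewrite lee_fin mulr_ge0// kap_ge0. Qed.

(** A divergent real-valued integral has the default value 0, so passing to real values never
    increases a nonnegative integral. This spares integrability proofs for the inner integrals of
    [YY]. *)
Let fine_le (y : \bar R) : (0 <= y)%E -> ((fine y)%:E <= y)%E.
Proof. by case: y => [r| |] //= _; rewrite leey. Qed.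

Let F (q : ((RM * X) * X) * X) : \bar R := (k (q.1.2, q.2) * D q.1.2 q.2 q.1.1.1 q.1.1.2)%E.
Let F0 q : (0 <= F q)%E. Proof. by rewrite mule_ge0. Qed.

Let mD : measurable_fun setT (fun q : ((RM * X) * X) * X => D q.1.2 q.2 q.1.1.1 q.1.1.2).
Proof.
have m1 : measurable_fun setT (fun q : ((RM * X) * X) * X => q.1.1) by exact: (measurableT_comp measurable_fst).
have m11 : measurable_fun setT (fun q : ((RM * X) * X) * X => q.1.1.1) by exact: (measurableT_comp measurable_fst).
have m12 : measurable_fun setT (fun q : ((RM * X) * X) * X => q.1.1.2) by exact: (measurableT_comp measurable_snd).
have m21 : measurable_fun setT (fun q : ((RM * X) * X) * X => q.1.2) by exact: (measurableT_comp measurable_snd).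
apply/measurable_EFinP; apply: measurable_funX; apply: measurableT_comp => //.
apply: measurable_funB.
  by apply: mw2 => //; exact: measurable_tadd.
by apply: mw2 => //; exact: measurable_tadd.
Qed.
Let mk : measurable_fun setT k.
Proof.
apply/measurable_EFinP; apply: measurable_funM.
  exact: (measurableT_comp kap_meas measurable_fst).
exact: (measurableT_comp meta measurable_snd).
Qed.
Let mF : measurable_fun setT F.
Proof.
apply: emeasurable_funM; last exact: mD.
have h : measurable_fun setT (fun q : ((RM * X) * X) * X => (q.1.2, q.2)).
  by apply: measurable_fun_pair => //; exact: (measurableT_comp measurable_snd).
exact: (measurableT_comp mk h).
Qed.
Let mG : measurable_fun setT (fun a : (RM * X) * X => \int[mu]_be F (a, be))%E.
Proof. exact: (@measurable_param _ _ ((RM * X) * X)%type X R mu F mF). Qed.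
Let mGG : measurable_fun setT (fun a : RM * X => \int[mu]_al \int[mu]_be F ((a, al), be))%E.
Proof. exact: (@measurable_param _ _ (RM * X)%type X R mu _ mG). Qed.

Let YY_le t x : ((YY eta etaj L j (w^~ t) x)%:E <= \int[mu]_al \int[mu]_be F (((t, x), al), be))%E.
Proof.
have mb (al : X) : measurable_fun setT (fun be : X => (eta be * `|w (tadd x al) t - w (tadd x be) t| ^+ 3)%:E).
  have h : measurable_fun setT (fun be : X => w (tadd x be) t).
    apply: mw2; last exact: measurable_cst.
    by apply: measurable_tadd => //; exact: measurable_cst.
  apply/measurable_EFinP; apply: measurable_funM => //; apply: measurable_funX.
  by apply: measurableT_comp => //; exact: measurable_funB.
apply: le_trans (fine_le _) _.
  apply: integral_ge0 => al _; rewrite lee_fin mulr_ge0 ?kap_ge0//.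
  by apply: Rint_ge0 => be; rewrite mulr_ge0 ?exprn_ge0.
have mP : measurable_fun setT (fun al : X => (\int[mu]_be F (((t, x), al), be))%E).
  exact: (meas_sect1 mG (t, x)).
have mL : measurable_fun setT (fun al : X => (kp al * \int[mu]_be (eta be * `|w (tadd x al) t - w (tadd x be) t| ^+ 3))%:E).
  apply/measurable_EFinP; apply: measurable_funM; first exact: kap_meas.
  apply: (@measurable_Rparam _ _ X X R mu (fun p => eta p.2 * `|w (tadd x p.1) t - w (tadd x p.2) t| ^+ 3)).
  apply: measurable_funM; first exact: (measurableT_comp meta).
  apply: measurable_funX; apply: measurableT_comp => //.
  have h1 : measurable_fun setT (fun p : X * X => w (tadd x p.1) t).
    apply: mw2; last exact: measurable_cst.
    by apply: measurable_tadd => //; exact: measurable_cst.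
  have h2 : measurable_fun setT (fun p : X * X => w (tadd x p.2) t).
    apply: mw2; last exact: measurable_cst.
    by apply: measurable_tadd => //; exact: measurable_cst.
  exact: measurable_funB.
apply: ge0_le_integral => //.
  move=> al _; rewrite lee_fin mulr_ge0 ?kap_ge0//.
  by apply: Rint_ge0 => be; rewrite mulr_ge0 ?exprn_ge0.
move=> al _; rewrite EFinM.
have -> : (\int[mu]_be F (t, x, al, be) =
    (kp al)%:E * \int[mu]_be (eta be * `|w (tadd x al) t - w (tadd x be) t| ^+ 3)%:E)%E.
  have e0 : forall be : X, setT be -> (0 <= (eta be * `|w (tadd x al) t - w (tadd x be) t| ^+ 3)%:E)%E.
    by move=> be _; rewrite lee_fin mulr_ge0 ?exprn_ge0.
  have ka0 : (0 <= (kp al)%:E)%E by rewrite lee_fin kap_ge0.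
  rewrite -(@ge0_integralZl _ _ _ mu setT measurableT _ (mb al) (kp al)%:E e0 ka0).
  apply: eq_integral => be _; rewrite /F /k /D/=. by rewrite -!EFinM -mulrA.
apply: lee_wpmul2l; first by rewrite lee_fin kap_ge0.
by apply: fine_le; apply: integral_ge0 => be _; rewrite lee_fin mulr_ge0 ?exprn_ge0.
Qed.

(** The part |eta_j| of [kap] has mass at most L, the part L eta exactly L. *)
Lemma int_kap_eta : (\int[mu]_al \int[mu]_be k (al, be) <= (2 * L)%:E)%E.
Proof.
have -> : (\int[mu]_x \int[mu]_y k (x, y) = \int[mu]_x (kp x)%:E)%E.
  apply: eq_integral => x _.
  have e0 : forall be : X, setT be -> (0 <= (eta be)%:E)%E by move=> be _; rewrite lee_fin.
  have ka0 : (0 <= (kp x)%:E)%E by rewrite lee_fin kap_ge0.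
  have mE : measurable_fun setT (fun y : X => (eta y)%:E) by exact/measurable_EFinP.
  have := @ge0_integralZl _ _ _ mu setT measurableT _ mE (kp x)%:E e0 ka0.
  by rewrite eta1 mule1 => <-; apply: eq_integral => y _; rewrite /k EFinM.
rewrite /kap; under eq_integral do rewrite EFinD.
rewrite ge0_integralD//; last 3 first.
- by apply/measurable_EFinP; exact: measurableT_comp.
- by move=> x _; rewrite lee_fin mulr_ge0.
- by apply/measurable_EFinP; exact: measurable_funM.
have -> : (\int[mu]_x (L * eta x)%:E = L%:E)%E.
  have e0 : forall be : X, setT be -> (0 <= (eta be)%:E)%E by move=> be _; rewrite lee_fin.
  have ka0 : (0 <= L%:E)%E by rewrite lee_fin.
  have mE : measurable_fun setT (fun y : X => (eta y)%:E) by exact/measurable_EFinP.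
  have := @ge0_integralZl _ _ _ mu setT measurableT _ mE L%:E e0 ka0.
  by rewrite eta1 mule1 => <-; apply: eq_integral => y _; rewrite EFinM.
by rewrite (_ : 2 * L = L + L) ?EFinD; [exact: leeD|ring].
Qed.

(** Tonelli brings the integration over time and space inside, so the increment bound is used for
    one pair of shifts at a time, and only for pairs carrying weight. *)
Lemma YI_time (B : R) : 0 <= B ->
  (forall al be, kp al != 0 -> eta be != 0 -> (\int[m]_t \int[mu]_x D al be t x <= B%:E)%E) ->
  (\int[m]_t YI eta etaj L j (w^~ t) <= (2 * L * B)%:E)%E.
Proof.
move=> B0 HB.
have mYY : measurable_fun setT (fun a : RM * X => (YY eta etaj L j (w^~ a.1) a.2)%:E).
  apply/measurable_EFinP.
  apply: (@measurable_Rparam _ _ (RM * X)%type X R mu (fun q => kp q.2 * \int[mu]_be (eta be * `|w (tadd q.1.2 q.2) q.1.1 - w (tadd q.1.2 be) q.1.1| ^+ 3))).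
  apply: measurable_funM; first exact: (measurableT_comp kap_meas).
  apply: (@measurable_Rparam _ _ ((RM * X) * X)%type X R mu (fun q => eta q.2 * `|w (tadd q.1.1.2 q.1.2) q.1.1.1 - w (tadd q.1.1.2 q.2) q.1.1.1| ^+ 3)).
  have m1 : measurable_fun setT (fun q : ((RM * X) * X) * X => q.1.1) by exact: (measurableT_comp measurable_fst).
  have m11 : measurable_fun setT (fun q : ((RM * X) * X) * X => q.1.1.1) by exact: (measurableT_comp measurable_fst).
  have m12 : measurable_fun setT (fun q : ((RM * X) * X) * X => q.1.1.2) by exact: (measurableT_comp measurable_snd).
  have m2 : measurable_fun setT (fun q : ((RM * X) * X) * X => q.1.2) by exact: (measurableT_comp measurable_snd).
  apply: measurable_funM; first exact: (measurableT_comp meta).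
  apply: measurable_funX; apply: measurableT_comp => //; apply: measurable_funB.
    by apply: mw2 => //; exact: measurable_tadd.
  by apply: mw2 => //; exact: measurable_tadd.
apply: (@le_trans _ _ (\int[m]_t \int[mu]_x \int[mu]_al \int[mu]_be F (((t, x), al), be))%E).
  apply: ge0_le_integral => //.
  - by move=> t _; apply: integral_ge0 => x _; rewrite lee_fin; apply: Rint_ge0 => al;
      rewrite mulr_ge0 ?kap_ge0//; apply: Rint_ge0 => be; rewrite mulr_ge0 ?exprn_ge0.
  - exact: (@measurable_param _ _ RM X R mu _ mYY).
  - exact: (@measurable_param _ _ RM X R mu _ mGG).
  - move=> t _; apply: ge0_le_integral => //.
    + by move=> x _; rewrite lee_fin; apply: Rint_ge0 => al;
        rewrite mulr_ge0 ?kap_ge0//; apply: Rint_ge0 => be; rewrite mulr_ge0 ?exprn_ge0.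
    + exact: (meas_sect1 mYY t).
    + exact: (meas_sect1 mGG t).
have G0 q : (0 <= \int[mu]_be F (q, be))%E by apply: integral_ge0.
rewrite (@tonelli3 _ _ _ RM X X R m mu mu _ mG G0).
have sw al : (\int[m]_t \int[mu]_x \int[mu]_be F (((t, x), al), be) =
    \int[mu]_be \int[m]_t \int[mu]_x F (((t, x), al), be))%E.
  apply: (@tonelli3 _ _ _ RM X X R m mu mu (fun q => F ((q.1, al), q.2))) => //.
  apply: (measurableT_comp mF); apply: measurable_fun_pair => //.
  by apply: measurable_fun_pair => //; exact: measurable_cst.
under eq_integral do rewrite sw.
have mI : measurable_fun setT (fun p : X * X => \int[m]_t \int[mu]_x F (((t, x), p.1), p.2))%E.
  apply: (@measurable_param _ _ (X * X)%type RM R m (fun q => \int[mu]_x F (((q.2, x), q.1.1), q.1.2))%E).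
  apply: (@measurable_param _ _ ((X * X) * RM)%type X R mu (fun q => F (((q.1.2, q.2), q.1.1.1), q.1.1.2))).
  have n1 : measurable_fun setT (fun q : ((X * X) * RM) * X => q.1.1) by exact: (measurableT_comp measurable_fst).
  have n11 : measurable_fun setT (fun q : ((X * X) * RM) * X => q.1.1.1) by exact: (measurableT_comp measurable_fst).
  have n12 : measurable_fun setT (fun q : ((X * X) * RM) * X => q.1.1.2) by exact: (measurableT_comp measurable_snd).
  have n2 : measurable_fun setT (fun q : ((X * X) * RM) * X => q.1.2) by exact: (measurableT_comp measurable_snd).
  apply: (measurableT_comp mF); apply: measurable_fun_pair => //.
  by apply: measurable_fun_pair => //; apply: measurable_fun_pair.
have B0' : (0 <= B%:E)%E by rewrite lee_fin.
apply: (@le_trans _ _ (\int[mu]_al \int[mu]_be (k (al, be) * B%:E))%E).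
  apply: ge0_le_integral => //.
  - by move=> al _; apply: integral_ge0 => be _; apply: integral_ge0 => t _; exact: integral_ge0.
  - exact: (@measurable_param _ _ X X R mu _ mI).
  - apply: (@measurable_param _ _ X X R mu (fun p => k p * B%:E)%E).
    by apply: emeasurable_funM => //; exact: measurable_cst.
  - move=> al _; apply: ge0_le_integral => //.
    + by move=> be _; apply: integral_ge0 => t _; exact: integral_ge0.
    + exact: (meas_sect1 mI al).
    + by apply: emeasurable_funM; [exact: (meas_sect1 mk al)|exact: measurable_cst].
    + move=> be _.
      have mDs : measurable_fun setT (fun a : RM * X => D al be a.1 a.2).
        apply: (measurableT_comp mD (f := fun q => D q.1.2 q.2 q.1.1.1 q.1.1.2) (g := fun a => ((a, al), be))).
        by apply: measurable_fun_pair; [apply: measurable_fun_pair => //|]; exact: measurable_cst.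
      have -> : (\int[m]_t \int[mu]_x F (((t, x), al), be) = k (al, be) * \int[m]_t \int[mu]_x D al be t x)%E.
        have mDi : measurable_fun setT (fun t => \int[mu]_x D al be t x)%E.
          exact: (@measurable_param _ _ RM X R mu _ mDs).
        have h1 : forall t : RM, setT t -> (0 <= \int[mu]_x D al be t x)%E by move=> t _; exact: integral_ge0.
        rewrite -(@ge0_integralZl _ _ _ m setT measurableT _ mDi (k (al, be)) h1 (k0 _)).
        apply: eq_integral => t _.
        have h2 : forall x : X, setT x -> (0 <= D al be t x)%E by [].
        by rewrite -(@ge0_integralZl _ _ _ mu setT measurableT _ (meas_sect1 mDs t) (k (al, be)) h2 (k0 _)).
      have [k00|kn0] := eqVneq (k (al, be)) 0%E; first by rewrite k00 !mul0e.
      apply: lee_wpmul2l => //.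
      have : kp al * eta be != 0 by apply: contra kn0 => /eqP h; rewrite /k/= h.
      by rewrite mulf_eq0 negb_or => /andP[h1 h2]; exact: HB.
have mKi : measurable_fun setT (fun al => \int[mu]_be k (al, be))%E.
  exact: (@measurable_param _ _ X X R mu _ mk).
have -> : (\int[mu]_al \int[mu]_be (k (al, be) * B%:E) = \int[mu]_al (\int[mu]_be k (al, be) * B%:E))%E.
  apply: eq_integral => al _.
  have h2 : forall x : X, setT x -> (0 <= k (al, x))%E by [].
  by rewrite (@ge0_integralZr _ _ _ mu setT measurableT _ (meas_sect1 mk al) B%:E h2 B0').
have h2 : forall x : X, setT x -> (0 <= \int[mu]_be k (x, be))%E by move=> x _; exact: integral_ge0.
rewrite (@ge0_integralZr _ _ _ mu setT measurableT _ mKi B%:E h2 B0').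
by rewrite EFinM; apply: lee_wpmul2r => //; exact: int_kap_eta.
Qed.
End YITime.

Section ChainIneq.
Variable R : realType.
Implicit Types (m r c B : R).

Lemma quot_lip m r m' r' c B : 0 < c -> c <= r -> c <= r' -> `|m| <= B ->
  `|m' / r' - m / r| <= (c^-1 + B / c ^+ 2) * (`|m' - m| + `|r' - r|).
Proof.
move=> c0 cr cr' mB.
have r0 : 0 < r by exact: lt_le_trans cr.
have r0' : 0 < r' by exact: lt_le_trans cr'.
have B0 : 0 <= B by exact: le_trans mB.
have -> : m' / r' - m / r = (m' - m) / r' - m * (r' - r) / (r' * r).
  by field; rewrite !gt_eqF.
apply: le_trans (ler_normB _ _) _.
have E1 : `|(m' - m) / r'| <= c^-1 * `|m' - m|.
  rewrite normrM mulrC ler_wpM2r// gtr0_norm ?invr_gt0// lef_pV2//.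
have E2 : `|m * (r' - r) / (r' * r)| <= B / c ^+ 2 * `|r' - r|.
  rewrite !normrM -mulrA [_ * `|_^-1|]mulrC mulrA ler_wpM2r//.
  apply: ler_pM => //; rewrite gtr0_norm ?invr_gt0 ?mulr_gt0// lef_pV2 ?posrE ?mulr_gt0 ?exprn_gt0//.
  by rewrite expr2 ler_pM// ltW.
apply: le_trans (lerD E1 E2) _; rewrite mulrDl !mulrDr.
have h1 : 0 <= c^-1 * `|r' - r| by rewrite mulr_ge0// invr_ge0 ltW.
have h2 : 0 <= B / c ^+ 2 * `|m' - m| by rewrite mulr_ge0// divr_ge0// exprn_ge0// ltW.
lra.
Qed.

Lemma sq_lip (a b V : R) : `|a| <= V -> `|b| <= V -> `|2^-1 * a ^+ 2 - 2^-1 * b ^+ 2| <= V * `|a - b|.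
Proof.
move=> aV bV; rewrite -mulrBr subr_sqr mulrCA normrM mulrC; apply: ler_wpM2r => //.
rewrite normrM ger0_norm ?invr_ge0// ler_pdivrMl//.
by apply: le_trans (ler_normD _ _) _; rewrite mulr2n mulrDl mul1r lerD.
Qed.

(** The remainder of m^2 / (2 r) after its first-order expansion is exactly ((m' - m) - (m / r) (r'
    - r))^2 / (2 r'). *)
Lemma kin_quad m r m' r' c V : 0 < c -> c <= r -> c <= r' -> `|m / r| <= V ->
  `|2^-1 * (m' ^+ 2 / r') - 2^-1 * (m ^+ 2 / r) - m / r * (m' - m) - - (2^-1 * (m / r) ^+ 2) * (r' - r)|
    <= (2 * c)^-1 * (1 + V) ^+ 2 * (`|m' - m| + `|r' - r|) ^+ 2.
Proof.
move=> c0 cr cr' vV.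
have r0 : 0 < r by exact: lt_le_trans cr.
have r0' : 0 < r' by exact: lt_le_trans cr'.
have V0 : 0 <= V by exact: le_trans vV.
have -> : 2^-1 * (m' ^+ 2 / r') - 2^-1 * (m ^+ 2 / r) - m / r * (m' - m) - - (2^-1 * (m / r) ^+ 2) * (r' - r)
   = (2 * r')^-1 * ((m' - m) - m / r * (r' - r)) ^+ 2.
  by field; rewrite !gt_eqF.
have E1 : `|(m' - m) - m / r * (r' - r)| <= (1 + V) * (`|m' - m| + `|r' - r|).
  apply: le_trans (ler_normB _ _) _; rewrite normrM.
  have h1 : `|m / r| * `|r' - r| <= V * `|r' - r| by rewrite ler_wpM2r.
  have h2 : 0 <= V * `|m' - m| by rewrite mulr_ge0.
  have h3 : 0 <= `|r' - r| by [].
  rewrite mulrDl mul1r mulrDr; lra.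
rewrite normrM normrX -[leRHS]mulrA -exprMn ger0_norm; last by rewrite invr_ge0 mulr_ge0// ltW.
apply: ler_pM; rewrite ?invr_ge0 ?mulr_ge0 ?(ltW r0') ?exprn_ge0//.
  by rewrite lef_pV2 ?posrE ?mulr_gt0// ler_pM2l.
by rewrite ler_pXn2r ?nnegrE ?mulr_ge0 ?addr_ge0.
Qed.

Lemma powR_lip c C g s t : 0 < c -> c <= s <= C -> c <= t <= C ->
  `|s `^ g - t `^ g| <= `|g| * (c `^ (g - 1) + C `^ (g - 1)) * `|s - t|.
Proof.
move=> c0.
wlog ts : s t / t <= s.
  move=> W sI tI; have [ts|/ltW st] := leP t s; first exact: W.
  by rewrite distrC [`|s - t|]distrC; exact: W.
move=> /andP[cs sC] /andP[ct tC]; move: ts; rewrite le_eqVlt => /predU1P[->|ts].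
  by rewrite !subrr normr0 mulr0.
have [z /andP[tz zs] ->] := powR_mvt c0 g ct ts.
rewrite !normrM ler_wpM2r// ler_wpM2l// ger0_norm ?powR_ge0//.
by apply: powR_bnd => //; rewrite (le_trans ct (ltW tz)) (le_trans (ltW zs)).
Qed.
End ChainIneq.

(** * Energy densities along the mollified equations *)

Section Ode.
Variables (R : realType) (T c C : R).
Hypotheses (T0 : 0 < T) (c0 : 0 < c).
Notation RM := (measurableTypeR R).
Notation m := (lamT T).

Lemma ae_pick2 (P : RM -> Prop) a b : {ae m, forall t, P t} -> 0 <= a -> a < b -> b <= T ->
  exists2 p, a < p < b & P p.
Proof.
move=> [A [mA A0 HA]] a0 ab bT; apply: contrapT => H.
have sub : `]a, b[%classic `<=` A.
  by move=> p; rewrite /= in_itv/= => pr; apply: HA => Pp; apply: H; exists p.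
have : (m (`]a, b[%classic : set R) <= m A)%E.
  by apply: le_measure; rewrite ?inE//; exact: measurable_itv.
rewrite A0 /lamT /mrestr setIidl; last first.
  by move=> t; rewrite /= !in_itv/= => /andP[at_ tb]; rewrite (le_lt_trans a0)//= (lt_le_trans tb).
by rewrite lebesgue_measure_itv/= lte_fin ab -EFinB lee_fin leNgt subr_gt0 ab.
Qed.

Lemma J_congr (f g : RM -> R) t : intg m f -> measurable_fun setT g ->
  {ae m, forall s, f s = g s} -> intg m g /\ J T g t = J T f t.
Proof.
move=> iF mg fg; have mf := intg_meas iF.
split.
  apply: intgP => //; rewrite (_ : integral _ _ _ = \int[m]_s `|f s|%:E)%E; first exact: intg_lt.
  apply: ae_eq_integral => //; try by apply/measurable_EFinP; exact: measurableT_comp.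
  by apply: aeS fg => s E _; rewrite E.
rewrite /J /Rintegral; congr fine; apply: ae_eq_integral => //.
- by apply/measurable_EFinP; apply: measurable_funM => //; exact: meas_lt.
- by apply/measurable_EFinP; apply: measurable_funM => //; exact: meas_lt.
- by apply: aeS fg => s E _; rewrite E.
Qed.

Variables (r0 : R) (h rt : RM -> R).
Hypotheses (ih : intg m h) (mrt : measurable_fun setT rt) (rtI : forall t, c <= rt t <= C)
  (r0I : c <= r0 <= C) (rtE : {ae m, forall t, rt t = r0 + J T h t}).

Let rr (t : R) : R := r0 + J T h t.
Definition clip (y : R) : R := Num.max c (Num.min C y).
Let cC : c <= C. Proof. by have /andP[h1 h2] := r0I; exact: le_trans h2. Qed.
Lemma clip_itv y : c <= clip y <= C.
Proof. by rewrite /clip le_max lexx ge_max cC ge_min lexx. Qed.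
Lemma clip_id y : c <= y <= C -> clip y = y.
Proof. by move=> /andP[h1 h2]; rewrite /clip min_r// max_r. Qed.

(** The primitive agrees with [rt] almost everywhere, hence lies in [c, C] on a dense set of times;
    continuity extends the bounds to every time in [0, T). *)
Lemma rr_itv_ode t : 0 <= t -> t < T -> c <= rr t <= C.
Proof.
rewrite le_eqVlt => /predU1P[<-|t0] tT; first by rewrite /rr J_0// addr0.
have cJ : J T h x @[x --> t] --> J T h t.
  have /(continuous_within_itvP _ T0)[H _ _] := J_cont (ltW T0) ih.
  by apply: H; rewrite in_itv/= t0.
have app e : 0 < e -> exists2 s, c <= rr s <= C & `|rr t - rr s| <= e.
  move=> e0; move/cvgrPdist_le: cJ => /(_ _ e0) [dl/= dl0 H].
  pose b := Num.min T (t + dl).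
  have tb : t < b by rewrite lt_min tT ltrDl.
  have bT : b <= T by rewrite ge_min lexx.
  have [s /andP[ts sb] Es] := ae_pick2 rtE (ltW t0) tb bT.
  exists s; first by rewrite /rr -Es.
  rewrite /rr opprD addrACA subrr add0r; apply: H => /=.
  rewrite ltr_distl (lt_trans ts) ?ltrDl// andbT ltrBlDr.
  by move: sb; rewrite lt_min => /andP[_].
apply/andP; split.
- apply/ler_addgt0Pr => e e0; have [s /andP[h1 h2]] := app e e0.
  by rewrite ler_distl => /andP[h3 h4]; lra.
- apply/ler_addgt0Pr => e e0; have [s /andP[h1 h2]] := app e e0.
  by rewrite ler_distl => /andP[h3 h4]; lra.
Qed.

Lemma ode_kin (m0 : R) (g mt : RM -> R) : intg m g -> measurable_fun setT mt ->
  {ae m, forall t, mt t = m0 + J T g t} ->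
  intg m (fun s => mt s / rt s * g s - 2^-1 * (mt s / rt s) ^+ 2 * h s) /\
  {ae m, forall t, 2^-1 * (mt t ^+ 2 / rt t) = 2^-1 * (m0 ^+ 2 / r0) +
     J T (fun s => mt s / rt s * g s - 2^-1 * (mt s / rt s) ^+ 2 * h s) t}.
Proof.
move=> ig mmt mtE.
(* The chain rule is run on the primitives, of which mt and rt are almost everywhere copies.
   Clipping keeps the denominator in [c, C] at all real times, so the coefficients are bounded
   everywhere. *)
pose mm t := m0 + J T g t; pose rc t := clip (rr t).
pose B := `|m0| + \int[m]_t `|g t|.
have mB t : `|mm t| <= B.
  apply: le_trans (ler_normD _ _) _; rewrite lerD2l /J.
  apply: le_trans (Rint_abs (intg_J t ig)) _; apply: Rint_le; [exact: intg_abs (intg_J t ig)|exact: intg_abs|].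
  by move=> s; rewrite normrM -[leRHS]mulr1 ler_wpM2l// natb_le1.
have B0 : 0 <= B by exact: le_trans (mB 0).
have rcI t : c <= rc t <= C by exact: clip_itv.
have rc0 t : 0 < rc t by have /andP[h1 _] := rcI t; exact: lt_le_trans h1.
have rc_c t : c <= rc t by have /andP[] := rcI t.
have rcE t : 0 <= t -> t < T -> rc t = rr t by move=> t0 tT; rewrite /rc clip_id// rr_itv_ode.
pose V := B / c.
have V0 : 0 <= V by rewrite divr_ge0// ltW.
pose A t := mm t / rc t; pose A2 t := - (2^-1 * (mm t / rc t) ^+ 2).
have AV t : `|A t| <= V.
  rewrite normrM; apply: ler_pM => //.
  by rewrite gtr0_norm ?invr_gt0// lef_pV2 ?posrE.
have mmm : measurable_fun setT (mm : RM -> R).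
  by apply: measurable_funD => //; apply: J_meas; exact: intg_meas ig.
have mrc : measurable_fun setT (rc : RM -> R).
  apply: measurable_maxr => //; apply: measurable_minr => //.
  by apply: measurable_funD => //; apply: J_meas; exact: intg_meas ih.
have mV (f : RM -> R) : measurable_fun setT f -> (forall t, 0 < f t) -> measurable_fun setT (fun t => (f t)^-1).
  move=> mf f0; rewrite (_ : (fun t => _) = (fun t => f t `^ (-1))).
    exact: (measurableT_comp (measurable_powR (-1)) mf).
  by apply/funext => y; rewrite powR_inv1// ltW.
have mA : measurable_fun setT (A : RM -> R) by apply: measurable_funM => //; exact: mV.
have mA2 : measurable_fun setT (A2 : RM -> R).
  apply: measurableT_comp => //; apply: measurable_funM => //; exact: measurable_funX.
have iA : intg m (fun s => A s * g s) by exact: intgMb ig mA AV.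
have A2V t : `|A2 t| <= V ^+ 2.
  rewrite normrN normrM ger0_norm ?invr_ge0// normrX.
  apply: (@le_trans _ _ (1 * V ^+ 2)); last by rewrite mul1r.
  apply: ler_pM; rewrite ?invr_ge0 ?exprn_ge0//; first by lra.
  by rewrite ler_pXn2r ?nnegrE//; exact: AV.
have iA2 : intg m (fun s => A2 s * h s) by exact: intgMb ih mA2 A2V.
have iAA := intgD iA iA2.
have key t : 0 <= t -> t < T -> 2^-1 * (mm t ^+ 2 / rc t) = 2^-1 * (m0 ^+ 2 / r0) + J T (fun s => A s * g s + A2 s * h s) t.
  move=> t0 tT.
  (* One constant above the Lipschitz bounds of both coefficients ([quot_lip], [sq_lip]) and above
     the quadratic remainder of [kin_quad]. *)
  pose K := (1 + V) * (c^-1 + B / c ^+ 2) + (2 * c)^-1 * (1 + V) ^+ 2.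
  have K1 : 0 <= c^-1 + B / c ^+ 2 by rewrite addr_ge0 ?invr_ge0 ?divr_ge0 ?exprn_ge0// ltW.
  have K2 : 0 <= (2 * c)^-1 * (1 + V) ^+ 2.
    by rewrite mulr_ge0 ?exprn_ge0 ?addr_ge0// invr_ge0 mulr_ge0// ltW.
  have V1 : 0 <= 1 + V by rewrite addr_ge0.
  have K0 : 0 <= K by rewrite addr_ge0// mulr_ge0.
  have KA : c^-1 + B / c ^+ 2 <= K.
    by apply: ler_wpDr => //; rewrite -[leLHS]mul1r ler_wpM2r// lerDl.
  have KA2 : V * (c^-1 + B / c ^+ 2) <= K.
    by apply: ler_wpDr => //; rewrite ler_wpM2r// lerDr.
  have KQ : (2 * c)^-1 * (1 + V) ^+ 2 <= K by rewrite lerDr mulr_ge0.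
  pose I := J T (fun s => `|g s| + `|h s|).
  have ia := intgD (intg_abs ig) (intg_abs ih).
  have DI a b : 0 <= a -> a <= b -> b <= t -> `|mm b - mm a| + `|rc b - rc a| <= I b - I a.
    move=> a0 ab bt; rewrite !rcE ?(le_trans a0 ab) ?(le_lt_trans bt tT)//; last first.
      exact: le_lt_trans (le_trans ab bt) tT.
    rewrite /mm /rr !opprD !addrA ![_ + _ - m0]addrC ![_ + _ - r0]addrC !addrA !addNr !add0r.
    have -> : I b - I a = (J T (fun s => `|g s|) b - J T (fun s => `|g s|) a) + (J T (fun s => `|h s|) b - J T (fun s => `|h s|) a).
      by rewrite /I !J_D; [ring|exact: intg_abs..].
    by apply: lerD; apply: J_norm => //; exact: intg_abs.
  have lipA a b : 0 <= a -> a <= b -> b <= t -> `|A b - A a| <= (c^-1 + B / c ^+ 2) * (I b - I a).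
    move=> a0 ab bt; rewrite /A.
    apply: le_trans (@quot_lip R (mm a) (rc a) (mm b) (rc b) c B c0 (rc_c a) (rc_c b) (mB a)) _.
    by apply: ler_wpM2l => //; apply: DI.
  have I0 a b : 0 <= a -> a <= b -> b <= t -> 0 <= I b - I a.
    by move=> a0 ab bt; apply: le_trans (DI a b a0 ab bt); rewrite addr_ge0.
  have JE f : intg m f -> J T f 0 = 0 by move=> iF; exact: J_0.
  have <- : 2^-1 * (mm 0 ^+ 2 / rc 0) = 2^-1 * (m0 ^+ 2 / r0).
    by rewrite rcE// /mm /rr (JE _ ig) (JE _ ih) !addr0.
  apply: (@J_chain R T g h (fun t => 2^-1 * (mm t ^+ 2 / rc t)) A A2 K (V + V ^+ 2) t t0 K0 ig ih mA mA2).
  - move=> s; split; first by apply: le_trans (AV s) _; rewrite lerDl exprn_ge0.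
    by apply: le_trans (A2V s) _; rewrite lerDr.
  - move=> a b a0 ab bt; apply: le_trans (lipA a b a0 ab bt) _.
    by apply: ler_wpM2r => //; exact: I0.
  - move=> a b a0 ab bt; rewrite /A2 -opprB opprK [_ + _]addrC.
    rewrite [X in `|X|](_ : _ = 2^-1 * (mm a / rc a) ^+ 2 - 2^-1 * (mm b / rc b) ^+ 2); last by ring.
    apply: le_trans (sq_lip (AV a) (AV b)) _; rewrite distrC.
    apply: le_trans (ler_wpM2l V0 (lipA a b a0 ab bt)) _; rewrite mulrA.
    by apply: ler_wpM2r => //; exact: I0.
  - move=> a b a0 ab bt.
    have -> : J T g b - J T g a = mm b - mm a by rewrite /mm; ring.
    have -> : J T h b - J T h a = rc b - rc a.
      rewrite !rcE ?(le_trans a0 ab) ?(le_lt_trans bt tT)//; first by rewrite /rr; ring.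
      exact: le_lt_trans (le_trans ab bt) tT.
    rewrite /A /A2; apply: le_trans (@kin_quad R (mm a) (rc a) (mm b) (rc b) c V c0 (rc_c a) (rc_c b) (AV a)) _.
    apply: ler_pM; [exact: K2|by rewrite exprn_ge0 ?addr_ge0|exact: KQ|].
    have S0 : 0 <= `|mm b - mm a| + `|rc b - rc a| by rewrite addr_ge0.
    have SI := I0 a b a0 ab bt.
    rewrite ler_pXn2r ?nnegrE//; exact: DI.
have msu : measurable_fun setT (fun s : RM => mt s / rt s * g s - 2^-1 * (mt s / rt s) ^+ 2 * h s).
  have mq : measurable_fun setT (fun s : RM => mt s / rt s).
    apply: measurable_funM => //; apply: mV => // t.
    by have /andP[h1 _] := rtI t; exact: lt_le_trans h1.
  apply: measurable_funB; first by apply: measurable_funM => //; exact: intg_meas ig.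
  apply: measurable_funM; last exact: intg_meas ih.
  by apply: measurable_funM => //; exact: measurable_funX.
have inT : {ae m, forall t : RM, 0 < t < T} by apply: lamT_ae; apply: aeW.
have eqf : {ae m, forall s : RM, A s * g s + A2 s * h s = mt s / rt s * g s - 2^-1 * (mt s / rt s) ^+ 2 * h s}.
  apply: aeS (aeI inT (aeI mtE rtE)) => s [/andP[s0 sT] [E1 E2]].
  by rewrite /A /A2 rcE ?ltW// /mm /rr -E1 -E2 mulNr.
split; first exact: (J_congr 0 iAA msu eqf).1.
apply: aeS (aeI inT (aeI mtE rtE)) => t [/andP[t0 tT] [E1 E2]].
rewrite (J_congr t iAA msu eqf).2 -key ?ltW// rcE ?ltW//.
by rewrite /mm /rr -E1 -E2.
Qed.

Lemma ode_prs (gamma : R) : 1 < gamma ->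
  intg m (fun s => gamma / (gamma - 1) * rt s `^ (gamma - 1) * h s) /\
  {ae m, forall t, rt t `^ gamma / (gamma - 1) = r0 `^ gamma / (gamma - 1) +
     J T (fun s => gamma / (gamma - 1) * rt s `^ (gamma - 1) * h s) t}.
Proof.
move=> g1.
have g0 : 0 < gamma by exact: lt_trans g1.
have g10 : 0 < gamma - 1 by rewrite subr_gt0.
have g0' := ltW g0; have g10' := ltW g10.
pose k0 := gamma / (gamma - 1).
have k00 : 0 <= k0 by rewrite divr_ge0// ltW.
pose rc t := clip (rr t).
have rcI t : c <= rc t <= C by exact: clip_itv.
have rcE t : 0 <= t -> t < T -> rc t = rr t by move=> t0 tT; rewrite /rc clip_id// rr_itv_ode.
have mrc : measurable_fun setT (rc : RM -> R).
  apply: measurable_maxr => //; apply: measurable_minr => //.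
  by apply: measurable_funD => //; apply: J_meas; exact: intg_meas ih.
pose A2 t := k0 * rc t `^ (gamma - 1).
pose P1 := c `^ (gamma - 1) + C `^ (gamma - 1); pose P2 := c `^ (gamma - 2) + C `^ (gamma - 2).
have P10 : 0 <= P1 by rewrite addr_ge0 ?powR_ge0.
have P20 : 0 <= P2 by rewrite addr_ge0 ?powR_ge0.
have A2V t : `|A2 t| <= k0 * P1.
  by rewrite /A2 normrM (ger0_norm k00) (ger0_norm (powR_ge0 _ _)); apply: ler_wpM2l => //; exact: powR_bnd.
have mA2 : measurable_fun setT (A2 : RM -> R).
  by apply: measurable_funM => //; exact: (measurableT_comp (measurable_powR _) mrc).
have iA2 : intg m (fun s => A2 s * h s) by exact: intgMb ih mA2 A2V.
have key t : 0 <= t -> t < T -> rc t `^ gamma / (gamma - 1) = r0 `^ gamma / (gamma - 1) + J T (fun s => A2 s * h s) t.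
  move=> t0 tT.
  pose K := k0 * ((gamma - 1) * P2) + gamma * P2.
  have KA : k0 * ((gamma - 1) * P2) <= K by rewrite lerDl mulr_ge0.
  have KQ : gamma * P2 <= K by rewrite lerDr mulr_ge0// mulr_ge0.
  have K0 : 0 <= K by apply: le_trans KQ; rewrite mulr_ge0.
  have i0 : intg m (fun _ : RM => 0 : R) by exact: intg_cst.
  pose I := J T (fun s => `|(fun=> 0 : R) s| + `|h s|).
  have DI a b : 0 <= a -> a <= b -> b <= t -> `|rc b - rc a| <= I b - I a.
    move=> a0 ab bt; rewrite !rcE ?(le_trans a0 ab) ?(le_lt_trans bt tT)//; last first.
      exact: le_lt_trans (le_trans ab bt) tT.
    rewrite /rr !opprD !addrA ![_ + _ - r0]addrC !addrA !addNr !add0r.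
    apply: J_norm => //; first exact: intgD (intg_abs i0) (intg_abs ih).
    by move=> s; rewrite normr0 add0r.
  have JE f : intg m f -> J T f 0 = 0 by move=> iF; exact: J_0.
  have I0 a b : 0 <= a -> a <= b -> b <= t -> 0 <= I b - I a.
    by move=> a0 ab bt; apply: le_trans (DI a b a0 ab bt).
  have <- : rc 0 `^ gamma / (gamma - 1) = r0 `^ gamma / (gamma - 1).
    by rewrite rcE// /rr (JE _ ih) addr0.
  (* [J_chain] takes two driving terms; the one belonging to the momentum is filled with 0. *)
  rewrite (_ : (fun s => A2 s * h s) = (fun s => 0 * 0 + A2 s * h s)); last first.
    by apply/funext => s; rewrite mul0r add0r.
  apply: (@J_chain R T (fun=> 0) h (fun t => rc t `^ gamma / (gamma - 1)) (fun=> 0) A2 K (k0 * P1) t t0 K0 i0 ih (measurable_cst _) mA2).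
  - by move=> s; split => //; rewrite normr0 mulr_ge0.
  - by move=> a b a0 ab bt; rewrite subrr [leLHS]normr0; apply: mulr_ge0 => //; exact: (I0 a b).
  - move=> a b a0 ab bt; rewrite /A2 -mulrBr normrM ger0_norm//.
    have := powR_lip (gamma - 1) c0 (rcI b) (rcI a).
    rewrite (_ : gamma - 1 - 1 = gamma - 2); last by ring.
    rewrite (ger0_norm (ltW g10)) -/P2 => H.
    apply: le_trans (ler_wpM2l k00 H) _; rewrite mulrA; apply: ler_pM => //; last exact: DI.
    by rewrite mulr_ge0// mulr_ge0.
  - move=> a b a0 ab bt; rewrite mul0r subr0.
    have -> : J T h b - J T h a = rc b - rc a.
      rewrite !rcE ?(le_trans a0 ab) ?(le_lt_trans bt tT)//; first by rewrite /rr; ring.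
      exact: le_lt_trans (le_trans ab bt) tT.
    have /andP[h1 h2] := powR_tangent c0 g1 (rcI b) (rcI a).
    have -> : rc b `^ gamma / (gamma - 1) - rc a `^ gamma / (gamma - 1) - A2 a * (rc b - rc a) =
      (rc b `^ gamma - rc a `^ gamma - gamma * rc a `^ (gamma - 1) * (rc b - rc a)) / (gamma - 1).
      rewrite /A2 /k0; move: (rc b `^ gamma) (rc a `^ gamma) (rc a `^ (gamma - 1)) (rc b - rc a) => p1 p2 p3 x.
      by field; rewrite gt_eqF.
    rewrite ger0_norm; last by rewrite divr_ge0// ltW.
    rewrite ler_pdivrMr//; apply: le_trans h2 _.
    rewrite -/P2 (_ : gamma * (gamma - 1) * P2 * (rc b - rc a) ^+ 2 = gamma * P2 * (rc b - rc a) ^+ 2 * (gamma - 1)); last by ring.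
    apply: ler_wpM2r; first exact: ltW.
    rewrite -[(rc b - rc a) ^+ 2]real_normK ?num_real//; apply: ler_pM; rewrite ?exprn_ge0 ?mulr_ge0 ?(ltW g0)//.
    by rewrite ler_pXn2r ?nnegrE//; [exact: DI|exact: I0].
have msu : measurable_fun setT (fun s : RM => gamma / (gamma - 1) * rt s `^ (gamma - 1) * h s).
  apply: measurable_funM; last exact: intg_meas ih.
  by apply: measurable_funM => //; exact: (measurableT_comp (measurable_powR _) mrt).
have inT : {ae m, forall t : RM, 0 < t < T} by apply: lamT_ae; apply: aeW.
have eqf : {ae m, forall s : RM, A2 s * h s = gamma / (gamma - 1) * rt s `^ (gamma - 1) * h s}.
  by apply: aeS (aeI inT rtE) => s [/andP[s0 sT] E2]; rewrite /A2 rcE ?ltW// /rr -E2.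
split; first exact: (J_congr 0 iA2 msu eqf).1.
apply: aeS (aeI inT rtE) => t [/andP[t0 tT] E2].
rewrite (J_congr t iA2 msu eqf).2 -key ?ltW// rcE ?ltW//.
by rewrite /rr -E2.
Qed.
End Ode.

(** * The mollified energy balance *)

Section SumInt.
Context d (Y : measurableType d) (R : realType) (m : {finite_measure set Y -> \bar R}).
Lemma int_sum_le (n : nat) (f : 'I_n -> Y -> R) (b : R) :
  (forall i, measurable_fun setT (f i)) -> (forall i y, 0 <= f i y) ->
  (forall i, (\int[m]_y (f i y)%:E <= b%:E)%E) ->
  (\int[m]_y (\sum_(i < n) f i y)%:E <= (n%:R * b)%:E)%E.
Proof.
move=> mf f0 fb; under eq_integral do rewrite -sumEFin.
rewrite ge0_integral_sum//; last 2 first.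
- by move=> i; apply/measurable_EFinP.
- by move=> i y _; rewrite lee_fin.
apply: le_trans (lee_sum _ (fun i _ => fb i)) _.
by rewrite sumEFin sumr_const card_ord mulr_natl.
Qed.
Lemma measurable_invf (f : Y -> R) c : measurable_fun setT f -> 0 < c -> (forall y, c <= f y) ->
  measurable_fun setT (fun y => (f y)^-1).
Proof.
move=> mf c0 cf; rewrite (_ : (fun y => _) = (fun y => f y `^ (-1))).
  exact: (measurableT_comp (measurable_powR (-1)) mf).
by apply/funext => y; rewrite powR_inv1//; apply: le_trans (cf y); exact: ltW.
Qed.

Lemma int_comb_gen (f : Y -> R) (Z1 Z2 : Y -> \bar R) k1 k2 b1 b2 :
  measurable_fun setT f -> measurable_fun setT Z1 -> measurable_fun setT Z2 ->
  (forall t, 0 <= Z1 t)%E -> (forall t, 0 <= Z2 t)%E -> 0 <= k1 -> 0 <= k2 ->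
  (forall t, (`|f t|%:E <= k1%:E * Z1 t + k2%:E * Z2 t)%E) ->
  (\int[m]_t Z1 t <= b1%:E)%E -> (\int[m]_t Z2 t <= b2%:E)%E ->
  (\int[m]_t `|f t|%:E <= (k1 * b1 + k2 * b2)%:E)%E.
Proof.
move=> mf m1 m2 Z10 Z20 k10 k20 H H1 H2.
have k1' : (0 <= k1%:E)%E by rewrite lee_fin.
have k2' : (0 <= k2%:E)%E by rewrite lee_fin.
have mk1 : measurable_fun setT (fun t => k1%:E * Z1 t)%E by exact: measurable_funeM.
have mk2 : measurable_fun setT (fun t => k2%:E * Z2 t)%E by exact: measurable_funeM.
apply: (@le_trans _ _ (\int[m]_t (k1%:E * Z1 t + k2%:E * Z2 t))%E).
  apply: ge0_le_integral => //.
  - by apply/measurable_EFinP; exact: measurableT_comp.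
  - exact: emeasurable_funD.
rewrite ge0_integralD//; last 2 first.
- by move=> t _; rewrite mule_ge0.
- by move=> t _; rewrite mule_ge0.
rewrite !ge0_integralZl//.
by rewrite EFinD !EFinM; apply: leeD; exact: lee_wpmul2l.
Qed.
End SumInt.

Section Core.
Variables (R : realType) (d : nat) (T c C gamma : R).
Notation X := (d.-tuple R).
Notation RM := (measurableTypeR R).
Notation mu := (muT R d).
Notation m := (lamT T).
Variables (rho : X -> R -> R) (u : 'I_d -> X -> R -> R).
Hypotheses (T0 : 0 < T) (c0 : 0 < c) (gamma1 : 1 < gamma).
Hypotheses (mrho : measurable_fun setT (fun p : X * RM => rho p.1 p.2))
  (mu_ : forall i, measurable_fun setT (fun p : X * RM => u i p.1 p.2))
  (prho : forall t, perT (rho ^~ t)) (pu : forall i t, perT (u i ^~ t))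
  (rhoc : forall x t, c <= rho x t <= C)
  (u3 : forall i t, intg mu (fun x => `|u i x t| ^+ 3))
  (u3T : forall i, intg m (fun t => \int[mu]_x `|u i x t| ^+ 3)).

Lemma mrt t : measurable_fun setT (rho ^~ t).
Proof. exact: (meas_sect2 mrho t). Qed.
Lemma mut i t : measurable_fun setT (u i ^~ t).
Proof. exact: (meas_sect2 (mu_ i) t). Qed.
Lemma p3u i t : p3 (u i ^~ t).
Proof. by split; [exact: pu|exact: mut|exact: u3]. Qed.
Lemma cC : c <= C.
Proof. by have /andP[h1 h2] := rhoc [tuple 0 | i < d] 0; exact: le_trans h2. Qed.
Lemma C_gt0 : 0 < C. Proof. exact: lt_le_trans cC. Qed.
Lemma rho_abs x t : `|rho x t| <= C.
Proof. by have /andP[h1 h2] := rhoc x t; rewrite gtr0_norm//; exact: lt_le_trans h1. Qed.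

Lemma meas_EEt (k : X -> R) (f : X -> R -> R) : measurable_fun setT k ->
  measurable_fun setT (fun p : X * RM => f p.1 p.2) ->
  measurable_fun setT (fun p : X * RM => EE k (f ^~ p.2) p.1).
Proof.
move=> mk mf.
apply: (@measurable_Rparam _ _ (X * RM)%type X R mu (fun q => k q.2 * f (tadd q.1.1 q.2) q.1.2)).
apply: measurable_funM; first exact: (measurableT_comp mk).
apply: (mw2 mf); last exact: (measurableT_comp measurable_snd).
by apply: measurable_tadd => //; exact: (measurableT_comp measurable_fst).
Qed.

(** An integrable function of time whose cube root [Wt] dominates the spatial L^3 norms and is at
    least 1. Mollified quantities are bounded uniformly in x by powers of [Wt] up to the third,
    hence by a multiple of [Usum]. *)
Definition Usum (t : RM) : R := 1 + \sum_(i < d) \int[mu]_x `|u i x t| ^+ 3.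
Definition Wt (t : RM) : R := Usum t `^ 3^-1.

Lemma Usum_ge1 t : 1 <= Usum t.
Proof. by rewrite lerDl sumr_ge0// => i _; apply: Rint_ge0 => x; rewrite exprn_ge0. Qed.
Lemma Wt3 t : Wt t ^+ 3 = Usum t.
Proof.
have U0 : 0 <= Usum t by exact: le_trans (Usum_ge1 t).
by rewrite -powR_mulrn ?powR_ge0// /Wt -powRrM mulVf// powRr1.
Qed.
Lemma Wt_ge1 t : 1 <= Wt t.
Proof.
by rewrite leNgt; apply/negP => h; have := Usum_ge1 t;
  rewrite -Wt3 leNgt => /negP; apply; rewrite exprn_ilt1// ?powR_ge0.
Qed.
Lemma intg_Usum : intg m Usum.
Proof. by apply: intgD; [exact: intg_cst|apply: intg_sum => i; exact: u3T]. Qed.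

Lemma intg_u i t : intg mu (fun x => `|u i x t|).
Proof.
apply: (@intg_le _ _ _ mu _ (fun x => 1 + `|u i x t| ^+ 3)).
- by apply: measurableT_comp => //; exact: mut.
- by apply: intgD; [exact: intg_cst|exact: u3].
- by move=> x; rewrite normr_id; exact: le1cube.
Qed.
Lemma intg_uu i j t : intg mu (fun x => `|u i x t * u j x t|).
Proof.
apply: (@intg_le _ _ _ mu _ (fun x => 1 + `|u i x t| ^+ 3 + `|u j x t| ^+ 3)).
- by apply: measurableT_comp => //; apply: measurable_funM; exact: mut.
- by apply: intgD; [apply: intgD; [exact: intg_cst|exact: u3]|exact: u3].
- by move=> x; rewrite normr_id normrM; exact: mul_le1cube.
Qed.
Lemma int_u3_le i t : \int[mu]_x `|u i x t| ^+ 3 <= Wt t ^+ 3.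
Proof.
rewrite Wt3 /Usum (bigD1 i)//= addrCA lerDl addr_ge0// sumr_ge0// => j _.
by apply: Rint_ge0 => x; rewrite exprn_ge0.
Qed.

(** Hölder's inequality is replaced by |u| W^2 <= |u|^3 + W^3, with W the value of [Wt], divided by
    W^2 after integration. *)
Lemma int_u_le i t : \int[mu]_x `|u i x t| <= 2 * Wt t.
Proof.
have W0 : 0 < Wt t by exact: lt_le_trans ltr01 (Wt_ge1 t).
have W20 : 0 < Wt t ^+ 2 by rewrite exprn_gt0.
rewrite -(ler_pM2r W20) -RintZr; last exact: intg_u.
apply: (@le_trans _ _ (\int[mu]_x (`|u i x t| ^+ 3 + Wt t ^+ 3))).
  apply: Rint_le; [exact: intgZr (intg_u i t)|exact: intgD (u3 i t) (intg_cst _ _)|].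
  by move=> x; apply: mulsq_le => //; exact: ltW.
rewrite RintD; [|exact: u3|exact: intg_cst].
rewrite Rmu_cst (_ : 2 * Wt t * Wt t ^+ 2 = Wt t ^+ 3 + Wt t ^+ 3); last by ring.
by rewrite lerD2r int_u3_le.
Qed.

Lemma int_uu_le i j t : \int[mu]_x `|u i x t * u j x t| <= 4 * Wt t ^+ 2.
Proof.
have W0 : 0 < Wt t by exact: lt_le_trans ltr01 (Wt_ge1 t).
rewrite -(ler_pM2r W0) -RintZr; last exact: intg_uu.
apply: (@le_trans _ _ (\int[mu]_x (`|u i x t| ^+ 3 + `|u j x t| ^+ 3 + 2 * Wt t ^+ 3))).
  apply: Rint_le; [exact: intgZr (intg_uu i j t)|exact: intgD (intgD (u3 i t) (u3 j t)) (intg_cst _ _)|].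
  move=> x; rewrite normrM.
  have h1 := mulsq_le (ltW W0) (normr_ge0 (u i x t)).
  have h2 := mulsq_le (ltW W0) (normr_ge0 (u j x t)).
  have h3 : 0 <= Wt t * (`|u i x t| - `|u j x t|) ^+ 2 by rewrite mulr_ge0 ?sqr_ge0// ltW.
  have h4 : 0 <= `|u i x t| * `|u j x t| * Wt t by rewrite !mulr_ge0// ltW.
  move: h1 h2 h3 h4; move: `|u i x t| `|u j x t| (Wt t) => a b w; nra.
rewrite RintD; [|exact: intgD (u3 i t) (u3 j t)|exact: intg_cst].
rewrite RintD; [|exact: u3|exact: u3].
rewrite Rmu_cst (_ : 4 * Wt t ^+ 2 * Wt t = Wt t ^+ 3 + Wt t ^+ 3 + 2 * Wt t ^+ 3); last by ring.
by rewrite lerD2r lerD// int_u3_le.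
Qed.

Section Eps.
Variables (eta : X -> R) (etaj : 'I_d -> X -> R) (N L dl : R).
Hypotheses (metaj : forall j, measurable_fun setT (etaj j))
  (Hm : mollifier eta N dl) (peta : perT eta) (HNj : forall j x, `|etaj j x| <= N)
  (HD : forall j, pd j eta (etaj j)) (etaL : forall j, \int[mu]_x `|etaj j x| <= L) (L0 : 0 <= L).
Let meta : measurable_fun setT eta. Proof. by case: Hm. Qed.
Let HN : forall x, `|eta x| <= N. Proof. by case: Hm. Qed.
Let eta0 : forall x, 0 <= eta x. Proof. by case: Hm. Qed.
Let eta1 : \int[mu]_x eta x = 1. Proof. by case: Hm. Qed.
Let N0 : 0 <= N. Proof. by apply: le_trans (HN [tuple 0 | i < d]). Qed.

Definition rr (x : X) (t : RM) : R := EE eta (rho ^~ t) x.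
Definition mm i (x : X) (t : RM) : R := EE eta (fun y => rho y t * u i y t) x.
Definition hh (x : X) (t : RM) : R := \sum_(j < d) EE (etaj j) (fun y => rho y t * u j y t) x.
Definition gg i (x : X) (t : RM) : R :=
  \sum_(j < d) EE (etaj j) (fun y => rho y t * (u i y t * u j y t)) x
  + EE (etaj i) (fun y => rho y t `^ gamma) x.
(** The time derivative of [enE] at x, obtained from the mollified equations in which [hh] and [gg]
    are the derivatives of [rr] and [mm]. *)
Definition Phi (x : X) (t : RM) : R :=
  \sum_(i < d) (mm i x t / rr x t * gg i x t - 2^-1 * (mm i x t / rr x t) ^+ 2 * hh x t)
  + gamma / (gamma - 1) * rr x t `^ (gamma - 1) * hh x t.

Lemma rr_itv x t : c <= rr x t <= C.
Proof. by apply: (@r_itv R d eta N meta HN eta0 eta1 (rho ^~ t) c C) => //; exact: mrt. Qed.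
Lemma rr_gt0 x t : 0 < rr x t.
Proof. by have /andP[h _] := rr_itv x t; exact: lt_le_trans h. Qed.

Lemma mj_rr : measurable_fun setT (fun p : X * RM => rr p.1 p.2).
Proof. exact: (meas_EEt meta mrho). Qed.
Lemma mj_mm i : measurable_fun setT (fun p : X * RM => mm i p.1 p.2).
Proof. by apply: (@meas_EEt eta (fun y t => rho y t * u i y t)) => //; exact: measurable_funM. Qed.
Lemma mj_hh : measurable_fun setT (fun p : X * RM => hh p.1 p.2).
Proof.
apply: measurable_sum => j.
by apply: (@meas_EEt (etaj j) (fun y t => rho y t * u j y t)) => //; exact: measurable_funM.
Qed.
Lemma mj_gg i : measurable_fun setT (fun p : X * RM => gg i p.1 p.2).
Proof.
apply: measurable_funD.
  apply: measurable_sum => j.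
  apply: (@meas_EEt (etaj j) (fun y t => rho y t * (u i y t * u j y t))) => //.
  by apply: measurable_funM => //; exact: measurable_funM.
apply: (@meas_EEt (etaj i) (fun y t => rho y t `^ gamma)) => //.
exact: (measurableT_comp (measurable_powR gamma) mrho).
Qed.
Lemma mj_rrV : measurable_fun setT (fun p : X * RM => (rr p.1 p.2)^-1).
Proof. by apply: (measurable_invf mj_rr c0) => p; have /andP[] := rr_itv p.1 p.2. Qed.
Lemma mj_Phi : measurable_fun setT (fun p : X * RM => Phi p.1 p.2).
Proof.
have mq i : measurable_fun setT (fun p : X * RM => mm i p.1 p.2 / rr p.1 p.2).
  by apply: measurable_funM; [exact: mj_mm|exact: mj_rrV].
apply: measurable_funD.
  apply: measurable_sum => i; apply: measurable_funB.
    by apply: measurable_funM => //; exact: mj_gg.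
  apply: measurable_funM; last exact: mj_hh.
  by apply: measurable_funM => //; exact: measurable_funX.
apply: measurable_funM; last exact: mj_hh.
by apply: measurable_funM => //; exact: (measurableT_comp (measurable_powR _) mj_rr).
Qed.

Lemma pint_ru i t : pint (fun y => rho y t * u i y t).
Proof. by apply: (pint_a (prho t) (mrt t) c0) => //; exact: p3u. Qed.
Lemma pint_ruu i j t : pint (fun y => rho y t * (u i y t * u j y t)).
Proof. by apply: (pint_ab (prho t) (mrt t) c0) => //; exact: p3u. Qed.
Lemma pint_rg t : pint (fun y => rho y t `^ gamma).
Proof. exact: (pint_p (prho t) (mrt t) c0 (fun x => rhoc x t) gamma1). Qed.

Lemma EE_le_int (k f g : X -> R) B x : measurable_fun setT k -> (forall y, `|k y| <= N) ->
  pint f -> intg mu g -> (forall y, `|f y| <= C * g y) -> \int[mu]_y g y <= B ->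
  `|EE k f x| <= N * (C * B).
Proof.
move=> mk kN pf ig fg gB.
apply: le_trans (EE_bound mk kN x pf.1 pf.2) _; apply: ler_wpM2l => //.
apply: (@le_trans _ _ (C * \int[mu]_y g y)); last by apply: ler_wpM2l => //; exact: ltW C_gt0.
by rewrite -RintZ//; apply: Rint_le => //; [exact: intg_abs pf.2|exact: intgZ].
Qed.

Lemma ru_le i (k : X -> R) x t : measurable_fun setT k -> (forall y, `|k y| <= N) ->
  `|EE k (fun y => rho y t * u i y t) x| <= N * (C * (2 * Wt t)).
Proof.
move=> mk kN; apply: (EE_le_int x mk kN (pint_ru i t) (intg_u i t)) (int_u_le i t) => y.
by rewrite normrM ler_wpM2r// rho_abs.
Qed.
Lemma ruu_le i j (k : X -> R) x t : measurable_fun setT k -> (forall y, `|k y| <= N) ->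
  `|EE k (fun y => rho y t * (u i y t * u j y t)) x| <= N * (C * (4 * Wt t ^+ 2)).
Proof.
move=> mk kN; apply: (EE_le_int x mk kN (pint_ruu i j t) (intg_uu i j t)) (int_uu_le i j t) => y.
by rewrite normrM ler_wpM2r// rho_abs.
Qed.

(** Here and in [K2] the constants depend on the kernel through its sup bound; they provide
    domination for Fubini and [dubois], while smallness comes from the commutator bounds. *)
Definition K1 : R := d%:R * (N * (C * 4)) + N * (C * 4) + N * (c `^ gamma + C `^ gamma) + 1.
Lemma NC0 : 0 <= N * (C * 4).
Proof. by rewrite mulr_ge0// mulr_ge0// ltW// C_gt0. Qed.
Lemma NP0 : 0 <= N * (c `^ gamma + C `^ gamma).
Proof. by rewrite mulr_ge0// addr_ge0 ?powR_ge0. Qed.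
Lemma dNC0 : 0 <= d%:R * (N * (C * 4)).
Proof. by rewrite mulr_ge0// NC0. Qed.
Lemma K1_ge0 : 0 <= K1.
Proof. by have := (NC0, NP0, dNC0); rewrite /K1 => -[[]]; lra. Qed.

Lemma mm_le i x t : `|mm i x t| <= K1 * Wt t.
Proof.
apply: le_trans (ru_le i x t meta HN) _.
have W0 : 0 <= Wt t by exact: le_trans (Wt_ge1 t).
rewrite !mulrA; apply: ler_wpM2r => //.
have := (NC0, NP0, dNC0); rewrite /K1 => -[[]]; have : 0 <= N * C by rewrite mulr_ge0// ltW// C_gt0.
lra.
Qed.

Lemma hh_le x t : `|hh x t| <= K1 * Wt t.
Proof.
have W0 : 0 <= Wt t by exact: le_trans (Wt_ge1 t).
apply: le_trans (ler_norm_sum _ _ _) _.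
apply: le_trans (ler_sum _ (fun j _ => ru_le j x t (metaj j) (HNj j))) _.
rewrite sumr_const card_ord -[leLHS]mulr_natl !mulrA; apply: ler_wpM2r => //.
have := (NC0, NP0, dNC0); rewrite /K1 => -[[]].
have : 0 <= d%:R * (N * C) by rewrite mulr_ge0// mulr_ge0// ltW// C_gt0.
lra.
Qed.

Lemma gg_le i x t : `|gg i x t| <= K1 * Wt t ^+ 2.
Proof.
have W1 := Wt_ge1 t; have W20 : 0 <= Wt t ^+ 2 by rewrite sqr_ge0.
have W21 : 1 <= Wt t ^+ 2 by rewrite exprn_ege1.
apply: le_trans (ler_normD _ _) _.
have h1 : `|\sum_(j < d) EE (etaj j) (fun y => rho y t * (u i y t * u j y t)) x| <= d%:R * (N * (C * 4)) * Wt t ^+ 2.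
  apply: le_trans (ler_norm_sum _ _ _) _.
  apply: le_trans (ler_sum _ (fun j _ => ruu_le i j x t (metaj j) (HNj j))) _.
  by rewrite sumr_const card_ord -[leLHS]mulr_natl !mulrA.
have h2 : `|EE (etaj i) (fun y => rho y t `^ gamma) x| <= N * (c `^ gamma + C `^ gamma).
  apply: le_trans (EE_bound (metaj i) (HNj i) x (pint_rg t).1 (pint_rg t).2) _.
  apply: ler_wpM2l => //; rewrite -[leRHS](Rmu_cst d).
  apply: Rint_le; [exact: intg_abs (pint_rg t).2|exact: intg_cst|].
  by move=> y; rewrite ger0_norm ?powR_ge0//; exact: powR_bnd.
apply: le_trans (lerD h1 h2) _; rewrite /K1.
have h3 := mulr_ge0 NC0 W20.
have h4 : N * (c `^ gamma + C `^ gamma) <= N * (c `^ gamma + C `^ gamma) * Wt t ^+ 2.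
  by rewrite ler_peMr// NP0.
have gen (a b p w : R) : 0 <= b * w -> p <= p * w -> 0 <= w -> a * w + p <= (a + b + p + 1) * w.
  by move=> *; rewrite !mulrDl mul1r; lra.
exact: gen.
Qed.

Definition K2 : R := d%:R * (K1 / c * K1 + 2^-1 * (K1 / c) ^+ 2 * K1)
  + gamma / (gamma - 1) * (c `^ (gamma - 1) + C `^ (gamma - 1)) * K1.

Lemma gg1_ge0 : 0 <= gamma / (gamma - 1).
Proof.
apply: divr_ge0; first by apply: ltW; exact: lt_trans ltr01 gamma1.
by rewrite subr_ge0; exact: ltW.
Qed.

Lemma Phi_le x t : `|Phi x t| <= K2 * Usum t.
Proof.
have W1 := Wt_ge1 t; have W0 : 0 <= Wt t by exact: le_trans W1.
have K10 := K1_ge0.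
have Kc0 : 0 <= K1 / c by rewrite divr_ge0// ltW.
have v_le i : `|mm i x t / rr x t| <= K1 / c * Wt t.
  rewrite normrM mulrAC; apply: ler_pM => //; first exact: mm_le.
  rewrite gtr0_norm ?invr_gt0 ?rr_gt0// lef_pV2 ?posrE ?rr_gt0//.
  by have /andP[] := rr_itv x t.
rewrite -Wt3 /K2 mulrDl; apply: le_trans (ler_normD _ _) _; apply: lerD.
  apply: le_trans (ler_norm_sum _ _ _) _.
  have h i : `|mm i x t / rr x t * gg i x t - 2^-1 * (mm i x t / rr x t) ^+ 2 * hh x t|
     <= (K1 / c * K1 + 2^-1 * (K1 / c) ^+ 2 * K1) * Wt t ^+ 3.
    apply: le_trans (ler_normB _ _) _; rewrite mulrDl; apply: lerD.
      rewrite normrM (_ : K1 / c * K1 * Wt t ^+ 3 = K1 / c * Wt t * (K1 * Wt t ^+ 2)); last by ring.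
      by apply: ler_pM => //; exact: gg_le.
    rewrite normrM (_ : 2^-1 * (K1 / c) ^+ 2 * K1 * Wt t ^+ 3 = 2^-1 * (K1 / c * Wt t) ^+ 2 * (K1 * Wt t)); last by ring.
    apply: ler_pM => //; last exact: hh_le.
    rewrite normrM ger0_norm ?invr_ge0// ler_pM2l ?invr_gt0// normrX.
    have KW : 0 <= K1 / c * Wt t by rewrite mulr_ge0.
    by rewrite ler_pXn2r ?nnegrE//; exact: v_le.
  apply: le_trans (ler_sum _ (fun i _ => h i)) _.
  by rewrite sumr_const card_ord -[leLHS]mulr_natl mulrA.
rewrite normrM -[leRHS]mulrA; apply: ler_pM => //.
  rewrite normrM (ger0_norm gg1_ge0) ger0_norm ?powR_ge0//.
  by apply: ler_wpM2l; [exact: gg1_ge0|apply: powR_bnd => //; exact: rr_itv].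
apply: le_trans (hh_le x t) _; apply: ler_wpM2l => //.
by rewrite -[leLHS]mulr1 exprS; apply: ler_wpM2l => //; rewrite exprn_ege1.
Qed.

Lemma Phi_split x t : Phi x t =
  \sum_(i < d) \sum_(j < d) Kin eta etaj (rho ^~ t) (u i ^~ t) (u j ^~ t) j x
  + \sum_(j < d) Prs eta etaj j (rho ^~ t) (u j ^~ t) gamma x.
Proof.
transitivity (\sum_(i < d) (\sum_(j < d) Kin eta etaj (rho ^~ t) (u i ^~ t) (u j ^~ t) j x
    + mm i x t / rr x t * EE (etaj i) (fun y => rho y t `^ gamma) x)
  + gamma / (gamma - 1) * rr x t `^ (gamma - 1) * hh x t).
  rewrite /Phi; congr (_ + _); apply: eq_bigr => i _.
  by rewrite /gg /hh /Kin mulrDr !mulr_sumr sumrB addrAC.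
rewrite big_split/= -addrA; congr (_ + _).
by rewrite /hh mulr_sumr -big_split.
Qed.

(** A bound depending on time alone suffices for Fubini, because the spatial measure is a
    probability. *)
Lemma intg_sw (f : X -> RM -> R) (g : RM -> R) : measurable_fun setT (fun p : X * RM => f p.1 p.2) ->
  intg m g -> (forall x t, `|f x t| <= g t) ->
  [/\ forall x, intg m (f x), forall t, intg mu (f ^~ t) & (mu \x m)%E.-integrable setT (fun p : X * RM => (f p.1 p.2)%:E)].
Proof.
move=> mf ig fg; split.
- by move=> x; apply: intg_le ig _ => //; exact: (meas_sect1 mf x).
- move=> t; apply: (@intg_bounded _ _ _ mu _ (g t)) => //; exact: (meas_sect2 mf t).
apply/integrableP; split; first exact/measurable_EFinP.
have ma : measurable_fun setT (fun p : X * RM => `|f p.1 p.2|%:E).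
  by apply/measurable_EFinP; exact: measurableT_comp.
rewrite (@fubini_tonelli1 _ _ X RM R mu m _ ma)//= /fubini_F.
apply: (@le_lt_trans _ _ (\int[mu]_x (\int[m]_t g t)%:E)%E).
  apply: ge0_le_integral => //.
  - by move=> x _; apply: integral_ge0.
  - exact: (@measurable_param _ _ X RM R m _ ma).
  - move=> x _; rewrite EFin_Rint//; apply: ge0_le_integral => //.
    + exact: (meas_sect1 ma x).
    + by apply/measurable_EFinP; exact: intg_meas ig.
    + by move=> t _; rewrite lee_fin.
by rewrite integral_cst//= probability_setT mule1 ltry.
Qed.

Variables (rho0 : X -> R) (u0 : 'I_d -> X -> R).
Hypotheses (prho0 : perT rho0) (mrho0 : measurable_fun setT rho0) (rho0c : forall x, c <= rho0 x <= C)
  (pu0 : forall i, perT (u0 i)) (iu0 : forall i, intg mu (fun x => rho0 x * u0 i x)).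
Hypotheses
  (Wr : forall x, wtest T (rr x) (hh x))
  (Wi : forall i x, wtest T (mm i x) (gg i x))
  (init_r : forall x e, 0 < e -> exists2 dl, 0 < dl & {ae m, forall t, t < dl -> `|rr x t - EE eta rho0 x| <= e})
  (init_m : forall i x e, 0 < e -> exists2 dl, 0 < dl &
     {ae m, forall t, t < dl -> `|mm i x t - EE eta (fun y => rho0 y * u0 i y) x| <= e}).

Lemma Wt_leU t : Wt t <= Usum t /\ Wt t ^+ 2 <= Usum t.
Proof.
have W1 := Wt_ge1 t; have W0 : 0 <= Wt t by exact: le_trans W1.
rewrite -Wt3; split.
  by rewrite -[leLHS]mulr1 exprS; apply: ler_wpM2l => //; rewrite exprn_ege1.
by rewrite [leRHS]exprSr ler_peMr// sqr_ge0.
Qed.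

Lemma ae_rr x : {ae m, forall t, rr x t = EE eta rho0 x + J T (hh x) t}.
Proof.
apply: dubois => //.
- apply: (@intg_bounded _ _ _ m _ C); first exact: (meas_sect1 mj_rr x).
  by move=> t; rewrite gtr0_norm ?rr_gt0//; have /andP[] := rr_itv x t.
- apply: (@intg_le _ _ _ m _ (fun t => K1 * Usum t)); first exact: (meas_sect1 mj_hh x).
    exact: intgZ intg_Usum.
  by move=> t; apply: le_trans (hh_le x t) _; apply: ler_wpM2l; [exact: K1_ge0|exact: (Wt_leU t).1].
- exact: init_r.
Qed.

Lemma intg_hh x : intg m (hh x).
Proof.
apply: (@intg_le _ _ _ m _ (fun t => K1 * Usum t)); first exact: (meas_sect1 mj_hh x).
  exact: intgZ intg_Usum.
by move=> t; apply: le_trans (hh_le x t) _; apply: ler_wpM2l; [exact: K1_ge0|exact: (Wt_leU t).1].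
Qed.
Lemma intg_gg i x : intg m (gg i x).
Proof.
apply: (@intg_le _ _ _ m _ (fun t => K1 * Usum t)); first exact: (meas_sect1 (mj_gg i) x).
  exact: intgZ intg_Usum.
by move=> t; apply: le_trans (gg_le i x t) _; apply: ler_wpM2l; [exact: K1_ge0|exact: (Wt_leU t).2].
Qed.

Lemma ae_mm i x : {ae m, forall t, mm i x t = EE eta (fun y => rho0 y * u0 i y) x + J T (gg i x) t}.
Proof.
apply: dubois => //.
- apply: (@intg_le _ _ _ m _ (fun t => K1 * Usum t)); first exact: (meas_sect1 (mj_mm i) x).
    exact: intgZ intg_Usum.
  by move=> t; apply: le_trans (mm_le i x t) _; apply: ler_wpM2l; [exact: K1_ge0|exact: (Wt_leU t).1].
- exact: intg_gg.
- exact: init_m.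
Qed.

Lemma ae_all (n : nat) (P : 'I_n -> RM -> Prop) : (forall i, {ae m, forall t, P i t}) ->
  {ae m, forall t, forall i, P i t}.
Proof.
move=> H; have : forall k : nat, {ae m, forall t, forall i : 'I_n, i = k :> nat -> P i t}.
  move=> k; have [kn|nk] := ltnP k n.
    by apply: aeS (H (Ordinal kn)) => t h i E; have -> : i = Ordinal kn by exact: val_inj.
  by apply: aeW => t i E; have := ltn_ord i; rewrite E ltnNge nk.
by move/ae_foralln; apply: aeS => t h i; exact: (h i i).
Qed.

Lemma ae_en x : {ae m, forall t, enE gamma (rho ^~ t) (fun i => u i ^~ t) eta x
   = enE gamma rho0 u0 eta x + J T (Phi x) t}.
Proof.
have r0I : c <= EE eta rho0 x <= C.
  by apply: (@r_itv R d eta N meta HN eta0 eta1 rho0 c C).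
have mr : measurable_fun setT (rr x) by exact: (meas_sect1 mj_rr x).
have rI t : c <= rr x t <= C by exact: rr_itv.
have k i := ode_kin T0 c0 (intg_hh x) mr rI r0I (ae_rr x) (intg_gg i x) (meas_sect1 (mj_mm i) x) (ae_mm i x).
have [pi p] := ode_prs T0 c0 (intg_hh x) mr rI r0I (ae_rr x) gamma1.
apply: aeS (aeI (ae_all (fun i => (k i).2)) p) => t [E1 E2].
rewrite /enE -/(rr x t) E2 (eq_bigr _ (fun i _ => E1 i)) big_split/= -J_sum; last by move=> i; exact: (k i).1.
rewrite addrACA -J_D//; apply: intg_sum => i; exact: (k i).1.
Qed.

Definition Psi (t : RM) : R := \int[mu]_x Phi x t.

Lemma Psi_le t : `|Psi t| <= K2 * Usum t.
Proof.
have [_ i2 _] := intg_sw mj_Phi (intgZ K2 intg_Usum) Phi_le.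
apply: le_trans (Rint_abs (i2 t)) _; rewrite -[leRHS](Rmu_cst d).
by apply: Rint_le; [exact: intg_abs (i2 t)|exact: intg_cst|move=> x; exact: Phi_le].
Qed.
Lemma Psi_meas : measurable_fun setT Psi.
Proof.
apply: (@measurable_Rparam _ _ RM X R mu (fun q => Phi q.2 q.1)).
apply: (mw2 (w := Phi)) => //; exact: mj_Phi.
Qed.
Lemma intg_Psi : intg m Psi.
Proof. exact: intg_le Psi_meas (intgZ K2 intg_Usum) Psi_le. Qed.

Lemma J_Phi_fub t : \int[mu]_x J T (Phi x) t = J T Psi t.
Proof.
have mlt : measurable_fun setT (fun p : X * RM => (p.2 < t)%R%:R : R).
  exact: (measurableT_comp (meas_lt t) measurable_snd).
have mP := measurable_funM mj_Phi mlt.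
have bP x s : `|Phi x s * (s < t)%R%:R| <= K2 * Usum s.
  by rewrite normrM; apply: le_trans (Phi_le x s); rewrite -[leRHS]mulr1 ler_wpM2l// natb_le1.
have [i1 i2 i3] := intg_sw (f := fun x s => Phi x s * (s < t)%R%:R) mP (intgZ K2 intg_Usum) bP.
rewrite /J (@Rint_fubini _ _ X RM R mu m (fun p => Phi p.1 p.2 * (p.2 < t)%R%:R) i3 i1 i2)/=.
apply: eq_Rintegral => s _; rewrite RintZr//.
by have [_ h _] := intg_sw mj_Phi (intgZ K2 intg_Usum) Phi_le.
Qed.

(** In [ae_en] the exceptional set of times depends on x. By Tonelli the defect [G] has zero
    integral over space and time, so for almost every t it vanishes for almost every x, which allows
    integration in x at that t. *)
Lemma ae_int_en : {ae m, forall t, \int[mu]_x enE gamma (rho ^~ t) (fun i => u i ^~ t) eta x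
   = \int[mu]_x enE gamma rho0 u0 eta x + J T Psi t}.
Proof.
pose G (x : X) (t : RM) : R := enE gamma (rho ^~ t) (fun i => u i ^~ t) eta x - (enE gamma rho0 u0 eta x + J T (Phi x) t).
have ir0 i : intg mu (fun y => rho0 y * u0 i y) by exact: iu0.
have b0 : bm (enE gamma rho0 u0 eta).
  by apply: (@bm_enE R d c C gamma c0 rho0 u0 prho0 mrho0 rho0c pu0 ir0 eta N dl).
have bt t : bm (enE gamma (rho ^~ t) (fun i => u i ^~ t) eta).
  by apply: (@bm_enE R d c C gamma c0 (rho ^~ t) (fun i => u i ^~ t) (prho t) (mrt t) (fun x => rhoc x t) (fun i => pu i t) (fun i => (pint_ru i t).2) eta N dl).
have mJ : measurable_fun setT (fun p : X * RM => J T (Phi p.1) p.2).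
  apply: (@measurable_Rparam _ _ (X * RM)%type RM R m (fun q => Phi q.1.1 q.2 * (q.2 < q.1.2)%R%:R)).
  apply: measurable_funM.
    by apply: (mw2 (w := Phi)); [exact: mj_Phi|exact: (measurableT_comp measurable_fst)|].
  pose k : bool -> R := fun b => b%:R.
  apply: (measurableT_comp (f := k)) => //; apply: measurable_fun_ltr => //.
  exact: (measurableT_comp measurable_snd).
have menE : measurable_fun setT (fun p : X * RM => enE gamma (rho ^~ p.2) (fun i => u i ^~ p.2) eta p.1).
  apply: measurable_funD.
    apply: measurable_sum => i; apply: measurable_funM => //; apply: measurable_funM; last exact: mj_rrV.
    by apply: measurable_funX; exact: mj_mm.
  by apply: measurable_funM => //; exact: (measurableT_comp (measurable_powR _) mj_rr).
have mG : measurable_fun setT (fun p : X * RM => G p.1 p.2).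
  apply: measurable_funB; first exact: menE.
  apply: measurable_funD; last exact: mJ.
  exact: (measurableT_comp b0.1 measurable_fst).
have mGa : measurable_fun setT (fun p : X * RM => `|G p.1 p.2|%:E).
  by apply/measurable_EFinP; exact: measurableT_comp.
have Z : (\int[m]_t \int[mu]_x `|G x t|%:E = 0)%E.
  have <- := @fubini_tonelli _ _ X RM R mu m (fun p => `|G p.1 p.2|%:E) mGa (fun p => normr_ge0 _).
  apply: integral0_eq => x _ /=.
  have /(ae_eq_integral_abs m measurableT)  : measurable_fun setT (fun t : RM => (G x t)%:E).
    by apply/measurable_EFinP; exact: (meas_sect1 mG x).
  move=> [_ H]; rewrite -[RHS]H; first by apply: eq_integral => t _.
  by apply: aeS (ae_en x) => t E _; rewrite /G E subrr.
have mI : measurable_fun setT (fun t : RM => \int[mu]_x `|G x t|%:E)%E.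
  apply: (@measurable_param _ _ RM X R mu (fun q => `|G q.2 q.1|%:E)).
  apply/measurable_EFinP; apply: measurableT_comp => //.
  by apply: (mw2 (w := G)).
have aeG : {ae m, forall t, (\int[mu]_x `|G x t|%:E = 0)%E}.
  have /(ae_eq_integral_abs m measurableT)[H _] := mI.
  have := H; rewrite (_ : integral _ _ _ = 0)%E.
    by move=> /(_ erefl); apply: aeS => t; exact.
  by rewrite -[RHS]Z; apply: eq_integral => t _; rewrite gee0_abs// integral_ge0.
apply: aeS aeG => t Et.
have [i1 i2 i3] := intg_sw mj_Phi (intgZ K2 intg_Usum) Phi_le.
have iJ : intg mu (fun x => J T (Phi x) t).
  apply: (@intg_bounded _ _ _ mu _ (\int[m]_s (K2 * Usum s))); first exact: (meas_sect2 mJ t).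
  move=> x; apply: le_trans (Rint_abs (intg_J t (i1 x))) _.
  apply: Rint_le; [exact: intg_abs (intg_J t (i1 x))|exact: intgZ intg_Usum|].
  by move=> s; rewrite normrM; apply: le_trans (Phi_le x s); rewrite -[leRHS]mulr1 ler_wpM2l// natb_le1.
have iG : intg mu (G ^~ t) by exact: intgB (bm_intg mu (bt t)) (intgD (bm_intg mu b0) iJ).
rewrite -J_Phi_fub -RintD//; last exact: bm_intg b0.
apply/eqP; rewrite -subr_eq0 -RintB; [|exact: bm_intg (bt t)|exact: intgD (bm_intg mu b0) iJ].
rewrite -normr_le0 -lee_fin; apply: (@le_trans _ _ (\int[mu]_x `|G x t|)%:E).
  by rewrite lee_fin; exact: Rint_abs iG.
by rewrite EFin_Rint ?Et//; exact: intg_abs.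
Qed.

Lemma ae_int_en_le Q : (\int[m]_s `|Psi s|%:E <= Q%:E)%E ->
  {ae m, forall t, `|\int[mu]_x enE gamma (rho ^~ t) (fun i => u i ^~ t) eta x
   - \int[mu]_x enE gamma rho0 u0 eta x| <= Q}.
Proof.
move=> HQ; apply: aeS ae_int_en => t ->.
have E (a b : R) : a + b - a = b by rewrite addrC addKr.
rewrite E.
apply: le_trans (Rint_abs (intg_J t intg_Psi)) _.
apply: (@le_trans _ _ (\int[m]_s `|Psi s|)).
  apply: Rint_le; [exact: intg_abs (intg_J t intg_Psi)|exact: intg_abs intg_Psi|].
  by move=> s; rewrite normrM -[leRHS]mulr1 ler_wpM2l// natb_le1.
by rewrite -lee_fin EFin_Rint//; exact: intg_abs intg_Psi.
Qed.

Variables (Bu Br q Kg : R).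
Hypotheses (HBu : forall i j, (\int[m]_t YI eta etaj L j (u i ^~ t) <= Bu%:E)%E)
  (HBr : forall j, (\int[m]_t YI eta etaj L j (rho ^~ t) <= Br%:E)%E)
  (q0 : 0 < q) (Kg0 : 0 <= Kg)
  (HKg : forall s t, c <= s <= C -> c <= t <= C ->
     `|s `^ gamma - t `^ gamma - gamma * t `^ (gamma - 1) * (s - t)| <= Kg * (s - t) ^+ 2).

Lemma mYI (w : X -> R -> R) j : measurable_fun setT (fun p : X * RM => w p.1 p.2) ->
  measurable_fun setT (fun t : RM => YI eta etaj L j (w ^~ t)).
Proof.
move=> mw.
apply: (@measurable_param _ _ RM X R mu (fun q => (YY eta etaj L j (w ^~ q.1) q.2)%:E)).
apply/measurable_EFinP.
apply: (@measurable_Rparam _ _ (RM * X)%type X R mu (fun q => kap eta etaj L j q.2 * \int[mu]_be (eta be * `|w (tadd q.1.2 q.2) q.1.1 - w (tadd q.1.2 be) q.1.1| ^+ 3))).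
apply: measurable_funM.
  by apply: (measurableT_comp (kap_meas L j meta metaj)).
apply: (@measurable_Rparam _ _ ((RM * X) * X)%type X R mu (fun q => eta q.2 * `|w (tadd q.1.1.2 q.1.2) q.1.1.1 - w (tadd q.1.1.2 q.2) q.1.1.1| ^+ 3)).
have m1 : measurable_fun setT (fun q : ((RM * X) * X) * X => q.1.1) by exact: (measurableT_comp measurable_fst).
have m11 : measurable_fun setT (fun q : ((RM * X) * X) * X => q.1.1.1) by exact: (measurableT_comp measurable_fst).
have m12 : measurable_fun setT (fun q : ((RM * X) * X) * X => q.1.1.2) by exact: (measurableT_comp measurable_snd).
have m2 : measurable_fun setT (fun q : ((RM * X) * X) * X => q.1.2) by exact: (measurableT_comp measurable_snd).
apply: measurable_funM; first exact: (measurableT_comp meta).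
apply: measurable_funX; apply: measurableT_comp => //; apply: measurable_funB.
  by apply: (mw2 mw) => //; exact: measurable_tadd.
by apply: (mw2 mw) => //; exact: measurable_tadd.
Qed.

Lemma YI_ge0 (w : X -> R) j : (0 <= YI eta etaj L j w)%E.
Proof. by apply: integral_ge0 => x _; rewrite lee_fin; exact: YY_ge0. Qed.

Lemma int_comb (f : RM -> R) (w1 w2 : X -> R -> R) j k1 k2 b1 b2 :
  measurable_fun setT f -> measurable_fun setT (fun p : X * RM => w1 p.1 p.2) ->
  measurable_fun setT (fun p : X * RM => w2 p.1 p.2) -> 0 <= k1 -> 0 <= k2 ->
  (forall t, (`|f t|%:E <= k1%:E * YI eta etaj L j (w1 ^~ t) + k2%:E * YI eta etaj L j (w2 ^~ t))%E) ->
  (\int[m]_t YI eta etaj L j (w1 ^~ t) <= b1%:E)%E ->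
  (\int[m]_t YI eta etaj L j (w2 ^~ t) <= b2%:E)%E ->
  (\int[m]_t `|f t|%:E <= (k1 * b1 + k2 * b2)%:E)%E.
Proof.
move=> mf m1 m2 k10 k20 H H1 H2.
have mY1 := mYI j m1; have mY2 := mYI j m2.
exact: (int_comb_gen mf mY1 mY2 (fun t => YI_ge0 _ _) (fun t => YI_ge0 _ _) k10 k20 H H1 H2).
Qed.

Definition KB : R := Kc c C * Bu + Kc c C * Bu.
Definition PB : R := C / c * Kg * q ^+ 6 * (C / c) ^+ 3 * Bu + C / c * Kg / q ^+ 3 * Br.

Lemma Kc_ge0 : 0 <= Kc c C.
Proof.
have C0 := ltW C_gt0; have c0' := ltW c0; have Cc : 0 <= C / c by exact: divr_ge0.
by rewrite /Kc mulr_ge0 ?exprn_ge0// addr_ge0// mulr_ge0.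
Qed.

Let KI i j (t : RM) : R := \int[mu]_x Kin eta etaj (rho ^~ t) (u i ^~ t) (u j ^~ t) j x.
Let PI j (t : RM) : R := \int[mu]_x Prs eta etaj j (rho ^~ t) (u j ^~ t) gamma x.

Lemma mKI i j : measurable_fun setT (KI i j).
Proof.
apply: (@measurable_Rparam _ _ RM X R mu (fun q => Kin eta etaj (rho ^~ q.1) (u i ^~ q.1) (u j ^~ q.1) j q.2)).
have sw (f : X * RM -> R) : measurable_fun setT f -> measurable_fun setT (fun q : RM * X => f (q.2, q.1)).
  by move=> mf; apply: (measurableT_comp mf); exact: measurable_fun_pair.
have mv : measurable_fun setT (fun q : RM * X => mm i q.2 q.1 / rr q.2 q.1).
  exact: (sw _ (measurable_funM (mj_mm i) mj_rrV)).
apply: measurable_funB; apply: measurable_funM => //.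
- apply: (sw (fun p => EE (etaj j) (fun y => rho y p.2 * (u i y p.2 * u j y p.2)) p.1)).
  apply: (@meas_EEt (etaj j) (fun y t => rho y t * (u i y t * u j y t))) => //.
  by apply: measurable_funM => //; exact: measurable_funM.
- by apply: measurable_funM => //; exact: measurable_funX.
- apply: (sw (fun p => EE (etaj j) (fun y => rho y p.2 * u j y p.2) p.1)).
  by apply: (@meas_EEt (etaj j) (fun y t => rho y t * u j y t)) => //; exact: measurable_funM.
Qed.

Lemma mPI j : measurable_fun setT (PI j).
Proof.
apply: (@measurable_Rparam _ _ RM X R mu (fun q => Prs eta etaj j (rho ^~ q.1) (u j ^~ q.1) gamma q.2)).
have sw (f : X * RM -> R) : measurable_fun setT f -> measurable_fun setT (fun q : RM * X => f (q.2, q.1)).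
  by move=> mf; apply: (measurableT_comp mf); exact: measurable_fun_pair.
apply: measurable_funD; apply: measurable_funM => //.
- exact: (sw _ (measurable_funM (mj_mm j) mj_rrV)).
- apply: (sw (fun p => EE (etaj j) (fun y => rho y p.2 `^ gamma) p.1)).
  apply: (@meas_EEt (etaj j) (fun y t => rho y t `^ gamma)) => //.
  exact: (measurableT_comp (measurable_powR gamma) mrho).
- apply: measurable_funM => //; apply: (measurableT_comp (measurable_powR _)).
  exact: (sw _ mj_rr).
- apply: (sw (fun p => EE (etaj j) (fun y => rho y p.2 * u j y p.2) p.1)).
  by apply: (@meas_EEt (etaj j) (fun y t => rho y t * u j y t)) => //; exact: measurable_funM.
Qed.

Lemma int_KI i j : (\int[m]_t `|KI i j t|%:E <= KB%:E)%E.
Proof.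
apply: (@int_comb (KI i j) (u i) (u j) j (Kc c C) (Kc c C) Bu Bu) => //.
- exact: mKI.
- exact: Kc_ge0.
- exact: Kc_ge0.
- move=> t.
  exact: (Kin_bound meta metaj peta HN HNj HD eta0 eta1 etaL j L0 (prho t) (mrt t) c0 (fun x => rhoc x t) (p3u i t) (p3u j t)).
Qed.

Lemma int_PI j : (\int[m]_t `|PI j t|%:E <= PB%:E)%E.
Proof.
have C0 := ltW C_gt0; have c0' := ltW c0; have Cc : 0 <= C / c by exact: divr_ge0.
have q0' := ltW q0.
apply: (@int_comb (PI j) (u j) rho j (C / c * Kg * q ^+ 6 * (C / c) ^+ 3) (C / c * Kg / q ^+ 3) Bu Br) => //.
- exact: mPI.
- apply: mulr_ge0; last exact: exprn_ge0.
  by apply: mulr_ge0; [exact: mulr_ge0|exact: exprn_ge0].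
- by rewrite divr_ge0 ?exprn_ge0// mulr_ge0.
- move=> t.
  exact: (Prs_bound meta metaj peta HN HNj HD eta0 eta1 etaL j L0 (prho t) (mrt t) c0 (fun x => rhoc x t) (p3u j t) gamma1 HKg Kg0 q0).
Qed.

Lemma Psi_split t : `|Psi t| <= \sum_(i < d) \sum_(j < d) `|KI i j t| + \sum_(j < d) `|PI j t|.
Proof.
have bK i j : intg mu (Kin eta etaj (rho ^~ t) (u i ^~ t) (u j ^~ t) j).
  exact: bm_intg (bm_Kin meta metaj HN HNj eta0 eta1 (prho t) (mrt t) c0 (fun x => rhoc x t) j (p3u i t) (p3u j t)).
have bP j : intg mu (Prs eta etaj j (rho ^~ t) (u j ^~ t) gamma).
  exact: bm_intg (bm_Prs meta metaj HN HNj eta0 eta1 j (prho t) (mrt t) c0 (fun x => rhoc x t) (p3u j t) gamma1).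
have -> : Psi t = \sum_(i < d) \sum_(j < d) KI i j t + \sum_(j < d) PI j t.
  rewrite /Psi; under eq_Rintegral do rewrite Phi_split.
  rewrite RintD; [|by apply: intg_sum => i; exact: intg_sum|exact: intg_sum].
  rewrite !Rint_sum//; last by move=> i; exact: intg_sum.
  by congr (_ + _); apply: eq_bigr => i _; rewrite Rint_sum.
apply: le_trans (ler_normD _ _) _; apply: lerD; last exact: ler_norm_sum.
apply: le_trans (ler_norm_sum _ _ _) _; apply: ler_sum => i _; exact: ler_norm_sum.
Qed.

Lemma int_Psi : (\int[m]_t `|Psi t|%:E <= (d%:R * (d%:R * KB) + d%:R * PB)%:E)%E.
Proof.
have mK i : measurable_fun setT (fun t => \sum_(j < d) `|KI i j t|).
  by apply: measurable_sum => j; apply: measurableT_comp => //; exact: mKI.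
have mP j : measurable_fun setT (fun t => `|PI j t|) by apply: measurableT_comp => //; exact: mPI.
have mKs : measurable_fun setT (fun t => \sum_(i < d) \sum_(j < d) `|KI i j t|) by exact: measurable_sum.
have mPs : measurable_fun setT (fun t => \sum_(j < d) `|PI j t|) by exact: measurable_sum.
have K0 i t : 0 <= \sum_(j < d) `|KI i j t| by exact: sumr_ge0.
apply: (@le_trans _ _ (\int[m]_t ((\sum_(i < d) \sum_(j < d) `|KI i j t|)%:E + (\sum_(j < d) `|PI j t|)%:E))%E).
  apply: ge0_le_integral => //.
  - by apply/measurable_EFinP; apply: measurableT_comp => //; exact: Psi_meas.
  - by apply: emeasurable_funD; exact/measurable_EFinP.
  - by move=> t _; rewrite -EFinD lee_fin Psi_split.
rewrite ge0_integralD//; last 4 first.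
- by move=> t _; rewrite lee_fin sumr_ge0.
- exact/measurable_EFinP.
- by move=> t _; rewrite lee_fin sumr_ge0.
- exact/measurable_EFinP.
rewrite EFinD; apply: leeD.
  apply: int_sum_le => // i; apply: int_sum_le => j //.
  - by apply: measurableT_comp => //; exact: mKI.
  - exact: int_KI.
by apply: int_sum_le => // j; exact: int_PI.
Qed.
End Eps.
End Core.

Section EqLim.
Variable R : realType.
(** If b were below a, fix A strictly between them: along small [del n] the values f n stay above A
    while remaining arbitrarily close to g n, which is at most b. *)
Lemma lim_le (a b : \bar R) (f g : nat -> R) (del : nat -> R) :
  (forall n, 0 < del n) -> (forall e, 0 < e -> \forall n \near \oo, del n < e) ->
  (forall e, 0 < e -> exists2 dl, 0 < dl & forall n, del n < dl -> `|f n - g n| <= e) ->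
  (0 <= b)%E -> (forall n, ((g n)%:E <= b)%E) ->
  (forall A : R, (A%:E < a)%E -> exists2 dl, 0 < dl & forall n, del n < dl -> A <= f n) ->
  (a <= b)%E.
Proof.
move=> d0 dn fg b0 gb fa; rewrite leNgt; apply/negP => ba.
have bf : b \is a fin_num by rewrite ge0_fin_numE// (lt_le_trans ba)// leey.
have [A bA Aa] : exists2 A : R, fine b < A & (A%:E < a)%E.
  move: ba; rewrite -(fineK bf); case: a fa => [r| |] fa //; rewrite ?lte_fin => br.
    by exists ((fine b + r) / 2); rewrite ?lte_fin; lra.
  by exists (fine b + 1); [rewrite ltrDl|rewrite ltry].
have e0 : 0 < (A - fine b) / 2 by rewrite divr_gt0// subr_gt0.
have [d1 d10 H1] := fg _ e0; have [d2 d20 H2] := fa _ Aa.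
have [n [n1 n2]] : exists n, del n < d1 /\ del n < d2.
  apply: (@filter_ex _ (\oo : set_system nat)); near=> n; split.
    by near: n; exact: dn.
  by near: n; exact: dn.
have h1 : g n <= fine b by rewrite -lee_fin fineK.
have h2 := H2 n n2; have := H1 n n1; rewrite ler_distl => /andP[h3 h4].
move: (fine b) bA e0 h1 h3 h4 => y; lra.
Unshelve. all: by end_near. Qed.
End EqLim.

Section Supp.
Variables (R : realType) (d : nat) (T eps : R).
Hypothesis eps01 : 0 < eps < 1.
Notation X := (d.-tuple R).
Notation RM := (measurableTypeR R).
Notation mu := (muT R d).
Notation m := (lamT T).

Lemma etaK_mollifier N : (forall x : X, `|etaK eps x| <= N) -> mollifier (@etaK R d eps) N eps.
Proof.
move=> HN; split => //.
- exact: etaK_meas.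
- exact: etaK_ge0.
- exact: etaK_int1.
- move=> x cx ex i; have /andP[h1 h2] := etaK_supp eps01 cx ex i.
  by rewrite gtr0_norm.
Qed.

Lemma hj_per j i s : @hj R d eps j i (s + 1) = hj eps j i s.
Proof. by rewrite /hj /hpick; case: ifP => _; rewrite ?gk1 ?gk'1. Qed.
Lemma etajK_per j : perT (@etajK R d eps j).
Proof. by apply: per_prodk => i s; exact: hj_per. Qed.

Lemma fr_supp (x : X) : etaK eps x != 0 \/ (exists j, etajK eps j x != 0) ->
  forall i, 0 < tnth (fr x) i < eps.
Proof.
case=> [h|[j h]].
  have h' : etaK eps (fr x) != 0 by rewrite (per_fr (@etaK_per R d eps) x).
  exact: (etaK_supp eps01 (fr_cell x) h').
have h' : etajK eps j (fr x) != 0 by rewrite (per_fr (@etajK_per j) x).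
exact: (etajK_supp eps01 (fr_cell x) h').
Qed.

(** Replace both shifts by their cell representatives and translate the variable by [fr be]: only
    the single increment h = [fr al] - [fr be] remains, with coordinates of size at most eps because
    both representatives lie in (0, eps)^d. *)
Lemma incr_shift (w : X -> R -> R) (al be : X) (B : R) :
  measurable_fun setT (fun p : X * RM => w p.1 p.2) -> (forall t, perT (w ^~ t)) ->
  (forall i, 0 < tnth (fr al) i < eps) -> (forall i, 0 < tnth (fr be) i < eps) ->
  (forall h, (forall k, `|tnth h k| <= eps) ->
     (\int[m]_t \int[mu]_x (`|w (tadd x h) t - w x t| ^+ 3)%:E <= B%:E)%E) ->
  (\int[m]_t \int[mu]_x (`|w (tadd x al) t - w (tadd x be) t| ^+ 3)%:E <= B%:E)%E.
Proof.
move=> mw pw sa sb H.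
pose h : X := [tuple tnth (fr al) i - tnth (fr be) i | i < d].
have hE x : tadd (tadd x (fr be)) h = tadd x (fr al).
  by apply: eq_from_tnth => i; rewrite !tnth_mktuple; ring.
have hk k : `|tnth h k| <= eps.
  rewrite tnth_mktuple ler_norml; have /andP[a1 a2] := sa k; have /andP[b1 b2] := sb k.
  by apply/andP; split; lra.
apply: le_trans (H h hk); rewrite le_eqVlt; apply/orP; left; apply/eqP.
apply: eq_integral => t _.
have mwt : measurable_fun setT (w ^~ t) by exact: (meas_sect2 mw t).
rewrite -(@ge0_muT_shift R d (fun x => (`|w (tadd x h) t - w x t| ^+ 3)%:E) (fr be)).
- apply: eq_integral => x _; rewrite hE.
  have pf : perT (fun al => w (tadd x al) t) by move=> y j; rewrite taddA pw.
  by rewrite (per_fr pf al) (per_fr pf be).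
- apply/measurable_EFinP; apply: measurable_funX; apply: measurableT_comp => //.
  apply: measurable_funB; last exact: mwt.
  exact: (measurableT_comp mwt (measurable_taddl h)).
- by move=> x; rewrite lee_fin exprn_ge0.
- by move=> x j; rewrite taddAC !pw.
Qed.
End Supp.

Section CoreFinal.
Variables (R : realType) (d : nat) (T c C gamma : R).
Notation X := (d.-tuple R).
Notation RM := (measurableTypeR R).
Notation mu := (muT R d).
Notation m := (lamT T).
Variables (rho : X -> R -> R) (u : 'I_d -> X -> R -> R).
Hypotheses (T0 : 0 < T) (c0 : 0 < c) (gamma1 : 1 < gamma).
Hypotheses (mrho : measurable_fun setT (fun p : X * RM => rho p.1 p.2))
  (mu_ : forall i, measurable_fun setT (fun p : X * RM => u i p.1 p.2))
  (prho : forall t, perT (rho ^~ t)) (pu : forall i t, perT (u i ^~ t))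
  (rhoc : forall x t, c <= rho x t <= C)
  (u3 : forall i t, intg mu (fun x => `|u i x t| ^+ 3))
  (u3T : forall i, intg m (fun t => \int[mu]_x `|u i x t| ^+ 3)).
Variables (rho0 : X -> R) (u0 : 'I_d -> X -> R).
Hypotheses (prho0 : perT rho0) (mrho0 : measurable_fun setT rho0) (rho0c : forall x, c <= rho0 x <= C)
  (pu0 : forall i, perT (u0 i)) (mu0 : forall i, measurable_fun setT (u0 i))
  (iu0 : forall i, intg mu (fun x => rho0 x * u0 i x)).
Hypotheses
  (Wr : forall eps x, 0 < eps < 1 -> wtest T (rr rho (etaK eps) x) (hh rho u (etajK eps) x))
  (Wi : forall eps i x, 0 < eps < 1 ->
     wtest T (mm rho u (etaK eps) i x) (gg gamma rho u (etajK eps) i x))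
  (init_r : forall eps x e, 0 < eps < 1 -> 0 < e -> exists2 dl, 0 < dl &
     {ae m, forall t, t < dl -> `|rr rho (etaK eps) x t - EE (etaK eps) rho0 x| <= e})
  (init_m : forall eps i x e, 0 < eps < 1 -> 0 < e -> exists2 dl, 0 < dl &
     {ae m, forall t, t < dl ->
       `|mm rho u (etaK eps) i x t - EE (etaK eps) (fun y => rho0 y * u0 i y) x| <= e}).
Hypotheses
  (incr_u : forall i e, 0 < e -> exists2 dl, 0 < dl & forall r h, 0 < r -> r < dl ->
     (forall k, `|tnth h k| <= r) ->
     (\int[m]_t \int[mu]_x (`|u i (tadd x h) t - u i x t| ^+ 3)%:E <= (e * r)%:E)%E)
  (incr_rho : exists M dl, [/\ 0 <= M, 0 < dl & forall r h, 0 < r -> r < dl ->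
     (forall k, `|tnth h k| <= r) ->
     (\int[m]_t \int[mu]_x (`|rho (tadd x h) t - rho x t| ^+ 3)%:E <= (M * r)%:E)%E]).

Lemma YI_eps (w : X -> R -> R) j M1 eps B : 0 < eps < 1 -> 0 <= M1 ->
  (forall x, `|ddstp (x : R)| <= M1) -> 0 <= B ->
  measurable_fun setT (fun p : X * RM => w p.1 p.2) -> (forall t, perT (w ^~ t)) ->
  (forall h, (forall k, `|tnth h k| <= eps) ->
     (\int[m]_t \int[mu]_x (`|w (tadd x h) t - w x t| ^+ 3)%:E <= (B * eps)%:E)%E) ->
  (\int[m]_t YI (etaK eps) (etajK eps) (M1 / eps) j (w ^~ t) <= (2 * M1 * B)%:E)%E.
Proof.
move=> e01 M10 HM B0 mw pw H.
have /andP[e0 _] := e01.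
have L0 : 0 <= M1 / eps by rewrite divr_ge0// ltW.
have [N [HN HNj]] := @etaK_bound R d eps e01.
have mj := @etajK_meas R d eps e01.
have i1 := int_eta1 (etaK_mollifier e01 HN).
have iL : (\int[mu]_x `|etajK eps j x|%:E <= (M1 / eps)%:E)%E.
  rewrite -EFin_Rint; first by rewrite lee_fin; exact: etajK_int.
  by apply: intg_abs; apply: (@intg_bounded _ _ _ mu _ N) => //; exact: mj.
(* The factor 1 / eps in the mass of the derivative kernel cancels against the order eps of the
   cubic increments. *)
rewrite (_ : 2 * M1 * B = 2 * (M1 / eps) * (B * eps)); last by field; rewrite gt_eqF.
have Be : 0 <= B * eps by rewrite mulr_ge0// ltW.
refine (@YI_time R d T (etaK eps) (etajK eps) (M1 / eps) j (@etaK_meas R d eps e01) mj (@etaK_ge0 R d eps e01) i1 L0 iL w mw (B * eps) Be _).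
move=> al be kal ebe; apply: (@incr_shift R d T eps w al be (B * eps) mw pw _ _ H).
- apply: (fr_supp e01); have [h|h] := eqVneq (etaK eps al) 0; last by left.
  right; exists j; apply: contra kal => /eqP h'; rewrite /kap h h' normr0 mulr0 addr0//.
- by apply: (fr_supp e01); left.
Qed.

Lemma small_flux e' : 0 < e' -> exists2 dl, 0 < dl & forall eps, 0 < eps < 1 -> eps < dl ->
  {ae m, forall t, `|\int[mu]_x enE gamma (rho ^~ t) (fun i => u i ^~ t) (etaK eps) x
   - \int[mu]_x enE gamma rho0 u0 (etaK eps) x| <= e'}.
Proof.
move=> e'0.
have [M1 M10 HM] := cpt_bounded (ddstp_smooth R 0) (@ddstp_out R).
have [M [dl1 [M0 dl10 Hrho]]] := incr_rho.
pose Kg := gamma * (gamma - 1) * (c `^ (gamma - 2) + C `^ (gamma - 2)).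
have g0 : 0 < gamma by exact: lt_trans gamma1.
have Kg0 : 0 <= Kg.
  apply: mulr_ge0; last by rewrite addr_ge0 ?powR_ge0.
  by apply: mulr_ge0; [exact: ltW|rewrite subr_ge0; exact: ltW].
have HKg s t : c <= s <= C -> c <= t <= C ->
     `|s `^ gamma - t `^ gamma - gamma * t `^ (gamma - 1) * (s - t)| <= Kg * (s - t) ^+ 2.
  by move=> sI tI; have /andP[h1 h2] := powR_tangent c0 gamma1 sI tI; rewrite ger0_norm.
have C0 : 0 < C by exact: (C_gt0 c0 rhoc).
have Cc : 0 <= C / c by rewrite divr_ge0// ltW.
pose Br := 2 * M1 * M.
have Br0 : 0 <= Br by rewrite !mulr_ge0.
pose A0 := d%:R * (C / c * Kg * Br).
have A00 : 0 <= A0 by apply: mulr_ge0 => //; apply: mulr_ge0 => //; exact: mulr_ge0.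
(* The Young parameter is fixed first, large enough that the density term A0 / q^3 is at most e' /
   2; the density bound itself does not become small. *)
pose q := 1 + 2 * A0 / e'.
have q1 : 1 <= q by rewrite lerDl; apply: divr_ge0; [exact: mulr_ge0|exact: ltW].
have q0 : 0 < q by exact: lt_le_trans q1.
have qA : A0 / q ^+ 3 <= e' / 2.
  have q3 : q <= q ^+ 3 by rewrite -[leLHS]mulr1 exprS ler_wpM2l ?exprn_ege1// ltW.
  rewrite ler_pdivrMr ?exprn_gt0// mulrAC ler_pdivlMr//.
  apply: (@le_trans _ _ (e' * q)); last by rewrite ler_wpM2l// ltW.
  have -> : e' * q = e' + 2 * A0 by rewrite /q; field; rewrite gt_eqF.
  by move: e'0; lra.
pose A1 := d%:R * (d%:R * (Kc c C + Kc c C)) + d%:R * (C / c * Kg * q ^+ 6 * (C / c) ^+ 3).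
have A10 : 0 <= A1.
  have K0 := Kc_ge0 c0 rhoc.
  have q60 : 0 <= q ^+ 6 by rewrite exprn_ge0// ltW.
  have Cc3 : 0 <= (C / c) ^+ 3 by rewrite exprn_ge0.
  by apply: addr_ge0; [rewrite !mulr_ge0// addr_ge0|apply: mulr_ge0 => //; apply: mulr_ge0 => //; apply: mulr_ge0 => //; exact: mulr_ge0].
(* Chosen after q, because [A1] contains q^6: the velocity increments vanish relative to eps and can
   absorb any fixed constant. The added 1 avoids division by 0. *)
pose e := e' / (4 * (A1 * M1 + 1)).
have AM : 0 <= A1 * M1 by exact: mulr_ge0.
have AM1 : 0 < A1 * M1 + 1 by rewrite ltr_wpDl.
have e0 : 0 < e by rewrite divr_gt0// mulr_gt0.
have eA : A1 * (2 * M1 * e) <= e' / 2.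
  have : (A1 * M1 + 1) * (4 * e) = e' by rewrite /e; field; rewrite gt_eqF.
  by have := mulr_ge0 AM (ltW e0); lra.
have [dl2 dl20 Hu] := @fin_pos_min R d (fun i dl => forall r h, 0 < r -> r < dl ->
     (forall k, `|tnth h k| <= r) ->
     (\int[m]_t \int[mu]_x (`|u i (tadd x h) t - u i x t| ^+ 3)%:E <= (e * r)%:E)%E)
   (fun i x y H yx r h r0 ry => H r h r0 (lt_le_trans ry yx)) (fun i => incr_u i e0).
exists (Num.min dl1 dl2); first by rewrite lt_min dl10.
move=> eps e01; rewrite lt_min => /andP[ed1 ed2].
have /andP[ep0 ep1] := e01.
have [N [HN HNj]] := @etaK_bound R d eps e01.
have Hm := etaK_mollifier e01 HN.
have mj := @etajK_meas R d eps e01.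
have L0 : 0 <= M1 / eps by rewrite divr_ge0// ltW.
pose Bu := 2 * M1 * e.
have HBu i j : (\int[m]_t YI (etaK eps) (etajK eps) (M1 / eps) j (u i ^~ t) <= Bu%:E)%E.
  by apply: YI_eps => //; [exact: ltW|move=> h hk; exact: (Hu i eps h)].
have HBr j : (\int[m]_t YI (etaK eps) (etajK eps) (M1 / eps) j (rho ^~ t) <= Br%:E)%E.
  by apply: YI_eps => //; move=> h hk; exact: (Hrho eps h).
have IP := int_Psi c0 gamma1 mrho mu_ prho pu rhoc u3 mj Hm (@etaK_per R d eps) HNj
  (@etaK_pd R d eps e01) (fun j => etajK_int e01 j M10 HM) L0 HBu HBr q0 Kg0 HKg.
have Q : (\int[m]_t `|Psi gamma rho u (etaK eps) (etajK eps) t|%:E <= e'%:E)%E.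
  apply: le_trans IP _; rewrite lee_fin /KB /PB.
  have -> : d%:R * (d%:R * (Kc c C * Bu + Kc c C * Bu)) +
    d%:R * (C / c * Kg * q ^+ 6 * (C / c) ^+ 3 * Bu + C / c * Kg / q ^+ 3 * Br) = A1 * Bu + A0 / q ^+ 3.
    rewrite /A1 /A0; move: (q ^+ 6) (q ^+ 3)^-1 ((C / c) ^+ 3) (C / c) (Kc c C) => a1 a2 a3 a4 a5; ring.
  by rewrite [leRHS]splitr lerD.
exact: (ae_int_en_le T0 c0 gamma1 mrho mu_ prho pu rhoc u3 u3T mj Hm HNj prho0 mrho0 rho0c pu0 iu0
  (fun x => @Wr eps x e01) (fun i x => @Wi eps i x e01) (fun x e2 => @init_r eps x e2 e01) (fun i x e2 => @init_m eps i x e2 e01) Q).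
Qed.

Lemma core_energy : {ae m, forall t,
  (\int[mu]_x (en gamma (rho ^~ t) (fun i => u i ^~ t) x)%:E = \int[mu]_x (en gamma rho0 u0 x)%:E)%E}.
Proof.
(* Starting from 1/2 keeps every scale strictly below 1, as the periodic kernel requires. *)
pose ep (n : nat) : R := n.+2%:R^-1.
have ep01 n : 0 < ep n < 1 by rewrite invr_gt0 ltr0n/= invf_lt1 ?ltr0n// ltr1n.
have ep0 n : 0 < ep n by have /andP[] := ep01 n.
have epl e : 0 < e -> \forall n \near \oo, ep n < e.
  move=> e0; have := near_inv_le e0; apply: filterS => n h; apply: lt_le_trans h.
  by rewrite ltf_pV2 ?posrE ?ltr0n// ltr_nat.
have /choice[dl Hdl] : forall k : nat, exists dl, 0 < dl /\ forall eps, 0 < eps < 1 -> eps < dl ->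
  {ae m, forall t, `|\int[mu]_x enE gamma (rho ^~ t) (fun i => u i ^~ t) (etaK eps) x
   - \int[mu]_x enE gamma rho0 u0 (etaK eps) x| <= k.+1%:R^-1}.
  move=> k; have k0 : 0 < k.+1%:R^-1 :> R by rewrite invr_gt0 ltr0n.
  by have [dl dl0 H] := small_flux k0; exists dl.
(* Only countably many tolerances and scales occur, so a single null set of times serves them all;
   the limit is then taken at a fixed time. *)
have A : {ae m, forall t, forall k n : nat, ep n < dl k ->
   `|\int[mu]_x enE gamma (rho ^~ t) (fun i => u i ^~ t) (etaK (ep n)) x
   - \int[mu]_x enE gamma rho0 u0 (etaK (ep n)) x| <= k.+1%:R^-1}.
  apply: ae_foralln => k; apply: ae_foralln => n.
  have [h|h] := ltP (ep n) (dl k); last by apply: aeW.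
  by apply: aeS ((Hdl k).2 (ep n) (ep01 n) h) => t H _.
apply: aeS A => t H.
have /choice[N HN] : forall n, exists N, forall x : X, `|etaK (ep n) x| <= N.
  by move=> n; have [N [HN _]] := @etaK_bound R d (ep n) (ep01 n); exists N.
have Hm n : mollifier (@etaK R d (ep n)) (N n) (ep n) := etaK_mollifier (ep01 n) (HN n).
have iut i : intg mu (fun y => rho y t * u i y t).
  exact: (pint_ru c0 mrho mu_ prho pu rhoc u3 i t).2.
pose f n := \int[mu]_x enE gamma (rho ^~ t) (fun i => u i ^~ t) (etaK (ep n)) x.
pose g n := \int[mu]_x enE gamma rho0 u0 (etaK (ep n)) x.
have fg e : 0 < e -> exists2 dl, 0 < dl & forall n, ep n < dl -> `|f n - g n| <= e.
  move=> e0; have [k hk] : exists k : nat, k.+1%:R^-1 <= e.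
    by apply: (@filter_ex _ (\oo : set_system nat)); exact: near_inv_le.
  by exists (dl k); [exact: (Hdl k).1|move=> n h; apply: le_trans hk; exact: H].
have gf e : 0 < e -> exists2 dl, 0 < dl & forall n, ep n < dl -> `|g n - f n| <= e.
  by move=> e0; have [x x0 h] := fg e e0; exists x; [exact: x0|move=> n hn; rewrite distrC; exact: (h n hn)].
have rt := mrt mrho t; have ut := mut mu_.
have E0 (r : X -> R) a : (forall x, c <= r x <= C) -> (0 <= \int[mu]_x (en gamma r a x)%:E)%E.
  by move=> rc; apply: integral_ge0 => x _; rewrite lee_fin; exact: (en_ge0 c0 gamma1 a rc x).
have up A : (A%:E < \int[mu]_x (en gamma (rho ^~ t) (fun i => u i ^~ t) x)%:E)%E ->
    exists2 dl, 0 < dl & forall n, ep n < dl -> A <= f n.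
  move=> hA; have [x x0 h] := enE_ge c0 gamma1 (prho t) rt (fun x => rhoc x t) (fun i => pu i t) (fun i => ut i t) iut hA.
  by exists x => // n hn; apply: (h _ (N n)); apply: mollifier_mon (Hm n); exact: ltW.
have up0 A : (A%:E < \int[mu]_x (en gamma rho0 u0 x)%:E)%E ->
    exists2 dl, 0 < dl & forall n, ep n < dl -> A <= g n.
  move=> hA; have [x x0 h] := enE_ge c0 gamma1 prho0 mrho0 rho0c pu0 mu0 iu0 hA.
  by exists x => // n hn; apply: (h _ (N n)); apply: mollifier_mon (Hm n); exact: ltW.
have lo n : ((f n)%:E <= \int[mu]_x (en gamma (rho ^~ t) (fun i => u i ^~ t) x)%:E)%E.
  exact: (enE_le c0 gamma1 (prho t) rt (fun x => rhoc x t) (fun i => pu i t) (fun i => ut i t) iut (Hm n)).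
have lo0 n : ((g n)%:E <= \int[mu]_x (en gamma rho0 u0 x)%:E)%E.
  exact: (enE_le c0 gamma1 prho0 mrho0 rho0c pu0 mu0 iu0 (Hm n)).
apply/eqP; rewrite eq_le; apply/andP; split.
  by apply: (lim_le ep0 epl fg _ lo0 up); exact: E0.
by apply: (lim_le ep0 epl gf _ lo up0); apply: E0 => x; exact: rhoc.
Qed.
End CoreFinal.

(** * Extracting increment bounds from the Besov-type norms *)

Section NonMeas.
Import HBNNSimple.
Context d (Y : measurableType d) (R : realType) (m : {measure set Y -> \bar R}).
Lemma le_nnintegral_any (D : set Y) (f g : Y -> \bar R) :
  (forall x, D x -> 0 <= f x)%E -> (forall x, D x -> f x <= g x)%E ->
  (\int[m]_(x in D) f x <= \int[m]_(x in D) g x)%E.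
Proof.
move=> f0 fg.
have g0 x : D x -> (0 <= g x)%E by move=> Dx; exact: le_trans (f0 _ Dx) (fg _ Dx).
rewrite !ge0_integralE//; apply: ub_ereal_sup => _ [h /= hf <-].
apply: ereal_sup_ubound; exists h => // x /=.
apply: le_trans (hf x) _; rewrite !patchE; case: ifP => // /set_mem; exact: fg.
Qed.
End NonMeas.

Section Norms.
Variables (R : realType) (d : nat).
Notation X := (d.-tuple R).
Notation mu := (muT R d).
Notation leb := (@lebesgue_measure R).

(** [lebesgue_measure] is defined on all sets as an outer measure, hence monotone without
    measurability; this is applied to superlevel sets of [Vnorm] in time. *)
Lemma leb_outer (A B : set (measurableTypeR R)) : A `<=` B -> (leb A <= leb B)%E.
Proof.
by move=> AB; rewrite /lebesgue_measure /lebesgue_stieltjes_measure /measure_extension; exact: le_mu_ext.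
Qed.

Lemma tnorm_ge0 (h : X) : 0 <= tnorm h. Proof. exact: sqrtr_ge0. Qed.
Lemma tnorm_le (h : X) r : 0 <= r -> (forall k, `|tnth h k| <= r) -> tnorm h <= d%:R * r.
Proof.
move=> r0 hr; have dr0 : 0 <= d%:R * r by rewrite mulr_ge0.
rewrite /tnorm -[leRHS]ger0_norm// -sqrtr_sqr; apply: ler_wsqrtr.
apply: (@le_trans _ _ (\sum_(i < d) r ^+ 2)).
  apply: ler_sum => i _; rewrite -[tnth h i ^+ 2]real_normK ?num_real//.
  by rewrite ler_pXn2r ?nnegrE.
rewrite sumr_const card_ord -[leLHS]mulr_natl exprMn; apply: ler_wpM2r; first exact: sqr_ge0.
have dd : (d <= d ^ 2)%N by case: (d) => // k; rewrite expnS expn1 leq_pmulr.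
by rewrite -natrX ler_nat.
Qed.
Lemma tnorm0 (h : X) : tnorm h = 0 -> forall x, tadd x h = x.
Proof.
move=> /eqP; rewrite sqrtr_eq0 => H x; apply: eq_from_tnth => i; rewrite tnth_mktuple.
have : tnth h i ^+ 2 <= 0.
  apply: le_trans H; rewrite (bigD1 i)//= lerDl sumr_ge0// => j _; exact: sqr_ge0.
by rewrite le_eqVlt ltNge sqr_ge0 orbF sqrf_eq0 => /eqP ->; rewrite addr0.
Qed.

Lemma Vnorm3_incr (delta : R) (incr : X -> X -> R) (h : X) : 0 < tnorm h -> tnorm h < delta ->
  (forall x, 0 <= incr h x) -> measurable_fun setT (incr h) ->
  (((tnorm h)^-1)%:E * \int[mu]_x (incr h x ^+ 3)%:E <= poweR (Vnorm 3^-1 3%:E delta incr) 3)%E.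
Proof.
move=> h0 hd i0 mi.
have I0 : (0 <= \int[mu]_x (incr h x ^+ 3)%:E)%E.
  by apply: integral_ge0 => x _; rewrite lee_fin exprn_ge0.
have E1 : (((tnorm h) `^ (- 3^-1))%:E * LpT 3 (incr h) <= Vnorm 3^-1 3%:E delta incr)%E.
  by apply: ereal_sup_ubound; exists h => //=; rewrite h0 hd.
have E2 : (LpT 3 (incr h) = poweR (\int[mu]_x (incr h x ^+ 3)%:E) 3^-1)%E.
  rewrite /LpT integral_cell; last first.
    apply/measurable_EFinP; apply: (measurableT_comp (measurable_powR 3)).
    exact: measurableT_comp.
  congr (poweR _ _); apply: eq_integral => x _.
  by rewrite ger0_norm// powR_mulrn.
have L0 : (0 <= ((tnorm h) `^ (- 3^-1))%:E * LpT 3 (incr h))%E.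
  by rewrite mule_ge0 ?lee_fin ?powR_ge0// E2 poweR_ge0.
have : (poweR (((tnorm h) `^ (- 3^-1))%:E * LpT 3 (incr h)) 3 <= poweR (Vnorm 3^-1 3%:E delta incr) 3)%E.
  apply: gt0_ler_poweR => //; rewrite ?in_itv/= ?leey ?andbT//; exact: le_trans E1.
apply: le_trans; rewrite poweRM ?lee_fin ?powR_ge0//; last by rewrite E2 poweR_ge0.
rewrite E2 -poweRrM mulVf// poweRe1// poweR_EFin -powRrM mulNr mulVf//.
by rewrite powR_inv1 ?tnorm_ge0.
Qed.

Lemma LinfT_incr (alpha delta M : R) (incr : X -> X -> R) (h : X) : 0 <= M ->
  0 < tnorm h -> tnorm h < delta -> (forall x, 0 <= incr h x) -> measurable_fun setT (incr h) ->
  (Vnorm alpha +oo delta incr <= M%:E)%E ->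
  (\int[mu]_x (incr h x ^+ 3)%:E <= (((M + 1) * tnorm h `^ alpha) ^+ 3)%:E)%E.
Proof.
move=> M0 h0 hd i0 mi HM.
have E1 : (((tnorm h) `^ (- alpha))%:E * LinfT (incr h) <= M%:E)%E.
  by apply: le_trans HM; apply: ereal_sup_ubound; exists h => //=; rewrite h0 hd.
have pa : 0 < tnorm h `^ alpha by rewrite powR_gt0.
have pn : 0 < tnorm h `^ (- alpha) by rewrite powR_gt0.
(* M + 1 instead of M makes the inequality strict, so some level admissible in the essential
   supremum lies below it, whether or not the infimum is attained. *)
have E2 : (LinfT (incr h) < ((M + 1) * tnorm h `^ alpha)%:E)%E.
  rewrite ltNge; apply/negP => H.
  have : (((tnorm h) `^ (- alpha))%:E * ((M + 1) * tnorm h `^ alpha)%:E <= M%:E)%E.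
    by apply: le_trans E1; apply: lee_wpmul2l => //; rewrite lee_fin ltW.
  rewrite -EFinM lee_fin powRN mulrCA mulVf ?gt_eqF// mulr1; lra.
have [M1 /= HM1 M1lt] := ereal_inf_lt E2.
have N1 : mu [set x | (((M + 1) * tnorm h `^ alpha)%:E < `|incr h x|%:E)%E] = 0%E.
  have mA : measurable [set x | (((M + 1) * tnorm h `^ alpha)%:E < `|incr h x|%:E)%E].
    rewrite -[X in measurable X]setTI; apply: emeasurable_fun_o_infty => //.
    by apply/measurable_EFinP; exact: measurableT_comp.
  have mB : measurable [set x | (M1 < `|incr h x|%:E)%E].
    rewrite -[X in measurable X]setTI; apply: emeasurable_fun_o_infty => //.
    by apply/measurable_EFinP; exact: measurableT_comp.
  have B0 : mu [set x | (M1 < `|incr h x|%:E)%E] = 0%E.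
    by rewrite -lebT_cell// -[RHS]HM1; congr (@lebT R d _); apply/seteqP; split => x /= [].
  apply/eqP; rewrite eq_le measure_ge0 andbT -B0; apply: le_measure; rewrite ?inE//.
  by move=> x /=; exact: lt_trans.
pose K := (M + 1) * tnorm h `^ alpha; rewrite -/K in N1 *.
have K0 : 0 <= K by rewrite mulr_ge0 ?addr_ge0 ?powR_ge0.
have mm3 (f : X -> R) : measurable_fun setT f -> measurable_fun setT (fun x => (f x ^+ 3)%:E).
  by move=> mf; apply/measurable_EFinP; exact: measurable_funX.
have -> : (\int[mu]_x (incr h x ^+ 3)%:E = \int[mu]_x (Num.min (incr h x) K ^+ 3)%:E)%E.
  apply: ae_eq_integral => //; [exact: mm3|by apply: mm3; exact: measurable_minr|].
  exists [set x | (K%:E < `|incr h x|%:E)%E]; split => //.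
    rewrite -[X in measurable X]setTI; apply: emeasurable_fun_o_infty => //.
    by apply/measurable_EFinP; exact: measurableT_comp.
  move=> x /= nE; rewrite lte_fin ltNge; apply/negP => hK; apply: nE => _.
  by rewrite min_l// (le_trans (ler_norm _)).
apply: (@le_trans _ _ (\int[mu]_x (K ^+ 3)%:E)%E).
  apply: ge0_le_integral => //.
  - by move=> x _; rewrite lee_fin exprn_ge0// le_min i0 K0.
  - by apply: mm3; exact: measurable_minr.
  - move=> x _; rewrite lee_fin ler_pXn2r ?nnegrE ?le_min ?i0 ?K0//.
    by rewrite ge_min lexx orbT.
by rewrite integral_cst//= probability_setT mule1.
Qed.
End Norms.

(** * Replacing the solution by everywhere bounded representatives *)

Section Tests.
Variables (R : realType) (d : nat).
Notation X := (d.-tuple R).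
Lemma testS0 : testS ((fun=> 0) : 'rV[R]_d -> R).
Proof. by split=> // k; exact: Ck_cst. Qed.
Lemma testST0 T : 0 < T -> testST T ((fun=> 0) : 'rV[R]_d.+1 -> R).
Proof.
move=> T0; split; first by move=> k; exact: Ck_cst.
split=> //; exists (T / 2), (T / 2); split; first by rewrite divr_gt0.
by split=> //; split=> //; rewrite ltr_pdivrMr// mulr_natr mulr2n ltrDl.
Qed.
Lemma dt0 x t : dt ((fun=> 0) : 'rV[R]_d.+1 -> R) x t = 0.
Proof. by rewrite /dt derive_cst. Qed.
Lemma dx0 j x t : dx j ((fun=> 0) : 'rV[R]_d.+1 -> R) x t = 0.
Proof. by rewrite /dx derive_cst. Qed.
Lemma sum_pick (A : 'I_d -> R) (B : R) i : \sum_(k < d) A k * (if k == i then B else 0) = A i * B.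
Proof.
rewrite (bigD1 i)//= eqxx big1 ?addr0// => k /negPf ->; exact: mulr0.
Qed.
Lemma cvg_right_elim (f : R -> \bar R) (l : R) : (f t @[t --> 0^'+] --> l%:E)%classic ->
  forall e, 0 < e -> exists2 dl, 0 < dl & forall t, 0 < t -> t < dl -> `|fine (f t) - l| <= e.
Proof.
move=> /fine_cvgP[_ H] e e0; move/cvgrPdist_le: H => /(_ _ e0) [dl/= dl0 H].
exists dl => // t t0 tdl; rewrite distrC; apply: H => //=.
by rewrite sub0r normrN gtr0_norm.
Qed.
Notation mu := (muT R d).

Lemma tadd_topp (a x : X) : tadd (tadd a x) (topp x) = a.
Proof. by apply: eq_from_tnth => i; rewrite !tnth_mktuple addrK. Qed.

Lemma EE_topp (k f : X -> R) N x : measurable_fun setT k -> perT k -> (forall y, `|k y| <= N) ->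
  pint f -> intg mu (fun y => f y * k (tadd y (topp x))) /\
  \int[mu]_y (f y * k (tadd y (topp x))) = EE k f x.
Proof.
move=> mk pk kN [pf iF].
have mkk : measurable_fun setT (fun y => k (tadd y (topp x))).
  exact: (measurableT_comp mk (measurable_taddl (topp x))).
have i1 : intg mu (fun y => f y * k (tadd y (topp x))).
  have := intgMb iF mkk (fun y => kN (tadd y (topp x))).
  by congr (integrable _ _ _); apply/funext => y /=; rewrite mulrC.
split => //; rewrite -(@Rmu_shift R d (fun y => f y * k (tadd y (topp x))) x).
- by apply: eq_Rintegral => a _; rewrite tadd_topp mulrC taddC.
- by move=> y j; rewrite pf taddAC pk.
- exact: intg_meas i1.
Qed.
End Tests.

Section Reduce.
Variables (R : realType) (d : nat) (T c C gamma : R).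
Notation X := (d.-tuple R).
Notation RM := (measurableTypeR R).
Notation mu := (muT R d).
Notation m := (lamT T).
Notation leb := (@lebesgue_measure R).
Variables (rho : X -> R -> R) (u : 'I_d -> X -> R -> R).
Hypotheses (T0 : 0 < T) (c0 : 0 < c) (cC : c <= C) (gamma1 : 1 < gamma).
Hypotheses (mrho : measurable_fun setT (fun p : X * RM => rho p.1 p.2))
  (mu_ : forall i, measurable_fun setT (fun p : X * RM => u i p.1 p.2))
  (prho : forall t, perT (rho ^~ t)) (pu : forall i t, perT (u i ^~ t)).

(** The bounds then hold at every point and time. Clipping preserves periodicity and does not
    enlarge increments. *)
Definition r1 (x : X) (t : R) : R := clip c C (rho x t).
(** The times at which every component is cubically integrable over the torus; they have full
    measure, and setting the velocity to 0 at the other times makes the integrability hold at every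
    time. *)
Definition G : set RM := [set t | forall i, (\int[mu]_x (`|u i x t| ^+ 3)%:E < +oo)%E].
Definition u1 i (x : X) (t : R) : R := u i x t * \1_G t.

Lemma clipI y : c <= clip c C y <= C.
Proof. by rewrite /clip le_max lexx ge_max cC ge_min lexx. Qed.
Lemma clip_id' y : c <= y <= C -> clip c C y = y.
Proof. by move=> /andP[h1 h2]; rewrite /clip min_r// max_r. Qed.
Lemma clip_lip a b : `|clip c C a - clip c C b| <= `|a - b|.
Proof.
have l1 (z x y : R) : `|Num.max z x - Num.max z y| <= `|x - y|.
  rewrite /Num.max; case: ltP => h1; case: ltP => h2 //; rewrite ?subrr ?normr0//.
    by rewrite !gtr0_norm ?subr_gt0//; [lra|exact: le_lt_trans h1].
  by rewrite !ltr0_norm ?subr_lt0//; [lra|exact: le_lt_trans h2].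
have l2 (z x y : R) : `|Num.min z x - Num.min z y| <= `|x - y|.
  rewrite /Num.min; case: ltP => h1; case: ltP => h2 //; rewrite ?subrr ?normr0//.
    by rewrite ger0_norm ?subr_ge0// ger0_norm; lra.
  by rewrite ler0_norm ?subr_le0// ler0_norm; lra.
exact: le_trans (l1 _ _ _) (l2 _ _ _).
Qed.
Lemma meas_clip : measurable_fun setT (clip c C : RM -> R).
Proof. by apply: measurable_maxr => //; exact: measurable_minr. Qed.

(** Clipping is the projection onto [c, C], so no other value of the interval is closer. In
    [rho0_ae] it is compared with a mollified density. *)
Lemma clip_best a y : c <= a <= C -> `|clip c C y - y| <= `|a - y|.
Proof.
move=> /andP[h1 h2]; have [yc|cy] := leP y c.
  rewrite /clip min_r ?(le_trans yc)// max_l// !ger0_norm ?subr_ge0//; first by rewrite lerD2r.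
  exact: le_trans h1.
have [yC|Cy] := leP y C; first by rewrite clip_id' ?subrr ?normr0// yC ltW.
rewrite /clip min_l ?(ltW Cy)// max_r// !ler0_norm ?subr_le0 ?(ltW Cy)//; first by rewrite lerN2 lerD2r.
exact: le_trans h2 (ltW Cy).
Qed.

Lemma mu3i i : measurable_fun setT (fun t : RM => \int[mu]_x (`|u i x t| ^+ 3)%:E)%E.
Proof.
apply: (@measurable_param _ _ RM X R mu (fun q => (`|u i q.2 q.1| ^+ 3)%:E)).
apply/measurable_EFinP; apply: measurable_funX; apply: measurableT_comp => //.
exact: (mw2 (mu_ i)).
Qed.
Lemma mG : measurable G.
Proof.
rewrite (_ : G = \bigcap_(i in [set: 'I_d]) [set t | (\int[mu]_x (`|u i x t| ^+ 3)%:E < +oo)%E]).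
  apply: fin_bigcap_measurable => // i _; rewrite -[X in measurable X]setTI.
  exact: (emeasurable_fun_infty_o measurableT (mu3i i)).
by apply/seteqP; split => [t h i _|t h i]; exact: h.
Qed.

Lemma mr1 : measurable_fun setT (fun p : X * RM => r1 p.1 p.2).
Proof. exact: (measurableT_comp meas_clip mrho). Qed.
Lemma mu1 i : measurable_fun setT (fun p : X * RM => u1 i p.1 p.2).
Proof.
apply: measurable_funM => //; apply: (measurableT_comp _ measurable_snd).
by apply: measurable_indic; exact: mG.
Qed.
Lemma pr1 t : perT (r1 ^~ t). Proof. by move=> x j; rewrite /r1 prho. Qed.
Lemma pu1 i t : perT (u1 i ^~ t). Proof. by move=> x j; rewrite /u1 pu. Qed.
Lemma r1c x t : c <= r1 x t <= C. Proof. exact: clipI. Qed.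

Lemma mut0 i t : measurable_fun setT (u i ^~ t). Proof. exact: (meas_sect2 (mu_ i) t). Qed.

Lemma u13 i t : intg mu (fun x => `|u1 i x t| ^+ 3).
Proof.
have mt : measurable_fun setT (fun x => `|u1 i x t| ^+ 3).
  by apply: measurable_funX; apply: measurableT_comp => //; exact: (meas_sect2 (mu1 i) t).
apply: intgP => //; have [Gt|nG] := pselect (G t).
  rewrite (_ : integral _ _ _ = \int[mu]_x (`|u i x t| ^+ 3)%:E)%E; first exact: Gt.
  apply: eq_integral => x _; rewrite ger0_norm ?exprn_ge0//.
  by rewrite /u1 indicE mem_set// mulr1.
rewrite (_ : integral _ _ _ = 0)%E ?ltry//; apply: integral0_eq => x _.
by rewrite /u1 indicE memNset// mulr0 normr0 expr0n normr0.
Qed.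

Hypotheses (hc : {ae leb, forall t, 0 < t < T -> @lebT R d [set x | @cell R d x /\ ~ (c <= rho x t <= C)] = 0%E})
  (hu : (intST T (fun x t => powR (Num.sqrt (sqnorm u x t)) 3) < +oo)%E).

Let msq : measurable_fun setT (fun p : X * RM => powR (Num.sqrt (sqnorm u p.1 p.2)) 3).
Proof.
apply: (measurableT_comp (measurable_powR 3)).
have mS : measurable_fun setT (fun p : X * RM => sqnorm u p.1 p.2).
  by apply: measurable_sum => i; exact: measurable_funX.
exact: (measurableT_comp (continuous_measurable_fun (@sqrt_continuous R)) mS).
Qed.

Lemma cube_sqnorm i x t : `|u i x t| ^+ 3 <= powR (Num.sqrt (sqnorm u x t)) 3.
Proof.
rewrite powR_mulrn ?sqrtr_ge0// ler_pXn2r ?nnegrE ?sqrtr_ge0//.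
rewrite -sqrtr_sqr; apply: ler_wsqrtr; rewrite /sqnorm (bigD1 i)//= lerDl.
by apply: sumr_ge0 => j _; exact: sqr_ge0.
Qed.

Lemma int_u3_lt i : (\int[m]_t \int[mu]_x (`|u i x t| ^+ 3)%:E < +oo)%E.
Proof.
apply: le_lt_trans hu; rewrite /intST.
have mi : measurable_fun setT (fun t : RM => \int[mu]_x (powR (Num.sqrt (sqnorm u x t)) 3)%:E)%E.
  apply: (@measurable_param _ _ RM X R mu (fun q => (powR (Num.sqrt (sqnorm u q.2 q.1)) 3)%:E)).
  apply/measurable_EFinP.
  exact: (mw2 (w := fun x t => powR (Num.sqrt (sqnorm u x t)) 3) msq).
have E t : intT (fun x => powR (Num.sqrt (sqnorm u x t)) 3) = (\int[mu]_x (powR (Num.sqrt (sqnorm u x t)) 3)%:E)%E.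
  by rewrite intT_muT//; exact: (meas_sect2 msq t).
under [leRHS]eq_integral do rewrite E.
rewrite ge0_integral_mrestr//; last 2 first.
- exact: mu3i.
- by move=> t; apply: integral_ge0 => x _; rewrite lee_fin exprn_ge0.
apply: ge0_le_integral => //.
- by move=> t _; apply: integral_ge0 => x _; rewrite lee_fin exprn_ge0.
- by apply: measurable_funTS; exact: mu3i.
- exact: measurable_funTS.
- move=> t _; apply: ge0_le_integral => //.
  + apply/measurable_EFinP; apply: measurable_funX; apply: measurableT_comp => //; exact: mut0.
  + by apply/measurable_EFinP; exact: (meas_sect2 msq t).
  + by move=> x _; rewrite lee_fin cube_sqnorm.
Qed.

Lemma aeG : {ae m, forall t, G t}.
Proof.
apply: ae_all => i.
have I : m.-integrable setT (fun t : RM => \int[mu]_x (`|u i x t| ^+ 3)%:E)%E.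
  apply/integrableP; split; first exact: mu3i.
  under eq_integral do rewrite gee0_abs ?integral_ge0//.
  exact: int_u3_lt.
have := integrable_ae measurableT I; apply: aeS => t /(_ Logic.I).
by rewrite ge0_fin_numE// integral_ge0.
Qed.

Lemma u13T i : intg m (fun t => \int[mu]_x `|u1 i x t| ^+ 3).
Proof.
have mi : measurable_fun setT (fun t : RM => \int[mu]_x `|u1 i x t| ^+ 3).
  apply: (@measurable_Rparam _ _ RM X R mu (fun q => `|u1 i q.2 q.1| ^+ 3)).
  by apply: measurable_funX; apply: measurableT_comp => //; exact: (mw2 (mu1 i)).
apply: intgP => //; apply: le_lt_trans (int_u3_lt i).
apply: ge0_le_integral => //.
- by apply/measurable_EFinP; exact: measurableT_comp.
- exact: mu3i.
- move=> t _; rewrite ger0_norm; last by apply: Rint_ge0 => x; rewrite exprn_ge0.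
  rewrite (EFin_Rint (u13 i t)); apply: ge0_le_integral => //.
  + by apply/measurable_EFinP; exact: intg_meas (u13 i t).
  + by apply/measurable_EFinP; apply: measurable_funX; apply: measurableT_comp => //; exact: mut0.
  + move=> x _; rewrite lee_fin ler_pXn2r ?nnegrE// /u1 normrM -[leRHS]mulr1 ler_wpM2l//.
    by rewrite indicE natb_le1.
Qed.

(** Times at which the replacement is invisible to spatial integrals. *)
Definition good (t : RM) := [/\ 0 < t < T, G t & {ae mu, forall x, rho x t = r1 x t}].

Lemma ae_good : {ae m, forall t, good t}.
Proof.
have h1 : {ae m, forall t : RM, 0 < t < T} by apply: lamT_ae; apply: aeW.
apply: aeS (aeI h1 (aeI aeG (lamT_ae hc))) => t [tT [Gt Ht]]; split => //.
have mB : measurable [set x : X | ~ (c <= rho x t <= C)].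
  rewrite (_ : [set x | _] = ~` [set x | c <= rho x t <= C])//; apply: measurableC.
  have mt : measurable_fun setT (rho ^~ t) by exact: (meas_sect2 mrho t).
  rewrite (_ : [set x | _] = (rho ^~ t) @^-1` `[c, C]%classic).
    by rewrite -[X in measurable X]setTI; exact: mt.
  by apply/seteqP; split => x /=; rewrite in_itv.
exists [set x : X | ~ (c <= rho x t <= C)]; split => //.
  rewrite -lebT_cell// -[RHS]Ht; congr (@lebT R d _); apply/seteqP; split => x /= []; tauto.
by move=> x /= h1' h2; apply: h1'; rewrite /r1 clip_id'.
Qed.

Lemma conv_int t (F H : X -> R) : good t -> measurable_fun setT F -> measurable_fun setT H ->
  (forall x, rho x t = r1 x t -> F x = H x) -> intT F = (\int[mu]_x (H x)%:E)%E.
Proof.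
move=> [_ _ Hae] mF mH E; rewrite intT_muT//; apply: ae_eq_integral => //; try exact/measurable_EFinP.
by apply: aeS Hae => x h _; rewrite E.
Qed.

Lemma u1E t i x : good t -> u1 i x t = u i x t.
Proof. by move=> [_ Gt _]; rewrite /u1 indicE mem_set// mulr1. Qed.

Lemma weak_conv (F : X -> R -> R) (V : RM -> R) :
  measurable_fun setT (fun p : X * RM => F p.1 p.2) -> intg m V ->
  (forall t, good t -> intT (F ^~ t) = (V t)%:E) -> intST T F = 0%E -> \int[m]_t V t = 0.
Proof.
move=> mF iV FV; rewrite /intST => H.
have mi : measurable_fun setT (fun t : RM => \int[mu]_x (F x t)%:E)%E.
  apply: (@measurable_param _ _ RM X R mu (fun q => (F q.2 q.1)%:E)).
  by apply/measurable_EFinP; exact: (mw2 mF).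
have E t : intT (F ^~ t) = (\int[mu]_x (F x t)%:E)%E.
  by rewrite intT_muT//; exact: (meas_sect2 mF t).
rewrite /Rintegral -[RHS]/(fine 0%E) -H; congr fine.
under [RHS]eq_integral do rewrite E.
transitivity (\int[m]_t \int[mu]_x (F x t)%:E)%E; last by rewrite integral_mrestr.
apply: ae_eq_integral => //.
  by apply/measurable_EFinP; exact: intg_meas iV.
by apply: aeS ae_good => t gt _; rewrite -E FV.
Qed.

Section Weak.
Variable eps : R.
Hypothesis e01 : 0 < eps < 1.
Notation ek := (@etaK R d eps).
Notation ej := (@etajK R d eps).
Let h : 'I_d -> R -> R := fun=> gk eps.
Let h' : 'I_d -> R -> R := fun=> gk' eps.

Let Dh i s : is_derive (s : R) 1 (h i) (h' i s). Proof. exact: is_derive_gk. Qed.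

Let pej j : perT (ej j). Proof. exact: etajK_per. Qed.
Lemma mshk (k : X -> R) x : measurable_fun setT k -> measurable_fun setT (fun y => k (tadd y (topp x))).
Proof. by move=> mk; exact: (measurableT_comp mk (measurable_taddl (topp x))). Qed.

Lemma kE (k f : X -> R) x N : measurable_fun setT k -> perT k -> (forall y, `|k y| <= N) -> pint f ->
  intg mu (fun y => f y * k (tadd y (topp x))) /\
  \int[mu]_y (f y * k (tadd y (topp x))) = EE k f x.
Proof. exact: EE_topp. Qed.

Lemma wtest_mass : (forall phi, testST T phi ->
     intST T (fun x t => rho x t * dt phi x t + \sum_(j < d) rho x t * u j x t * dx j phi x t) = 0%E) ->
  forall x, wtest T (rr r1 ek x) (hh r1 u1 ej x).
Proof.
move=> HM x chi chi' p q sc Dc p0 pq qT chi0 i1 i2.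
have [N [HN HNj]] := @etaK_bound R d eps e01.
have tst : testST T (stker chi h x).
  by apply: (stker_test x p0 pq qT chi0 sc) => [i|i s]; [exact: gk_smooth|exact: gk1].
have mchi' : measurable_fun setT (chi' : RM -> R).
  have [s' D'] := smooth1_derive sc.
  rewrite (_ : chi' = derive1 chi); first exact: smooth1_meas.
  by apply/funext => s; have D := Dc s; rewrite derive1E (@derive_val _ _ _ _ _ _ _ D).
have mchi := smooth1_meas sc.
rewrite -RintD//.
apply: (@weak_conv (fun y t => rho y t * (chi' t * ek (tadd y (topp x))) +
    \sum_(j < d) rho y t * u j y t * (chi t * ej j (tadd y (topp x))))).
- have mk (k : X -> R) : measurable_fun setT k -> measurable_fun setT (fun p : X * RM => k (tadd p.1 (topp x))).
    by move=> mk; exact: (measurableT_comp (mshk x mk) measurable_fst).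
  have mc (f : RM -> R) : measurable_fun setT f -> measurable_fun setT (fun p : X * RM => f p.2).
    by move=> mf; exact: (measurableT_comp mf measurable_snd).
  apply: measurable_funD.
    apply: measurable_funM => //; apply: measurable_funM; [exact: (mc _ mchi')|exact: (mk _ (etaK_meas e01))].
  apply: measurable_sum => j; apply: measurable_funM; first exact: measurable_funM.
  by apply: measurable_funM; [exact: (mc _ mchi)|exact: (mk _ (@etajK_meas R d eps e01 j))].
- exact: intgD.
- move=> t gt.
  have [ir Er] := kE x (etaK_meas e01) (@etaK_per R d eps) HN (pint_rho (pr1 t) (mrt mr1 t) c0 (fun y => r1c y t)).
  have Ek j := kE x (@etajK_meas R d eps e01 j) (pej j) (HNj j) (pint_ru c0 mr1 mu1 pr1 pu1 r1c u13 j t).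
  have iH : intg mu (fun y => r1 y t * ek (tadd y (topp x)) * chi' t +
     \sum_(j < d) (r1 y t * u1 j y t * ej j (tadd y (topp x))) * chi t).
    by apply: intgD; [exact: intgZr|apply: intg_sum => j; apply: intgZr; exact: (Ek j).1].
  rewrite (conv_int (H := fun y => r1 y t * ek (tadd y (topp x)) * chi' t +
     \sum_(j < d) (r1 y t * u1 j y t * ej j (tadd y (topp x))) * chi t) gt); last 3 first.
  + have mrt0 : measurable_fun setT (rho ^~ t) by exact: (meas_sect2 mrho t).
    apply: measurable_funD.
      by apply: measurable_funM => //; apply: measurable_funM => //; exact: (mshk x (etaK_meas e01)).
    apply: measurable_sum => j; apply: measurable_funM; first by apply: measurable_funM => //; exact: mut0.
    by apply: measurable_funM => //; exact: (mshk x (@etajK_meas R d eps e01 j)).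
  + exact: intg_meas iH.
  + move=> y ->; congr (_ + _); first by ring.
    by apply: eq_bigr => j _; rewrite (u1E j y gt); ring.
  rewrite -EFin_Rint//; congr (_%:E); rewrite RintD; last 2 first.
  + exact: intgZr.
  + by apply: intg_sum => j; apply: intgZr; exact: (Ek j).1.
  rewrite RintZr// Er Rint_sum; last by move=> j; apply: intgZr; exact: (Ek j).1.
  congr (_ + _); rewrite /hh mulr_suml; apply: eq_bigr => j _.
  by rewrite RintZr ?(Ek j).2//; exact: (Ek j).1.
- rewrite -[RHS](HM _ tst); congr (intST T _); apply/funext => y; apply/funext => t.
  rewrite (dt_stker h x y t Dc); congr (_ + _); apply: eq_bigr => j _.
  by rewrite (dx_stker chi x y t j Dh).
Qed.

Lemma wtest_mom : (forall psi : 'I_d -> 'rV[R]_d.+1 -> R, (forall i, testST T (psi i)) ->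
     intST T (fun x t =>
        \sum_(i < d) rho x t * u i x t * dt (psi i) x t
      + \sum_(i < d) \sum_(j < d) rho x t * u i x t * u j x t * dx j (psi i) x t
      + rho x t `^ gamma * \sum_(i < d) dx i (psi i) x t) = 0%E) ->
  forall i x, wtest T (mm r1 u1 ek i x) (gg gamma r1 u1 ej i x).
Proof.
move=> HM i x chi chi' p q sc Dc p0 pq qT chi0 i1 i2.
have [N [HN HNj]] := @etaK_bound R d eps e01.
have tst : testST T (stker chi h x).
  by apply: (stker_test x p0 pq qT chi0 sc) => [k|k s]; [exact: gk_smooth|exact: gk1].
have mchi' : measurable_fun setT (chi' : RM -> R).
  have [s' D'] := smooth1_derive sc.
  rewrite (_ : chi' = derive1 chi); first exact: smooth1_meas.
  by apply/funext => s; have D := Dc s; rewrite derive1E (@derive_val _ _ _ _ _ _ _ D).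
have mchi := smooth1_meas sc.
rewrite -RintD//.
apply: (@weak_conv (fun y t => rho y t * u i y t * (chi' t * ek (tadd y (topp x))) +
    \sum_(j < d) rho y t * u i y t * u j y t * (chi t * ej j (tadd y (topp x))) +
    rho y t `^ gamma * (chi t * ej i (tadd y (topp x))))).
- have mk (k : X -> R) : measurable_fun setT k -> measurable_fun setT (fun p : X * RM => k (tadd p.1 (topp x))).
    by move=> mk; exact: (measurableT_comp (mshk x mk) measurable_fst).
  have mc (f : RM -> R) : measurable_fun setT f -> measurable_fun setT (fun p : X * RM => f p.2).
    by move=> mf; exact: (measurableT_comp mf measurable_snd).
  have mcj j : measurable_fun setT (fun p : X * RM => chi p.2 * ej j (tadd p.1 (topp x))).
    by apply: measurable_funM; [exact: (mc _ mchi)|exact: (mk _ (@etajK_meas R d eps e01 j))].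
  apply: measurable_funD; first apply: measurable_funD.
  + apply: measurable_funM; first exact: measurable_funM.
    by apply: measurable_funM; [exact: (mc _ mchi')|exact: (mk _ (etaK_meas e01))].
  + apply: measurable_sum => j; apply: measurable_funM; last exact: mcj.
    by apply: measurable_funM => //; exact: measurable_funM.
  + by apply: measurable_funM; [exact: (measurableT_comp (measurable_powR gamma) mrho)|exact: mcj].
- exact: intgD.
- move=> t gt.
  have [ir Er] := kE x (etaK_meas e01) (@etaK_per R d eps) HN (pint_ru c0 mr1 mu1 pr1 pu1 r1c u13 i t).
  have Ek j := kE x (@etajK_meas R d eps e01 j) (pej j) (HNj j) (pint_ruu c0 mr1 mu1 pr1 pu1 r1c u13 i j t).
  have [ig Eg] := kE x (@etajK_meas R d eps e01 i) (pej i) (HNj i) (pint_rg c0 gamma1 mr1 pr1 r1c t).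
  have iS : intg mu (fun y => \sum_(j < d) (r1 y t * (u1 i y t * u1 j y t) * ej j (tadd y (topp x))) * chi t).
    by apply: intg_sum => j; apply: intgZr; exact: (Ek j).1.
  have iA := intgD (intgZr (chi' t) ir) iS.
  have iH := intgD iA (intgZr (chi t) ig).
  rewrite (conv_int (H := fun y => r1 y t * u1 i y t * ek (tadd y (topp x)) * chi' t +
     \sum_(j < d) (r1 y t * (u1 i y t * u1 j y t) * ej j (tadd y (topp x))) * chi t +
     r1 y t `^ gamma * ej i (tadd y (topp x)) * chi t) gt); last 3 first.
  + have mrt0 : measurable_fun setT (rho ^~ t) by exact: (meas_sect2 mrho t).
    have mcj j : measurable_fun setT (fun y : X => chi t * ej j (tadd y (topp x))).
      by apply: measurable_funM => //; exact: (mshk x (@etajK_meas R d eps e01 j)).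
    apply: measurable_funD; first apply: measurable_funD.
    * apply: measurable_funM; first by apply: measurable_funM => //; exact: mut0.
      by apply: measurable_funM => //; exact: (mshk x (etaK_meas e01)).
    * apply: measurable_sum => j; apply: measurable_funM; last exact: mcj.
      by apply: measurable_funM; [apply: measurable_funM => //|]; exact: mut0.
    * by apply: measurable_funM; [exact: (measurableT_comp (measurable_powR gamma) mrt0)|exact: mcj].
  + exact: intg_meas iH.
  + move=> y ->; rewrite (u1E i y gt); congr (_ + _ + _); [by ring| |by ring].
    by apply: eq_bigr => j _; rewrite (u1E j y gt); ring.
  rewrite -EFin_Rint//; congr (_%:E); rewrite (RintD iA (intgZr (chi t) ig)) (RintD (intgZr (chi' t) ir) iS).
  rewrite RintZr// Er RintZr// Eg Rint_sum; last by move=> j; apply: intgZr; exact: (Ek j).1.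
  rewrite -addrA; congr (_ + _); rewrite /gg mulrDl mulr_suml; congr (_ + _); apply: eq_bigr => j _.
  by rewrite RintZr ?(Ek j).2//; exact: (Ek j).1.
(* A vector test function with a single nonzero component isolates the i-th momentum equation. *)
- pose psi k : 'rV[R]_d.+1 -> R := if k == i then stker chi h x else fun=> 0.
  have tp k : testST T (psi k) by rewrite /psi; case: ifP => // _; exact: testST0.
  rewrite -[RHS](HM _ tp); congr (intST T _); apply/funext => y; apply/funext => t.
  have Edt k : dt (psi k) y t = if k == i then chi' t * ek (tadd y (topp x)) else 0.
    by rewrite /psi; case: ifP => _; [rewrite (dt_stker h x y t Dc)|rewrite dt0].
  have Edx k j : dx j (psi k) y t = if k == i then chi t * ej j (tadd y (topp x)) else 0.
    by rewrite /psi; case: ifP => _; [rewrite (dx_stker chi x y t j Dh)|rewrite dx0].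
  under [X in _ = X + _ + _]eq_bigr do rewrite Edt.
  rewrite sum_pick; congr (_ + _ + _).
    rewrite exchange_big/=; apply: eq_bigr => j _.
    under eq_bigr do rewrite Edx.
    by rewrite (sum_pick (fun k => rho y t * u k y t * u j y t)).
  congr (_ * _); under eq_bigr do rewrite Edx -[X in if _ then X else _]mul1r.
  rewrite (bigD1 i)//= eqxx big1 ?addr0 ?mul1r// => k /negPf ->; by [].
Qed.

(** The limit at 0 concerns integrals of the original solution; at good times these equal the
    mollified representatives, and good times have full measure. Hence closeness is obtained for
    almost every small t. *)
Lemma init_gen (f : X -> RM -> R) (g : X -> R) (F : R -> \bar R) x :
  (forall t, pint (f ^~ t)) -> (forall t, good t -> F t = (\int[mu]_y (f y t * ek (tadd y (topp x)))%:E)%E) ->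
  pint g -> (F t @[t --> 0^'+] --> (\int[mu]_y (g y * ek (tadd y (topp x)))%:E)%E)%classic ->
  forall e, 0 < e -> exists2 dl, 0 < dl & {ae m, forall t, t < dl -> `|EE ek (f ^~ t) x - EE ek g x| <= e}.
Proof.
move=> pf FE pg; have [N [HN HNj]] := @etaK_bound R d eps e01.
have [ig Eg] := kE x (etaK_meas e01) (@etaK_per R d eps) HN pg.
rewrite -EFin_Rint// Eg => H e e0; have [dl dl0 Hd] := cvg_right_elim H e0.
exists dl => //; apply: aeS ae_good => t gt tdl; have [/andP[t0 _] _ _] := gt.
have := Hd t t0 tdl; rewrite FE//.
have [i1 E1] := kE x (etaK_meas e01) (@etaK_per R d eps) HN (pf t).
by rewrite -EFin_Rint//= E1.
Qed.
End Weak.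
End Reduce.

(** * Cubic increments of the representatives and bounds on the initial density *)

Section Incr.
Variables (R : realType) (d : nat) (T c C gamma : R).
Notation X := (d.-tuple R).
Notation RM := (measurableTypeR R).
Notation mu := (muT R d).
Notation m := (lamT T).
Notation leb := (@lebesgue_measure R).
Variables (rho : X -> R -> R) (u : 'I_d -> X -> R -> R).
Hypotheses (d2 : (2 <= d)%N) (T0 : 0 < T) (c0 : 0 < c) (cC : c <= C) (gamma1 : 1 < gamma).
Hypotheses (mrho : measurable_fun setT (fun p : X * RM => rho p.1 p.2))
  (mu_ : forall i, measurable_fun setT (fun p : X * RM => u i p.1 p.2)).
Hypothesis prho : forall t, perT (rho ^~ t).
Let alpha : R := 2 / (3 * Num.min gamma 2).

Let d0 : 0 < d%:R :> R. Proof. by rewrite ltr0n; apply: leq_trans d2. Qed.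

Lemma meas_incrV (h : X) : measurable_fun setT (fun p : X * RM => incrV (fun i x => u i x p.2) h p.1).
Proof.
have mS : measurable_fun setT (fun p : X * RM => \sum_(i < d) (u i (tadd p.1 h) p.2 - u i p.1 p.2) ^+ 2).
  apply: measurable_sum => i; apply: measurable_funX; apply: measurable_funB => //.
  by apply: (mw2 (mu_ i)) => //; apply: measurable_tadd => //; exact: measurable_cst.
exact: (measurableT_comp (continuous_measurable_fun (@sqrt_continuous R)) mS).
Qed.

Lemma incrV_ge i (h x : X) t : `|u i (tadd x h) t - u i x t| <= incrV (fun i x => u i x t) h x.
Proof.
rewrite -sqrtr_sqr; apply: ler_wsqrtr; rewrite (bigD1 i)//= lerDl.
by apply: sumr_ge0 => j _; exact: sqr_ge0.
Qed.

Lemma small_h (r dl : R) (h : X) : 0 < r -> r < dl / d.+1%:R -> (forall k, `|tnth h k| <= r) ->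
  tnorm h <= d%:R * r /\ tnorm h < dl.
Proof.
move=> r0 rdl hr; have H := tnorm_le (ltW r0) hr; split => //.
apply: le_lt_trans H _; move: rdl; rewrite ltr_pdivlMr ?ltr0n// => rd.
by apply: lt_trans rd; rewrite -natr1 mulrDr mulr1 mulrC ltrDl.
Qed.

Lemma lamT_lt (f : RM -> \bar R) : measurable_fun setT f -> (forall t, 0 <= f t)%E ->
  (\int[m]_t f t = \int[leb]_(t in `]0%R, T[) f t)%E.
Proof. by move=> mf f0; rewrite ge0_integral_mrestr. Qed.

Lemma mw1 (h : X) i : measurable_fun setT (fun p : X * RM => (`|u1 u i (tadd p.1 h) p.2 - u1 u i p.1 p.2| ^+ 3)%:E).
Proof.
have mu1i := mu1 mu_ i.
apply/measurable_EFinP; apply: measurable_funX; apply: measurableT_comp => //.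
apply: measurable_funB => //; apply: (mw2 mu1i) => //.
by apply: measurable_tadd => //; exact: measurable_cst.
Qed.

Lemma incr_u_lemma :
  ((fun delta => LqTime T 3%:E (fun t => Vnorm 3^-1 3%:E delta (incrV (fun i x => u i x t)))) @ 0^'+ --> 0%E)%classic ->
  forall i e, 0 < e -> exists2 dl, 0 < dl & forall r (h : X), 0 < r -> r < dl ->
     (forall k, `|tnth h k| <= r) ->
     (\int[m]_t \int[mu]_x (`|u1 u i (tadd x h) t - u1 u i x t| ^+ 3)%:E <= (e * r)%:E)%E.
Proof.
(* Coordinates of size at most r give |h| <= d r, whence the division by d; the cube root taken next
   matches the L^3 norm in time. *)
move=> H i e e0; pose e1 := e / d%:R.
have e10 : 0 < e1 by rewrite divr_gt0.
pose kap := e1 `^ 3^-1.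
have kap0 : 0 < kap by rewrite powR_gt0.
have [dl dl0 Hdl] : exists2 dl, 0 < dl & (LqTime T 3%:E (fun t => Vnorm 3^-1 3%:E dl (incrV (fun i x => u i x t))) <= kap%:E)%E.
  move: H => /fine_cvgP[Hf H].
  move/cvgrPdist_le: H => /(_ _ kap0) H.
  suff [x [x0 [xf xk]]] : exists x, 0 < x /\
    (LqTime T 3%:E (fun t => Vnorm 3^-1 3%:E x (incrV (fun i x => u i x t))) \is a fin_num /\
    `|0 - fine (LqTime T 3%:E (fun t => Vnorm 3^-1 3%:E x (incrV (fun i x => u i x t))))| <= kap).
    exists x => //; rewrite -(fineK xf) lee_fin; apply: le_trans (ler_norm _) _.
    by move: xk; rewrite sub0r normrN.
  apply: (@filter_ex _ (0^'+ : set_system R)).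
  by near=> x; split; [near: x; exact: nbhs_right_gt|split; near: x].
have HI : (\int[leb]_(t in `]0%R, T[) poweR (Vnorm 3^-1 3%:E dl (incrV (fun i x => u i x t))) 3 <= e1%:E)%E.
  set I := integral _ _ _.
  have I0 : (0 <= I)%E by apply: integral_ge0 => t _; exact: poweR_ge0.
  have -> : I = poweR (poweR I 3^-1) 3 by rewrite -poweRrM mulVf// poweRe1.
  have -> : e1%:E = poweR kap%:E 3 by rewrite poweR_EFin /kap -powRrM mulVf// powRr1// ltW.
  apply: gt0_ler_poweR => //; rewrite ?in_itv/= ?leey ?andbT ?poweR_ge0//.
  by rewrite lee_fin ltW.
exists (dl / d.+1%:R); first by rewrite divr_gt0.
move=> r h r0 rdl hr; have [hd hdl] := small_h r0 rdl hr.
(* [Vnorm] ranges over nonzero shifts only, so the trivial shift is treated apart. *)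
have [h0|h0] := eqVneq (tnorm h) 0.
  have E := tnorm0 h0.
  rewrite (_ : integral _ _ _ = 0)%E ?lee_fin ?mulr_ge0 ?ltW//.
  apply: integral0_eq => t _; apply: integral0_eq => x _.
  by rewrite E subrr normr0 expr0n.
have hp : 0 < tnorm h by rewrite lt_neqAle eq_sym h0 tnorm_ge0.
have mV := meas_incrV h.
have mV3 : measurable_fun setT (fun p : X * RM => (incrV (fun i x => u i x p.2) h p.1 ^+ 3)%:E).
  by apply/measurable_EFinP; exact: measurable_funX.
have V0 x t : 0 <= incrV (fun i x => u i x t) h x by exact: sqrtr_ge0.
have mVi : measurable_fun setT (fun t : RM => \int[mu]_x (incrV (fun i x => u i x t) h x ^+ 3)%:E)%E.
  apply: (@measurable_param _ _ RM X R mu (fun q => (incrV (fun i x => u i x q.1) h q.2 ^+ 3)%:E)).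
  apply/measurable_EFinP; apply: measurable_funX.
  exact: (mw2 (w := fun x t => incrV (fun i x => u i x t) h x) mV).
have Vi0 t : (0 <= \int[mu]_x (incrV (fun i x => u i x t) h x ^+ 3)%:E)%E.
  by apply: integral_ge0 => x _; rewrite lee_fin exprn_ge0.
have B1 : (\int[leb]_(t in `]0%R, T[) (((tnorm h)^-1)%:E * \int[mu]_x (incrV (fun i x => u i x t) h x ^+ 3)%:E) <= e1%:E)%E.
  apply: le_trans HI; apply: le_nnintegral_any => t _.
    by rewrite mule_ge0// lee_fin invr_ge0 tnorm_ge0.
  by apply: Vnorm3_incr => //; exact: (meas_sect2 mV t).
have mVr : measurable_fun (`]0, T[%classic : set RM) (fun t : RM => \int[mu]_x (incrV (fun i x => u i x t) h x ^+ 3)%:E)%E.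
  exact: measurable_funTS.
have hi0 : (0 <= ((tnorm h)^-1)%:E)%E by rewrite lee_fin invr_ge0 tnorm_ge0.
move: B1; rewrite (@ge0_integralZl _ _ _ leb _ (mIT T) _ mVr ((tnorm h)^-1)%:E (fun t _ => Vi0 t) hi0) => B1.
have B2 : (\int[leb]_(t in `]0%R, T[) \int[mu]_x (incrV (fun i x => u i x t) h x ^+ 3)%:E <= (tnorm h * e1)%:E)%E.
  move: B1; rewrite -lee_pdivlMl ?invr_gt0// invrK -EFinM; exact.
apply: (@le_trans _ _ (tnorm h * e1)%:E); last first.
  rewrite lee_fin (_ : e * r = d%:R * r * e1); last by rewrite /e1; field; rewrite gt_eqF.
  by apply: ler_wpM2r => //; exact: ltW.
apply: le_trans B2; have mw := mw1 h i.
have mwi : measurable_fun setT (fun t : RM => \int[mu]_x (`|u1 u i (tadd x h) t - u1 u i x t| ^+ 3)%:E)%E.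
  apply: (@measurable_param _ _ RM X R mu (fun q => (`|u1 u i (tadd q.2 h) q.1 - u1 u i q.2 q.1| ^+ 3)%:E)).
  apply/measurable_EFinP.
  exact: (mw2 (w := fun x t => `|u1 u i (tadd x h) t - u1 u i x t| ^+ 3) ((measurable_EFinP _ _).1 mw)).
rewrite lamT_lt//; last by move=> t; apply: integral_ge0 => x _; rewrite lee_fin exprn_ge0.
apply: le_nnintegral_any => t _.
  by apply: integral_ge0 => x _; rewrite lee_fin exprn_ge0.
apply: le_nnintegral_any => x _; first by rewrite lee_fin exprn_ge0.
rewrite lee_fin ler_pXn2r ?nnegrE//; apply: le_trans (incrV_ge i h x t).
by rewrite /u1 -mulrBl normrM -[leRHS]mulr1 ler_wpM2l// indicE natb_le1.
Unshelve. all: by end_near. Qed.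

(** This is what makes |h|^(3 alpha) at most |h| when |h| <= 1, the order that the kernel can
    absorb. *)
Lemma alpha_ge : 1 <= alpha * 3.
Proof.
have g0 : 0 < Num.min gamma 2 by rewrite lt_min (lt_trans _ gamma1)//=.
rewrite (_ : alpha * 3 = 2 / Num.min gamma 2); last by rewrite /alpha; field; rewrite gt_eqF.
by rewrite ler_pdivlMr// mul1r ge_min lexx orbT.
Qed.

Lemma incr_rho_lemma delta0 : 0 < delta0 ->
  (LqTime T +oo (fun t => Vnorm alpha +oo delta0 (incrS (rho ^~ t))) < +oo)%E ->
  exists M dl, [/\ 0 <= M, 0 < dl & forall r (h : X), 0 < r -> r < dl ->
     (forall k, `|tnth h k| <= r) ->
     (\int[m]_t \int[mu]_x (`|r1 c C rho (tadd x h) t - r1 c C rho x t| ^+ 3)%:E <= (M * r)%:E)%E].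
Proof.
move=> del0 /ereal_inf_lt [M' /= HM' M'lt].
pose M := Num.max (fine M') 0.
have M0 : 0 <= M by rewrite le_max lexx orbT.
have M'M : (M' <= M%:E)%E.
  case: M' M'lt {HM'} @M M0 => [x| |] //= _ M0; rewrite ?leNye// lee_fin le_max lexx//.
have HM : leb [set t | 0 < t < T /\ (M%:E < Vnorm alpha +oo delta0 (incrS (rho ^~ t)))%E] = 0%E.
  apply/eqP; rewrite eq_le -{1}HM'; apply/andP; split.
    by apply: leb_outer => t /= [h1 h2]; split => //; exact: le_lt_trans h2.
  by rewrite -(measure0 leb); exact: leb_outer.
pose K := (M + 1) ^+ 3.
have K0 : 0 <= K by rewrite exprn_ge0// addr_ge0.
(* The factor d comes from |h| <= d r and T from integrating in time. The cap 1 gives |h| < 1, so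
   that |h|^(3 alpha) <= |h|; dividing by d + 1 turns the bound on r into one on |h|. *)
exists (K * d%:R * T), (Num.min delta0 1 / d.+1%:R); split.
- by apply: mulr_ge0; [exact: mulr_ge0|exact: ltW].
- by rewrite divr_gt0// lt_min del0 ltr01.
move=> r h r0 rdl hr; have [hd] := small_h r0 rdl hr; rewrite lt_min => /andP[hdl h1].
have [h0|h0] := eqVneq (tnorm h) 0.
  have E := tnorm0 h0.
  rewrite (_ : integral _ _ _ = 0)%E.
    by rewrite lee_fin; apply: mulr_ge0; [apply: mulr_ge0; [exact: mulr_ge0|exact: ltW]|exact: ltW].
  apply: integral0_eq => t _; apply: integral0_eq => x _.
  by rewrite E subrr normr0 expr0n.
have hp : 0 < tnorm h by rewrite lt_neqAle eq_sym h0 tnorm_ge0.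
have mS : measurable_fun setT (fun p : X * RM => incrS (rho ^~ p.2) h p.1).
  apply: measurableT_comp => //; apply: measurable_funB => //.
  by apply: (mw2 mrho) => //; apply: measurable_tadd => //; exact: measurable_cst.
pose g (t : RM) : \bar R := (\int[mu]_x (incrS (rho ^~ t) h x ^+ 3)%:E)%E.
have mg : measurable_fun setT g.
  apply: (@measurable_param _ _ RM X R mu (fun q => (incrS (rho ^~ q.1) h q.2 ^+ 3)%:E)).
  apply/measurable_EFinP; apply: measurable_funX.
  exact: (mw2 (w := fun x t => incrS (rho ^~ t) h x) mS).
have S0 x t : 0 <= incrS (rho ^~ t) h x by exact: normr_ge0.
have g0 t : (0 <= g t)%E by apply: integral_ge0 => x _; rewrite lee_fin exprn_ge0.
pose B := ((M + 1) * tnorm h `^ alpha) ^+ 3.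
have BK : B <= K * tnorm h.
  rewrite /B exprMn /K; apply: ler_wpM2l => //.
  rewrite -powR_mulrn ?powR_ge0// -powRrM.
  rewrite (_ : alpha * 3 = 1 + (alpha * 3 - 1)); last by ring.
  rewrite powRD; last by apply/implyP => _; rewrite gt_eqF.
  rewrite powRr1 ?tnorm_ge0// -[leRHS]mulr1 ler_wpM2l ?tnorm_ge0//.
  have H1 : tnorm h `^ (alpha * 3 - 1) <= 1 `^ (alpha * 3 - 1).
    by apply: ge0_ler_powR; rewrite ?nnegrE ?subr_ge0 ?alpha_ge ?tnorm_ge0 ?ler01// ltW.
  by move: H1; rewrite powR1.
(* A measurable stand-in for the times at which [Vnorm] exceeds M: within (0, T) it is contained in
   that null set by [LinfT_incr]. *)
pose S : set RM := [set t | (B%:E < g t)%E].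
have mSet : measurable S.
  by rewrite -[X in measurable X]setTI; apply: emeasurable_fun_o_infty.
have SN : m S = 0%E.
  apply/eqP; rewrite eq_le measure_ge0 andbT -HM /lamT /mrestr.
  apply: leb_outer => t /= [hS]; rewrite in_itv/= => tT; split => //.
  rewrite ltNge; apply/negP => hV; move: hS; rewrite /S /mkset ltNge => /negP; apply.
  by apply: (LinfT_incr M0 hp hdl _ _ hV) => //; exact: (meas_sect2 mS t).
have mw : measurable_fun setT (fun p : X * RM => `|r1 c C rho (tadd p.1 h) p.2 - r1 c C rho p.1 p.2| ^+ 3).
  apply: measurable_funX; apply: measurableT_comp => //.
  have mr := mr1 c C mrho.
  apply: measurable_funB => //; apply: (mw2 mr) => //.
  by apply: measurable_tadd => //; exact: measurable_cst.
have mwi : measurable_fun setT (fun t : RM => \int[mu]_x (`|r1 c C rho (tadd x h) t - r1 c C rho x t| ^+ 3)%:E)%E.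
  apply: (@measurable_param _ _ RM X R mu (fun q => (`|r1 c C rho (tadd q.2 h) q.1 - r1 c C rho q.2 q.1| ^+ 3)%:E)).
  by apply/measurable_EFinP; exact: (mw2 (w := fun x t => `|r1 c C rho (tadd x h) t - r1 c C rho x t| ^+ 3) mw).
apply: (@le_trans _ _ (\int[m]_t g t)%E).
  apply: le_nnintegral_any => t _; first by apply: integral_ge0 => x _; rewrite lee_fin exprn_ge0.
  apply: le_nnintegral_any => x _; first by rewrite lee_fin exprn_ge0.
  by rewrite lee_fin ler_pXn2r ?nnegrE//; exact: clip_lip.
rewrite (@ge0_negligible_integral _ _ _ m setT S)//.
apply: (@le_trans _ _ (\int[m]_(t in setT `\` S) B%:E)%E).
  apply: le_nnintegral_any => t [_ nS]; first exact: g0.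
  by rewrite leNgt; apply/negP.
have B0 : 0 <= B by rewrite exprn_ge0// mulr_ge0 ?powR_ge0// addr_ge0.
rewrite integral_cst/=; last exact: measurableD.
apply: (@le_trans _ _ (B%:E * T%:E)%E).
  apply: lee_wpmul2l; first by rewrite lee_fin.
  apply: (@le_trans _ _ (leb `]0%R, T[%classic)).
    by apply: leb_outer => t [].
  by rewrite lebesgue_measure_itv/= lte_fin T0 sube0.
rewrite -EFinM lee_fin (_ : K * _ * _ * _ = K * (d%:R * r) * T); last by ring.
rewrite ler_wpM2r ?(ltW T0)// (le_trans BK)// ler_wpM2l//.
Qed.

(** Bounds on the initial density are inherited from later times. Its mollification is a limit of
    mollified clipped densities, hence lies in [c, C]; since clipping is the best approximation, the
    distance from rho0 to its clipping is at most its distance to its mollification, which tends to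
    0 in L^1. *)
Lemma rho0_ae (rho0 : X -> R) : pint rho0 ->
  (forall eps x e, 0 < eps < 1 -> 0 < e -> exists2 dl, 0 < dl &
     {ae m, forall t, t < dl -> `|EE (@etaK R d eps) (r1 c C rho ^~ t) x - EE (etaK eps) rho0 x| <= e}) ->
  {ae mu, forall x, rho0 x = clip c C (rho0 x)}.
Proof.
move=> pr0 H.
have m0 := intg_meas pr0.2.
have mcl : measurable_fun setT (fun x => clip c C (rho0 x)) by exact: (measurableT_comp (meas_clip c C) m0).
have EI eps x : 0 < eps < 1 -> c <= EE (etaK eps) rho0 x <= C.
  move=> e01; have [N [HN _]] := @etaK_bound R d eps e01.
  have app e : 0 < e -> exists2 y, c <= y <= C & `|y - EE (etaK eps) rho0 x| <= e.
    move=> e0; have [dl dl0 Hd] := H eps x e e01 e0.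
    have mt0 : 0 < Num.min dl T by rewrite lt_min dl0.
    have mT : Num.min dl T <= T by rewrite ge_min lexx orbT.
    have [t /andP[t0]] := ae_pick Hd mt0 mT.
    rewrite lt_min => /andP[tdl _] h; exists (EE (etaK eps) (r1 c C rho ^~ t) x); last exact: h.
    apply: (@r_itv R d (etaK eps) N (@etaK_meas R d eps e01) HN (@etaK_ge0 R d eps e01) (@etaK_int1 R d eps e01) (r1 c C rho ^~ t) c C); first [exact: (mrt (mr1 c C mrho) t)|exact: c0|exact: (pr1 c C prho t)|by move=> y; exact: clipI].
  apply/andP; split; apply/ler_addgt0Pr => e e0; have [y /andP[h1 h2]] := app e e0;
    by rewrite ler_distl => /andP[h3 h4]; lra.
have icl : intg mu (fun x => clip c C (rho0 x) - rho0 x).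
  apply: intgB; last exact: pr0.2.
  apply: (@intg_bounded _ _ _ mu _ C) => // x; have /andP[h1 h2] := clipI cC (rho0 x).
  by rewrite ger0_norm// (le_trans (ltW c0)).
have Z : \int[mu]_x `|clip c C (rho0 x) - rho0 x| <= 0.
  apply/ler_addgt0Pr => e e0; rewrite add0r.
  have [dl dl0 Hd] := E_L1 pr0.1 pr0.2 e0.
  pose eps := Num.min dl 1 / 2.
  have mn : 0 < Num.min dl 1 by rewrite lt_min dl0 ltr01.
  have mn1 : Num.min dl 1 <= 1 by rewrite ge_min lexx orbT.
  have mnd : Num.min dl 1 <= dl by rewrite ge_min lexx.
  have e01 : 0 < eps < 1 by rewrite divr_gt0//= /eps; lra.
  have edl : eps <= dl by rewrite /eps; lra.
  have [N [HN _]] := @etaK_bound R d eps e01.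
  apply: le_trans (Hd _ N (mollifier_mon edl (etaK_mollifier e01 HN))).
  apply: Rint_le; [exact: intg_abs icl| |].
    apply: intg_abs; apply: intgB; last exact: pr0.2.
    by apply: bm_intg; exact: (bmE (@etaK_meas R d eps e01) HN pr0).
  move=> x; have h := EI eps x e01; first [exact: (clip_best _ h)|exact: (clip_best cC _ h)|by apply: clip_best].
have Z0 : (\int[mu]_x `|(clip c C (rho0 x) - rho0 x)%:E| = 0)%E.
  apply/eqP; rewrite eq_le; apply/andP; split; last exact: integral_ge0.
  by move: Z; rewrite -lee_fin EFin_Rint//; exact: intg_abs icl.
have mF : measurable_fun setT (fun x : X => (clip c C (rho0 x) - rho0 x)%:E).
  by apply/measurable_EFinP; exact: intg_meas icl.
have [/(_ Z0) A _] := ae_eq_integral_abs mu measurableT mF.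
by apply: aeS A => x /(_ Logic.I) /= [] /eqP; rewrite subr_eq0 => /eqP.
Qed.

Lemma EE_ae eps (f g : X -> R) x : 0 < eps < 1 -> pint f -> pint g -> {ae mu, forall y, f y = g y} ->
  EE (@etaK R d eps) f x = EE (etaK eps) g x.
Proof.
move=> e01 pf pg fg; have [N [HN _]] := @etaK_bound R d eps e01.
have [i1 <-] := EE_topp x (@etaK_meas R d eps e01) (@etaK_per R d eps) HN pf.
have [i2 <-] := EE_topp x (@etaK_meas R d eps e01) (@etaK_per R d eps) HN pg.
rewrite /Rintegral; congr fine; apply: ae_eq_integral => //.
- by apply/measurable_EFinP; exact: intg_meas i1.
- by apply/measurable_EFinP; exact: intg_meas i2.
- by apply: aeS fg => y E _; rewrite E.
Qed.

Lemma pint_cell (f : X -> R) : perT f -> measurable_fun setT f ->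
  (@lebT R d).-integrable (@cell R d) (fun x => (f x)%:E) -> pint f.
Proof.
move=> pf mf; rewrite integrable.unlock; first [move=> [_ H]|move=> /asboolP[_ H]|move=> /andP[_ H]]; split; first exact: pf.
apply: intgP => //; move: H; rewrite integral_cell//.
by apply/measurable_EFinP; exact: measurableT_comp.
Qed.
End Incr.

(** * Initial conditions and energies of the representatives *)

Section Initial.
Variables (R : realType) (d : nat) (T c C gamma : R).
Notation X := (d.-tuple R).
Notation RM := (measurableTypeR R).
Notation mu := (muT R d).
Notation m := (lamT T).
Notation leb := (@lebesgue_measure R).
Variables (rho : X -> R -> R) (u : 'I_d -> X -> R -> R).
Hypotheses (T0 : 0 < T) (c0 : 0 < c) (cC : c <= C) (gamma1 : 1 < gamma).
Hypotheses (mrho : measurable_fun setT (fun p : X * RM => rho p.1 p.2))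
  (mu_ : forall i, measurable_fun setT (fun p : X * RM => u i p.1 p.2))
  (prho : forall t, perT (rho ^~ t)) (pu : forall i t, perT (u i ^~ t)).
Hypotheses (hc : {ae leb, forall t, 0 < t < T -> @lebT R d [set x | @cell R d x /\ ~ (c <= rho x t <= C)] = 0%E})
  (hu : (intST T (fun x t => powR (Num.sqrt (sqnorm u x t)) 3) < +oo)%E).
Variables (rho0 : X -> R) (u0 : 'I_d -> X -> R).
Hypotheses (mrho0 : measurable_fun setT rho0) (mu0 : forall i, measurable_fun setT (u0 i))
  (pr0 : pint rho0) (pru0 : forall i, pint (fun x => rho0 x * u0 i x)).
Notation rh := (r1 c C rho).
Notation uh := (u1 u).

Let gd := good T c C rho u.
Let mrt0 t : measurable_fun setT (rho ^~ t). Proof. exact: (meas_sect2 mrho t). Qed.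
Let mrh t : measurable_fun setT (rh ^~ t). Proof. exact: (meas_sect2 (mr1 c C mrho) t). Qed.
Let rhI x t : c <= rh x t <= C. Proof. exact: clipI. Qed.
Let mek eps x : 0 < eps < 1 -> measurable_fun setT (fun y : X => @etaK R d eps (tadd y (topp x))).
Proof. by move=> e01; exact: (measurableT_comp (@etaK_meas R d eps e01) (measurable_taddl (topp x))). Qed.

Lemma init_mass :
  (forall phi, testS phi -> ((fun t => intT (fun x => rho x t * phi (trow x))) @ 0^'+
       --> intT (fun x => rho0 x * phi (trow x)))%classic) ->
  forall eps x e, 0 < eps < 1 -> 0 < e -> exists2 dl, 0 < dl &
     {ae m, forall t, t < dl -> `|EE (@etaK R d eps) (rh ^~ t) x - EE (etaK eps) rho0 x| <= e}.
Proof.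
move=> Im eps x e e01; have tS : testS (rowker (fun _ : 'I_d => gk eps) x).
  by apply: rowker_test => [i|i s]; [exact: gk_smooth|exact: gk1].
have tr y : rowker (fun _ : 'I_d => gk eps) x (trow y) = etaK eps (tadd y (topp x)) by rewrite rowker_trow.
have := Im _ tS.
have -> : intT (fun y => rho0 y * rowker (fun _ : 'I_d => gk eps) x (trow y)) =
    (\int[mu]_y (rho0 y * etaK eps (tadd y (topp x)))%:E)%E.
  rewrite (_ : (fun y => _) = (fun y => rho0 y * etaK eps (tadd y (topp x)))).
    by rewrite intT_muT//; apply: measurable_funM => //; exact: mek.
  by apply/funext => y; rewrite tr.
move=> H; apply: (init_gen mrho mu_ hc hu e01 (f := rh) _ _ pr0 H).
  by move=> t; apply: (pint_rho (pr1 c C prho t) (mrh t) c0) => y; exact: rhI.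
move=> t gt; apply: (conv_int gt).
- rewrite (_ : (fun y => _) = (fun y => rho y t * etaK eps (tadd y (topp x)))).
    by apply: measurable_funM => //; exact: mek.
  by apply/funext => y; rewrite tr.
- by apply: measurable_funM => //; exact: mek.
- by move=> y ->; rewrite tr.
Qed.

Lemma init_mom :
  (forall psi : 'I_d -> 'rV[R]_d -> R, (forall i, testS (psi i)) ->
     ((fun t => intT (fun x => \sum_(i < d) rho x t * u i x t * psi i (trow x))) @ 0^'+
       --> intT (fun x => \sum_(i < d) rho0 x * u0 i x * psi i (trow x)))%classic) ->
  forall eps i x e, 0 < eps < 1 -> 0 < e -> exists2 dl, 0 < dl &
     {ae m, forall t, t < dl -> `|EE (@etaK R d eps) (fun y => rh y t * uh i y t) x -
        EE (etaK eps) (fun y => rho0 y * u0 i y) x| <= e}.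
Proof.
move=> Ip eps i x e e01; pose K := rowker (fun _ : 'I_d => gk eps) x.
have tS : testS K.
  by apply: rowker_test => [k|k s]; [exact: gk_smooth|exact: gk1].
have tr y : K (trow y) = etaK eps (tadd y (topp x)) by rewrite /K rowker_trow.
pose psi k : 'rV[R]_d -> R := if k == i then K else fun=> 0.
have tp k : testS (psi k) by rewrite /psi; case: ifP => // _; exact: testS0.
have pE k y : psi k (trow y) = if k == i then etaK eps (tadd y (topp x)) else 0.
  by rewrite /psi; case: ifP => _ //; rewrite tr.
have := Ip psi tp.
have -> : intT (fun y => \sum_(k < d) rho0 y * u0 k y * psi k (trow y)) =
    (\int[mu]_y (rho0 y * u0 i y * etaK eps (tadd y (topp x)))%:E)%E.
  rewrite (_ : (fun y => _) = (fun y => rho0 y * u0 i y * etaK eps (tadd y (topp x)))).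
    rewrite intT_muT//; apply: measurable_funM; last exact: mek.
    exact: measurable_funM.
  apply/funext => y; under eq_bigr do rewrite pE.
  by rewrite (sum_pick (fun k => rho0 y * u0 k y)).
have mru t : measurable_fun setT (fun y => rh y t * uh i y t).
  by apply: measurable_funM => //; exact: (meas_sect2 (mu1 mu_ i) t).
move=> H; apply: (init_gen mrho mu_ hc hu e01 (f := fun y t => rh y t * uh i y t) _ _ (pru0 i) H).
  move=> t; exact: (pint_ru c0 (mr1 c C mrho) (mu1 mu_) (pr1 c C prho) (pu1 pu) rhI (u13 mu_) i t).
move=> t gt.
have E : (fun y => \sum_(k < d) rho y t * u k y t * psi k (trow y)) =
    (fun y => rho y t * u i y t * etaK eps (tadd y (topp x))).
  apply/funext => y; under eq_bigr do rewrite pE.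
  by rewrite (sum_pick (fun k => rho y t * u k y t)).
rewrite E; apply: (conv_int gt).
- apply: measurable_funM; last exact: mek.
  by apply: measurable_funM => //; exact: (meas_sect2 (mu_ i) t).
- by apply: measurable_funM; last exact: mek.
- by move=> y ->; rewrite (u1E i y gt).
Qed.

Lemma energy_good t : gd t ->
  intT (fun x => 2^-1 * (rho x t * sqnorm u x t) + rho x t `^ gamma / (gamma - 1)) =
  (\int[mu]_x (en gamma (rh ^~ t) (fun i => uh i ^~ t) x)%:E)%E.
Proof.
move=> gt; apply: (conv_int gt).
- apply: measurable_funD.
    apply: measurable_funM => //; apply: measurable_funM => //.
    by apply: measurable_sum => i; apply: measurable_funX; exact: (meas_sect2 (mu_ i) t).
  by apply: measurable_funM => //; exact: (measurableT_comp (measurable_powR gamma) (mrt0 t)).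
- apply: (@meas_en R d gamma (rh ^~ t) (fun i => uh i ^~ t)) => //.
  by move=> i; exact: (meas_sect2 (mu1 mu_ i) t).
- move=> x ->; rewrite /en; congr (_ + _); rewrite /sqnorm !mulr_sumr.
  by apply: eq_bigr => i _; rewrite (u1E i x gt).
Qed.

Lemma energy_init : {ae mu, forall x, rho0 x = clip c C (rho0 x)} ->
  intT (fun x => 2^-1 * (rho0 x * \sum_(i < d) u0 i x ^+ 2) + rho0 x `^ gamma / (gamma - 1)) =
  (\int[mu]_x (en gamma (fun x => clip c C (rho0 x)) u0 x)%:E)%E.
Proof.
move=> E; have mcl : measurable_fun setT (fun x => clip c C (rho0 x)).
  exact: (measurableT_comp (meas_clip c C) mrho0).
have mF : measurable_fun setT (fun x => 2^-1 * (rho0 x * \sum_(i < d) u0 i x ^+ 2) + rho0 x `^ gamma / (gamma - 1)).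
  apply: measurable_funD.
    apply: measurable_funM => //; apply: measurable_funM => //.
    by apply: measurable_sum => i; exact: measurable_funX.
  by apply: measurable_funM => //; exact: (measurableT_comp (measurable_powR gamma) mrho0).
rewrite (intT_muT mF).
apply: ae_eq_integral; [exact: measurableT| | |].
- by apply/measurable_EFinP.
- by apply/measurable_EFinP; exact: (meas_en gamma mcl mu0).
by apply: aeS E => x Ex _; rewrite /en -Ex; congr ((_ + _)%:E); rewrite !mulr_sumr.
Qed.

Lemma intg_rho0u0 i : {ae mu, forall x, rho0 x = clip c C (rho0 x)} ->
  intg mu (fun x => clip c C (rho0 x) * u0 i x).
Proof.
move=> E; have mcl : measurable_fun setT (fun x => clip c C (rho0 x)).
  exact: (measurableT_comp (meas_clip c C) mrho0).
have mF : measurable_fun setT (fun x => clip c C (rho0 x) * u0 i x) by exact: measurable_funM.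
apply: intgP => //; rewrite (_ : integral _ _ _ = \int[mu]_x `|rho0 x * u0 i x|%:E)%E.
  exact: intg_lt (pru0 i).2.
apply: ae_eq_integral => //.
- by apply/measurable_EFinP; exact: measurableT_comp.
- by apply/measurable_EFinP; apply: measurableT_comp => //; exact: intg_meas (pru0 i).2.
- by apply: aeS E => x Ex _; rewrite -Ex.
Qed.

Lemma pint_clip0 : pint (fun x => clip c C (rho0 x)).
Proof.
have [p0 _] := pr0; apply: (pint_rho _ _ c0) => [x j||x]; last exact: clipI.
  by rewrite p0.
exact: (measurableT_comp (meas_clip c C) mrho0).
Qed.
End Initial.

(** Allows the upper bound to be enlarged to the maximum of c and C0, so that [c, C] is nonempty by
    construction. *)
Lemma hc_mono (R : realType) d (T c C C' : R) (rho : d.-tuple R -> R -> R) : C <= C' ->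
  (forall t, measurable_fun setT (rho ^~ t)) ->
  {ae @lebesgue_measure R, forall t, 0 < t < T -> @lebT R d [set x | @cell R d x /\ ~ (c <= rho x t <= C)] = 0%E} ->
  {ae @lebesgue_measure R, forall t, 0 < t < T -> @lebT R d [set x | @cell R d x /\ ~ (c <= rho x t <= C')] = 0%E}.
Proof.
move=> CC mr [A [mA A0 HA]]; exists A; split => // t ht; apply: HA => /= h1; apply: ht => tT.
have mB K : measurable [set x | ~ (c <= rho x t <= K)].
  rewrite (_ : [set x | _] = ~` [set x | c <= rho x t <= K])//; apply: measurableC.
  rewrite (_ : [set x | _] = (rho ^~ t) @^-1` `[c, K]%classic).
    by rewrite -[X in measurable X]setTI; exact: mr.
  by apply/seteqP; split => x /=; rewrite in_itv.
have E K : [set x | cell x /\ ~ (c <= rho x t <= K)] = [set x | ~ (c <= rho x t <= K)] `&` @cell R d.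
  by apply/seteqP; split => x /= []; tauto.
have := h1 tT; rewrite !E !lebT_cell// => H.
apply/eqP; rewrite eq_le measure_ge0 andbT -H; apply: le_measure; rewrite ?inE//.
by move=> x /= nx; apply: contra_not nx => /andP[a1 a2]; rewrite a1 (le_trans a2).
Qed.

Theorem theorem1p3 (R : realType) (d : nat) (T gamma : R)
    (rho : d.-tuple R -> R -> R) (u : 'I_d -> d.-tuple R -> R -> R)
    (rho0 : d.-tuple R -> R) (u0 : 'I_d -> d.-tuple R -> R) :
  (2 <= d)%N -> 0 < T -> 1 < gamma ->
  let alpha := 2 / (3 * Num.min gamma 2) in
  weak_solution T gamma rho u rho0 u0 ->
  (* rho > 0, rho and rho^-1 in L^oo(T^d x (0,T)) *)
  (forall x t, 0 < t < T -> 0 < rho x t) ->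
  (exists c C : R, 0 < c /\
     {ae lebesgue_measure, forall t, 0 < t < T ->
        @lebT R d [set x | @cell R d x /\ ~ (c <= rho x t <= C)] = 0%E}) ->
  (* u in L^3(T^d x (0,T)) *)
  (intST T (fun x t => powR (Num.sqrt (sqnorm u x t)) 3) < +oo)%E ->
  (* Besov-type regularity *)
  (exists delta0 : R, 0 < delta0 /\
     (LqTime T +oo (fun t => Vnorm alpha +oo delta0 (incrS (rho ^~ t)))
      + LqTime T 3%:E (fun t => Vnorm (3^-1) 3%:E delta0
                                  (incrV (fun i x => u i x t))) < +oo)%E) ->
  (fun delta => LqTime T 3%:E (fun t => Vnorm (3^-1) 3%:E delta
                                  (incrV (fun i x => u i x t)))) @ 0^'+
     --> 0%E ->
  (2 <= gamma ->
   (fun delta => LqTime T +oo (fun t => Vnorm alpha +oo delta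
                                  (incrS (rho ^~ t)))) @ 0^'+ --> 0%E) ->
  {ae lebesgue_measure, forall t, 0 < t < T ->
     intT (fun x => 2^-1 * (rho x t * sqnorm u x t) + rho x t `^ gamma / (gamma - 1))
     = intT (fun x => 2^-1 * (rho0 x * \sum_(i < d) u0 i x ^+ 2)
                      + rho0 x `^ gamma / (gamma - 1))}.
Proof.
move=> d2 T0 gamma1 alpha [mrho [mu_ [prho [pu [_ [mrho0 [mu0 [prho0 [pu0 [_ [ir0 [iru0 [Wm [Wp [Im Ip]]]]]]]]]]]]]]] _ [c [C0 [c0 hc0]]] hu [delta0 [del0 hsum]] hlim _.
pose C := Num.max c C0.
have cC : c <= C by rewrite le_max lexx.
have CC : C0 <= C by rewrite le_max lexx orbT.
have hc := hc_mono CC (fun t => meas_sect2 mrho t) hc0.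
have pr0 : pint rho0 by exact: pint_cell.
have pru0 i : pint (fun x => rho0 x * u0 i x).
  apply: pint_cell => //; last exact: measurable_funM.
  by move=> x j; rewrite prho0 pu0.
have rhI (x : d.-tuple R) t : c <= r1 c C rho x t <= C by exact: clipI.
have gd := ae_good mrho mu_ hc hu.
have initr := init_mass c0 cC mrho mu_ prho hc hu mrho0 pr0 Im.
have initm := init_mom c0 cC mrho mu_ prho pu hc hu mrho0 mu0 pru0 Ip.
have Erho0 := rho0_ae T0 c0 cC mrho prho pr0 initr.
have pc0 := pint_clip0 c0 cC mrho0 pr0.
(* The velocity norm is nonnegative, so finiteness of the sum passes to the density norm, with no
   case of the form +oo - oo. *)
have hrho : (LqTime T +oo (fun t => Vnorm alpha +oo delta0 (incrS (rho ^~ t))) < +oo)%E.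
  rewrite ltNge leye_eq; apply/negP => /eqP E; move: hsum; rewrite E addye ?ltxx//.
  by rewrite gt_eqF// (lt_le_trans (ltNyr 0))// poweR_ge0.
have core := core_energy T0 c0 gamma1 (mr1 c C mrho) (mu1 mu_) (pr1 c C prho) (pu1 pu) rhI
  (u13 mu_) (u13T mu_ hu) pc0.1 (intg_meas pc0.2) (fun x => clipI cC (rho0 x)) pu0 mu0
  (fun i => intg_rho0u0 mrho0 mu0 pru0 i Erho0)
  (fun eps x e01 => wtest_mass (x := x) c0 cC mrho mu_ prho pu hc hu e01 Wm)
  (fun eps i x e01 => wtest_mom (i := i) (x := x) T0 c0 cC gamma1 mrho mu_ prho pu hc hu e01 Wp).
have {}core := core _ _ (incr_u_lemma d2 mu_ hlim) (incr_rho_lemma c C T0 gamma1 mrho del0 hrho).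
have ae1 : {ae lamT T, forall t, intT (fun x => 2^-1 * (rho x t * sqnorm u x t) + rho x t `^ gamma / (gamma - 1))
     = intT (fun x => 2^-1 * (rho0 x * \sum_(i < d) u0 i x ^+ 2) + rho0 x `^ gamma / (gamma - 1))}.
  have cc : {ae lamT T, forall t, (\int[muT R d]_x (en gamma (r1 c C rho ^~ t) (fun i => u1 u i ^~ t) x)%:E
      = \int[muT R d]_x (en gamma (fun x => clip c C (rho0 x)) u0 x)%:E)%E}.
    apply: core.
    (* [core_energy] wants an initial density in [c, C] everywhere; the initial limits are carried
       from rho0 to its clipping, which has the same averages by [EE_ae]. *)
    - move=> eps x e e01 e0; have [dl dl0 H] := initr eps x e e01 e0; exists dl => //.
      apply: aeS H => t H tdl; rewrite -(EE_ae x e01 pr0 pc0 Erho0); exact: H.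
    - move=> eps i x e e01 e0; have [dl dl0 H] := initm eps i x e e01 e0; exists dl => //.
      have pcu : pint (fun y => clip c C (rho0 y) * u0 i y).
        split; last exact: (intg_rho0u0 mrho0 mu0 pru0 i Erho0).
        by move=> y j; rewrite prho0 pu0.
      have Eu : {ae muT R d, forall y, rho0 y * u0 i y = clip c C (rho0 y) * u0 i y}.
        by apply: aeS Erho0 => y <-.
      apply: aeS H => t H tdl; rewrite -(EE_ae x e01 (pru0 i) pcu Eu); exact: H.
  apply: aeS (aeI gd cc) => t [gt E].
  exact: (etrans (energy_good gamma mrho mu_ gt) (etrans E (esym (energy_init gamma mrho0 mu0 Erho0)))).
exact: (ae_lamT ae1).
Qed.
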